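(* Let $T>0$, $\omega=2\pi/T$, and let $p$ be a real-valued $T$-periodic function with Fourier coefficients $\widetilde p_\ell=\frac1T\int_0^T e^{-i\ell\omega x}p(x)\,dx$ satisfying $\sum_{\ell\in\mathbb Z}|\widetilde p_\ell|(1+\ell^2)^{1/4}<\infty$. For $k\in\mathbb R$ let $H(k)$ be the operator on $\ell^2(\mathbb Z)$ with matrix $$[H(k)]_{n,m}=B\big(\tfrac12-i\omega n-ik,\ \tfrac12+i\omega m+ik\big)\,\widetilde p_{n-m},\quad n,m\in\mathbb Z,$$ where $B(z_1,z_2)=\Gamma(z_1)\Gamma(z_2)/\Gamma(z_1+z_2)$ (each $H(k)$ is a compact, in fact trace class, self-adjoint operator). Then there is a finite or countable list $\mathcal E$ of non-vanishing real-valued real analytic functions $E$ on $\mathbb R$ (entries of the list may repeat) such that: - for each $k\in\mathbb R$ and each eigenvalue $E_*\neq 0$ of $H(k)$ of multiplicity $m\ge1$, there are exactly $m$ entries $E_1,\dots,E_m$ of $\mathcal E$ (counted with repetition) with $E_*=E_1(k)=\dots=E_m(k)$; - conversely, for each $k\in\mathbb R$ and each $E\in\mathcal E$, $E(k)$ is an eigenvalue of $H(k)$. Furthermore, if $E\in\mathcal E$, then the functions $k\mapsto E(-k)$ and $k\mapsto E(k+\omega n)$, $n\in\mathbb Z$, also belong to $\mathcal E$.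
   Context: $H(k)$ is the fiber operator of the Floquet–Bloch decomposition of the Hankel operator on $L^2(\mathbb R_+)$ with kernel $h(t)=p(\log t)/t$. *)

(* Defs.v *)
From HB Require Import structures.
From mathcomp Require Import all_boot all_order all_algebra.
From mathcomp Require Import all_classical all_reals all_analysis.
From mathcomp Require Import complex.

Set Implicit Arguments.
Unset Strict Implicit.
Unset Printing Implicit Defensive.

Import Order.TTheory GRing.Theory Num.Theory.
Import numFieldNormedType.Exports.
Local Open Scope classical_set_scope.
Local Open Scope ring_scope.
Local Open Scope complex_scope.

Section Defs.
Variable R : realType.

Definition cabs (z : R[i]) : R := Num.sqrt (complex.Re z ^+ 2 + complex.Im z ^+ 2).

Definition zpsum (f : int -> R) (N : nat) : R :=
  \sum_(i < (N + N).+1) f (i%:Z - N%:Z)%R.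

Definition zabs_summable (f : int -> R) : Prop :=
  exists M : R, forall N : nat, zpsum (fun m => `|f m|) N <= M.

Definition zsum_to (f : int -> R) (s : R) : Prop :=
  zabs_summable f /\ zpsum f @ \oo --> s.

Definition zsumC_to (f : int -> R[i]) (s : R[i]) : Prop :=
  zsum_to (fun m => complex.Re (f m)) (complex.Re s) /\ zsum_to (fun m => complex.Im (f m)) (complex.Im s).

Definition l2Z (v : int -> R[i]) : Prop :=
  zabs_summable (fun m => complex.Re (v m) ^+ 2 + complex.Im (v m) ^+ 2).

Definition omega (T : R) : R := 2 * pi / T.

Definition fourier_coef (T : R) (p : R -> R) (l : int) : R[i] :=
  Complex
    (T^-1 * Rintegral lebesgue_measure `[0, T]
       (fun x => cos (l%:~R * omega T * x) * p x))
    (- (T^-1 * Rintegral lebesgue_measure `[0, T]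
       (fun x => sin (l%:~R * omega T * x) * p x))).

(* Euler's Gamma function, Gamma(z) = int_0^oo t^{z-1} e^{-t} dt, Re z > 0,
   with t^{z-1} = t^{a-1} (cos (b ln t) + i sin (b ln t)) for z = a + i b. *)
Definition Gamma (z : R[i]) : R[i] :=
  Complex
    (Rintegral lebesgue_measure `]0, +oo[
       (fun t => powR t (complex.Re z - 1) * expR (- t) * cos (complex.Im z * ln t)))
    (Rintegral lebesgue_measure `]0, +oo[
       (fun t => powR t (complex.Re z - 1) * expR (- t) * sin (complex.Im z * ln t))).

Definition Beta (z1 z2 : R[i]) : R[i] := Gamma z1 * Gamma z2 / Gamma (z1 + z2).

Definition Hmat (T : R) (p : R -> R) (k : R) (n m : int) : R[i] :=
  Beta ((2^-1)%:C - 'i * (omega T * n%:~R)%:C - 'i * k%:C)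
       ((2^-1)%:C + 'i * (omega T * m%:~R)%:C + 'i * k%:C)
  * fourier_coef T p (n - m).

Definition in_eigenspace (A : int -> int -> R[i]) (E : R[i]) (v : int -> R[i])
  : Prop :=
  l2Z v /\ forall n : int, zsumC_to (fun m => A n m * v m) (E * v n).

Definition is_eigenvalue (A : int -> int -> R[i]) (E : R[i]) : Prop :=
  exists v, in_eigenspace A E v /\ exists n, v n <> 0.

Definition eig_multiplicity (A : int -> int -> R[i]) (E : R[i]) (m : nat) : Prop :=
  exists w : nat -> int -> R[i],
    (forall i, (i < m)%N -> in_eigenspace A E (w i)) /\
    (forall c : nat -> R[i],
        (forall n, \sum_(i < m) c i * w i n = 0) -> forall i, (i < m)%N -> c i = 0) /\
    (forall v, in_eigenspace A E v ->
        exists c : nat -> R[i], forall n, v n = \sum_(i < m) c i * w i n).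

Definition real_analytic (f : R -> R) : Prop :=
  forall x0 : R, exists2 r : R, 0 < r &
    exists a : nat -> R, forall x : R, `|x - x0| < r ->
      (fun N : nat => \sum_(j < N) a j * (x - x0) ^+ j) @ \oo --> f x.

End Defs.

(* Main.v *)
(* Put g_m(k) = Gamma(1/2 + i(omega m + k)). Then H(k)_{nm} = conj(g_n(k)) s_{n-m} g_m(k) with s
   independent of k, and the classical formulas |Gamma(1/2 + ix)|^2 = c / cosh(pi x) and
   |Gamma(1 + ix)|^2 = pi x / sinh(pi x) (proved by comparing the recursions in n of
   |Gamma(n/2 + 1 + ix)|^2 and of the integrals of cosh(2x th) cos^n th over [0, pi/2]) show that
   H(k) is Hilbert-Schmidt. They also show that, after rescaling coordinates by g_m(k)/g_m(k0), the
   equation H(k) v = E v becomes H(k0) u = E (cosh(pi x) + sinh(pi x) tau) u, where x = k - k0 and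
   tau is multiplication by tanh(pi(omega n + k0)). Only the scalar coefficients of this pencil
   depend on k. Near E0 != 0 it is deflated, by an explicit convergent power series, to a symmetric
   finite-dimensional problem, for which an elementary Rellich argument gives analytic eigenvalues
   E(k) with |E(k) - E0| <= L |E0| |k - k0|. As L is uniform, the branches extend to the whole line
   without vanishing. Along a branch f the multiplicity of f(k) is the same for all k outside a
   discrete set, and f is listed that many times; there are countably many branches because the
   eigenvalues of H(0) accumulate only at 0. Everything is done over the real Hilbert space
   underlying the complex one, where multiplicities double. *)

Require Import Defs.
From HB Require Import structures.
From mathcomp Require Import all_boot all_order all_algebra.
From mathcomp Require Import all_classical all_reals all_analysis.
From mathcomp Require Import complex ring lra zify.
From mathcomp Require Import measurable_realfun.
Set Implicit Arguments.
Unset Strict Implicit.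
Unset Printing Implicit Defensive.
Import Order.TTheory GRing.Theory Num.Theory.
Import numFieldNormedType.Exports.
Local Open Scope classical_set_scope.
Local Open Scope ring_scope.

(** * Real Hilbert spaces and compact symmetric operators *)

(** The entries of H(k) are products of Gamma values, so expanding H(k) itself in powers of k would
    require control of infinitely many Gamma functions at once. Conjugation by the diagonal of
    ratios g_m(k)/g_m(k0) moves the whole dependence on k into the squared moduli of these ratios,
    where the addition formula of cosh leaves two scalar functions and one bounded operator. The
    price is a generalised eigenvalue problem, so the reduction and the Rellich argument are carried
    out with respect to a weight that varies with x. Two difficulties shape the rest. Eigenvalues
    may cross, so multiplicity is attached to germs of branches and not to values. Continuation
    could break down at the value 0, where compactness gives no local description; but the bound on
    E - E0 is proportional to E0, with a factor independent of k0 and E0, so log |E| is Lipschitz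
    along a branch and 0 is out of reach of finite intervals. Power series are handled through
    geometric bounds on their remainders, so that operations on them involve only finite sums and
    inequalities. *)

Lemma le_geometric0 (R : realType) (x C q : R) : 0 <= q < 1 ->
  (forall N, x <= C * q ^+ N) -> x <= 0.
Proof.
move=> /andP[q0 q1] h.
have cv : (fun N => C * q ^+ N) @ \oo --> (0 : R).
  by apply: cvg_geometric; rewrite ger0_norm.
rewrite -(cvg_lim _ cv) //; apply: limr_ge; first by apply/cvg_ex; exists 0.
by near=> N; exact: h.
Unshelve. all: by end_near. Qed.

Lemma sum_geometric_le (R : realType) (C q : R) N M : 0 <= C -> 0 <= q < 1 ->
  \sum_(j < M) C * q ^+ (N + j) <= C * q ^+ N / (1 - q).
Proof.
move=> C0 /andP[q0 q1]; have q1' : 0 < 1 - q by rewrite subr_gt0.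
rewrite ler_pdivlMr //.
have -> : \sum_(j < M) C * q ^+ (N + j) = C * q ^+ N * \sum_(j < M) q ^+ j.
  by rewrite mulr_sumr; apply: eq_bigr => j _; rewrite exprD mulrA.
rewrite -[leLHS]mulrA ler_piMr ?mulr_ge0 ?exprn_ge0 //.
by rewrite mulrC -opprB mulNr -subrX1 opprB lerBlDr lerDl exprn_ge0.
Qed.

Lemma sum_mul_delta (R : pzRingType) n (F : 'I_n -> R) j : \sum_i F i * (i == j)%:R = F j.
Proof.
by rewrite (bigD1 j) //= eqxx mulr1 big1 ?addr0 // => i /negPf ->; rewrite mulr0.
Qed.

Definition free_family (R : pzRingType) (V : lmodType R) n (b : 'I_n -> V) :=
  forall c : 'I_n -> R, \sum_i c i *: b i = 0 -> forall i, c i = 0.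

(** If there were more vectors than generators, the coefficient matrix would have a nonzero row in
    its left kernel, and that row is a nontrivial relation among the [b i]. *)
Lemma free_leq_span (F : fieldType) (V : lmodType F) n m (h : 'I_n -> V) (b : 'I_m -> V) :
  free_family b -> (forall i, exists c : 'I_n -> F, b i = \sum_(j < n) c j *: h j) ->
  (m <= n)%N.
Proof.
move=> fb bh; rewrite leqNgt; apply/negP => lt_nm.
have /choice[C hC] := bh.
pose M : 'M[F]_(m, n) := \matrix_(i, j) C i j.
have : kermx M != 0.
  by rewrite -mxrank_eq0 mxrank_ker subn_eq0 -ltnNge (leq_ltn_trans (rank_leq_col M)).
move/rowV0Pn => [a /sub_kermxP aM /negP]; apply; apply/eqP/rowP => k; rewrite mxE.
apply: (fb (fun i => a 0 i)).
under eq_bigr do rewrite hC scaler_sumr.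
rewrite exchange_big big1 //= => j _.
under eq_bigr do rewrite scalerA.
rewrite -scaler_suml.
have /matrixP/(_ 0 j) := aM; rewrite !mxE => e.
have -> : \sum_i a 0 i * C i j = 0 by rewrite -[RHS]e; apply: eq_bigr => i _; rewrite !mxE.
by rewrite scale0r.
Qed.

Definition mklinear (R : pzRingType) (U V : lmodType R) (f : U -> V) (h : linear f) :
  {linear U -> V} := HB.pack f (GRing.isLinear.Build R U V *:%R f h).

Section HilbertDef.
Variables (R : realType) (H : lmodType R) (ip : H -> H -> R).

Definition hnorm (x : H) : R := Num.sqrt (ip x x).
Local Notation nm := hnorm.

(* Completeness is only required for geometrically convergent series. *)
Record hilbert : Prop := Hilbert {
  ipDl : forall x y z, ip (x + y) z = ip x z + ip y z;
  ipZl : forall a x y, ip (a *: x) y = a * ip x y;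
  ipC : forall x y, ip x y = ip y x;
  ip_gt0 : forall x, x != 0 -> 0 < ip x x;
  ip_complete : forall (a : nat -> H) (C q : R), 0 <= q < 1 -> 0 <= C ->
    (forall j, nm (a j) <= C * q ^+ j) ->
    exists s K, forall N, nm (s - \sum_(j < N) a j) <= K * q ^+ N }.

Definition orthonormal n (V : 'I_n -> H) := forall i j, ip (V i) (V j) = (i == j)%:R.

Definition symmetric_op (A : H -> H) := forall x y, ip (A x) y = ip x (A y).

(** Approximation in norm by operators of finite rank. On a Hilbert space this is equivalent to
    compactness, and it is the form that both the Hilbert-Schmidt estimate and the Fredholm argument
    use. *)
Definition compact_op (A : H -> H) := forall e : R, 0 < e ->
  exists n (f g : 'I_n -> H), forall x,
    nm (A x - \sum_(i < n) ip x (f i) *: g i) <= e * nm x.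

End HilbertDef.

Section HilbertTheory.
Variables (R : realType) (H : lmodType R) (ip : H -> H -> R).
Hypothesis hH : hilbert ip.
Local Notation nm := (hnorm ip).

Lemma ipDr x y z : ip x (y + z) = ip x y + ip x z.
Proof. by rewrite (ipC hH) (ipDl hH) !(ipC hH x). Qed.
Lemma ipZr a x y : ip x (a *: y) = a * ip x y.
Proof. by rewrite (ipC hH) (ipZl hH) (ipC hH x). Qed.
Lemma ip0l x : ip 0 x = 0.
Proof. by rewrite -(scale0r 0) (ipZl hH) mul0r. Qed.
Lemma ip0r x : ip x 0 = 0.
Proof. by rewrite (ipC hH) ip0l. Qed.
Lemma ipNl x y : ip (- x) y = - ip x y.
Proof. by rewrite -scaleN1r (ipZl hH) mulN1r. Qed.
Lemma ipNr x y : ip x (- y) = - ip x y.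
Proof. by rewrite -scaleN1r ipZr mulN1r. Qed.
Lemma ipBl x y z : ip (x - y) z = ip x z - ip y z.
Proof. by rewrite (ipDl hH) ipNl. Qed.
Lemma ipBr x y z : ip x (y - z) = ip x y - ip x z.
Proof. by rewrite ipDr // ipNr. Qed.
Lemma ip_suml (I : Type) (r : seq I) (P : pred I) (F : I -> H) y :
  ip (\sum_(i <- r | P i) F i) y = \sum_(i <- r | P i) ip (F i) y.
Proof. by apply: (big_morph (ip^~ y)) => [u v|]; [exact: ipDl|exact: ip0l]. Qed.
Lemma ip_sumr (I : Type) (r : seq I) (P : pred I) (F : I -> H) y :
  ip y (\sum_(i <- r | P i) F i) = \sum_(i <- r | P i) ip y (F i).
Proof. by apply: (big_morph (ip y)) => [u v|]; [exact: ipDr|exact: ip0r]. Qed.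

Lemma ip_ge0 x : 0 <= ip x x.
Proof. by have [->|/(ip_gt0 hH)/ltW//] := eqVneq x 0; rewrite ip0l. Qed.
Lemma nm_ge0 x : 0 <= nm x. Proof. exact: sqrtr_ge0. Qed.
Lemma sqr_nm x : nm x ^+ 2 = ip x x.
Proof. by rewrite sqr_sqrtr // ip_ge0. Qed.
Lemma nm0 : nm 0 = 0. Proof. by rewrite /hnorm ip0l sqrtr0. Qed.
Lemma nmZ a x : nm (a *: x) = `|a| * nm x.
Proof.
by rewrite /hnorm (ipZl hH) ipZr mulrA -expr2 sqrtrM ?sqr_ge0 // sqrtr_sqr.
Qed.
Lemma nmN x : nm (- x) = nm x.
Proof. by rewrite -scaleN1r nmZ normrN1 mul1r. Qed.
Lemma nm_eq0 x : nm x = 0 -> x = 0.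
Proof.
move=> h; apply/eqP/negPn/negP => /(ip_gt0 hH).
by rewrite -sqr_nm h expr0n ltxx.
Qed.
Lemma nm_le0 x : nm x <= 0 -> x = 0.
Proof. by move=> h; apply: nm_eq0; apply/eqP; rewrite eq_le h nm_ge0. Qed.

Lemma cauchy_schwarz x y : `|ip x y| <= nm x * nm y.
Proof.
have [->|y0] := eqVneq y 0; first by rewrite ip0r normr0 nm0 mulr0.
rewrite -ler_sqr ?nnegrE ?mulr_ge0 ?nm_ge0 // exprMn !sqr_nm real_normK ?num_real //.
have yy := ip_gt0 hH y0.
have := ip_ge0 (ip y y *: x - ip x y *: y).
rewrite ipBl !ipBr !(ipZl hH) !ipZr (ipC hH y x) => h.
have {h} : 0 <= ip y y * (ip x x * ip y y - ip x y ^+ 2) by apply: le_trans h _; lra.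
by rewrite pmulr_rge0 // subr_ge0.
Qed.

Lemma ler_ip x y : ip x y <= nm x * nm y.
Proof. exact: le_trans (ler_norm _) (cauchy_schwarz _ _). Qed.

Lemma nmD x y : nm (x + y) <= nm x + nm y.
Proof.
rewrite -ler_sqr ?nnegrE ?addr_ge0 ?nm_ge0 // sqrrD !sqr_nm (ipDl hH) !ipDr.
by rewrite (ipC hH y x); have := ler_ip x y; lra.
Qed.
Lemma nmB x y : nm (x - y) <= nm x + nm y.
Proof. by rewrite -(nmN y) nmD. Qed.
Lemma nm_dist x y : nm (x - y) = nm (y - x).
Proof. by rewrite -nmN opprB. Qed.
Lemma nm_sum (I : Type) (r : seq I) (P : pred I) (F : I -> H) :
  nm (\sum_(i <- r | P i) F i) <= \sum_(i <- r | P i) nm (F i).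
Proof.
elim/big_rec2: _ => [|i u v _ h]; first by rewrite nm0.
by apply: le_trans (nmD _ _) _; rewrite lerD2l.
Qed.

(** The constant [K] of [ip_complete] is uncontrolled, but comparison with the partial sum of length
    N + M multiplies it by q^(N+M), which disappears as M grows; what remains is the tail of the
    geometric series. *)
Lemma hilbert_complete (a : nat -> H) (C q : R) : 0 <= q < 1 -> 0 <= C ->
  (forall j, nm (a j) <= C * q ^+ j) ->
  exists s, forall N, nm (s - \sum_(j < N) a j) <= C * q ^+ N / (1 - q).
Proof.
move=> q01 C0 ha; have [s [K hK]] := ip_complete hH q01 C0 ha.
exists s => N; rewrite -subr_le0.
apply: (@le_geometric0 _ _ (K * q ^+ N) q) => // M; rewrite lerBlDr.
rewrite -(subrK (\sum_(j < N + M) a j) s) -addrA.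
apply: le_trans (nmD _ _) _; apply: lerD; first by rewrite -mulrA -exprD.
rewrite big_split_ord /= addrC addKr.
apply: le_trans (nm_sum _ _ _) _; apply: le_trans (sum_geometric_le N M C0 q01).
by apply: ler_sum => i _; exact: ha.
Qed.

Lemma pythagoras x y : ip x y = 0 -> nm (x + y) ^+ 2 = nm x ^+ 2 + nm y ^+ 2.
Proof. by move=> h; rewrite !sqr_nm (ipDl hH) !ipDr (ipC hH y x) h addr0 add0r. Qed.

Lemma ler_nm_sqr x (c : R) : 0 <= c -> nm x ^+ 2 <= c * nm x -> nm x <= c.
Proof.
move=> c0; have := nm_ge0 x; rewrite le_eqVlt => /predU1P[<-//|x0].
by rewrite expr2 ler_pM2r.
Qed.

(* Lax-Milgram: for small s > 0 the map x |-> x - s D x is a contraction. *)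
Lemma coercive_surjective (D : {linear H -> H}) (c B : R) : 0 < c ->
  (forall x, nm (D x) <= B * nm x) ->
  (forall x, c * nm x ^+ 2 <= ip (D x) x) -> forall r, exists x, D x = r.
Proof.
move=> c0 hB hc r.
pose b := `|B| + c.
have b0 : 0 < b by rewrite ltr_wpDl.
have hb x : nm (D x) <= b * nm x.
  apply: le_trans (hB x) _; rewrite ler_wpM2r ?nm_ge0 //.
  by apply: le_trans (ler_norm B) _; rewrite lerDl ltW.
(* This [s] minimises 1 - 2 s c + s^2 b^2, which bounds the square of the contraction factor of [T];
   the minimum is q^2. Enlarging B to [b] ensures c <= b, so that the minimum is nonnegative. *)
pose s := c / b ^+ 2.
have s0 : 0 < s by rewrite divr_gt0 // exprn_gt0.
pose q := Num.sqrt (1 - c ^+ 2 / b ^+ 2).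
have cb : c ^+ 2 / b ^+ 2 <= 1.
  by rewrite ler_pdivrMr ?exprn_gt0 // mul1r lerXn2r ?nnegrE ?(ltW c0) ?(ltW b0) ?lerDr.
have cb0 : 0 < c ^+ 2 / b ^+ 2 by rewrite divr_gt0 // exprn_gt0.
have q2 : q ^+ 2 = 1 - c ^+ 2 / b ^+ 2 by rewrite sqr_sqrtr // subr_ge0.
have q0 : 0 <= q by rewrite sqrtr_ge0.
have q1 : q < 1 by rewrite -(@ltr_pXn2r _ 2) ?nnegrE // q2 expr1n; lra.
pose T x := x - s *: D x.
have hT x : nm (T x) <= q * nm x.
  rewrite -ler_sqr ?nnegrE ?mulr_ge0 ?nm_ge0 // exprMn q2 sqr_nm.
  rewrite /T ipBl !ipBr !(ipZl hH) !ipZr (ipC hH x) -!sqr_nm.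
  have h1 : nm (D x) ^+ 2 <= b ^+ 2 * nm x ^+ 2.
    by rewrite -exprMn lerXn2r ?nnegrE ?mulr_ge0 ?nm_ge0 // ltW.
  have h2 := hc x.
  have e1 : s * b ^+ 2 = c by rewrite /s divfK // gt_eqF // exprn_gt0.
  have e2 : c ^+ 2 / b ^+ 2 = s * c by rewrite /s; ring.
  rewrite e2.
  have h3 : s * (s * nm (D x) ^+ 2) <= s * (c * nm x ^+ 2).
    by rewrite -e1 -mulrA !ler_wpM2l ?(ltW s0).
  have h4 : s * (c * nm x ^+ 2) <= s * ip (D x) x by rewrite ler_wpM2l ?(ltW s0).
  lra.
have hiter j : nm (iter j T r) <= q ^+ j * nm r.
  elim: j => [|j IH]; first by rewrite expr0 mul1r.
  by rewrite iterS exprS -mulrA; apply: le_trans (hT _) _; rewrite ler_wpM2l.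
have q01 : 0 <= q < 1 by rewrite q0.
have C0 : 0 <= s * nm r by rewrite mulr_ge0 ?nm_ge0 // ltW.
have [|x hx] := hilbert_complete (a := fun j => s *: iter j T r) q01 C0.
  move=> j; rewrite nmZ gtr0_norm // -mulrA ler_wpM2l ?(ltW s0) //.
  by rewrite mulrC; exact: hiter.
exists x; apply/eqP; rewrite -subr_eq0; apply/eqP/nm_le0.
apply: (@le_geometric0 _ _ (b * (s * nm r / (1 - q)) + nm r) q q01) => N.
(* Since s D = 1 - T, the images under D of the partial sums of the Neumann series telescope. *)
have DS : D (\sum_(j < N) s *: iter j T r) = r - iter N T r.
  elim: N => [|N IH]; first by rewrite big_ord0 linear0 subrr.
  rewrite big_ord_recr /= linearD IH linearZ /= /T.
  by rewrite opprB addrCA addrC.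
have -> : D x - r = D (x - \sum_(j < N) s *: iter j T r) - iter N T r.
  by rewrite linearB DS -addrA -opprD addrC subrK addrC.
apply: le_trans (nmB _ _) _.
rewrite mulrDl; apply: lerD; last by rewrite mulrC; exact: hiter.
apply: le_trans (hb _) _; rewrite -[leRHS]mulrA ler_wpM2l ?(ltW b0) //.
by apply: le_trans (hx N) _; rewrite mulrAC.
Qed.

Section Orthobasis.
Variable P : H -> Prop.
Hypotheses (P0 : P 0) (PD : forall x y, P x -> P y -> P (x + y))
  (PZ : forall a x, P x -> P (a *: x)).
Variables (n : nat) (h : 'I_n -> H).
Hypothesis hspan : forall x, P x -> exists c : 'I_n -> R, x = \sum_(i < n) c i *: h i.

Lemma orthonormal_leq m (V : 'I_m -> H) : orthonormal ip V -> (forall i, P (V i)) ->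
  (m <= n)%N.
Proof.
move=> oV PV; apply: (@free_leq_span _ _ n m h V) => [c s0 k|i]; last exact: hspan.
have := congr1 (ip^~ (V k)) s0; rewrite ip0l ip_suml.
under eq_bigr do rewrite (ipZl hH) oV.
by rewrite sum_mul_delta.
Qed.

(** Take an orthonormal family in P of maximal length, which exists because the length is bounded by
    [n]. A vector of P outside its span would leave a nonzero remainder, and the normalised
    remainder could be appended. *)
Lemma orthonormal_basis : exists m (V : 'I_m -> H), [/\ orthonormal ip V,
  forall i, P (V i) & forall x, P x -> x = \sum_(i < m) ip x (V i) *: V i].
Proof.
pose Q m := `[< exists V : 'I_m -> H, orthonormal ip V /\ forall i, P (V i) >].
have Q0 : exists m, Q m.
  exists 0%N; apply/asboolP; exists (fun=> 0); split; by case.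
have Qn m : Q m -> (m <= n)%N by move=> /asboolP[V [oV PV]]; exact: orthonormal_leq oV PV.
case: (ex_maxnP Q0 Qn) => m /asboolP[V [oV PV]] hmax.
exists m, V; split=> // x Px; apply/eqP; rewrite -subr_eq0; apply: contraT => v0.
set y := \sum_(i < m) _ in v0; pose v := x - y.
have Py : P y.
  rewrite /y; elim/big_ind: _ => // i _; exact/PZ/PV.
have Pv : P v by apply: PD => //; rewrite -scaleN1r; exact: PZ.
have vV k : ip v (V k) = 0.
  rewrite ipBl ip_suml (bigD1 k) //= (ipZl hH) oV eqxx mulr1 big1 ?addr0 ?subrr //.
  by move=> i ik; rewrite (ipZl hH) oV (negPf ik) mulr0.
have nv : 0 < nm v.
  by rewrite lt_neqAle nm_ge0 andbT eq_sym; apply: contra v0 => /eqP/nm_eq0; rewrite /v => ->.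
pose W (i : 'I_m.+1) := if unlift ord_max i is Some j then V j else (nm v)^-1 *: v.
have : Q m.+1.
  apply/asboolP; exists W; split.
    move=> i j; rewrite /W.
    case: unliftP => [i' ->|->]; case: unliftP => [j' ->|->].
    - by rewrite oV (inj_eq lift_inj).
    - by rewrite ipZr (ipC hH) vV mulr0 eq_sym (negPf (neq_lift _ _)).
    - by rewrite (ipZl hH) vV mulr0 (negPf (neq_lift _ _)).
    - by rewrite eqxx ipZr (ipZl hH) -sqr_nm expr2 mulKf ?gt_eqF // mulVf ?gt_eqF.
  by move=> i; rewrite /W; case: unliftP => // _; exact: PZ.
by move/hmax; rewrite ltnn.
Qed.
End Orthobasis.

(** * The Fredholm alternative for compact symmetric operators *)

Section Fredholm.
Variables (A : {linear H -> H}) (E : R).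
Hypotheses (sA : symmetric_op ip A) (cA : compact_op ip A) (E0 : E != 0).

Lemma compact_bounded : exists2 B, 0 <= B & forall x, nm (A x) <= B * nm x.
Proof.
have [n [f [g h]]] := cA ltr01.
exists (1 + \sum_(i < n) nm (f i) * nm (g i)).
  by rewrite addr_ge0 // sumr_ge0 // => i _; rewrite mulr_ge0 ?nm_ge0.
move=> x; rewrite -[A x](subrK (\sum_(i < n) ip x (f i) *: g i)).
apply: le_trans (nmD _ _) _; rewrite mulrDl; apply: lerD; first exact: h.
apply: le_trans (nm_sum _ _ _) _; rewrite mulr_suml; apply: ler_sum => i _.
rewrite nmZ mulrAC ler_wpM2r ?nm_ge0 // mulrC; exact: cauchy_schwarz.
Qed.

(** Let F be an operator of finite rank within |E|/2 of A. Then D = 1 - (A - F)/E is coercive, hence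
    invertible, and A x - E x = r becomes x = sum c_i h_i - t with c_i = <x, f_i>, where t depends
    on r alone. Inner products with the f_j leave a finite linear system for c with matrix [N], so
    an approximate eigenvector is corrected by linear algebra. *)
Lemma compact_near_kernel : exists n (h : 'I_n -> H) (C : R), 0 <= C /\
  forall x, exists c : 'I_n -> R, let x0 := \sum_(i < n) c i *: h i in
    A x0 = E *: x0 /\ nm (x - x0) <= C * nm (A x - E *: x).
Proof.
have e0 : 0 < `|E| / 2 by rewrite divr_gt0 // normr_gt0.
have [n [f [g hB]]] := cA e0.
pose F x := \sum_(i < n) ip x (f i) *: g i.
have linF : linear F.
  move=> a x y; rewrite /F scaler_sumr -big_split; apply: eq_bigr => i _ /=.
  by rewrite (ipDl hH) (ipZl hH) scalerDl scalerA.
have [D DE] : exists D : {linear H -> H}, forall x, D x = x - E^-1 *: (A x - F x).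
  by exists (idfun \- (E^-1 \*: (A \- mklinear linF))).
have hBD x : nm (E^-1 *: (A x - F x)) <= 2^-1 * nm x.
  rewrite nmZ normfV -ler_pdivlMl ?invr_gt0 ?normr_gt0 // invrK.
  by apply: le_trans (hB x) _; rewrite mulrA.
have nD x : nm (D x) <= 2 * nm x.
  by rewrite DE; apply: le_trans (nmB _ _) _; have := hBD x; have := nm_ge0 x; lra.
have cD x : 2^-1 * nm x ^+ 2 <= ip (D x) x.
  rewrite DE ipBl -sqr_nm; have := ler_ip (E^-1 *: (A x - F x)) x.
  have := ler_wpM2r (nm_ge0 x) (hBD x); rewrite expr2; lra.
have c2 : 0 < 2^-1 :> R by rewrite invr_gt0.
have lbD x : nm x <= 2 * nm (D x).
  apply: ler_nm_sqr; first by rewrite mulr_ge0 ?nm_ge0.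
  by have := cD x; have := ler_ip (D x) x; lra.
have /choice[T hT] := coercive_surjective c2 nD cD.
pose h i := T (E^-1 *: g i).
have ED x : E *: D x = E *: x - A x + F x.
  by rewrite DE scalerBr scalerA divff // scale1r opprB [F x - _]addrC addrA.
pose N : 'M[R]_n := \matrix_(i, j) ((i == j)%:R - ip (h i) (f j)).
pose P := pinvmx N.
pose K := \sum_i (\sum_j nm (f j) * `|P j i|) * nm (h i).
exists n, h, ((K + 1) * (2 * `|E|^-1)); split.
  rewrite mulr_ge0 ?mulr_ge0 ?invr_ge0 // addr_ge0 // /K sumr_ge0 // => i _.
  rewrite mulr_ge0 ?nm_ge0 ?sumr_ge0 // => j _; by rewrite mulr_ge0 ?nm_ge0.
move=> x; pose r := A x - E *: x; pose t := T (E^-1 *: r).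
pose c : 'rV_n := \row_i ip x (f i).
have xE : x = \sum_i c 0 i *: h i - t.
  apply/eqP; rewrite -subr_eq0; apply/eqP/nm_le0.
  apply: le_trans (lbD _) _; rewrite linearB linearB linear_sum /=.
  suff -> : D x = \sum_i D (c 0 i *: h i) - D t by rewrite subrr nm0 mulr0.
  apply: (scalerI E0); rewrite ED scalerBr scaler_sumr.
  rewrite /t hT scalerA divff // scale1r /r opprB addrC; congr (_ + _).
  by apply: eq_bigr => i _; rewrite linearZ /= hT !scalerA mulrAC divff // mul1r mxE.
pose tau : 'rV_n := \row_j ip t (f j).
have cN : c *m N = - tau.
  apply/rowP => j; rewrite !mxE.
  have := congr1 (ip^~ (f j)) xE; rewrite ipBl ip_suml => e.
  under eq_bigr do rewrite [N _ _]mxE mulrBr.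
  rewrite sumrB sum_mul_delta.
  rewrite [X in X - _]mxE e; under eq_bigr do rewrite (ipZl hH).
  by rewrite addrAC subrr add0r.
(* The generalised inverse [P] splits c: [c0] solves the homogeneous system, which makes [x0] an
   exact solution of A x0 = E x0, and [c1] is bounded by [tau], hence by the residual r. *)
pose c1 := c *m N *m P.
have c1N : c1 *m N = c *m N by rewrite mulmxKpV // submxMl.
pose c0 := c - c1.
have c0N : c0 *m N = 0 by rewrite mulmxBl c1N subrr.
exists (fun i => c0 0 i) => x0; split.
  have Dx0 : E *: D x0 = \sum_i c0 0 i *: g i.
    rewrite linear_sum /= scaler_sumr; apply: eq_bigr => i _.
    by rewrite linearZ /= hT !scalerA mulrAC divff // mul1r.
  have Fx0 : F x0 = \sum_i c0 0 i *: g i.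
    apply: eq_bigr => j _; congr (_ *: _).
    have /rowP/(_ j) := c0N; rewrite [LHS]mxE [RHS]mxE.
    under eq_bigr do rewrite [N _ _]mxE mulrBr.
    rewrite sumrB sum_mul_delta.
    move/eqP; rewrite subr_eq0 => /eqP ->; rewrite ip_suml.
    by apply: eq_bigr => i _; rewrite (ipZl hH).
  move: (ED x0); rewrite Dx0 Fx0 => /eqP; rewrite eq_sym -subr_eq0 addrK subr_eq0.
  by move=> /eqP.
have xx0 : x - x0 = \sum_i c1 0 i *: h i - t.
  rewrite {1}xE addrAC; congr (_ - _); rewrite -sumrB; apply: eq_bigr => i _.
  by rewrite -scalerBl; congr (_ *: _); rewrite /c0 !mxE opprD addrA subrr add0r opprK.
have nt : nm t <= 2 * `|E|^-1 * nm r.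
  by apply: le_trans (lbD _) _; rewrite hT nmZ normfV mulrA.
rewrite xx0; apply: (@le_trans _ _ ((K + 1) * nm t)); last first.
  rewrite -[leRHS]mulrA ler_wpM2l // addr_ge0 // /K sumr_ge0 // => i _.
  rewrite mulr_ge0 ?nm_ge0 ?sumr_ge0 // => j _; by rewrite mulr_ge0 ?nm_ge0.
apply: le_trans (nmB _ _) _; rewrite mulrDl mul1r; apply: lerD => //.
apply: le_trans (nm_sum _ _ _) _; rewrite /K mulr_suml; apply: ler_sum => i _.
rewrite nmZ mulrAC ler_wpM2r ?nm_ge0 // /c1 cN mxE.
apply: le_trans (ler_norm_sum _ _ _) _; rewrite mulr_suml; apply: ler_sum => j _.
rewrite normrM !mxE normrN mulrAC ler_wpM2r // mulrC; exact: cauchy_schwarz.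
Qed.

(* S is the reduced resolvent of A at E. *)
Lemma compact_spectral_split : exists m (V : 'I_m -> H) (S : H -> H) (C : R), [/\
  0 <= C, orthonormal ip V, (forall i, A (V i) = E *: V i),
  (forall z, (forall i, ip z (V i) = 0) -> nm z <= C * nm (A z - E *: z)) &
  forall r, [/\ A (S r) - E *: S r = r - \sum_i ip r (V i) *: V i,
    (forall i, ip (S r) (V i) = 0) & nm (S r) <= C * nm r]].
Proof.
have [n [h [C [C0 hk]]]] := compact_near_kernel.
(* For residual 0, [compact_near_kernel] says that [h] spans the eigenspace. *)
have [||||m [V [oV PV bV]]] := @orthonormal_basis (fun x => A x = E *: x) _ _ _ n h.
- by rewrite linear0 scaler0.
- by move=> x y hx hy; rewrite linearD hx hy scalerDr.
- by move=> a x hx; rewrite linearZ /= hx !scalerA mulrC.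
- move=> x hx; have [c [_]] := hk x.
  rewrite hx subrr nm0 mulr0 => /nm_le0/eqP; rewrite subr_eq0 => /eqP e.
  by exists c.
have ker_orth x z : A x = E *: x -> (forall i, ip z (V i) = 0) -> ip z x = 0.
  move=> /bV -> hz; rewrite ip_sumr big1 // => i _; by rewrite ipZr hz mulr0.
(* For z orthogonal to the eigenspace, subtracting [x0], which lies in it, can only increase the
   norm. *)
have gap z : (forall i, ip z (V i) = 0) -> nm z <= C * nm (A z - E *: z).
  move=> hz; have [c []] := hk z; set x0 := \sum_i _ => hx0; apply: le_trans.
  rewrite -ler_sqr ?nnegrE ?nm_ge0 // [leRHS]pythagoras ?nmN ?lerDl ?sqr_ge0 //.
  by rewrite ipNr; rewrite (ker_orth _ _ hx0 hz) oppr0.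
have [L LE] : exists L : {linear H -> H}, forall x, L x = A x - E *: x.
  by exists (A \- (E \*: idfun)).
have sL x y : ip (L x) y = ip x (L y) by rewrite !LE ipBl ipBr (ipZl hH) ipZr sA.
have linQ : linear (fun x => \sum_i ip x (V i) *: V i).
  move=> a x y; rewrite scaler_sumr -big_split; apply: eq_bigr => i _ /=.
  by rewrite (ipDl hH) (ipZl hH) scalerDl scalerA.
have [Q QE] : exists Q : {linear H -> H}, forall x, Q x = \sum_i ip x (V i) *: V i.
  by exists (mklinear linQ).
have QV x i : ip (Q x) (V i) = ip x (V i).
  rewrite QE ip_suml (bigD1 i) //= (ipZl hH) oV eqxx mulr1 big1 ?addr0 // => j ji.
  by rewrite (ipZl hH) oV (negPf ji) mulr0.
have LV i : L (V i) = 0 by rewrite LE PV subrr.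
have LQ x : L (Q x) = 0.
  by rewrite QE linear_sum big1 // => i _; rewrite linearZ /= LV scaler0.
have xQ x : ip (Q x) (x - Q x) = 0.
  rewrite (ipC hH) QE ip_sumr big1 // => i _; by rewrite ipZr ipBl -QE QV subrr mulr0.
have sQ x : ip (Q x) x = nm (Q x) ^+ 2.
  by have := xQ x; rewrite ipBr sqr_nm => /eqP; rewrite subr_eq0 => /eqP.
have pQ x : nm x ^+ 2 = nm (x - Q x) ^+ 2 + nm (Q x) ^+ 2.
  by have := pythagoras (etrans (ipC hH _ _) (xQ x)); rewrite subrK.
(* L = A - E has no sign, but L^2 + Q is coercive: the gap controls the complement, and Q the
   kernel. If L^2 x + Q x = r - Q r then Q x = 0, so S r := L x solves L (S r) = r - Q r and, being
   in the range of L, is orthogonal to the kernel. *)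
have [D DE] : exists D : {linear H -> H}, forall x, D x = L (L x) + Q x.
  by exists ((L \o L) \+ Q).
have [B B0 hB] := compact_bounded.
have nL x : nm (L x) <= (B + `|E|) * nm x.
  by rewrite LE; apply: le_trans (nmB _ _) _; rewrite nmZ mulrDl lerD2r.
have nQ x : nm (Q x) <= nm x.
  by rewrite -ler_sqr ?nnegrE ?nm_ge0 // (pQ x) lerDr sqr_ge0.
have BE0 : 0 <= B + `|E| by rewrite addr_ge0.
have bD x : nm (D x) <= ((B + `|E|) ^+ 2 + 1) * nm x.
  rewrite DE; apply: le_trans (nmD _ _) _; rewrite mulrDl mul1r; apply: lerD => //.
  by apply: le_trans (nL _) _; rewrite expr2 -mulrA ler_wpM2l.
have c0 : 0 < (C ^+ 2 + 1)^-1 by rewrite invr_gt0 ltr_wpDl ?sqr_ge0.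
have cD x : (C ^+ 2 + 1)^-1 * nm x ^+ 2 <= ip (D x) x.
  rewrite DE (ipDl hH) sQ sL -sqr_nm ler_pdivrMl ?ltr_wpDl ?sqr_ge0 //.
  rewrite pQ.
  have : nm (x - Q x) <= C * nm (L x).
    have -> : L x = L (x - Q x) by rewrite linearB LQ subr0.
    by rewrite LE; apply: gap => i; rewrite ipBl QV subrr.
  rewrite -ler_sqr ?nnegrE ?mulr_ge0 ?nm_ge0 // exprMn => h1.
  have := mulr_ge0 (sqr_ge0 C) (sqr_ge0 (nm (Q x))); have := sqr_ge0 (nm (L x)); lra.
have /choice[T hT] := coercive_surjective c0 bD cD.
pose S r := L (T (r - Q r)).
have SV r i : ip (S r) (V i) = 0 by rewrite /S sL LV ip0r.
have LS r : L (S r) = r - Q r.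
  rewrite /S; set x := T _; have := hT (r - Q r); rewrite -/x DE => e.
  suff Qx : Q x = 0 by move: e; rewrite Qx addr0.
  rewrite QE big1 // => i _.
  have := congr1 (ip^~ (V i)) e; rewrite (ipDl hH) sL LV ip0r add0r QV ipBl QV subrr => ->.
  by rewrite scale0r.
exists m, V, S, C; split=> // r; split=> //; first by rewrite -LE LS QE.
apply: le_trans (gap _ (SV r)) _; rewrite -LE LS ler_wpM2l //.
by rewrite -ler_sqr ?nnegrE ?nm_ge0 // (pQ r) lerDl sqr_ge0.
Qed.
End Fredholm.
End HilbertTheory.

(** * Analytic families with values in a normed space *)

(** Course-of-values recursion in which [Phi n] may take the whole sequence as argument, as long as
    it depends only on the terms below n; [s n] is the list of the first n terms. *)
Lemma rec_sequence (T : Type) (t0 : T) (Phi : nat -> (nat -> T) -> T) :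
  (forall n u v, (forall i, (i < n)%N -> u i = v i) -> Phi n u = Phi n v) ->
  exists u, forall n, u n = Phi n u.
Proof.
move=> hPhi.
pose s := fix s n := if n is n'.+1 then rcons (s n') (Phi n' (nth t0 (s n'))) else [::].
have ss n : size (s n) = n by elim: n => //= n IH; rewrite size_rcons IH.
have sn n m i : (i < n)%N -> nth t0 (s (n + m)%N) i = nth t0 (s n) i.
  move=> lin; elim: m => [|m IH]; first by rewrite addn0.
  by rewrite addnS /= nth_rcons ss (leq_trans lin) ?leq_addr.
exists (fun n => nth t0 (s n.+1) n) => n /=.
rewrite nth_rcons ss ltnn eqxx; apply: hPhi => i lin.
by rewrite -(subnKC lin) sn.
Qed.

Lemma sum_triangle (V : zmodType) (G : nat -> nat -> V) N :
  \sum_(i < N) \sum_(k < N - i) G i k = \sum_(j < N) \sum_(i < j.+1) G i (j - i)%N.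
Proof.
elim: N => [|N IH]; first by rewrite !big_ord0.
rewrite [RHS]big_ord_recr /= -IH big_ord_recr /= subSnn big_ord1.
rewrite [X in _ = _ + X]big_ord_recr /= subnn addrA; congr (_ + _).
rewrite -big_split; apply: eq_bigr => i _ /=.
by rewrite subSn ?big_ord_recr // ltnW.
Qed.

(** Lets the number of terms of a Cauchy product be absorbed by doubling the rate. *)
Lemma natr_le_expr2 (R : realType) N : N%:R <= 2 ^+ N :> R.
Proof. by rewrite -natrX ler_nat ltnW // ltn_expl. Qed.

Section AnalyticGeneral.
Variable R : realType.

Record is_norm (U : lmodType R) (nU : U -> R) : Prop := IsNorm {
  nrmD : forall x y, nU (x + y) <= nU x + nU y;
  nrmZ : forall a x, nU (a *: x) = `|a| * nU x;
  nrm_eq0 : forall x, nU x = 0 -> x = 0 }.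

(* f has the power series a at 0, with a geometric bound on the remainders; the domain of
   validity is tied to the rate r so that convergence never has to be mentioned. *)
Definition an_bound (U : lmodType R) (nU : U -> R) (f : R -> U) (a : nat -> U) (C r : R) :=
  forall x, r * `|x| <= 2^-1 ->
  forall N, nU (f x - \sum_(j < N) x ^+ j *: a j) <= C * (r * `|x|) ^+ N.

Definition an_coef (U : lmodType R) (nU : U -> R) f a :=
  exists C r, [/\ 0 <= C, 0 < r & an_bound nU f a C r].

Definition geo_complete (U : lmodType R) (nU : U -> R) :=
  forall (a : nat -> U) (C q : R), 0 <= q < 1 -> 0 <= C ->
    (forall j, nU (a j) <= C * q ^+ j) ->
    exists s, forall N, nU (s - \sum_(j < N) a j) <= C * q ^+ N / (1 - q).

Lemma near0_small (r : R) : 0 < r -> \forall x \near (0 : R), r * `|x| <= 2^-1.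
Proof.
move=> r0; apply/nbhs_ballP; exists (2 * r)^-1; first by rewrite /= invr_gt0 mulr_gt0.
move=> x; rewrite /ball /= sub0r normrN => h.
by rewrite ltW // -ltr_pdivlMl // mulrC -invfM.
Qed.

Section OneNorm.
Variables (U : lmodType R) (nU : U -> R).
Hypothesis hU : is_norm nU.

Lemma nrm0 : nU 0 = 0.
Proof. by rewrite -(scale0r 0) (nrmZ hU) normr0 mul0r. Qed.
Lemma nrmN x : nU (- x) = nU x.
Proof. by rewrite -scaleN1r (nrmZ hU) normrN1 mul1r. Qed.
Lemma nrm_ge0 x : 0 <= nU x.
Proof.
have := nrmD hU x (- x); rewrite subrr nrm0 nrmN -mulr2n -mulr_natl.
by rewrite pmulr_rge0.
Qed.
Lemma nrmB x y : nU (x - y) <= nU x + nU y.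
Proof. by rewrite -(nrmN y) (nrmD hU). Qed.
Lemma nrm_le0 x : nU x <= 0 -> x = 0.
Proof. by move=> h; apply: (nrm_eq0 hU); apply/eqP; rewrite eq_le h nrm_ge0. Qed.
Lemma nrm_sum (I : Type) (s : seq I) (P : pred I) (F : I -> U) :
  nU (\sum_(i <- s | P i) F i) <= \sum_(i <- s | P i) nU (F i).
Proof.
elim/big_rec2: _ => [|i u v _ h]; first by rewrite nrm0.
by apply: le_trans (nrmD hU _ _) _; rewrite lerD2l.
Qed.

Lemma an_bound_mono f a C r C' r' : 0 <= C -> 0 < r -> C <= C' -> r <= r' ->
  an_bound nU f a C r -> an_bound nU f a C' r'.
Proof.
move=> C0 r0 CC rr h x hx N; have x0 := normr_ge0 x.
have le1 : r * `|x| <= r' * `|x| by rewrite ler_wpM2r.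
apply: le_trans (h x (le_trans le1 hx) N) _.
have rx0 : 0 <= r * `|x| by rewrite mulr_ge0 // ltW.
by apply: ler_pM => //; [exact: exprn_ge0|apply: lerXn2r; rewrite ?nnegrE ?(le_trans rx0)].
Qed.

(** Cauchy estimate: two consecutive remainders differ by x^j a_j, and x = 1/(2r) is the largest
    point at which both are controlled. *)
Lemma an_bound_coef f a C r j : 0 <= C -> 0 < r -> an_bound nU f a C r ->
  nU (a j) <= 2 * C * r ^+ j.
Proof.
move=> C0 r0 h; pose x := (2 * r)^-1.
have x0 : 0 < x by rewrite invr_gt0 mulr_gt0.
have rx : r * `|x| = 2^-1 by rewrite gtr0_norm // /x invfM mulrCA divff ?gt_eqF // mulr1.
have hj := h x; rewrite rx in hj; have {}hj := hj (lexx _).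
have := nrmB (f x - \sum_(i < j) x ^+ i *: a i) (f x - \sum_(i < j.+1) x ^+ i *: a i).
have -> : f x - \sum_(i < j) x ^+ i *: a i - (f x - \sum_(i < j.+1) x ^+ i *: a i) =
    x ^+ j *: a j.
  by rewrite opprB addrC addrA subrK big_ord_recr /= addrC addKr.
rewrite (nrmZ hU) => hh.
have {hh} : `|x ^+ j| * nU (a j) <= C * 2^-1 ^+ j + C * 2^-1 ^+ j.+1.
  apply: le_trans hh _; apply: lerD; first exact: hj.
  exact: hj.
have -> : `|x ^+ j| = 2^-1 ^+ j * (r ^+ j)^-1.
  by rewrite normrX gtr0_norm // /x invfM exprMn !exprVn.
rewrite mulrAC ler_pdivrMr ?exprn_gt0 // exprS => hh.
have p0 : 0 < 2^-1 ^+ j :> R by rewrite exprn_gt0.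
rewrite -(ler_pM2l p0); apply: le_trans hh _.
have := exprn_ge0 j (ltW r0); have : 0 <= C * 2^-1 ^+ j * r ^+ j.
  by rewrite !mulr_ge0 ?exprn_ge0 // ltW.
set u := 2^-1 ^+ j; set v := r ^+ j; lra.
Qed.

Lemma an_coef0 f a : an_coef nU f a -> f 0 = a 0%N.
Proof.
move=> [C [r [C0 r0 h]]]; have := h 0; rewrite normr0 mulr0 invr_ge0 ler0n => /(_ isT 1%N).
rewrite big_ord1 expr0 scale1r expr1 mulr0 => /nrm_le0/eqP.
by rewrite subr_eq0 => /eqP.
Qed.

Lemma an_coef_eq f g a : an_coef nU f a -> an_coef nU g a -> \forall x \near 0, f x = g x.
Proof.
move=> [C [r [C0 r0 h]]] [C' [r' [C0' r0' h']]]; near=> x.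
have hx : (r + r') * `|x| <= 2^-1.
  by near: x; apply: near0_small; rewrite addr_gt0.
apply/eqP; rewrite -subr_eq0; apply/eqP/nrm_le0.
have rr0 : 0 <= (r + r') * `|x| by rewrite mulr_ge0 // ltW // addr_gt0.
apply: (@le_geometric0 _ _ (C + C') ((r + r') * `|x|)).
  by rewrite rr0 (le_lt_trans hx) // invf_lt1 // ltr1n.
move=> N; have -> : f x - g x = (f x - \sum_(j < N) x ^+ j *: a j) -
    (g x - \sum_(j < N) x ^+ j *: a j) by rewrite opprB addrA subrK.
apply: le_trans (nrmB _ _) _; rewrite mulrDl; apply: lerD.
  by apply: (an_bound_mono C0 r0 (lexx _) _ h); rewrite // lerDl ltW.
by apply: (an_bound_mono C0' r0' (lexx _) _ h'); rewrite // lerDr ltW.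
Unshelve. all: by end_near. Qed.

Lemma near0_radius (P : R -> Prop) : (\forall x \near 0, P x) ->
  exists2 r : R, 0 < r & forall x, r * `|x| <= 2^-1 -> P x.
Proof.
move=> /nbhs_ballP[e /= e0 he]; exists e^-1; first by rewrite invr_gt0.
move=> x hx; apply: he; rewrite /ball /= sub0r normrN.
have : `|x| <= e * 2^-1 by rewrite -ler_pdivrMl // mulrC.
by move/le_lt_trans; apply; rewrite gtr_pMr // invf_lt1 // ltr1n.
Qed.

Lemma an_ext f g a : (\forall x \near 0, f x = g x) -> an_coef nU f a -> an_coef nU g a.
Proof.
move=> /near0_radius[r' r0' e] [C [r [C0 r0 h]]].
exists C, (r + r'); split=> //; first by rewrite addr_gt0.
move=> x hx N; rewrite -e.
  by apply: (an_bound_mono C0 r0 (lexx _) _ h); rewrite // lerDl ltW.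
by apply: le_trans hx; rewrite ler_wpM2r // lerDr ltW.
Qed.

Lemma an_cst (u : U) : an_coef nU (fun=> u) (fun j => if j is 0%N then u else 0).
Proof.
exists (nU u), 1; split; rewrite ?nrm_ge0 // => x; rewrite mul1r => hx [|N].
  by rewrite big_ord0 subr0 expr0 mulr1.
rewrite big_ord_recl expr0 scale1r big1 ?addr0 ?subrr ?nrm0.
  by rewrite mulr_ge0 ?nrm_ge0 // exprn_ge0.
by move=> i _; rewrite scaler0.
Qed.

Lemma anD f g a b : an_coef nU f a -> an_coef nU g b ->
  an_coef nU (fun x => f x + g x) (fun j => a j + b j).
Proof.
move=> [C [r [C0 r0 h]]] [C' [r' [C0' r0' h']]].
exists (C + C'), (r + r'); split; rewrite ?addr_ge0 ?addr_gt0 // => x hx N.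
under eq_bigr do rewrite scalerDr.
rewrite big_split /= opprD addrACA.
apply: le_trans (nrmD hU _ _) _; rewrite mulrDl; apply: lerD.
  by apply: (an_bound_mono C0 r0 (lexx _) _ h); rewrite // lerDl ltW.
by apply: (an_bound_mono C0' r0' (lexx _) _ h'); rewrite // lerDr ltW.
Qed.

Lemma an_sum (I : Type) (s : seq I) (f : I -> R -> U) (a : I -> nat -> U) :
  (forall i, an_coef nU (f i) (a i)) ->
  an_coef nU (fun x => \sum_(i <- s) f i x) (fun j => \sum_(i <- s) a i j).
Proof.
move=> h; elim: s => [|i s IH].
  have := an_cst 0; congr an_coef; first by apply/funext => x; rewrite big_nil.
  by apply/funext => -[|j]; rewrite big_nil.
have := anD (h i) IH; congr an_coef; by apply/funext => x; rewrite big_cons.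
Qed.

Lemma an_of_coef a C r : geo_complete nU -> 0 <= C -> 0 < r ->
  (forall j, nU (a j) <= C * r ^+ j) -> exists f, an_bound nU f a (2 * C) r.
Proof.
move=> cU C0 r0 ha.
suff /choice[f hf] : forall x, exists y, r * `|x| <= 2^-1 ->
    forall N, nU (y - \sum_(j < N) x ^+ j *: a j) <= 2 * C * (r * `|x|) ^+ N.
  by exists f => x hx; exact: hf.
(* Beyond radius 1/(2r) nothing is required of the value, and 0 is taken; within it 1/(1 - r|x|) is
   at most 2, hence the factor in the constant. *)
move=> x; have [hx|hx] := leP (r * `|x|) 2^-1; last by exists 0.
have q0 : 0 <= r * `|x| by rewrite mulr_ge0 // ltW.
have [||s hs] := cU (fun j => x ^+ j *: a j) C (r * `|x|) _ C0.
- by rewrite q0 (le_lt_trans hx) // invf_lt1 // ltr1n.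
- move=> j; rewrite (nrmZ hU) normrX exprMn mulrA mulrC ler_wpM2r ?exprn_ge0 //.
- exists s => _ N; apply: le_trans (hs N) _.
  have p0 : 0 <= C * (r * `|x|) ^+ N by rewrite mulr_ge0 ?exprn_ge0.
  rewrite mulrC -mulrA ler_wpM2r // invf_ple ?posrE //; lra.
Qed.
End OneNorm.

(* Cauchy product of an analytic family of operators and an analytic family of vectors. *)
Lemma an_apply (U W : lmodType R) (nU : U -> R) (nW : W -> R) (T : R -> U -> W)
    (Ta : nat -> {linear U -> W}) f a :
  is_norm nU -> is_norm nW ->
  (exists C r, [/\ 0 <= C, 0 < r & forall u,
     an_bound nW (fun x => T x u) (fun j => Ta j u) (C * nU u) r]) ->
  an_coef nU f a ->
  an_coef nW (fun x => T x (f x)) (fun j => \sum_(i < j.+1) Ta i (a (j - i)%N)).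
Proof.
move=> hU hW [C1 [r1 [C10 r10 h1]]] [C2 [r2 [C20 r20 h2]]].
pose C := C1 + C2; pose r := r1 + r2.
have C0 : 0 <= C by rewrite addr_ge0.
have r0 : 0 < r by rewrite addr_gt0.
have hT u : an_bound nW (fun x => T x u) (fun j => Ta j u) (C * nU u) r.
  apply: an_bound_mono (h1 u) => //; rewrite ?mulr_ge0 ?(nrm_ge0 hU) //.
    by rewrite ler_wpM2r ?(nrm_ge0 hU) // lerDl.
  by rewrite lerDl ltW.
have hf : an_bound nU f a C r.
  by apply: an_bound_mono h2; rewrite // ?lerDr // ltW.
exists (3 * C ^+ 2), (2 * r); split; rewrite ?mulr_ge0 ?sqr_ge0 ?mulr_gt0 // => x hx N.
have hx1 : r * `|x| <= 2^-1.
  by apply: le_trans hx; rewrite -mulrA ler_peMl ?mulr_ge0 ?ler1n // ltW.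
have x0 : 0 <= r * `|x| by rewrite mulr_ge0 // ltW.
pose F k := \sum_(j < k) x ^+ j *: a j.
have conv : \sum_(j < N) x ^+ j *: \sum_(i < j.+1) Ta i (a (j - i)%N) =
    \sum_(i < N) x ^+ i *: Ta i (F (N - i)%N).
  transitivity (\sum_(i < N) \sum_(k < N - i) x ^+ (i + k) *: Ta i (a k)).
    rewrite (sum_triangle (fun i k => x ^+ (i + k) *: Ta i (a k))).
    apply: eq_bigr => j _; rewrite scaler_sumr; apply: eq_bigr => i _.
    by rewrite subnKC // -ltnS.
  apply: eq_bigr => i _; rewrite /F linear_sum scaler_sumr; apply: eq_bigr => k _.
  by rewrite linearZ /= scalerA exprD.
rewrite conv.
(* The remainder splits into that of T at the vector f x and the images under T_i of the remainders
   of f of order N - i. Each of the latter has size (r|x|)^N up to a constant, so their number N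
   appears as a factor. *)
have -> : T x (f x) - \sum_(i < N) x ^+ i *: Ta i (F (N - i)%N) =
    (T x (f x) - \sum_(i < N) x ^+ i *: Ta i (f x)) +
    \sum_(i < N) x ^+ i *: Ta i (f x - F (N - i)%N).
  rewrite -addrA; congr (_ + _); under [X in _ = _ + X]eq_bigr do rewrite linearB scalerBr.
  by rewrite sumrB addrA addNr add0r.
have nf : nU (f x) <= C by have := hf x hx1 0%N; rewrite big_ord0 subr0 expr0 mulr1.
have b1 : nW (T x (f x) - \sum_(i < N) x ^+ i *: Ta i (f x)) <= C ^+ 2 * (r * `|x|) ^+ N.
  apply: le_trans (hT (f x) x hx1 N) _; rewrite ler_wpM2r ?exprn_ge0 //.
  by rewrite expr2 ler_wpM2l.
have b2 : nW (\sum_(i < N) x ^+ i *: Ta i (f x - F (N - i)%N)) <=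
    2 * C ^+ 2 * N%:R * (r * `|x|) ^+ N.
  apply: le_trans (nrm_sum hW _ _ _) _.
  apply: (@le_trans _ _ (\sum_(i < N) 2 * C ^+ 2 * (r * `|x|) ^+ N)).
    apply: ler_sum => i _; rewrite (nrmZ hW) normrX.
    have := an_bound_coef hW i (mulr_ge0 C0 (nrm_ge0 hU (f x - F (N - i)%N))) r0 (hT _).
    have := hf x hx1 (N - i)%N; rewrite -/(F _); set y := f x - _ => h3 h4.
    have {h4} h4 : nW (Ta i y) <= 2 * (C * (C * (r * `|x|) ^+ (N - i))) * r ^+ i.
      apply: le_trans h4 _; rewrite ler_wpM2r ?exprn_ge0 ?(ltW r0) //.
      by rewrite ler_wpM2l // ler_wpM2l.
    apply: le_trans (ler_wpM2l _ h4) _; first by rewrite exprn_ge0.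
    rewrite -[in leRHS](subnKC (ltnW (ltn_ord i))) exprD [(r * `|x|) ^+ i]exprMn.
    by rewrite le_eqVlt; apply/orP; left; apply/eqP; ring.
  by rewrite sumr_const card_ord -[X in X <= _]mulr_natr mulrAC.
apply: le_trans (nrmD hW _ _) _; apply: le_trans (lerD b1 b2) _.
rewrite -[2 * r * _]mulrA [(2 * _) ^+ N]exprMn.
have p0 : 0 <= C ^+ 2 * (r * `|x|) ^+ N by rewrite mulr_ge0 ?sqr_ge0 ?exprn_ge0.
have n2 := natr_le_expr2 R N.
have n1 : 1 <= 2 ^+ N :> R by rewrite exprn_ege1 // ler1n.
have := ler_wpM2r p0 n2; have := ler_wpM2r p0 n1.
set u := C ^+ 2; set v := (r * `|x|) ^+ N; lra.
Qed.
End AnalyticGeneral.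

Lemma hilbert_norm (R : realType) (H : lmodType R) (ip : H -> H -> R) :
  hilbert ip -> is_norm (hnorm ip).
Proof. by move=> hH; split; [exact: nmD|exact: nmZ|exact: nm_eq0]. Qed.

Lemma an_lipschitz (R : realType) (U : lmodType R) (nU : U -> R) f a :
  is_norm nU -> an_coef nU f a ->
  exists K r, [/\ 0 <= K, 0 < r & forall x, r * `|x| <= 2^-1 -> nU (f x - f 0) <= K * `|x|].
Proof.
move=> hU fa; rewrite (an_coef0 hU fa); case: fa => C [r [C0 r0 h]].
exists (C * r), r; split; rewrite ?mulr_ge0 ?(ltW r0) // => x /h /(_ 1%N).
by rewrite big_ord1 expr0 scale1r expr1 mulrA.
Qed.

Section RealHilbert.
Variable R : realType.
(** The scalars as a Hilbert space of dimension one, so that products of scalar power series are an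
    instance of [an_ip]. *)
Definition Rip (x y : R^o) : R := x * y.

Lemma hnorm_Rip : hnorm Rip = @Num.norm R R.
Proof. by apply/funext => x; rewrite /hnorm /Rip -expr2 sqrtr_sqr. Qed.

Lemma geo_complete_real : geo_complete (U := R^o) (@Num.norm R R).
Proof.
move=> a C q /[dup] q01 /andP[q0 q1] C0 ha.
have cva : cvgn (series (a : R^o ^nat)).
  apply: normed_cvg; apply: (@series_le_cvg _ _ (geometric C q)).
  - by move=> n /=.
  - by move=> n /=; rewrite mulr_ge0 // exprn_ge0.
  - by move=> n /=; exact: ha.
  - by apply: is_cvg_geometric_series; rewrite ger0_norm.
exists (limn (series (a : R^o ^nat))) => N.
have cv : (fun M => `|series (a : R^o ^nat) M - \sum_(j < N) a j|) @ \oo -->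
    `|limn (series (a : R^o ^nat)) - \sum_(j < N) a j|.
  by apply: cvg_norm; apply: cvgB => //; exact: cvg_cst.
rewrite -(cvg_lim _ cv) //; apply: limr_le; first by apply/cvg_ex; eexists; exact: cv.
near=> M.
have NM : (N <= M)%N by near: M; exact: nbhs_infty_ge.
rewrite /series /= big_mkord -(subnKC NM) big_split_ord /= addrAC subrr add0r.
apply: le_trans (ler_norm_sum _ _ _) _.
apply: le_trans (sum_geometric_le N (M - N) C0 q01).
by apply: ler_sum => i _; exact: ha.
Unshelve. all: by end_near. Qed.

Lemma hilbert_real : hilbert Rip.
Proof.
split.
- by move=> x y z; rewrite /Rip mulrDl.
- by move=> a x y; rewrite /Rip -mulrA.
- by move=> x y; rewrite /Rip mulrC.
- by move=> x x0; rewrite /Rip -expr2 exprn_even_gt0.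
- move=> a C q q01 C0; rewrite hnorm_Rip => ha.
  have [s hs] := geo_complete_real q01 C0 ha; exists s, (C / (1 - q)) => N.
  by rewrite mulrAC.
Qed.

Lemma real_norm : is_norm (U := R^o) (@Num.norm R R).
Proof. by rewrite -hnorm_Rip; exact: hilbert_norm hilbert_real. Qed.
End RealHilbert.

(** Analyticity of a real function at 0; other base points are reached by translation. *)
Definition san (R : realType) (f : R -> R) :=
  exists a, an_coef (U := R^o) (@Num.norm R R) f a.

Section AnalyticProducts.
Variables (R : realType) (H : lmodType R) (ip : H -> H -> R).
Hypothesis hH : hilbert ip.
Let nH := hilbert_norm hH.

Lemma an_ip (f g : R -> H) a b : an_coef (hnorm ip) f a -> an_coef (hnorm ip) g b ->
  an_coef (U := R^o) (@Num.norm R R) (fun x => ip (f x) (g x))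
    (fun j => \sum_(i < j.+1) ip (a i) (b (j - i)%N)).
Proof.
move=> [C [r [C0 r0 h]]] hg.
have lin i : linear (ip (a i) : H -> R^o) by move=> c x y; rewrite (ipDr hH) (ipZr hH).
apply: (@an_apply R H R^o (hnorm ip) (@Num.norm R R) (fun x u => ip (f x) u)
  (fun i => mklinear (lin i)) g b nH (real_norm R) _ hg).
exists C, r; split=> // u x hx N.
have -> : ip (f x) u - \sum_(j < N) x ^+ j *: (mklinear (lin j) u : R^o) =
    ip (f x - \sum_(j < N) x ^+ j *: a j) u.
  by rewrite (ipBl hH) (ip_suml hH); congr (_ - _); apply: eq_bigr => i _; rewrite (ipZl hH).
apply: le_trans (cauchy_schwarz hH _ _) _; rewrite mulrAC ler_wpM2r ?nm_ge0 //; exact: h.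
Qed.

Lemma an_scale (f : R -> R) (g : R -> H) a b :
  an_coef (U := R^o) (@Num.norm R R) f a -> an_coef (hnorm ip) g b ->
  an_coef (hnorm ip) (fun x => f x *: g x) (fun j => \sum_(i < j.+1) a i *: b (j - i)%N).
Proof.
move=> [C [r [C0 r0 h]]] hg.
apply: (@an_apply R H H (hnorm ip) (hnorm ip) (fun x u => f x *: u)
  (fun i => a i \*: idfun) g b nH nH _ hg).
exists C, r; split=> // u x hx N /=.
under eq_bigr do rewrite scalerA.
rewrite -scaler_suml -scalerBl nmZ // mulrAC ler_wpM2r ?nm_ge0 //; exact: h.
Qed.

Lemma an_linear (A : {linear H -> H}) B (f : R -> H) a : 0 <= B ->
  (forall x, hnorm ip (A x) <= B * hnorm ip x) ->
  an_coef (hnorm ip) f a -> an_coef (hnorm ip) (A \o f) (A \o a).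
Proof.
move=> B0 hB [C [r [C0 r0 h]]]; exists (B * C), r; split; rewrite ?mulr_ge0 // => x hx N /=.
have -> : A (f x) - \sum_(j < N) x ^+ j *: A (a j) = A (f x - \sum_(j < N) x ^+ j *: a j).
  by under eq_bigr do rewrite -linearZ; rewrite -linear_sum -linearB.
by apply: le_trans (hB _) _; rewrite -mulrA ler_wpM2l //; exact: h.
Qed.
End AnalyticProducts.

Section ScalarAnalytic.
Variable R : realType.
Implicit Types f g : R -> R.
Let nR := real_norm R.

Lemma sanD f g : san f -> san g -> san (fun x => f x + g x).
Proof. by move=> [a ha] [b hb]; eexists; exact: (anD nR ha hb). Qed.
Lemma san_cst (c : R) : san (fun=> c).
Proof. by eexists; exact: (an_cst nR (c : R^o)). Qed.
Lemma sanM f g : san f -> san g -> san (fun x => f x * g x).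
Proof.
move=> [a ha] [b hb]; eexists.
by apply: (an_ip (hilbert_real R)); rewrite hnorm_Rip; [exact: ha|exact: hb].
Qed.
Lemma sanN f : san f -> san (fun x => - f x).
Proof.
move=> /(sanM (san_cst (-1))); congr san; apply/funext => x; by rewrite mulN1r.
Qed.
Lemma sanB f g : san f -> san g -> san (fun x => f x - g x).
Proof. by move=> hf /sanN; exact: sanD. Qed.
Lemma san_id : san (fun x : R => x).
Proof.
exists (fun j => (j == 1%N)%:R), 1, 1; split; rewrite ?ltr01 // => x; rewrite mul1r => hx.
case=> [|[|N]]; rewrite ?big_ord0 ?big_ord1 ?subr0 ?expr0 ?expr1 ?mul1r.
- by apply: le_trans hx _; rewrite invf_le1 ?ler1n.
- by rewrite scaler0 subr0.
- rewrite big_ord_recl big_ord_recl big1; last by move=> i _; rewrite scaler0.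
  by rewrite scaler0 add0r addr0 /= expr1 [_ *: _]mulr1 subrr normr0 exprn_ge0.
Qed.
Lemma san_sum (I : Type) (s : seq I) (P : pred I) (F : I -> R -> R) :
  (forall i, P i -> san (F i)) -> san (fun x => \sum_(i <- s | P i) F i x).
Proof.
move=> h; elim: s => [|i s IH].
  by have := san_cst 0; congr san; apply/funext => x; rewrite big_nil.
have [Pi|Pi] := boolP (P i); last by move: IH; congr san; apply/funext => x; rewrite big_cons (negPf Pi).
by have := sanD (h i Pi) IH; congr san; apply/funext => x; rewrite big_cons Pi.
Qed.
Lemma san_prod (I : Type) (s : seq I) (P : pred I) (F : I -> R -> R) :
  (forall i, P i -> san (F i)) -> san (fun x => \prod_(i <- s | P i) F i x).
Proof.
move=> h; elim: s => [|i s IH].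
  by have := san_cst 1; congr san; apply/funext => x; rewrite big_nil.
have [Pi|Pi] := boolP (P i); last by move: IH; congr san; apply/funext => x; rewrite big_cons (negPf Pi).
by have := sanM (h i Pi) IH; congr san; apply/funext => x; rewrite big_cons Pi.
Qed.
Lemma sanX f n : san f -> san (fun x => f x ^+ n).
Proof.
move=> hf; elim: n => [|n IH]; first exact: (san_cst 1).
by have := sanM hf IH; congr san; apply/funext => x; rewrite exprS.
Qed.

Lemma san_ext f g : (\forall x \near 0, f x = g x) -> san f -> san g.
Proof. by move=> h [a ha]; exists a; exact: an_ext h ha. Qed.

Lemma san_continuous f : san f -> forall e, 0 < e -> \forall x \near 0, `|f x - f 0| < e.
Proof.
move=> [a /(an_lipschitz nR)[K [r [K0 r0 h]]]] e e0.
pose s := r + K / e; have s0 : 0 < s by rewrite ltr_wpDr // divr_ge0 // ltW.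
apply: filterS (near0_small s0) => x hx.
have x0 := normr_ge0 x.
apply: le_lt_trans (h x _) _.
  by apply: le_trans hx; rewrite ler_wpM2r // lerDl divr_ge0 // ltW.
have : K / e * `|x| <= 2^-1.
  by apply: le_trans hx; rewrite ler_wpM2r // lerDr ltW.
rewrite mulrAC ler_pdivrMr //; move/le_lt_trans; apply.
by rewrite gtr_pMl // invf_lt1 // ltr1n.
Qed.

Lemma san_neq0 f : san f -> f 0 != 0 -> \forall x \near 0, f x != 0.
Proof.
move=> hf f0; apply: filterS (san_continuous hf (_ : 0 < `|f 0|)); last by rewrite normr_gt0.
by move=> x; apply: contraTneq => ->; rewrite sub0r normrN ltxx.
Qed.

Lemma sanV f : san f -> f 0 != 0 -> san (fun x => (f x)^-1).
Proof.
move=> /[dup] sf [a fa] f0; have a0 : a 0%N != 0 by rewrite -(an_coef0 nR fa).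
case: (fa) => C [r [C0 r0 h]].
have [|b bE] := @rec_sequence R 0 (fun n u => if n is 0%N then (a 0%N)^-1 else
    - (a 0%N)^-1 * \sum_(i < n) a i.+1 * u (n - i.+1)%N).
  move=> [//|n] u v uv; congr (_ * _); apply: eq_bigr => i _; congr (_ * _).
  by apply: uv; rewrite subSS ltnS leq_subr.
(* Here |a j| <= D r^j and B = |1/a_0|. Since K - 1 = D B, the geometric sum produced by the
   recursion is exactly K^m - 1, and the induction for |b j| <= B (K r)^j closes. *)
pose D := 2 * C; pose B := `|(a 0%N)^-1|; pose K := 1 + D * B.
have D0 : 0 <= D by rewrite mulr_ge0.
have B0 : 0 <= B by rewrite normr_ge0.
have K1 : 1 <= K by rewrite lerDl mulr_ge0.
have K0 : 0 < K by rewrite (lt_le_trans ltr01).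
have hb j : `|b j| <= B * (K * r) ^+ j.
  have [n] := ubnP j; elim: n j => // n IH [|j] jn; first by rewrite bE expr0 mulr1.
  rewrite bE normrM normrN -/B ler_wpM2l //.
  apply: le_trans (ler_norm_sum _ _ _) _.
  have gs m : D * B * \sum_(i < m) K ^+ (m - i.+1)%N = K ^+ m - 1.
    elim: m => [|m IHm]; first by rewrite big_ord0 mulr0 subrr.
    rewrite big_ord_recl /= subn1 /= mulrDr.
    under eq_bigr do rewrite /bump /= add1n subSS.
    by rewrite IHm exprS /K; ring.
  apply: (@le_trans _ _ (\sum_(i < j.+1) r ^+ j.+1 * (D * B * K ^+ (j.+1 - i.+1)%N))).
    apply: ler_sum => i _; rewrite normrM.
    have ij : (i.+1 + (j.+1 - i.+1) = j.+1)%N by rewrite subnKC.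
    have -> : r ^+ j.+1 * (D * B * K ^+ (j.+1 - i.+1)) =
        (D * r ^+ i.+1) * (B * (K * r) ^+ (j.+1 - i.+1)).
      by rewrite -{1}ij exprD exprMn; ring.
    apply: ler_pM => //; first exact: (an_bound_coef nR i.+1 C0 r0 h).
    by apply: IH; rewrite subSS (leq_ltn_trans (leq_subr _ _)).
  rewrite -mulr_sumr -mulr_sumr gs mulrC exprMn ler_wpM2r ?exprn_ge0 ?(ltW r0) //.
  by rewrite lerBlDr lerDl.
have Kr0 : 0 < K * r by rewrite mulr_gt0.
have [g hg] := an_of_coef nR (@geo_complete_real R) B0 Kr0 hb.
have gb : an_coef (U := R^o) Num.norm g b by exists (2 * B), (K * r); split; rewrite ?mulr_ge0.
suff fg1 : \forall x \near 0, f x * g x = 1.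
  exists b; apply: an_ext gb; near=> x.
  have e : f x * g x = 1 by near: x.
  have fx : f x != 0 by apply: contra_eq_neq e => ->; rewrite mul0r eq_sym oner_neq0.
  by apply: (mulfI fx); rewrite e divff.
apply: (@an_coef_eq R R^o Num.norm nR _ _ _ _ (an_cst nR (1 : R^o))).
have := @an_ip R R^o (@Rip R) (hilbert_real R) f g a b; rewrite hnorm_Rip => /(_ fa gb).
congr an_coef; apply/funext => -[|j]; first by rewrite big_ord1 /Rip bE divff.
rewrite big_ord_recl /= /Rip subn0 bE mulrA mulrN divff // mulN1r.
by apply/eqP; rewrite addrC subr_eq0; apply/eqP; apply: eq_bigr => i _.
Unshelve. all: by end_near. Qed.

(** The exponent n is the index of the first nonzero coefficient, and the series of g is the shifted
    one. At 0 the quotient is replaced by [a n]; the summand |a n| in the constant covers that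
    point. *)
Lemma san_factor f : san f -> (\forall x \near 0, f x = 0) \/
  exists n g, [/\ san g, g 0 != 0 & forall x, f x = x ^+ n * g x].
Proof.
move=> [a fa]; have [a0|/existsNP[n0 hn0]] := pselect (forall j, a j = 0).
  left; apply: (an_coef_eq nR fa); have := an_cst nR (0 : R^o); congr an_coef.
  by apply/funext => -[|j]; rewrite a0.
right; have exa : exists n, a n != 0 by exists n0; apply/eqP.
case: (ex_minnP exa) => n an hmin; have lt_n j : (j < n)%N -> a j = 0.
  by move=> jn; apply/eqP; apply: contraTT jn => /hmin; rewrite leqNgt.
pose g x := if x == 0 then a n else f x / x ^+ n.
have f0 : f 0 = 0 ^+ n * a n.
  rewrite (an_coef0 nR fa); case: n an hmin lt_n {g} => [|n] an hmin lt_n.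
    by rewrite expr0 mul1r.
  by rewrite expr0n mul0r lt_n.
exists n, g; split; last first.
- move=> x; rewrite /g; case: eqP => [->//|/eqP x0].
  by rewrite mulrC divfK // expf_neq0.
- by rewrite /g eqxx.
exists (fun j => a (n + j)%N); case: fa => C [r [C0 r0 h]].
exists (C * r ^+ n + `|a n|), r; split; rewrite ?addr_ge0 ?mulr_ge0 ?exprn_ge0 ?(ltW r0) //.
move=> x hx N; rewrite /g; case: eqP => [->|/eqP x0].
  rewrite normr0 mulr0; case: N => [|N].
    by rewrite big_ord0 subr0 expr0 mulr1 lerDr mulr_ge0 ?exprn_ge0 // ltW.
  rewrite big_ord_recl addn0 expr0 scale1r big1 ?addr0 ?subrr ?normr0.
    by rewrite exprS mul0r mulr0.
  by move=> i _; rewrite /= expr0n scale0r.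
have nx : 0 < `|x| ^+ n by rewrite exprn_gt0 // normr_gt0.
rewrite -(ler_pM2l nx) -normrX -normrM mulrBr mulrC divfK ?expf_neq0 //.
have -> : x ^+ n * \sum_(j < N) x ^+ j *: a (n + j)%N = \sum_(j < n + N) x ^+ j *: a j.
  rewrite big_split_ord /= [X in _ = X + _]big1 ?add0r; last first.
    by move=> i _; rewrite lt_n // scaler0.
  by rewrite mulr_sumr; apply: eq_bigr => j _; rewrite exprD; exact: mulrA.
apply: le_trans (h x hx (n + N)%N) _.
rewrite exprD exprMn normrX mulrDl mulrDr !mulrA.
have -> : C * r ^+ n * `|x| ^+ n * (r * `|x|) ^+ N = `|x| ^+ n * C * r ^+ n * (r * `|x|) ^+ N by ring.
by rewrite lerDl !mulr_ge0 ?exprn_ge0 ?mulr_ge0 // ltW.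
Qed.

Lemma san_zero_or_isolated f : san f ->
  (\forall x \near 0, f x = 0) \/ (\forall x \near 0^', f x != 0).
Proof.
move=> /san_factor[|[n [g [sg g0 e]]]]; [by left|right].
have := san_neq0 sg g0; rewrite /dnbhs => h; apply: filterS h => x gx x0.
by rewrite e mulf_neq0 // expf_neq0.
Qed.

(* Re-expansion at a nearby point, by absolute convergence of the binomial double series. *)
Lemma san_shift f : san f -> \forall y \near 0, san (fun h => f (y + h)).
Proof.
move=> [a [C [r [C0 r0 h]]]].
have r4 : 0 < 4 * r by rewrite mulr_gt0.
apply: filterS (near0_small r4) => y hy.
pose D := 2 * C; have D0 : 0 <= D by rewrite mulr_ge0.
have ha j : `|a j| <= D * r ^+ j by exact: (an_bound_coef nR j C0 r0 h).
(* The sum of [t i k] over k is the i-th Taylor coefficient at y. The binomial coefficient costs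
   2^(i+k), and |y| <= 1/(4r) leaves the convergent factor 2^-k. *)
pose t i k : R := 'C(i + k, i)%:R * a (i + k)%N * y ^+ k.
have ht i k : `|t i k| <= D * (2 * r) ^+ i * 2^-1 ^+ k.
  rewrite /t !normrM normrX ger0_norm ?ler0n //.
  have b2 : 'C(i + k, i)%:R <= 2 ^+ (i + k) :> R.
    rewrite -natrX ler_nat -[2%N]/(1 + 1)%N expnDn.
    have ik : (i < (i + k).+1)%N by rewrite ltnS leq_addr.
    rewrite (bigD1 (Ordinal ik)) //= !exp1n !muln1; exact: leq_addr.
  have b3 : `|y| ^+ k <= (4 * r)^-1 ^+ k.
    rewrite lerXn2r ?nnegrE ?invr_ge0 ?(ltW r4) //.
    rewrite -[leRHS]mulr1 ler_pdivlMl //; apply: le_trans hy _.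
    by rewrite invf_le1 ?ler1n.
  apply: le_trans (ler_pM _ _ (ler_pM _ _ b2 (ha (i + k)%N)) b3) _; rewrite ?mulr_ge0 ?exprn_ge0 //.
  rewrite le_eqVlt; apply/orP; left; apply/eqP.
  have -> : (4 * r)^-1 = 2^-1 * (2^-1 * r^-1) by rewrite invfM mulrA; congr (_ * _); lra.
  rewrite !exprD !exprMn.
  have e1 : 2 ^+ k * 2^-1 ^+ k = 1 :> R by rewrite -exprMn divff // expr1n.
  have e2 : r ^+ k * r^-1 ^+ k = 1 by rewrite -exprMn divff ?gt_eqF // expr1n.
  transitivity (D * 2 ^+ i * r ^+ i * 2^-1 ^+ k * (2 ^+ k * 2^-1 ^+ k) * (r ^+ k * r^-1 ^+ k)); first ring.
  by rewrite e1 e2 !mulr1 !mulrA.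
have h2 : 0 <= (2^-1 : R) < 1 by rewrite invr_ge0 ler0n invf_lt1 // ltr1n.
have /choice[b hb] : forall i, exists s : R, forall K,
    `|s - \sum_(k < K) t i k| <= 2 * (D * (2 * r) ^+ i) * 2^-1 ^+ K.
  move=> i; have D1 : 0 <= D * (2 * r) ^+ i by rewrite mulr_ge0 ?exprn_ge0 ?mulr_ge0 // ltW.
  have [s hs] := geo_complete_real h2 D1 (ht i); exists s => K.
  apply: le_trans (hs K) _.
  have -> : 1 - 2^-1 = 2^-1 :> R by lra.
  by rewrite invrK le_eqVlt; apply/orP; left; apply/eqP; ring.
exists b, (8 * D), (4 * r); split; rewrite ?mulr_ge0 // => x hx N.
pose q : R := 2^-1; have q0 : 0 <= q by rewrite invr_ge0.
have q1 : q <= 1 by rewrite invf_le1 ?ler1n.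
have x0 := normr_ge0 x.
have r0' := ltW r0.
have hxy : r * `|y + x| <= q.
  have := ler_wpM2l r0' (ler_normD y x); rewrite mulrDr.
  have -> : q = 4 * 8^-1 by rewrite /q; lra.
  have : r * `|y| <= 8^-1 by rewrite -(ler_pM2l (_ : 0 < 4)) // mulrA; apply: le_trans hy _; lra.
  have : r * `|x| <= 8^-1 by rewrite -(ler_pM2l (_ : 0 < 4)) // mulrA; apply: le_trans hx _; lra.
  lra.
have hx2 : 2 * r * `|x| <= q.
  by apply: le_trans hx; rewrite ler_wpM2r // ler_wpM2r // ler_nat.
have x20 : 0 <= 2 * r * `|x| by rewrite mulr_ge0 // mulr_ge0.
rewrite -subr_le0.
apply: (@le_geometric0 _ _ (C * q ^+ N + 2 * D * N%:R) q) => // J'.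
(* The finite double sum up to J = N + J' is compared with both expansions; letting J' grow removes
   everything but the terms with at least N powers of x. *)
pose J := (N + J')%N.
have pJ : \sum_(j < J) (y + x) ^+ j *: (a j : R^o) =
    \sum_(i < J) x ^+ i * \sum_(k < J - i) t i k.
  under [RHS]eq_bigr do rewrite mulr_sumr.
  rewrite (sum_triangle (fun i k => x ^+ i * t i k)).
  apply: eq_bigr => j _; rewrite exprDn scaler_suml; apply: eq_bigr => i _.
  have ij : (i + (j - i) = j)%N by rewrite subnKC // -ltnS.
  rewrite /t ij -mulr_natl;  rewrite [LHS](_ : _ = 'C(j, i)%:R * (y ^+ (j - i) * x ^+ i) * a j); last by [].
  set u := y ^+ _; set v := x ^+ _; set w := a _; set c := _%:R; ring.
have -> : f (y + x) - \sum_(i < N) x ^+ i *: (b i : R^o) =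
    (f (y + x) - \sum_(j < J) (y + x) ^+ j *: (a j : R^o)) +
    (\sum_(i < N) x ^+ i * (\sum_(k < J - i) t i k - b i) +
     \sum_(i < J') x ^+ (N + i) * \sum_(k < J - (N + i)) t (N + i)%N k).
  rewrite pJ big_split_ord /=; under [X in _ = _ + (X + _)]eq_bigr do rewrite mulrBr.
  rewrite sumrB; under [X in f (y + x) - X]eq_bigr do rewrite [_ *: _]/(_ * _).
  ring.
have b1 : `|f (y + x) - \sum_(j < J) (y + x) ^+ j *: (a j : R^o)| <= C * q ^+ N * q ^+ J'.
  apply: le_trans (h _ hxy J) _; rewrite -mulrA ler_wpM2l // -exprD lerXn2r ?nnegrE //.
  by rewrite mulr_ge0.
have b2 : `|\sum_(i < N) x ^+ i * (\sum_(k < J - i) t i k - b i)| <= 2 * D * N%:R * q ^+ J'.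
  apply: le_trans (ler_norm_sum _ _ _) _.
  apply: (@le_trans _ _ (\sum_(i < N) 2 * D * q ^+ J')).
    apply: ler_sum => i _; rewrite normrM normrX.
    have iN := ltnW (ltn_ord i).
    rewrite distrC; apply: le_trans (ler_wpM2l (exprn_ge0 i x0) (hb i (J - i)%N)) _.
    have -> : `|x| ^+ i * (2 * (D * (2 * r) ^+ i) * 2^-1 ^+ (J - i)) =
      2 * D * ((2 * r * `|x|) ^+ i * q ^+ (J - i)) by rewrite [(2 * r * _) ^+ _]exprMn; ring.
    rewrite ler_wpM2l ?mulr_ge0 //.
    have -> : q ^+ J' = 1 * q ^+ J' by rewrite mul1r.
    apply: ler_pM; rewrite ?exprn_ge0 //.
      by rewrite exprn_ile1 // (le_trans hx2).
    by rewrite ler_wiXn2l // /J addnC -addnBA // leq_addr.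
  by rewrite sumr_const card_ord -[X in X <= _]mulr_natr mulrAC.
have b3 : `|\sum_(i < J') x ^+ (N + i) * \sum_(k < J - (N + i)) t (N + i)%N k| <=
    8 * D * (4 * r * `|x|) ^+ N.
  apply: le_trans (ler_norm_sum _ _ _) _.
  have q01 : 0 <= 2 * r * `|x| < 1 by rewrite x20 (le_lt_trans hx2) // /q invf_lt1 // ltr1n.
  have D2 : 0 <= 2 * D by rewrite mulr_ge0.
  apply: (@le_trans _ _ (\sum_(i < J') 2 * D * (2 * r * `|x|) ^+ (N + i))).
    apply: ler_sum => i _; rewrite normrM normrX exprMn.
    have Dr : 0 <= D * (2 * r) ^+ (N + i) by rewrite mulr_ge0 // exprn_ge0 // mulr_ge0.
    have : `|\sum_(k < J - (N + i)) t (N + i)%N k| <= 2 * (D * (2 * r) ^+ (N + i)).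
      apply: le_trans (ler_norm_sum _ _ _) _.
      have := sum_geometric_le 0 (J - (N + i)) Dr h2; rewrite expr0 mulr1.
      have -> : (1 - 2^-1)^-1 = 2 :> R by rewrite (_ : 1 - 2^-1 = 2^-1) ?invrK //; lra.
      rewrite [_ * 2]mulrC; apply: le_trans; apply: ler_sum => k _; exact: ht.
    by move=> /(ler_wpM2l (exprn_ge0 (N + i) x0)) /le_trans; apply; rewrite mulrC !mulrA.
  apply: le_trans (sum_geometric_le N J' D2 q01) _.
  have i2 : (1 - 2 * r * `|x|)^-1 <= 2.
    rewrite invf_ple ?posrE //; rewrite /q in hx2; lra.
  apply: le_trans (ler_wpM2l _ i2) _; first by rewrite mulr_ge0 // exprn_ge0.
  have : (2 * r * `|x|) ^+ N <= (4 * r * `|x|) ^+ N.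
    by rewrite lerXn2r ?nnegrE ?mulr_ge0 // ler_wpM2r // ler_wpM2r // ler_nat.
  have : 0 <= (4 * r * `|x|) ^+ N by rewrite exprn_ge0 // !mulr_ge0.
  set u := _ ^+ N; set v := _ ^+ N => u0 /(ler_wpM2l D0); have := mulr_ge0 D0 u0; lra.
rewrite lerBlDr mulrDl.
apply: le_trans (ler_normD _ _) _; rewrite -addrA; apply: lerD => //.
by apply: le_trans (ler_normD _ _) _; apply: lerD.
Qed.
End ScalarAnalytic.

(** * Analytic matrix functions *)

Section MatrixAnalytic.
Variable R : realType.

Definition anmx p q (K : R -> 'M[R]_(p, q)) := forall i j, san (fun x => K x i j).

Lemma anmx_cst p q (A : 'M[R]_(p, q)) : anmx (fun=> A).
Proof. by move=> i j; exact: san_cst. Qed.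
Lemma anmxD p q (K L : R -> 'M[R]_(p, q)) : anmx K -> anmx L -> anmx (fun x => K x + L x).
Proof.
move=> hK hL i j; have := sanD (hK i j) (hL i j); congr san.
by apply/funext => x; rewrite mxE.
Qed.
Lemma anmxN p q (K : R -> 'M[R]_(p, q)) : anmx K -> anmx (fun x => - K x).
Proof.
move=> hK i j; have := sanN (hK i j); congr san; by apply/funext => x; rewrite mxE.
Qed.
Lemma anmxB p q (K L : R -> 'M[R]_(p, q)) : anmx K -> anmx L -> anmx (fun x => K x - L x).
Proof. by move=> hK /anmxN; exact: anmxD. Qed.
Lemma anmxM p q s (K : R -> 'M[R]_(p, q)) (L : R -> 'M[R]_(q, s)) :
  anmx K -> anmx L -> anmx (fun x => K x *m L x).
Proof.
move=> hK hL i j; have := san_sum (index_enum 'I_q) (P := xpredT)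
  (fun k _ => sanM (hK i k) (hL k j)); congr san.
by apply/funext => x; rewrite mxE.
Qed.
Lemma anmx_tr p q (K : R -> 'M[R]_(p, q)) : anmx K -> anmx (fun x => (K x)^T).
Proof.
move=> hK i j; have := hK j i; congr san; by apply/funext => x; rewrite mxE.
Qed.
Lemma anmx_scalar p (f : R -> R) : san f -> anmx (fun x => (f x)%:M : 'M[R]_p).
Proof.
move=> hf i j; have := sanM hf (san_cst (i == j)%:R); congr san.
by apply/funext => x; rewrite mxE mulr_natr.
Qed.
Lemma san_det p (K : R -> 'M[R]_p) : anmx K -> san (fun x => \det (K x)).
Proof.
move=> hK; apply: san_sum => s _; apply: sanM; first exact: san_cst.
by apply: san_prod => i _; exact: hK.
Qed.
(** Cramer's rule: the inverse is the adjugate divided by the determinant, and both are polynomials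
    in the entries. *)
Lemma anmx_inv p (K : R -> 'M[R]_p) : anmx K -> K 0 \in unitmx -> anmx (fun x => invmx (K x)).
Proof.
move=> hK K0; have d0 : \det (K 0) != 0 by move: K0; rewrite unitmxE unitfE.
have sd := san_det hK.
move=> i j.
apply: (@san_ext _ (fun x => (\det (K x))^-1 * \adj (K x) i j)).
  apply: filterS (san_neq0 sd d0) => x dx.
  by rewrite /invmx unitmxE unitfE dx [RHS]mxE.
apply: sanM; first exact: sanV.
have : san (fun x => cofactor (K x) j i).
  apply: sanM; first exact: san_cst.
  apply: (san_det (K := fun x => row' j (col' i (K x)))) => a b.
  have := hK (lift j a) (lift i b); congr san; by apply/funext => x; rewrite !mxE.
by congr san; apply/funext => x; rewrite mxE.
Qed.
Lemma near_unitmx p (K : R -> 'M[R]_p) : anmx K -> K 0 \in unitmx ->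
  \forall x \near 0, K x \in unitmx.
Proof.
move=> hK; rewrite unitmxE unitfE => d0; have := san_neq0 (san_det hK) d0.
by apply: filterS => x; rewrite unitmxE unitfE.
Qed.
End MatrixAnalytic.

(** * Deflation to a finite-dimensional problem *)

Section QuadraticRecursion.
Variable R : realType.
Implicit Types p q y : nat -> R.

(** All terms are nonnegative, and the triangle i + k < N lies in the square i, k < N. *)
Lemma weighted_conv_le p q (t : R) N : 0 <= t -> (forall n, 0 <= p n) -> (forall n, 0 <= q n) ->
  \sum_(n < N) t ^+ n * \sum_(i < n.+1) p i * q (n - i)%N <=
  (\sum_(n < N) t ^+ n * p n) * (\sum_(n < N) t ^+ n * q n).
Proof.
move=> t0 p0 q0.
have -> : \sum_(n < N) t ^+ n * \sum_(i < n.+1) p i * q (n - i)%N =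
    \sum_(i < N) \sum_(k < N - i) (t ^+ i * p i) * (t ^+ k * q k).
  rewrite (sum_triangle (fun i k => (t ^+ i * p i) * (t ^+ k * q k))).
  apply: eq_bigr => n _; rewrite mulr_sumr; apply: eq_bigr => i _.
  have -> : t ^+ n = t ^+ i * t ^+ (n - i) by rewrite -exprD subnKC // -ltnS.
  by ring.
rewrite mulr_suml; apply: ler_sum => i _; rewrite -mulr_sumr.
rewrite ler_wpM2l ?mulr_ge0 ?exprn_ge0 //.
have : (N - i <= N)%N by exact: leq_subr.
move: (N - i)%N => k kN; rewrite -(subnKC kN) [leRHS]big_split_ord /= lerDl sumr_ge0 // => j _.
by rewrite mulr_ge0 // exprn_ge0.
Qed.

(* Method of majorants: with t small, the weighted partial sums of y stay below 1/(2L). *)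
Lemma quadratic_recursion_bound y (B L C r : R) : 0 <= B -> 1 <= L -> 0 <= C -> 0 < r ->
  (forall n, 0 <= y n) -> y 0%N <= B ->
  (forall n, y n.+1 <= L * (\sum_(b < n) y b.+1 * y (n - b)%N +
     \sum_(a < n.+1) C * r ^+ a.+1 * (\sum_(b < (n - a).+1) y b * y (n - a - b)%N) +
     \sum_(a < n.+1) C * r ^+ a.+1 * y (n - a)%N)) ->
  exists D s, [/\ 0 <= D, 0 < s & forall n, y n <= D * s ^+ n].
Proof.
move=> B0 L1 C0 r0 y0 yB hy.
have L0 : 0 < L by rewrite (lt_le_trans ltr01).
(* With zeta N the sum of t^n y_n over 1 <= n <= N, the recursion gives zeta (N+1) <= L ((zeta N)^2
   + e), where e is small with t. The choice of [de] makes L de^2 = de/2, and [w] = 1/t is large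
   enough for L e <= de/2, so zeta <= de propagates. *)
pose de := (2 * L)^-1; have de0 : 0 < de by rewrite invr_gt0 mulr_gt0.
have Lde : L * de = 2^-1 by rewrite /de invfM mulrCA divff ?gt_eqF // mulr1.
have de1 : de <= 1 by rewrite invf_le1 ?mulr_gt0 //; lra.
pose Q := (B + 1) ^+ 2 + (B + 1); have Q0 : 0 <= Q by rewrite addr_ge0 ?sqr_ge0 ?addr_ge0.
pose w := 2 * r + 4 * L * C * r * Q / de.
have w1 : 2 * r <= w.
  by rewrite lerDl divr_ge0 ?mulr_ge0 ?(ltW r0) ?(ltW L0) ?(ltW de0).
have w0 : 0 < w by rewrite (lt_le_trans _ w1) // mulr_gt0.
pose t := w^-1; have t0 : 0 < t by rewrite invr_gt0.
have t0' := ltW t0; have r0' := ltW r0.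
have rt : r * t <= 2^-1 by rewrite ler_pdivrMr //; lra.
have rt0 : 0 <= r * t by rewrite mulr_ge0.
have tQ : L * (2 * C * (r * t)) * Q <= de / 2.
  have -> : L * (2 * C * (r * t)) * Q = (4 * L * C * r * Q / de) * t * (de / 2).
    field; rewrite gt_eqF //=.
  rewrite ler_piMl ?divr_ge0 ?(ltW de0) // ler_pdivrMr // mul1r /w lerDr; lra.
pose zeta N := \sum_(n < N) t ^+ n.+1 * y n.+1.
have zeta0 N : 0 <= zeta N by rewrite sumr_ge0 // => i _; rewrite mulr_ge0 ?exprn_ge0.
have wY N : \sum_(n < N.+1) t ^+ n * y n <= B + zeta N.
  by rewrite big_ord_recl expr0 mul1r lerD2r.
have wY0 N : 0 <= \sum_(n < N) t ^+ n * y n by rewrite sumr_ge0 // => i _; rewrite mulr_ge0 ?exprn_ge0.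
have wg N : t * (\sum_(n < N) t ^+ n * (C * r ^+ n.+1)) <= 2 * C * (r * t).
  have rt1 : 0 <= r * t < 1 by rewrite rt0 (le_lt_trans rt) // invf_lt1 // ltr1n.
  have := sum_geometric_le 1 N C0 rt1; rewrite expr1.
  have -> : \sum_(j < N) C * (r * t) ^+ (1 + j) = t * (\sum_(n < N) t ^+ n * (C * r ^+ n.+1)).
    by rewrite mulr_sumr; apply: eq_bigr => i _; rewrite add1n exprMn !exprS; ring.
  move=> /le_trans; apply; rewrite mulrC -[leRHS]mulrA ler_wpM2r ?mulr_ge0 //.
  rewrite invf_ple ?posrE //; lra.
have wg0 N : 0 <= t * (\sum_(n < N) t ^+ n * (C * r ^+ n.+1)).
  by rewrite mulr_ge0 // sumr_ge0 // => i _; rewrite !mulr_ge0 ?exprn_ge0.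
have hz N : zeta N <= de.
  elim: N => [|N IH]; first by rewrite /zeta big_ord0 ltW.
  pose c1 n := \sum_(b < n) y b.+1 * y (n - b)%N.
  pose yy n := \sum_(b < n.+1) y b * y (n - b)%N.
  pose c2 n := \sum_(a < n.+1) C * r ^+ a.+1 * yy (n - a)%N.
  pose c3 n := \sum_(a < n.+1) C * r ^+ a.+1 * y (n - a)%N.
  have yy0 n : 0 <= yy n by rewrite sumr_ge0 // => i _; rewrite mulr_ge0.
  (* Both indices in this convolution are positive, so the possibly large y 0 does not enter, and
     the bound is the square of zeta. *)
  have h1 : \sum_(n < N.+1) t ^+ n.+1 * c1 n <= zeta N ^+ 2.
    rewrite big_ord_recl /c1 big_ord0 mulr0 add0r.
    have := @weighted_conv_le (y \o S) (y \o S) t N t0' (fun n => y0 _) (fun n => y0 _).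
    move=> /(ler_wpM2l (sqr_ge0 t)).
    have -> : zeta N = t * \sum_(n < N) t ^+ n * (y \o S) n.
      by rewrite mulr_sumr; apply: eq_bigr => i _; rewrite exprS mulrA.
    rewrite exprMn (expr2 (\sum_(n < N) _)); apply: le_trans.
    rewrite mulr_sumr; apply: ler_sum => i _ /=.
    rewrite mulrA -exprD add2n /bump /= add1n le_eqVlt; apply/orP; left; apply/eqP.
    by congr (_ * _); apply: eq_bigr => j _; rewrite subSn // -ltnS.
  have h2 : \sum_(n < N.+1) t ^+ n.+1 * c2 n <= 2 * C * (r * t) * (B + 1) ^+ 2.
    have := @weighted_conv_le (fun n => C * r ^+ n.+1) yy t N.+1 t0' _ yy0.
    move=> /(_ (fun n => mulr_ge0 C0 (exprn_ge0 _ r0'))) /(ler_wpM2l t0').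
    have -> : t * (\sum_(n < N.+1) t ^+ n * \sum_(i < n.+1) C * r ^+ i.+1 * yy (n - i)%N) =
        \sum_(n < N.+1) t ^+ n.+1 * c2 n.
      by rewrite mulr_sumr; apply: eq_bigr => i _; rewrite exprS mulrA.
    move=> /le_trans; apply; rewrite [leLHS]mulrA; apply: ler_pM => //.
      by rewrite sumr_ge0 // => i _; rewrite mulr_ge0 ?exprn_ge0.
    have := @weighted_conv_le y y t N.+1 t0' y0 y0; rewrite -/yy => /le_trans; apply.
    by rewrite expr2; apply: ler_pM => //; apply: le_trans (wY N) _; rewrite lerD2l (le_trans IH).
  have h3 : \sum_(n < N.+1) t ^+ n.+1 * c3 n <= 2 * C * (r * t) * (B + 1).
    have := @weighted_conv_le (fun n => C * r ^+ n.+1) y t N.+1 t0' _ y0.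
    move=> /(_ (fun n => mulr_ge0 C0 (exprn_ge0 _ r0'))) /(ler_wpM2l t0').
    have -> : t * (\sum_(n < N.+1) t ^+ n * \sum_(i < n.+1) C * r ^+ i.+1 * y (n - i)%N) =
        \sum_(n < N.+1) t ^+ n.+1 * c3 n.
      by rewrite mulr_sumr; apply: eq_bigr => i _; rewrite exprS mulrA.
    move=> /le_trans; apply; rewrite [leLHS]mulrA; apply: ler_pM => //.
    by apply: le_trans (wY N) _; rewrite lerD2l (le_trans IH).
  have : zeta N.+1 <= L * (\sum_(n < N.+1) t ^+ n.+1 * c1 n +
      \sum_(n < N.+1) t ^+ n.+1 * c2 n + \sum_(n < N.+1) t ^+ n.+1 * c3 n).
    rewrite -!big_split mulr_sumr; apply: ler_sum => i _ /=.
    rewrite -!mulrDr mulrCA ler_wpM2l ?exprn_ge0 //; exact: hy.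
  move=> /le_trans; apply.
  apply: (@le_trans _ _ (L * (de ^+ 2 + 2 * C * (r * t) * (B + 1) ^+ 2 + 2 * C * (r * t) * (B + 1)))).
    rewrite ler_wpM2l ?(ltW L0) //; apply: lerD => //; apply: lerD => //.
    by apply: le_trans h1 _; rewrite lerXn2r ?nnegrE ?(ltW de0).
  have : L * de ^+ 2 = de / 2 by rewrite expr2 mulrA Lde mulrC.
  move: tQ; rewrite /Q; set u := r * t; lra.
exists (B + de), w; split; rewrite ?addr_ge0 ?(ltW de0) // => -[|n].
  by rewrite expr0 mulr1 (le_trans yB) // lerDl ltW.
have : t ^+ n.+1 * y n.+1 <= de.
  apply: le_trans (hz n.+1); rewrite /zeta big_ord_recr /= lerDr.
  by rewrite sumr_ge0 // => i _; rewrite mulr_ge0 ?exprn_ge0.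
rewrite /t exprVn ler_pdivrMl ?exprn_gt0 // => /le_trans; apply.
by rewrite mulrC ler_wpM2r ?exprn_ge0 ?(ltW w0) // lerDr.
Qed.
End QuadraticRecursion.

Section Deflation.
Variables (R : realType) (H : lmodType R) (ip : H -> H -> R).
Hypothesis hH : hilbert ip.
Local Notation nm := (hnorm ip).
Variables (A M : nat -> {linear H -> H}) (C r : R).
Hypotheses (C0 : 0 <= C) (r0 : 0 < r) (M0 : forall x, M 0%N x = x).
Hypotheses (hA : forall j x, nm (A j x) <= C * r ^+ j * nm x)
  (hM : forall j x, nm (M j x) <= C * r ^+ j * nm x).
Variables (E : R) (m : nat) (V : 'I_m -> H) (S : H -> H) (c : R).
Hypotheses (c0 : 0 <= c) (oV : orthonormal ip V) (AV : forall i, A 0%N (V i) = E *: V i).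
Hypothesis hS : forall x, [/\ A 0%N (S x) - E *: S x = x - \sum_i ip x (V i) *: V i,
    (forall i, ip (S x) (V i) = 0) & nm (S x) <= c * nm x].

(* Formal power series solution of A(x) X(x) = M(x) X(x) K(x) with V^* X = 1. *)
Lemma deflation : exists (X : nat -> 'I_m -> H) (K : nat -> 'M[R]_m) (D s : R),
  [/\ 0 <= D, 0 < s,
    (forall j i, nm (X j i) <= D * s ^+ j) /\ (forall j i l, `|K j i l| <= D * s ^+ j),
    [/\ forall i, X 0%N i = V i, K 0%N = E%:M & forall j i l, ip (X j.+1 i) (V l) = 0] &
    forall n l, \sum_(a < n.+1) A a (X (n - a)%N l) = \sum_(a < n.+1) M a
      (\sum_(b < (n - a).+1) \sum_i K b i l *: X (n - a - b)%N i)].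
Proof.
pose T := (('I_m -> H) * 'M[R]_m)%type.
pose U (u : nat -> T) k l := \sum_(b < k.+1) \sum_i (u b).2 i l *: (u (k - b)%N).1 i.
(* At order n+1 the equation reads (A_0 - E) X_(n+1) = Rem n + V K_(n+1). Taking for K_(n+1) minus
   the V-components of Rem n puts the right side in the complement of V, where [S] solves the
   equation. *)
pose Rem (u : nat -> T) n l := \sum_(b < n) \sum_i (u b.+1).2 i l *: (u (n - b)%N).1 i +
  \sum_(a < n.+1) M a.+1 (U u (n - a)%N l) - \sum_(a < n.+1) A a.+1 ((u (n - a)%N).1 l).
pose Phi n (u : nat -> T) : T := if n is n'.+1 then
   (fun l => S (Rem u n' l), \matrix_(i, l) - ip (Rem u n' l) (V i)) else (V, E%:M).
have eqU u v k l : (forall i, (i <= k)%N -> u i = v i) -> U u k l = U v k l.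
  move=> uv; apply: eq_bigr => b _; by rewrite (uv b) 1?(uv (k - b)%N) ?leq_subr // -ltnS.
have eqRem u v n l : (forall i, (i < n.+1)%N -> u i = v i) -> Rem u n l = Rem v n l.
  move=> uv; rewrite /Rem; congr (_ + _ - _).
  - by apply: eq_bigr => b _; rewrite (uv b.+1) ?ltnS // (uv (n - b)%N) // ltnS leq_subr.
  - apply: eq_bigr => a _; congr (M _ _); apply: eqU => i hi; apply: uv.
    by rewrite ltnS (leq_trans hi) // leq_subr.
  - by apply: eq_bigr => a _; rewrite uv // ltnS leq_subr.
have [|u uE] := @rec_sequence T (V, E%:M) Phi.
  move=> [//|n] u v uv /=; congr pair; last first.
    by apply/matrixP => i l; rewrite !mxE (eqRem _ v).
  by apply/funext => l; rewrite (eqRem _ v).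
pose X n := (u n).1; pose K n := (u n).2.
have X0 : X 0%N = V by rewrite /X uE.
have K0 : K 0%N = E%:M by rewrite /K uE.
have XS n l : X n.+1 l = S (Rem u n l) by rewrite /X uE.
have KS n i l : K n.+1 i l = - ip (Rem u n l) (V i) by rewrite /K uE mxE.
pose x n := \sum_i nm (X n i).
pose k n := \sum_l \sum_i `|K n i l|.
pose y n := x n + k n.
have x0 n : 0 <= x n by rewrite sumr_ge0 // => i _; exact: nm_ge0.
have k0 n : 0 <= k n by rewrite sumr_ge0 // => i _; rewrite sumr_ge0.
have y0 n : 0 <= y n by rewrite addr_ge0.
have hXK a b : \sum_l nm (\sum_i K a i l *: X b i) <= k a * x b.
  rewrite /k mulr_suml; apply: ler_sum => l _.
  apply: le_trans (nm_sum hH _ _ _) _; rewrite mulr_suml; apply: ler_sum => i _.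
  rewrite nmZ // ler_wpM2l //.
  by rewrite /x (bigD1 i) //= lerDl sumr_ge0 // => j _; exact: nm_ge0.
have hXK' a b : \sum_l nm (\sum_i K a i l *: X b i) <= y a * y b.
  by apply: le_trans (hXK a b) _; apply: ler_pM => //; rewrite ?lerDl ?lerDr.
have hU n : \sum_l nm (U u n l) <= \sum_(b < n.+1) y b * y (n - b)%N.
  apply: (@le_trans _ _ (\sum_l \sum_(b < n.+1) nm (\sum_i K b i l *: X (n - b)%N i))).
    by apply: ler_sum => l _; exact: nm_sum.
  by rewrite exchange_big; apply: ler_sum => b _; exact: hXK'.
pose L := 1 + c + m%:R.
have nV i : nm (V i) = 1 by rewrite /hnorm oV eqxx sqrtr1.
have yS n : y n.+1 <= L * \sum_l nm (Rem u n l).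
  rewrite /L -addrA mulrDl mul1r mulrDl.
  apply: (@le_trans _ _ (c * \sum_l nm (Rem u n l) + m%:R * \sum_l nm (Rem u n l))).
    apply: lerD; rewrite mulr_sumr; apply: ler_sum => l _.
      by rewrite XS; case: (hS (Rem u n l)).
    apply: (@le_trans _ _ (\sum_(i < m) nm (Rem u n l))).
      apply: ler_sum => i _; rewrite KS normrN.
      by apply: le_trans (cauchy_schwarz hH _ _) _; rewrite nV mulr1.
    by rewrite sumr_const card_ord mulr_natl.
  by rewrite lerDr sumr_ge0 // => l _; exact: nm_ge0.
have hRem n : \sum_l nm (Rem u n l) <= \sum_(b < n) y b.+1 * y (n - b)%N +
     \sum_(a < n.+1) C * r ^+ a.+1 * (\sum_(b < (n - a).+1) y b * y (n - a - b)%N) +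
     \sum_(a < n.+1) C * r ^+ a.+1 * y (n - a)%N.
  apply: (@le_trans _ _ (\sum_l (\sum_(b < n) nm (\sum_i K b.+1 i l *: X (n - b)%N i) +
      \sum_(a < n.+1) C * r ^+ a.+1 * nm (U u (n - a)%N l) +
      \sum_(a < n.+1) C * r ^+ a.+1 * nm (X (n - a)%N l)))).
    apply: ler_sum => l _; apply: le_trans (nmB hH _ _) _; apply: lerD.
      apply: le_trans (nmD hH _ _) _; apply: lerD; apply: le_trans (nm_sum hH _ _ _) _ => //.
      by apply: ler_sum => a _; exact: hM.
    apply: le_trans (nm_sum hH _ _ _) _; by apply: ler_sum => a _; exact: hA.
  rewrite !big_split /=; apply: lerD; first apply: lerD.
  - by rewrite exchange_big; apply: ler_sum => b _; exact: hXK'.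
  - rewrite exchange_big; apply: ler_sum => a _; rewrite -mulr_sumr ler_wpM2l //.
    by rewrite mulr_ge0 // exprn_ge0 // ltW.
  - rewrite exchange_big; apply: ler_sum => a _; rewrite -mulr_sumr ler_wpM2l //.
      by rewrite mulr_ge0 // exprn_ge0 // ltW.
    by rewrite lerDl.
have L1 : 1 <= L by rewrite /L -addrA lerDl addr_ge0.
have [|D [s [D0 s0 hy]]] := @quadratic_recursion_bound R y (y 0%N) L C r (y0 _) L1 C0 r0 y0 (lexx _).
  move=> n; apply: le_trans (yS n) _; rewrite ler_wpM2l //; exact: le_trans L1.
exists X, K, D, s; split=> //.
- split=> [j i|j i l]; apply: le_trans (hy j).
    rewrite /y /x (bigD1 i) //= -addrA lerDl addr_ge0 // sumr_ge0 // => a _; exact: nm_ge0.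
  apply: (@le_trans _ _ (k j)); last by rewrite lerDr.
  apply: (@le_trans _ _ (\sum_i `|K j i l|)).
    by rewrite (bigD1 i) //= lerDl sumr_ge0.
  by rewrite /k [leRHS](bigD1 l) //= lerDl sumr_ge0 // => a _; rewrite sumr_ge0.
- split=> [i||j i l]; rewrite ?X0 ?K0 // XS; by case: (hS (Rem u j i)).
- move=> [|n] l.
    suff h : A 0%N (X 0%N l) = M 0%N (\sum_i K 0%N i l *: X 0%N i) by rewrite !big_ord1; exact: h.
    rewrite M0 K0 X0 AV (bigD1 l) //= big1 ?addr0.
      by rewrite mxE eqxx mulr1n.
    by move=> i /negPf il; rewrite mxE il scale0r.
  rewrite big_ord_recl subn0 [RHS]big_ord_recl subn0 M0.
  have [hSe _ _] := hS (Rem u n l); rewrite -XS in hSe.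
  have -> : A ord0 (X n.+1 l) = E *: X n.+1 l + (Rem u n l - \sum_i ip (Rem u n l) (V i) *: V i).
    by rewrite -hSe addrC subrK.
  have -> : \sum_(b < n.+2) \sum_i K b i l *: X (n.+1 - b)%N i = E *: X n.+1 l +
      (\sum_(b < n) \sum_i K b.+1 i l *: X (n - b)%N i - \sum_i ip (Rem u n l) (V i) *: V i).
    rewrite big_ord_recl subn0; congr (_ + _).
      rewrite K0 (bigD1 l) //= big1 ?addr0; first by rewrite mxE eqxx mulr1n.
      by move=> i /negPf il; rewrite mxE il scale0r.
    rewrite big_ord_recr /=; congr (_ + _).
    rewrite /bump /= add1n subnn X0 -sumrN; apply: eq_bigr => i _; by rewrite KS scaleNr.
  rewrite -!addrA; congr (_ + _).
  have -> : \sum_(i < n.+1) A (lift ord0 i) (X (n.+1 - lift ord0 i)%N l) =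
      \sum_(a < n.+1) A a.+1 (X (n - a)%N l) by apply: eq_bigr.
  have -> : \sum_(i < n.+1) M (lift ord0 i) (\sum_(b < (n.+1 - lift ord0 i).+1)
      \sum_(i0 < m) K b i0 l *: X (n.+1 - lift ord0 i - b)%N i0) =
      \sum_(a < n.+1) M a.+1 (U u (n - a)%N l).
    by apply: eq_bigr.
  rewrite /Rem -!addrA; congr (_ + _); rewrite addrC.
  set P := \sum_(a < n.+1) A _ _; set Q := \sum_(a < n.+1) M _ _; set W := \sum_i _ *: _.
  by rewrite [- P + _]addrCA addNr addr0.
Qed.
End Deflation.

(** * Spectral theory of symmetric matrices *)

Section ColumnHilbert.
Variables (R : realType) (m : nat).
(** Columns with the Euclidean product form a Hilbert space on which every matrix is compact; the
    spectral split and the deflation thus apply to matrices without a separate proof. *)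
Definition cip (u v : 'cV[R]_m) : R := \sum_i u i 0 * v i 0.

Lemma cipE u v : cip u v = (u^T *m v) 0 0.
Proof. by rewrite mxE; apply: eq_bigr => i _; rewrite mxE. Qed.

Lemma cip_entry_le (u : 'cV[R]_m) i : `|u i 0| <= hnorm cip u.
Proof.
rewrite -[leLHS]sqrtr_sqr ler_wsqrtr // /cip (bigD1 i) //= -expr2 lerDl.
by rewrite sumr_ge0 // => j _; rewrite -expr2 sqr_ge0.
Qed.

Lemma cip_norm_le (u : 'cV[R]_m) (b : R) : 0 <= b -> (forall i, `|u i 0| <= b) -> hnorm cip u <= m%:R * b.
Proof.
move=> b0 hb; have mb : 0 <= m%:R * b by rewrite mulr_ge0.
rewrite -[leRHS]ger0_norm // -sqrtr_sqr ler_wsqrtr //.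
apply: (@le_trans _ _ (m%:R * b ^+ 2)).
  rewrite /cip mulr_natl -[m in leRHS](card_ord m) -sumr_const; apply: ler_sum => i _.
  by rewrite -expr2 -real_normK ?num_real // lerXn2r ?nnegrE.
rewrite exprMn ler_wpM2r ?sqr_ge0 // -natrX ler_nat; case: (m) => // k.
by rewrite -mulnn leq_pmulr.
Qed.

Lemma hilbert_column : hilbert cip.
Proof.
split.
- by move=> x y z; rewrite /cip -big_split; apply: eq_bigr => i _; rewrite mxE mulrDl.
- by move=> a x y; rewrite /cip mulr_sumr; apply: eq_bigr => i _; rewrite mxE mulrA.
- by move=> x y; apply: eq_bigr => i _; rewrite mulrC.
- move=> x x0; have [i xi] : exists i, x i 0 != 0.
    apply/existsP; apply: contraNT x0; rewrite negb_exists => /forallP h.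
    by apply/eqP/matrixP => i j; rewrite ord1 mxE; have := h i; rewrite negbK => /eqP.
  rewrite /cip (bigD1 i) //= ltr_pwDl //; first by rewrite -expr2 exprn_even_gt0.
  by rewrite sumr_ge0 // => j _; rewrite -expr2 sqr_ge0.
- move=> a C q q01 C0 ha.
  have /choice[s hs] : forall i, exists s : R, forall N,
      `|s - \sum_(j < N) a j i 0| <= C * q ^+ N / (1 - q).
    move=> i; have := @geo_complete_real R (fun j => a j i 0) C q q01 C0; apply.
    by move=> j; exact: le_trans (cip_entry_le _ _) (ha j).
  exists (\col_i s i), (m%:R * (C / (1 - q))) => N.
  case/andP: (q01) => q0 q1.
  rewrite -mulrA; apply: cip_norm_le.
    by rewrite mulr_ge0 ?exprn_ge0 // divr_ge0 // subr_ge0 ltW.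
  by move=> i; rewrite !mxE summxE mulrAC; exact: hs.
Qed.

Lemma column_basis (x : 'cV[R]_m) : x = \sum_i x i 0 *: delta_mx i 0.
Proof.
rewrite {1}(matrix_sum_delta x); apply: eq_bigr => i _; by rewrite big_ord1.
Qed.

Lemma column_compact (A : 'M[R]_m) : compact_op cip (mulmx A).
Proof.
move=> e e0; exists m, (fun i => (row i A)^T), (fun i => delta_mx i 0) => x.
have -> : A *m x - \sum_(i < m) cip x (row i A)^T *: delta_mx i 0 = 0.
  apply/eqP; rewrite subr_eq0 {1}(column_basis (A *m x)); apply/eqP/eq_bigr => i _.
  by congr (_ *: _); rewrite mxE; apply: eq_bigr => j _; rewrite !mxE mulrC.
by rewrite (nm0 hilbert_column) mulr_ge0 ?(ltW e0) ?nm_ge0.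
Qed.

Lemma cip_mulmx (A : 'M[R]_m) u v : cip (A *m u) v = cip u (A^T *m v).
Proof. by rewrite !cipE trmx_mul mulmxA. Qed.

Lemma cip_mulmx_le (A : 'M[R]_m) (b : R) : 0 <= b -> (forall i j, `|A i j| <= b) ->
  forall u, hnorm cip (A *m u) <= m%:R * (m%:R * b) * hnorm cip u.
Proof.
move=> b0 hb u; rewrite -mulrA; apply: cip_norm_le; first by rewrite !mulr_ge0 ?nm_ge0.
move=> i; rewrite mxE; apply: le_trans (ler_norm_sum _ _ _) _.
rewrite -mulrA mulr_natl.
have -> : b * hnorm cip u *+ m = \sum_(j < m) b * hnorm cip u.
  by rewrite sumr_const card_ord.
by apply: ler_sum => j _; rewrite normrM ler_pM // cip_entry_le.
Qed.
End ColumnHilbert.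

(** Over R[i] an eigenvalue al + i be exists. Its eigenvector x + i y satisfies x B = al x - be y
    and y B = be x + al y, and the symmetry of B turns this into be (|x|^2 + |y|^2) = 0; whichever
    of x, y is nonzero is then a real eigenvector. *)
Lemma symmetric_eigenvector (R : realType) m (B : 'M[R]_m) : (0 < m)%N -> B^T = B ->
  exists (F : R) (v : 'cV[R]_m), v != 0 /\ B *m v = F *: v.
Proof.
move=> m0 sB.
have [a /eigenvalueP[v hv v0]] := eigenvalue_closed (map_mx (real_complex R) B) m0.
pose x := map_mx (@complex.Re R) v; pose y := map_mx (@complex.Im R) v.
pose al := complex.Re a; pose be := complex.Im a.
have ReS (I : Type) (s : seq I) (F : I -> R[i]) :
    complex.Re (\sum_(i <- s) F i) = \sum_(i <- s) complex.Re (F i).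
  by elim/big_rec2: _ => // i u w _ <-; case: (F i) => ? ?; case: w.
have ImS (I : Type) (s : seq I) (F : I -> R[i]) :
    complex.Im (\sum_(i <- s) F i) = \sum_(i <- s) complex.Im (F i).
  by elim/big_rec2: _ => // i u w _ <-; case: (F i) => ? ?; case: w.
have hx : x *m B = al *: x - be *: y.
  apply/rowP => j; have /rowP/(_ j)/(congr1 (@complex.Re R)) := hv.
  rewrite !mxE ReS => e; transitivity (complex.Re (a * v 0 j)); last first.
    by rewrite /al /be; case: (a) => ? ?; case: (v 0 j).
  rewrite -e; apply: eq_bigr => k _; rewrite !mxE.
  by case: (v 0 k) => ? ? /=; rewrite mulr0 subr0.
have hy : y *m B = be *: x + al *: y.
  apply/rowP => j; have /rowP/(_ j)/(congr1 (@complex.Im R)) := hv.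
  rewrite !mxE ImS => e; transitivity (complex.Im (a * v 0 j)); last first.
    by rewrite /al /be; case: (a) => ? ?; case: (v 0 j) => ? ? /=; ring.
  rewrite -e; apply: eq_bigr => k _; rewrite !mxE.
  by case: (v 0 k) => ? ? /=; rewrite mulr0 add0r.
have key : be * ((x *m x^T) 0 0 + (y *m y^T) 0 0) = 0.
  have e1 : ((x *m B) *m y^T) 0 0 = ((y *m B) *m x^T) 0 0.
    by rewrite -[RHS]trace_mx11 -mxtrace_tr trace_mx11 !trmx_mul trmxK sB mulmxA.
  have e2 : (x *m y^T) 0 0 = (y *m x^T) 0 0.
    by rewrite -[RHS]trace_mx11 -mxtrace_tr trace_mx11 !trmx_mul trmxK.
  move: e1; rewrite hx hy mulmxBl mulmxDl -!scalemxAl !mxE.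
  move: e2; rewrite !mxE.
  set p := \sum_j _; set q := \sum_j _; set u := \sum_j _; set w := \sum_j _ => -> h.
  rewrite mulrDr; lra.
have sq0 (z : 'rV[R]_m) : 0 <= (z *m z^T) 0 0.
  by rewrite mxE sumr_ge0 // => i _; rewrite mxE -expr2 sqr_ge0.
have sqe (z : 'rV[R]_m) : (z *m z^T) 0 0 = 0 -> z = 0.
  rewrite mxE => /eqP; rewrite psumr_eq0; last by move=> i _; rewrite mxE -expr2 sqr_ge0.
  move/allP => h; apply/rowP => i; have := h i (mem_index_enum _).
  by rewrite !mxE -expr2 sqrf_eq0 => /eqP.
have xy0 : (x != 0) || (y != 0).
  rewrite -negb_and; apply: contra v0 => /andP[/eqP ex /eqP ey]; apply/eqP/rowP => j.
  have := congr1 (fun z : 'rV[R]_m => z 0 j) ex; have := congr1 (fun z : 'rV[R]_m => z 0 j) ey.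
  by rewrite !mxE; case: (v 0 j) => p q /= -> ->.
have be0 : be = 0.
  move/eqP: key; rewrite mulf_eq0 => /orP[/eqP//|].
  rewrite paddr_eq0 // => /andP[/eqP/sqe ex /eqP/sqe ey].
  by move: xy0; rewrite ex ey eqxx.
exists al; rewrite be0 !scale0r ?subr0 ?add0r in hx hy.
have tr (z : 'rV[R]_m) : z != 0 -> z *m B = al *: z -> z^T != 0 /\ B *m z^T = al *: z^T.
  move=> z0 hz; split; last by rewrite -{1}sB -trmx_mul hz linearZ.
  by apply: contra z0 => /eqP h; rewrite -(trmxK z) h trmx0.
by case/orP: xy0 => z0; [exists x^T|exists y^T]; exact: tr.
Qed.

Lemma san_coef_matrix (R : realType) p q (K : R -> 'M[R]_(p, q)) : anmx K ->
  exists (a : nat -> 'M[R]_(p, q)) (C r : R), [/\ 0 <= C, 0 < r,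
    forall i j, an_coef (U := R^o) (@Num.norm R R) (fun x => K x i j) (fun n => a n i j) &
    forall n i j, `|a n i j| <= C * r ^+ n].
Proof.
move=> hK.
have /choice[a ha] : forall ij : 'I_p * 'I_q, exists a : nat -> R,
    an_coef (U := R^o) (@Num.norm R R) (fun x => K x ij.1 ij.2) a.
  by case=> i j; exact: hK.
have /choice[Cr hCr] : forall ij : 'I_p * 'I_q, exists Cr : R * R, [/\ 0 <= Cr.1, 0 < Cr.2 &
    forall n, `|a ij n| <= Cr.1 * Cr.2 ^+ n].
  move=> ij; have [C [r [C0 r0 h]]] := ha ij; exists (2 * C, r); split; rewrite ?mulr_ge0 //=.
  by move=> n; exact: (an_bound_coef (real_norm R) n C0 r0 h).
exists (fun n => \matrix_(i, j) a (i, j) n), (\sum_ij (Cr ij).1), (1 + \sum_ij (Cr ij).2).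
split.
- by rewrite sumr_ge0 // => ij _; case: (hCr ij).
- by rewrite ltr_pwDl // sumr_ge0 // => ij _; case: (hCr ij) => _ /ltW.
- move=> i j; have := ha (i, j); congr an_coef; by apply/funext => n; rewrite mxE.
- move=> n i j; rewrite mxE; have [C0 r0 /(_ n) h] := hCr (i, j); apply: le_trans h _.
  apply: ler_pM => //; first by rewrite exprn_ge0 // ltW.
    by rewrite (bigD1 (i, j)) //= lerDl sumr_ge0 // => ij _; case: (hCr ij).
  have s0 : 0 <= \sum_ij (Cr ij).2 by rewrite sumr_ge0 // => ij _; case: (hCr ij) => _ /ltW.
  rewrite lerXn2r ?nnegrE ?(ltW r0) ?addr_ge0 // (bigD1 (i, j)) //= addrCA lerDl addr_ge0 //.
  by rewrite sumr_ge0 // => ij _; case: (hCr ij) => _ /ltW.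
Qed.

Lemma near_forall (R : realType) (I : finType) (P : I -> R -> Prop) (x0 : R) :
  (forall i, \forall x \near x0, P i x) -> \forall x \near x0, forall i, P i x.
Proof. by move=> h; exact: (@filter_forall R I P (nbhs x0) _ h). Qed.

Lemma dnbhs_ex2 (R : realType) (P Q : R -> Prop) (x0 : R) :
  (\forall x \near x0^', P x) -> (\forall x \near x0^', Q x) -> exists x, P x /\ Q x.
Proof. by move=> h1 h2; exact: (@filter_ex _ (x0^') _ _ (filterI h1 h2)). Qed.

Lemma san_dnbhs0 (R : realType) (f : R -> R) : san f ->
  (\forall x \near 0^', f x = 0) -> \forall x \near 0, f x = 0.
Proof.
move=> /san_zero_or_isolated[//|h1] h2.
by have [x [/eqP fx /fx]] := dnbhs_ex2 h1 h2.
Qed.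

(** The power n is the least order of vanishing among the entries with nonzero germ; an entry that
    attains it does not vanish in [B 0]. *)
Lemma anmx_factor (R : realType) p q (L : R -> 'M[R]_(p, q)) : anmx L ->
  (\forall x \near 0, L x = 0) \/ exists n B, [/\ anmx B, B 0 != 0 &
    \forall x \near 0, L x = x ^+ n *: B x].
Proof.
move=> hL.
pose Z ij := \forall x \near 0, L x ij.1 ij.2 = 0.
have /choice[ng hng] : forall ij : 'I_p * 'I_q, exists ng : nat * (R -> R), ~ Z ij ->
    [/\ san ng.2, ng.2 0 != 0 & forall x, L x ij.1 ij.2 = x ^+ ng.1 * ng.2 x].
  move=> ij; have [|[n [g h]]] := san_factor (hL ij.1 ij.2); first by exists (0%N, fun=> 0).
  by exists (n, g).
have [hZ|/existsNP[ij0 nZ0]] := pselect (forall ij, Z ij).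
  left; have : \forall x \near 0, forall ij : 'I_p * 'I_q, L x ij.1 ij.2 = 0.
    by apply: near_forall => ij; exact: hZ.
  by apply: filterS => x h; apply/matrixP => i j; rewrite mxE (h (i, j)).
right; pose P ij := ~~ `[< Z ij >].
have P0 : P ij0 by apply/negP => /asboolP.
case: (@arg_minnP _ ij0 P (fun ij => (ng ij).1) P0) => im Pm hmin.
pose n := (ng im).1.
pose B x := \matrix_(i, j) (if `[< Z (i, j) >] then 0
   else x ^+ ((ng (i, j)).1 - n) * (ng (i, j)).2 x) : 'M[R]_(p, q).
exists n, B; split.
- move=> i j; have [z|nz] := pselect (Z (i, j)).
    have := san_cst (0 : R); congr san; by apply/funext => x; rewrite mxE asboolT.
  have [sg _ _] := hng _ nz.
  have := sanM (sanX ((ng (i, j)).1 - n) (@san_id R)) sg; congr san.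
  by apply/funext => x; rewrite mxE asboolF.
- have nz : ~ Z im by move/negP: Pm => h /asboolP.
  have [_ g0 _] := hng _ nz; apply: contra g0 => /eqP/matrixP/(_ im.1 im.2).
  rewrite !mxE -surjective_pairing asboolF // subnn expr0 mul1r => ->; by [].
- have : \forall x \near 0, forall ij : 'I_p * 'I_q, Z ij -> L x ij.1 ij.2 = 0.
    apply: near_forall => ij; have [z|nz] := pselect (Z ij); first exact: filterS z.
    by apply: filterE => x /nz.
  apply: filterS => x h; apply/matrixP => i j; rewrite !mxE.
  have [z|nz] := pselect (Z (i, j)); first by rewrite asboolT // mulr0 (h (i, j)).
  rewrite asboolF //; have [_ _ /(_ x) /= ->] := hng _ nz.
  by rewrite mulrA -exprD subnKC // hmin //; apply/negP => /asboolP.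
Qed.

(** * Rellich's theorem for matrices *)

Lemma an_mul (R : realType) (f g : R -> R) (a b : nat -> R) :
  an_coef (U := R^o) (@Num.norm R R) f a -> an_coef (U := R^o) (@Num.norm R R) g b ->
  an_coef (U := R^o) (@Num.norm R R) (fun x => f x * g x)
    (fun n => \sum_(i < n.+1) a i * b (n - i)%N).
Proof.
by move=> fa gb; apply: (an_ip (hilbert_real R)); rewrite hnorm_Rip; [exact: fa|exact: gb].
Qed.

(** Deflation with the constant weight 1. The columns of X continue an orthonormal basis of the
    F-eigenspace of [B 0] to a space invariant under B x, and [Z0] completes that basis to an
    orthogonal matrix. *)
Lemma matrix_deflation (R : realType) m (B : R -> 'M[R]_m) (F : R) :
  anmx B -> (B 0)^T = B 0 ->
  exists m1 m2 (X : R -> 'M[R]_(m, m1)) (K : R -> 'M[R]_m1) (Z0 : 'M[R]_(m, m2)),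
  [/\ anmx X, (\forall x \near 0, B x *m X x = X x *m K x), B 0 *m X 0 = F *: X 0,
    (row_mx (X 0) Z0)^T *m row_mx (X 0) Z0 = 1%:M &
    row_mx (X 0) Z0 *m (row_mx (X 0) Z0)^T = 1%:M /\
    forall v : 'cV[R]_m, B 0 *m v = F *: v -> v != 0 -> (0 < m1)%N].
Proof.
move=> anB sB.
(* The spectral split needs a nonzero eigenvalue, and F may vanish; the shift moves it to 1. *)
pose A0 := B 0 - (F - 1)%:M.
have hc := hilbert_column R m.
have A0E v : A0 *m v - 1 *: v = B 0 *m v - F *: v.
  by rewrite mulmxBl mul_scalar_mx scalerBl opprB addrA addrAC addrK.
have sA0 : symmetric_op (@cip R m) (mulmx A0).
  by move=> u v; rewrite cip_mulmx linearB /= sB tr_scalar_mx.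
have [m1 [V [S [C [C0 oV AV gap hS]]]]] :=
  compact_spectral_split hc sA0 (column_compact A0) (oner_neq0 R).
have BV i : B 0 *m V i = F *: V i.
  by apply/eqP; rewrite -subr_eq0 -A0E AV subrr.
pose ortho (z : 'cV[R]_m) := forall i, cip z (V i) = 0.
have [||||m2 [W [oW PW bW]]] := @orthonormal_basis R _ _ hc ortho _ _ _ m (fun i => delta_mx i 0).
- by move=> i; exact: ip0l.
- by move=> x y hx hy i; rewrite (ipDl hc) hx hy addr0.
- by move=> a x hx i; rewrite (ipZl hc) hx mulr0.
- by move=> x _; exists (fun i => x i 0); exact: column_basis.
have [a [Ca [ra [Ca0 ra0 hBa ha]]]] := san_coef_matrix anB.
have a0 : a 0%N = B 0.
  by apply/matrixP => i j; rewrite -(an_coef0 (real_norm R) (hBa i j)).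
pose A n : {linear 'cV[R]_m -> 'cV[R]_m} := mulmx (a n).
pose M n : {linear 'cV[R]_m -> 'cV[R]_m} := (n == 0%N)%:R \*: idfun.
pose C' := m%:R * (m%:R * Ca) + 1.
have mC0 : 0 <= m%:R * (m%:R * Ca) by rewrite !mulr_ge0.
have C'0 : 0 <= C' by rewrite addr_ge0.
have M0 x : M 0%N x = x by rewrite /M /= scale1r.
have MS n x : M n.+1 x = 0 by rewrite /M /= scale0r.
have hA n x : hnorm (@cip R m) (A n x) <= C' * ra ^+ n * hnorm (@cip R m) x.
  apply: le_trans (cip_mulmx_le _ (ha n) x) _; first by rewrite mulr_ge0 // exprn_ge0 // ltW.
  rewrite ler_wpM2r ?nm_ge0 // /C' mulrDl -!mulrA lerDl mul1r exprn_ge0 // ltW //.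
have hM n x : hnorm (@cip R m) (M n x) <= C' * ra ^+ n * hnorm (@cip R m) x.
  case: n => [|n] /=; last by rewrite scale0r nm0 // !mulr_ge0 ?nm_ge0 ?exprn_ge0 ?(ltW ra0).
  by rewrite scale1r expr0 mulr1 ler_peMl ?nm_ge0 // lerDr.
have AV0 i : A 0%N (V i) = F *: V i by rewrite /A /= a0 BV.
have hS' x : [/\ A 0%N (S x) - F *: S x = x - \sum_i cip x (V i) *: V i,
    (forall i, cip (S x) (V i) = 0) & hnorm (@cip R m) (S x) <= C * hnorm (@cip R m) x].
  by have [h1 h2 h3] := hS x; split=> //; rewrite /A /= a0 -A0E.
have [Xc [Kc [D [s [D0 s0 [hX hK] [X0 K0 _] rel]]]]] :=
  @deflation R _ _ hc A M C' ra C'0 ra0 M0 hA hM F m1 V S C C0 oV AV0 hS'.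
have /choice[fX hfX] : forall il : 'I_m * 'I_m1, exists f : R -> R,
    an_coef (U := R^o) (@Num.norm R R) f (fun n => Xc n il.2 il.1 0).
  move=> [i l]; have [|f hf] := an_of_coef (real_norm R) (@geo_complete_real R) D0 s0
    (a := fun n => Xc n l i 0); first by move=> n; exact: le_trans (cip_entry_le _ _) (hX n l).
  by exists f, (2 * D), s; split; rewrite ?mulr_ge0.
have /choice[fK hfK] : forall il : 'I_m1 * 'I_m1, exists f : R -> R,
    an_coef (U := R^o) (@Num.norm R R) f (fun n => Kc n il.1 il.2).
  move=> [i l]; have [|f hf] := an_of_coef (real_norm R) (@geo_complete_real R) D0 s0
    (a := fun n => Kc n i l); first by move=> n; exact: hK.
  by exists f, (2 * D), s; split; rewrite ?mulr_ge0.
pose X x : 'M[R]_(m, m1) := \matrix_(i, l) fX (i, l) x.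
pose K x : 'M[R]_m1 := \matrix_(i, l) fK (i, l) x.
pose Z0 : 'M[R]_(m, m2) := \matrix_(i, l) W l i 0.
have XV l : col l (X 0) = V l.
  apply/matrixP => i j; rewrite !mxE ord1 (an_coef0 (real_norm R) (hfX (i, l))) /=.
  by rewrite X0.
have ZW l : col l Z0 = W l by apply/matrixP => i j; rewrite !mxE ord1.
have trE p q (P : 'M[R]_(m, p)) (Q : 'M[R]_(m, q)) i j :
    (P^T *m Q) i j = cip (col i P) (col j Q).
  by rewrite mxE; apply: eq_bigr => k _; rewrite !mxE.
have CTC : (row_mx (X 0) Z0)^T *m row_mx (X 0) Z0 = 1%:M.
  rewrite tr_row_mx mul_col_row (scalar_mx_block m1 m2); congr block_mx.
  - by apply/matrixP => i j; rewrite trE !XV oV mxE.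
  - by apply/matrixP => i j; rewrite trE XV ZW (ipC hc) PW mxE.
  - by apply/matrixP => i j; rewrite trE XV ZW PW mxE.
  - by apply/matrixP => i j; rewrite trE !ZW oW mxE.
exists m1, m2, X, K, Z0; split=> //.
- move=> i l; exists (fun n => Xc n l i 0); have := hfX (i, l); congr an_coef.
  by apply/funext => x; rewrite mxE.
- suff h : forall il : 'I_m * 'I_m1, \forall x \near 0, (B x *m X x) il.1 il.2 = (X x *m K x) il.1 il.2.
    apply: filterS (near_forall h) => x hx.
    by apply/matrixP => i l; exact: (hx (i, l)).
  case=> i l /=.
  have h1 := an_sum (real_norm R) (index_enum 'I_m) (fun k => an_mul (hBa i k) (hfX (k, l))).
  have h2 := an_sum (real_norm R) (index_enum 'I_m1) (fun k => an_mul (hfK (k, l)) (hfX (i, k))).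
  have := an_coef_eq (real_norm R) (f := fun x => \sum_k B x i k * fX (k, l) x)
    (g := fun x => \sum_k fK (k, l) x * fX (i, k) x) h1.
  have e : (fun n => \sum_(k < m) \sum_(b < n.+1) a b i k * Xc (n - b)%N l k 0) =
      (fun n => \sum_(k < m1) \sum_(b < n.+1) Kc b k l * Xc (n - b)%N k i 0).
    apply/funext => n; have := congr1 (fun z : 'cV[R]_m => z i 0) (rel n l).
    rewrite [X in _ = X -> _](_ : _ = \sum_(k < m1) \sum_(b < n.+1) Kc b k l * Xc (n - b)%N k i 0).
      move=> <-; rewrite exchange_big summxE; apply: eq_bigr => b _.
      by rewrite mxE.
    rewrite big_ord_recl subn0 M0 [X in _ + X]big1 ?addr0; last by move=> b _; exact: MS.
    rewrite exchange_big summxE; apply: eq_bigr => b _; rewrite summxE.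
    by apply: eq_bigr => k _; rewrite !mxE.
  rewrite e => /(_ h2); apply: filterS => x.
  rewrite !mxE; under [X in _ -> X = _]eq_bigr do rewrite mxE.
  by move=> ->; apply: eq_bigr => k _; rewrite !mxE mulrC.
- apply/matrixP => i l; have e : col l (B 0 *m X 0) = F *: col l (X 0) by rewrite colE -mulmxA -colE XV BV.
  have := congr1 (fun z : 'cV[R]_m => z i 0) e.
  by rewrite mxE => ->; rewrite [LHS]mxE [RHS]mxE; congr (_ * _); rewrite mxE.
split.
  rewrite tr_row_mx mul_row_col; apply/matrixP => i j.
  suff h (v : 'cV[R]_m) : (X 0 *m (X 0)^T + Z0 *m Z0^T) *m v = v.
    have := congr1 (fun z : 'cV[R]_m => z i 0) (h (delta_mx j 0)).
    by rewrite -colE mxE => ->; rewrite !mxE eqxx andbT.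
  rewrite mulmxDl -!mulmxA.
  have pr q (P : 'M[R]_(m, q)) : P *m (P^T *m v) = \sum_l cip v (col l P) *: col l P.
    apply/matrixP => a' b'; rewrite mxE summxE; apply: eq_bigr => l _.
    rewrite !mxE mulrC ord1; congr (_ * _); apply: eq_bigr => k _; by rewrite !mxE mulrC.
  rewrite !pr; under eq_bigr do rewrite XV; under [X in _ + X]eq_bigr do rewrite ZW.
  set y := \sum_l _ *: V l.
  have yV k : cip y (V k) = cip v (V k).
    rewrite (ip_suml hc) (bigD1 k) //= (ipZl hc) oV eqxx mulr1 big1 ?addr0 // => l lk.
    by rewrite (ipZl hc) oV (negPf lk) mulr0.
  have /bW : ortho (v - y) by move=> k; rewrite (ipBl hc) yV subrr.
  move=> hvy; rewrite -[RHS](subrK y) [v - y]hvy addrC; congr (_ + _).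
  apply: eq_bigr => l _; rewrite (ipBl hc) [cip y _](_ : _ = 0) ?subr0 //.
  rewrite (ip_suml hc) big1 // => k _; by rewrite (ipZl hc) (ipC hc (V k)) PW mulr0.
move=> v hv v0; case: (posnP m1) => // m10; case/negP: v0; apply/eqP.
have := gap v; rewrite A0E hv subrr nm0 // mulr0 => h; apply: (nm_le0 hc); apply: h.
by move=> i; move: (ltn_ord i); rewrite {2}m10.
Qed.

Lemma near_dnbhs (R : realType) (x0 : R) (P : R -> Prop) :
  (\forall x \near x0, x != x0 -> P x) -> \forall x \near x0^', P x.
Proof. by rewrite /dnbhs; apply: filterS => x h /h. Qed.

Lemma near_dnbhsW (R : realType) (x0 : R) (P : R -> Prop) :
  (\forall x \near x0, P x) -> \forall x \near x0^', P x.
Proof. by move=> h; apply: near_dnbhs; apply: filterS h. Qed.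

Lemma san_at0_eq (R : realType) (f : R -> R) : san f ->
  (\forall x \near 0^', f x = 0) -> f 0 = 0.
Proof. by move=> sf /(san_dnbhs0 sf) /nbhs_singleton. Qed.

Lemma anmx_near_sym (R : realType) m (N : R -> 'M[R]_m) : anmx N ->
  (\forall x \near 0^', (N x)^T = N x) -> \forall x \near 0, (N x)^T = N x.
Proof.
move=> aN h.
suff hij : forall ij : 'I_m * 'I_m, \forall x \near 0, N x ij.2 ij.1 - N x ij.1 ij.2 = 0.
  apply: filterS (near_forall hij) => x hx; apply/matrixP => i j.
  by rewrite mxE; apply/eqP; rewrite -subr_eq0; apply/eqP; exact: (hx (i, j)).
case=> i j; apply: san_dnbhs0; first exact: sanB.
by apply: filterS h => x /matrixP/(_ i j); rewrite mxE => -> /=; rewrite subrr.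
Qed.

Lemma mxrank_congruence (F : fieldType) m (C N A : 'M[F]_m) :
  C \in unitmx -> N \in unitmx -> \rank (C^T *m N *m A *m C) = \rank A.
Proof.
move=> uC uN; rewrite mxrankMfree ?row_free_unit //.
rewrite -mxrank_tr trmx_mul mxrankMfree ?mxrank_tr //.
by rewrite row_free_unit unitmx_tr unitmx_mul unitmx_tr uC.
Qed.

Lemma mxrank_unitM (F : fieldType) m (N A : 'M[F]_m) : N \in unitmx ->
  \rank (N *m A) = \rank A.
Proof.
by move=> uN; rewrite -mxrank_tr trmx_mul mxrankMfree ?mxrank_tr // row_free_unit unitmx_tr.
Qed.

(* Rellich's theorem for matrices that are symmetric with respect to M. At a point where the
   matrix is not scalar modulo higher order terms, it splits into two blocks of smaller size. *)
Lemma rellich (R : realType) m (K M : R -> 'M[R]_m) :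
  anmx K -> anmx M -> M 0 = 1%:M -> (\forall x \near 0, (M x)^T = M x) ->
  (\forall x \near 0, (M x *m K x)^T = M x *m K x) ->
  exists es : seq (R -> R), [/\ size es = m,
    (forall i, (i < size es)%N -> san (nth (fun=> 0) es i)) &
    \forall x \near 0, forall E : R,
      (m - \rank (K x - E%:M)%R)%N = count (fun f : R -> R => f x == E) es].
Proof.
elim/ltn_ind: m K M => m IHm K M aK aM M0 sM sMK.
have [m0|m_gt0] := posnP m.
  exists [::]; split; rewrite ?m0 //; apply: filterE => x E.
  by apply/eqP; rewrite /= -leqn0 (leq_trans (leq_subr _ _)) // m0.
pose i0 := Ordinal m_gt0.
(* Subtracting a diagonal entry and dividing by the largest power of x gives B with [B 0] nonzero
   but with a zero on its diagonal. Hence [B 0] is not scalar, its eigenspaces are proper, and both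
   blocks are smaller than K. *)
pose e x := K x i0 i0.
have ae : san e by exact: aK.
have aL : anmx (fun x => K x - (e x)%:M) by apply: anmxB => //; exact: anmx_scalar.
have [L0|[n [B [aB B0 LB]]]] := anmx_factor aL.
  exists (nseq m e); split; first by rewrite size_nseq.
    by move=> i; rewrite size_nseq => im; rewrite nth_nseq im.
  apply: filterS L0 => x /eqP; rewrite subr_eq0 => /eqP -> E.
  rewrite -raddfB /= count_nseq; have [->|eE] := eqVneq (e x) E.
    by rewrite subrr raddf0 mxrank0 subn0 mul1n.
  rewrite mxrank_unit ?subnn // unitmxE det_scalar unitfE expf_neq0 // subr_eq0 //.
have LBd : \forall x \near 0^', B x = (x ^+ n)^-1 *: (K x - (e x)%:M).
  apply: near_dnbhs; apply: filterS LB => x -> x0.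
  by rewrite scalerA mulVf ?scale1r // expf_neq0.
have B00 : B 0 i0 i0 = 0.
  apply: (san_at0_eq (aB i0 i0)); apply: filterS LBd => x ->.
  by rewrite !mxE eqxx mulr1n subrr mulr0.
have aMB : anmx (fun x => M x *m B x) by exact: anmxM.
(* Off 0, M B is x^-n (M K - e M) and hence symmetric; analyticity extends the symmetry to 0. *)
have sMB : \forall x \near 0, (M x *m B x)^T = M x *m B x.
  apply: anmx_near_sym => //.
  have sM' := near_dnbhsW sM; have sMK' := near_dnbhsW sMK.
  apply: filterS3 LBd sM' sMK' => x -> hM hMK.
  rewrite -scalemxAr linearZ /= mulmxBr linearB /= hMK mul_mx_scalar linearZ /= hM.
  by [].
have sB : (B 0)^T = B 0 by have := nbhs_singleton sMB; rewrite M0 mul1mx.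
have [F0 [v [v0 Bv]]] := symmetric_eigenvector m_gt0 sB.
have [m1 [m2 [X [K1 [Z0 [aX BX BX0 CTC [CCT hm1]]]]]]] := matrix_deflation F0 aB sB.
have m1_gt0 := hm1 v Bv v0.
have Em : m = (m1 + m2)%N.
  by apply/eqP; rewrite eqn_leq (mulmx1_min CCT) (mulmx1_min CTC).
have m2_gt0 : (0 < m2)%N.
  rewrite lt0n; apply: contraNneq B0 => m20.
  have XX : X 0 *m (X 0)^T = 1%:M.
    rewrite -CCT tr_row_mx mul_row_col [X in _ + X](_ : _ = 0) ?addr0 //.
    by apply/matrixP => i j; rewrite mxE big1 ?mxE // => k _; move: (ltn_ord k); rewrite {2}m20.
  have BF : B 0 = F0%:M by rewrite -[B 0]mulmx1 -XX mulmxA BX0 -scalemxAl XX scalemx1.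
  move: B00; rewrite BF mxE eqxx mulr1n => ->.
  by apply/eqP/matrixP => i j; rewrite !mxE mul0rn.
subst m.
pose N1 x := (X x)^T *m M x *m X x.
(* Gram-Schmidt for the weight M x: Z is orthogonal to X. As the range of X is invariant under B and
   M B is symmetric, M B has no block mixing X and Z either. *)
pose Z x := Z0 - X x *m invmx (N1 x) *m (X x)^T *m M x *m Z0.
pose N2 x := (Z x)^T *m M x *m Z x.
pose C x := row_mx (X x) (Z x).
(* The compressions of B, written with inverse Gram matrices so that N1 K1' and N2 K2' are symmetric
   by construction, as the induction hypothesis requires. *)
pose K1' x := invmx (N1 x) *m ((X x)^T *m (M x *m B x) *m X x).
pose K2' x := invmx (N2 x) *m ((Z x)^T *m (M x *m B x) *m Z x).
move: (CTC); rewrite tr_row_mx mul_col_row (scalar_mx_block m1 m2) => /eq_block_mx[XX XZ ZX ZZ].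
have N10 : N1 0 = 1%:M by rewrite /N1 M0 mulmx1.
have Z00 : Z 0 = Z0.
  by rewrite /Z N10 invmx1 mulmx1 M0 mulmx1 -mulmxA XZ mulmx0 subr0.
have N20 : N2 0 = 1%:M by rewrite /N2 Z00 M0 mulmx1.
have aN1 : anmx N1 by apply: anmxM => //; apply: anmxM => //; exact: anmx_tr.
have aiN1 : anmx (fun x => invmx (N1 x)) by apply: anmx_inv => //; rewrite N10 unitmx1.
have aZ : anmx Z.
  apply: anmxB; first exact: anmx_cst.
  apply: anmxM; last exact: anmx_cst.
  apply: anmxM => //; apply: anmxM; last exact: anmx_tr.
  exact: anmxM.
have aN2 : anmx N2 by apply: anmxM => //; apply: anmxM => //; exact: anmx_tr.
have aiN2 : anmx (fun x => invmx (N2 x)) by apply: anmx_inv => //; rewrite N20 unitmx1.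
have aK1 : anmx K1'.
  by apply: anmxM => //; apply: anmxM => //; apply: anmxM => //; exact: anmx_tr.
have aK2 : anmx K2'.
  by apply: anmxM => //; apply: anmxM => //; apply: anmxM => //; exact: anmx_tr.
have aC : anmx C.
  move=> i j; rewrite /C; case: (split_ordP j) => k ->.
    by have := aX i k; congr san; apply/funext => x; rewrite row_mxEl.
  by have := aZ i k; congr san; apply/funext => x; rewrite row_mxEr.
have uN1 : \forall x \near 0, N1 x \in unitmx by apply: near_unitmx => //; rewrite N10 unitmx1.
have uN2 : \forall x \near 0, N2 x \in unitmx by apply: near_unitmx => //; rewrite N20 unitmx1.
have uM : \forall x \near 0, M x \in unitmx by apply: near_unitmx => //; rewrite M0 unitmx1.
have uC : \forall x \near 0, C x \in unitmx.
  apply: near_unitmx => //; rewrite /C Z00; have [] := mulmx1_unit CTC; by [].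
have symc p (Y : 'M[R]_(m1 + m2, p)) (S : 'M[R]_(m1 + m2)) : S^T = S ->
    (Y^T *m S *m Y)^T = Y^T *m S *m Y.
  by move=> hS; rewrite !trmx_mul trmxK hS mulmxA.
have [|||es1 [sz1 san1 cnt1]] := IHm m1 _ K1' N1 aK1 aN1 N10.
- by rewrite -[ltnLHS]addn0 ltn_add2l.
- by apply: filterS sM => x; exact: symc.
- apply: filterS2 sMB uN1 => x hs u1; rewrite /K1' mulKVmx //; exact: symc.
have [|||es2 [sz2 san2 cnt2]] := IHm m2 _ K2' N2 aK2 aN2 N20.
- by rewrite -[ltnLHS]add0n ltn_add2r.
- by apply: filterS sM => x; exact: symc.
- apply: filterS2 sMB uN2 => x hs u1; rewrite /K2' mulKVmx //; exact: symc.
pose es := [seq (fun x => e x + x ^+ n * f x) | f : R -> R <- es1 ++ es2].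
have szE : size es = (m1 + m2)%N by rewrite size_map size_cat sz1 sz2.
exists es; split=> //.
  move=> i; rewrite size_map => iz; rewrite (nth_map (fun=> 0)) //.
  apply: sanD => //; apply: sanM; first exact: sanX (@san_id R).
  rewrite nth_cat; case: ltnP => i1; first exact: san1.
  by apply: san2; rewrite -(ltn_add2l (size es1)) subnKC // -size_cat.
near=> x => E.
have LBx : K x - (e x)%:M = x ^+ n *: B x by near: x.
(* This occurs at x = 0 when n > 0: there K is scalar and all branches take the value e x. *)
have [xn0|xn0] := eqVneq (x ^+ n) 0.
  move/eqP: LBx; rewrite xn0 scale0r subr_eq0 => /eqP ->.
  rewrite -raddfB /= count_map /preim /=.
  rewrite (@eq_count _ _ (fun=> e x == E)); last by move=> f /=; rewrite xn0 mul0r addr0.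
  have [->|eE] := eqVneq (e x) E.
    by rewrite subrr raddf0 mxrank0 subn0 count_predT -szE size_map.
  by rewrite mxrank_unit ?subnn ?count_pred0 // unitmxE det_scalar unitfE expf_neq0 // subr_eq0.
have hM : (M x)^T = M x by near: x.
have hMB : (M x *m B x)^T = M x *m B x by near: x.
have hBX : B x *m X x = X x *m K1 x by near: x.
have u1 : N1 x \in unitmx by near: x.
have u2 : N2 x \in unitmx by near: x.
have hMu : M x \in unitmx by near: x.
have hCu : C x \in unitmx by near: x.
have c1 : forall E, (m1 - \rank (K1' x - E%:M)%R)%N = count (fun f : R -> R => f x == E) es1 by near: x.
have c2 : forall E, (m2 - \rank (K2' x - E%:M)%R)%N = count (fun f : R -> R => f x == E) es2 by near: x.
pose F := (E - e x) / x ^+ n.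
have KE : K x - E%:M = x ^+ n *: (B x - F%:M).
  rewrite scalerBr -LBx scale_scalar_mx /F mulrC divfK // -addrA -opprD -raddfD.
  by rewrite [e x + _]addrC subrK.
rewrite KE mxrank_scale_nz // -(mxrank_congruence (B x - F%:M) hCu hMu).
have XMZ : (X x)^T *m M x *m Z x = 0.
  rewrite /Z mulmxBr !mulmxA -/(N1 x) mulmxV // mul1mx subrr //.
have XMBZ : (X x)^T *m (M x *m B x) *m Z x = 0.
  have -> : (X x)^T *m (M x *m B x) = (M x *m B x *m X x)^T by rewrite trmx_mul hMB.
  by rewrite -(mulmxA (M x)) hBX !trmx_mul hM -!mulmxA (mulmxA (X x)^T) XMZ mulmx0.
have ZMX : (Z x)^T *m M x *m X x = 0.
  have -> : (Z x)^T *m M x *m X x = ((X x)^T *m M x *m Z x)^T.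
    by rewrite !trmx_mul trmxK hM mulmxA.
  by rewrite XMZ trmx0.
have ZMBX : (Z x)^T *m (M x *m B x) *m X x = 0.
  have -> : (Z x)^T *m (M x *m B x) *m X x = ((X x)^T *m (M x *m B x) *m Z x)^T.
    by rewrite (trmx_mul (_ *m _) (Z x)) (trmx_mul _ (M x *m B x)) trmxK hMB -[LHS]mulmxA.
  by rewrite XMBZ trmx0.
have blk p q (P : 'M[R]_(p, m1 + m2)) (Q : 'M[R]_(m1 + m2, q)) :
    P *m (M x *m B x - F *: M x) *m Q = P *m (M x *m B x) *m Q - F *: (P *m M x *m Q).
  by rewrite mulmxBr mulmxBl -scalemxAr -scalemxAl.
have -> : (C x)^T *m M x *m (B x - F%:M) *m C x =
    block_mx (N1 x *m (K1' x - F%:M)) 0 0 (N2 x *m (K2' x - F%:M)).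
  rewrite -(mulmxA _ (M x)) mulmxBr mul_mx_scalar /C tr_row_mx mul_col_mx mul_col_row.
  congr block_mx; rewrite blk.
  - by rewrite [in RHS]mulmxBr /K1' mulKVmx // mul_mx_scalar.
  - by rewrite XMBZ XMZ scaler0 subr0.
  - by rewrite ZMBX ZMX scaler0 subr0.
  - by rewrite [in RHS]mulmxBr /K2' mulKVmx // mul_mx_scalar.
rewrite rank_diag_block_mx !mxrank_unitM // /es count_map count_cat.
have cF (s : seq (R -> R)) : count (preim (fun (f : R -> R) x => e x + x ^+ n * f x)
    (fun f : R -> R => f x == E)) s = count (fun f : R -> R => f x == F) s.
  apply: eq_count => f /=; rewrite /F; apply/eqP/eqP => [<-|->].
    by rewrite [e x + _]addrC addrK mulrC mulKf.
  by rewrite mulrC divfK // addrC subrK.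
rewrite !cF -c1 -c2.
have := rank_leq_row (K1' x - F%:M); have := rank_leq_row (K2' x - F%:M).
move: (\rank _) (\rank _) => r2 r1; lia.
Unshelve. all: by end_near. Qed.

(** * Analytic eigenvalue branches of an operator pencil *)

(** P stands for a subspace given as a predicate. Dimension is a relation, so that it can be
    asserted without establishing finiteness beforehand. *)
Definition rdim (F : fieldType) (V : lmodType F) (P : V -> Prop) (n : nat) :=
  exists b : 'I_n -> V, [/\ forall i, P (b i), free_family b &
    forall x, P x -> exists c : 'I_n -> F, x = \sum_(i < n) c i *: b i].

Lemma rdim_unique (F : fieldType) (V : lmodType F) (P : V -> Prop) n m :
  rdim P n -> rdim P m -> n = m.
Proof.
move=> [b [Pb fb sb]] [b' [Pb' fb' sb']]; apply/eqP; rewrite eqn_leq.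
by rewrite (free_leq_span fb (fun i => sb' _ (Pb i))) (free_leq_span fb' (fun i => sb _ (Pb' i))).
Qed.

Lemma rdim_map (F : fieldType) (V W : lmodType F) (P : V -> Prop) (Q : W -> Prop)
    (phi : {linear V -> W}) n :
  (forall x, P x -> Q (phi x)) -> (forall x, phi x = 0 -> x = 0) ->
  (forall y, Q y -> exists2 x, P x & y = phi x) -> rdim P n -> rdim Q n.
Proof.
move=> PQ inj sur [b [Pb fb sb]]; exists (phi \o b); split.
- by move=> i; exact: PQ.
- move=> c; have -> : \sum_i c i *: (phi \o b) i = phi (\sum_i c i *: b i).
    by rewrite linear_sum; apply: eq_bigr => i _; rewrite linearZ.
  by move=> /inj /fb.
- move=> y /sur[x /sb[c ->] ->]; exists c; rewrite linear_sum.
  by apply: eq_bigr => i _; rewrite linearZ.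
Qed.

Lemma rdim_kernel (F : fieldType) m (A : 'M[F]_m) (E : F) :
  rdim (fun c : 'cV[F]_m => A *m c = E *: c) (m - \rank (A - E%:M)%R).
Proof.
pose N := row_base (kermx (A - E%:M)^T).
have e : \rank (kermx (A - E%:M)^T) = (m - \rank (A - E%:M)%R)%N.
  by rewrite mxrank_ker mxrank_tr.
rewrite -e; exists (fun i => (row i N)^T); split.
- move=> i; apply/eqP; rewrite -subr_eq0 -mul_scalar_mx -mulmxBl.
  rewrite -[X in X *m _]trmxK -trmx_mul; apply/eqP; rewrite -[RHS]trmx0; congr (_^T).
  apply/sub_kermxP; apply: submx_trans (row_sub i _) _; by rewrite /N eq_row_base.
- move=> c h i.
  have fN : row_free N by exact: row_base_free.
  have h' : (\row_i c i) *m N = 0 *m N.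
    rewrite mul0mx -[LHS]trmxK -[RHS]trmxK trmx0 -[X in _ = X^T]h; congr (_^T).
    rewrite mulmx_sum_row linear_sum; apply: eq_bigr => j _; by rewrite linearZ /= mxE.
  by have /rowP/(_ i) := row_free_inj fN h'; rewrite !mxE.
- move=> x hx.
  have : (x^T <= N)%MS.
    rewrite /N eq_row_base; apply/sub_kermxP.
    by rewrite -trmx_mul mulmxBl mul_scalar_mx hx subrr trmx0.
  move=> /submxP[D hD]; exists (fun i => D 0 i).
  rewrite -[LHS]trmxK hD mulmx_sum_row linear_sum; apply: eq_bigr => j _; by rewrite linearZ.
Qed.

Section LocalTheorem.
Variables (R : realType) (H : lmodType R) (ip : H -> H -> R).
Hypothesis hH : hilbert ip.
Local Notation nm := (hnorm ip).
Variables (ch sh : R -> R) (Kc Ks : R).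
Hypotheses (ach : san ch) (ash : san sh) (ch0 : ch 0 = 1) (sh0 : sh 0 = 0)
  (Kc0 : 0 <= Kc) (Ks0 : 0 <= Ks)
  (hKc : \forall x \near 0, `|ch x - 1| <= Kc * `|x|)
  (hKs : \forall x \near 0, `|sh x| <= Ks * `|x|).
Variables (A tau : {linear H -> H}) (E0 : R).
Hypotheses (sA : symmetric_op ip A) (cA : compact_op ip A) (E0n : E0 != 0)
  (stau : symmetric_op ip tau) (ntau : forall x, nm (tau x) <= nm x).

Definition pencil_op (x : R) : {linear H -> H} := (ch x \*: idfun) \+ (sh x \*: tau).
Local Notation M := pencil_op.

Lemma pencil_opE x u : M x u = ch x *: u + sh x *: tau u. Proof. by []. Qed.

Lemma pencil_op_sym x : symmetric_op ip (M x).
Proof.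
move=> u v; rewrite !pencil_opE (ipDl hH) (ipDr hH) !(ipZl hH) !(ipZr hH); congr (_ + _ * _).
exact: stau.
Qed.

(* With [ch = cosh] and [sh = sinh] this is the fiber eigenvalue equation at quasimomentum
   [k0 + x], up to rescaling of the coordinates of u: see [eigsp_rdim]. *)
Definition pencil_ker (x E : R) (u : H) := A u = E *: M x u.

Let nH := hilbert_norm hH.

Lemma an_ip_cst (f : R -> H) a v : an_coef nm f a ->
  an_coef (U := R^o) (@Num.norm R R) (fun x => ip (f x) v) (fun n => ip (a n) v).
Proof.
move=> [C [r [C0 r0 h]]]; exists (C * nm v), r; split; rewrite ?mulr_ge0 ?nm_ge0 // => x hx N.
have -> : ip (f x) v - \sum_(j < N) x ^+ j *: (ip (a j) v : R^o) =
    ip (f x - \sum_(j < N) x ^+ j *: a j) v.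
  by rewrite (ipBl hH) (ip_suml hH); congr (_ - _); apply: eq_bigr => i _; rewrite (ipZl hH).
apply: le_trans (cauchy_schwarz hH _ _) _; rewrite mulrAC ler_wpM2r ?nm_ge0 //; exact: h.
Qed.

Lemma an_near_le (f : R -> H) a e : an_coef nm f a -> 0 < e ->
  \forall x \near 0, nm (f x - f 0) <= e.
Proof.
move=> /(an_lipschitz nH)[K [r [K0 r0 h]]] e0.
have : san (fun x => K * x) by apply: sanM; [exact: san_cst|exact: san_id].
move=> /san_continuous /(_ e e0); rewrite mulr0.
apply: filterS2 (near0_small r0) => x hx; rewrite subr0 normrM (ger0_norm K0) => /ltW.
exact: le_trans (h x hx).
Qed.

(** Apply [deflation] with constant A and weight ch + sh tau. The higher coefficients of X are
    orthogonal to V, so the normalisation against V holds exactly near 0. *)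
Lemma local_analytic_frame : exists m (V : 'I_m -> H) (X : 'I_m -> R -> H) (K : R -> 'M[R]_m)
    (C : R), [/\ [/\ 0 <= C, orthonormal ip V, (forall i, A (V i) = E0 *: V i) &
      forall z, (forall i, ip z (V i) = 0) -> nm z <= C * nm (A z - E0 *: z)],
    (forall i, exists a, an_coef nm (X i) a), anmx K,
    (forall i, X i 0 = V i) /\ K 0 = E0%:M &
    \forall x \near 0, (forall l, A (X l x) = M x (\sum_i K x i l *: X i x)) /\
      (forall i l, ip (X i x) (V l) = (i == l)%:R)].
Proof.
have [m [V [S [C [C0 oV AV gap hS]]]]] := compact_spectral_split hH sA cA E0n.
have [cc [Cc [rc [Cc0 rc0 hcc]]]] := ach.
have [cs [Cs [rs [Cs0 rs0 hcs]]]] := ash.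
have acc : an_coef (U := R^o) (@Num.norm R R) ch cc by exists Cc, rc.
have acs : an_coef (U := R^o) (@Num.norm R R) sh cs by exists Cs, rs.
have cc0 : cc 0%N = 1 by rewrite -(an_coef0 (real_norm R) acc).
have cs0 : cs 0%N = 0 by rewrite -(an_coef0 (real_norm R) acs).
have [B B0 hB] := compact_bounded hH cA.
pose Mj n : {linear H -> H} := (cc n \*: idfun) \+ (cs n \*: tau).
pose Aj n : {linear H -> H} := (n == 0%N)%:R \*: A.
have MjE n u : Mj n u = cc n *: u + cs n *: tau u by [].
have Aj0 u : Aj 0%N u = A u by rewrite /Aj /= scale1r.
have AjS n u : Aj n.+1 u = 0 by rewrite /Aj /= scale0r.
pose C' := B + (2 * Cc + 2 * Cs); pose r := rc + rs.
have r0 : 0 < r by rewrite addr_gt0.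
have C'0 : 0 <= C' by rewrite !addr_ge0 // mulr_ge0.
have Mj0 u : Mj 0%N u = u by rewrite MjE cc0 cs0 scale1r scale0r addr0.
have rn n (q : R) : 0 < q -> q <= r -> q ^+ n <= r ^+ n.
  by move=> q0 qr; rewrite lerXn2r ?nnegrE ?(ltW q0) ?(ltW r0).
have hAj n u : nm (Aj n u) <= C' * r ^+ n * nm u.
  case: n => [|n]; last by rewrite AjS nm0 // !mulr_ge0 ?nm_ge0 ?exprn_ge0 // ltW.
  rewrite Aj0 expr0 mulr1; apply: le_trans (hB u) _; rewrite ler_wpM2r ?nm_ge0 //.
  by rewrite lerDl addr_ge0 ?mulr_ge0.
have hMj n u : nm (Mj n u) <= C' * r ^+ n * nm u.
  rewrite MjE; apply: le_trans (nmD hH _ _) _; rewrite !nmZ //.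
  have h1 : `|cc n| <= 2 * Cc * r ^+ n.
    apply: le_trans (an_bound_coef (real_norm R) n Cc0 rc0 hcc) _.
    by rewrite ler_wpM2l ?mulr_ge0 // rn // lerDl ltW.
  have h2 : `|cs n| <= 2 * Cs * r ^+ n.
    apply: le_trans (an_bound_coef (real_norm R) n Cs0 rs0 hcs) _.
    by rewrite ler_wpM2l ?mulr_ge0 // rn // lerDr ltW.
  have h3 : `|cs n| * nm (tau u) <= 2 * Cs * r ^+ n * nm u by rewrite ler_pM ?nm_ge0.
  have h4 := ler_wpM2r (nm_ge0 ip u) h1.
  have h5 : 0 <= B * r ^+ n * nm u by rewrite !mulr_ge0 ?nm_ge0 ?exprn_ge0 // ltW.
  by rewrite /C' !mulrDl; lra.
have AV0 i : Aj 0%N (V i) = E0 *: V i by rewrite Aj0 AV.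
have hS' x : [/\ Aj 0%N (S x) - E0 *: S x = x - \sum_i ip x (V i) *: V i,
    (forall i, ip (S x) (V i) = 0) & nm (S x) <= C * nm x].
  by have [h1 h2 h3] := hS x; rewrite Aj0.
have [Xc [Kc' [D [s [D0 s0 [hX hK] [X0 K0 XV] rel]]]]] :=
  @deflation R _ _ hH Aj Mj C' r C'0 r0 Mj0 hAj hMj E0 m V S C C0 oV AV0 hS'.
have gc : geo_complete nm by move=> a c q q01 c0 ha; exact: (hilbert_complete hH q01 c0 ha).
have /choice[X hX'] : forall i, exists f, an_coef nm f (fun n => Xc n i).
  move=> i; have [f hf] := an_of_coef nH gc D0 s0 (fun n => hX n i).
  by exists f, (2 * D), s; split; rewrite ?mulr_ge0.
have /choice[fK hfK] : forall il : 'I_m * 'I_m, exists f : R -> R,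
    an_coef (U := R^o) (@Num.norm R R) f (fun n => Kc' n il.1 il.2).
  move=> [i l]; have [|f hf] := an_of_coef (real_norm R) (@geo_complete_real R) D0 s0
    (a := fun n => Kc' n i l); first by move=> n; exact: hK.
  by exists f, (2 * D), s; split; rewrite ?mulr_ge0.
pose K x : 'M[R]_m := \matrix_(i, l) fK (i, l) x.
exists m, V, X, K, C; split=> //.
- by move=> i; eexists; exact: hX'.
- move=> i l; exists (fun n => Kc' n i l); have := hfK (i, l); congr an_coef.
  by apply/funext => x; rewrite mxE.
- split=> [i|]; first by rewrite (an_coef0 nH (hX' i)) X0.
  by apply/matrixP => i l; rewrite mxE (an_coef0 (real_norm R) (hfK (i, l))) /= K0.
have h1 : \forall x \near 0, forall l, A (X l x) = M x (\sum_i K x i l *: X i x).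
  apply: near_forall => l.
  have aU : an_coef nm (fun x => \sum_i fK (i, l) x *: X i x)
      (fun n => \sum_i \sum_(b < n.+1) Kc' b i l *: Xc (n - b)%N i).
    apply: (an_sum nH) => i; exact: (an_scale hH (hfK (i, l)) (hX' i)).
  have aMU := @an_apply R H H nm nm (fun x u => M x u) Mj _ _ nH nH _ aU.
  have := @an_coef_eq R H nm nH (A \o X l) (fun x => M x (\sum_i fK (i, l) x *: X i x)) (A \o Xc^~ l).
  move=> /(_ (an_linear B0 hB (hX' l))) h.
  have : an_coef nm (fun x => M x (\sum_i fK (i, l) x *: X i x)) (A \o Xc^~ l).
    have -> : A \o Xc^~ l = fun j => \sum_(a < j.+1) Mj a
        (\sum_i \sum_(b < (j - a).+1) Kc' b i l *: Xc (j - a - b)%N i).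
      apply/funext => n /=; transitivity (\sum_(a < n.+1) Aj a (Xc (n - a)%N l)).
        by rewrite big_ord_recl subn0 Aj0 big1 ?addr0 // => a _; exact: AjS.
      by rewrite rel; apply: eq_bigr => a _; rewrite exchange_big.
    apply: aMU; exists (Cc + Cs), r; split; rewrite ?addr_ge0 // => u x hx N.
    have x0 : 0 <= r * `|x| by rewrite mulr_ge0 // ltW.
    have -> : M x u - \sum_(j < N) x ^+ j *: Mj j u =
        (ch x - \sum_(j < N) x ^+ j * cc j) *: u + (sh x - \sum_(j < N) x ^+ j * cs j) *: tau u.
      under eq_bigr do rewrite MjE scalerDr !scalerA.
      by rewrite pencil_opE big_split /= -!scaler_suml opprD addrACA -!scalerBl.
    apply: le_trans (nmD hH _ _) _; rewrite !nmZ // mulrAC mulrDl mulrDl.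
    have rcr : rc <= r by rewrite lerDl ltW.
    have rsr : rs <= r by rewrite lerDr ltW.
    have b1 := an_bound_mono Cc0 rc0 (lexx Cc) rcr hcc hx N.
    have b2 := an_bound_mono Cs0 rs0 (lexx Cs) rsr hcs hx N.
    apply: lerD; first by rewrite ler_wpM2r ?nm_ge0.
    by apply: ler_pM; rewrite ?nm_ge0.
  move=> /h; apply: filterS => x /= ->; congr (M x _); apply: eq_bigr => i _; by rewrite mxE.
have h2 : \forall x \near 0, forall il : 'I_m * 'I_m, ip (X il.1 x) (V il.2) = (il.1 == il.2)%:R.
  apply: near_forall => -[i l] /=.
  have := an_coef_eq (real_norm R) (an_ip_cst (V l) (hX' i)); apply.
  have := an_cst (real_norm R) ((i == l)%:R : R^o); congr an_coef.
  by apply/funext => -[|n]; rewrite ?X0 ?oV ?XV.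
apply: filterS2 h1 h2 => x e1 e2; split=> // i l; exact: (e2 (i, l)).
Qed.

Lemma pencil_op0 u : M 0 u = u.
Proof. by rewrite pencil_opE ch0 sh0 scale1r scale0r addr0. Qed.

Lemma an_pencil_op (f : R -> H) a : an_coef nm f a ->
  exists b, an_coef nm (fun x => M x (f x)) b.
Proof.
move=> fa; have [ac hc] := ach; have [as_ hs] := ash.
have nt x : nm (tau x) <= 1 * nm x by rewrite mul1r.
have ht := an_linear ler01 nt fa.
eexists; exact: (anD nH (an_scale hH hc fa) (an_scale hH hs ht)).
Qed.

(** The branches are the Rellich eigenvalues of K, with the Gram matrix [G] as weight. Two points go
    beyond finite dimensions: every eigenvector with E near E0 is a combination of the X l x, and E
    moves at a rate proportional to |E0|. *)
Lemma local_branches : exists (es : seq (R -> R)) (eps : R), [/\ 0 < eps,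
  forall i, (i < size es)%N -> san (nth (fun=> 0) es i) /\ nth (fun=> 0) es i 0 = E0 &
  \forall x \near 0, forall E : R, `|E - E0| < eps ->
    rdim (pencil_ker x E) (count (fun f : R -> R => f x == E) es) /\
    forall u, pencil_ker x E u -> u != 0 -> `|E - E0| <= 2 * (Kc + 2 * Ks) * `|E0| * `|x|].
Proof.
have [m [V [X [K [C [[C0 oV AV gap] aX aK [X0 K0] hAX]]]]]] := local_analytic_frame.
pose G x : 'M[R]_m := \matrix_(i, l) ip (X i x) (M x (X l x)).
have aG : anmx G.
  move=> i l; have [a ha] := aX i; have [b hb] := aX l; have [c hc] := an_pencil_op hb.
  eexists; have := an_ip hH ha hc; congr an_coef; by apply/funext => x; rewrite mxE.
have G0 : G 0 = 1%:M by apply/matrixP => i l; rewrite !mxE pencil_op0 !X0 oV.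
have sG x : (G x)^T = G x.
  by apply/matrixP => i l; rewrite !mxE -pencil_op_sym (ipC hH).
have sG' : \forall x \near 0, (G x)^T = G x by exact: filterE.
have GK : \forall x \near 0, (G x *m K x)^T = G x *m K x.
  apply: filterS hAX => x [hA _].
  have e i l : (G x *m K x) i l = ip (X i x) (A (X l x)).
    rewrite hA linear_sum (ip_sumr hH) mxE; apply: eq_bigr => k _.
    by rewrite linearZ /= (ipZr hH) mxE mulrC.
  by apply/matrixP => i l; rewrite mxE !e -sA (ipC hH).
have [es [szes saes hes]] := rellich aK aG G0 sG' GK.
pose th := (16 * (C + 1))^-1.
have C1 : 0 < C + 1 by rewrite ltr_wpDl.
have th0 : 0 < th by rewrite invr_gt0 mulr_gt0.
have Cth : C * (4 * th) <= 4^-1.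
  have : (C + 1) * (16 * th) = 1 by rewrite /th invfM mulrA; field; rewrite gt_eqF.
  by rewrite mulrDl; lra.
have E0p : 0 < `|E0| by rewrite normr_gt0.
(* The bound th makes E M(x) - E0 small against the gap constant C, the bound 1 keeps |E| <= |E0| +
   1 in that estimate, and the bound |E0| gives |E| <= 2 |E0| in the final one. *)
pose eps := Num.min (Num.min th 1) `|E0|.
have eps0 : 0 < eps by rewrite !lt_min th0 ltr01.
have es0 i : (i < size es)%N -> nth (fun=> 0) es i 0 = E0.
  have := nbhs_singleton hes E0; rewrite K0 subrr mxrank0 subn0 -szes => e iz.
  have : all (fun f : R -> R => f 0 == E0) es by rewrite all_count e.
  by move=> /(all_nthP (fun=> 0))/(_ i iz)/eqP.
exists es, eps; split=> // [i iz|]; first by split; [exact: saes|exact: es0].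
have uG : \forall x \near 0, G x \in unitmx by apply: near_unitmx => //; rewrite G0 unitmx1.
have q0 : 0 < (4 * (m%:R + 1))^-1 :> R by rewrite invr_gt0 mulr_gt0 // ltr_wpDl.
have mq : m%:R * (4 * (m%:R + 1))^-1 <= 4^-1 :> R.
  by rewrite invfM mulrCA ler_piMr ?invr_ge0 // ler_pdivrMr ?mul1r ?ltr_wpDl // lerDl.
have nMX : \forall x \near 0, forall i, nm (V i - M x (X i x)) <= (4 * (m%:R + 1))^-1.
  apply: near_forall => i; have [a ha] := aX i; have [b hb] := an_pencil_op ha.
  have := an_near_le hb q0; apply: filterS => x; by rewrite pencil_op0 X0 (nm_dist hH).
have nX : \forall x \near 0, forall i, nm (X i x - V i) <= (4 * (m%:R + 1))^-1.
  apply: near_forall => i; have [a ha] := aX i.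
  have := an_near_le ha q0; apply: filterS => x; by rewrite X0.
have c1 : \forall x \near 0, `|ch x - 1| < th / (`|E0| + 1).
  have := san_continuous ach (_ : 0 < th / (`|E0| + 1)); rewrite ch0; apply.
  by rewrite divr_gt0 // ltr_wpDl.
have s1 : \forall x \near 0, `|sh x| < th / (`|E0| + 1).
  have := san_continuous ash (_ : 0 < th / (`|E0| + 1)); rewrite sh0.
  have d0 : 0 < th / (`|E0| + 1) by rewrite divr_gt0 // ltr_wpDl.
  by move=> /(_ d0); apply: filterS => x; rewrite subr0.
near=> x => E; rewrite !lt_min => /andP[/andP[Eth E1] EE0].
have [hA hb] : (forall l, A (X l x) = M x (\sum_i K x i l *: X i x)) /\
      (forall i l, ip (X i x) (V l) = (i == l)%:R) by near: x.
have hG : G x \in unitmx by near: x.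
have hMX : forall i, nm (V i - M x (X i x)) <= (4 * (m%:R + 1))^-1 by near: x.
have hX : forall i, nm (X i x - V i) <= (4 * (m%:R + 1))^-1 by near: x.
have hc : `|ch x - 1| < th / (`|E0| + 1) by near: x.
have hs : `|sh x| < th / (`|E0| + 1) by near: x.
have hr : forall E, (m - \rank (K x - E%:M)%R)%N = count (fun f : R -> R => f x == E) es by near: x.
have hKc' : `|ch x - 1| <= Kc * `|x| by near: x.
have hKs' : `|sh x| <= Ks * `|x| by near: x.
have E01 : 0 < `|E0| + 1 by rewrite ltr_wpDl.
have hc' : (`|E0| + 1) * `|ch x - 1| <= th.
  by rewrite mulrC -ler_pdivlMr // ltW.
have hs' : (`|E0| + 1) * `|sh x| <= th.
  by rewrite mulrC -ler_pdivlMr // ltW.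
have th1 : th <= 1.
  rewrite /th invf_le1 ?mulr_gt0 //; lra.
have ch2 : `|ch x| <= 2.
  have : `|ch x - 1| <= 1.
    apply: le_trans th1; apply: le_trans hc'; rewrite ler_peMl //.
    by rewrite lerDr.
  have := ler_normD (ch x - 1) 1; rewrite subrK normr1; lra.
have nE : `|E| <= `|E0| + 1.
  have := ler_normD (E - E0) E0; rewrite subrK; lra.
have smallM z : nm (E *: M x z - E0 *: z) <= 4 * th * nm z.
  have -> : E *: M x z - E0 *: z = ((E - E0) * ch x + E0 * (ch x - 1)) *: z + (E * sh x) *: tau z.
    rewrite pencil_opE scalerDr !scalerA addrAC -scalerBl; congr (_ *: _ + _); ring.
  apply: le_trans (nmD hH _ _) _; rewrite !nmZ //.
  have t1 : `|(E - E0) * ch x + E0 * (ch x - 1)| <= 3 * th.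
    apply: le_trans (ler_normD _ _) _; rewrite !normrM.
    have : `|E - E0| * `|ch x| <= th * 2 by rewrite ler_pM // ltW.
    have : `|E0| * `|ch x - 1| <= th.
      by apply: le_trans hc'; rewrite ler_wpM2r // lerDl.
    lra.
  have t2 : `|E * sh x| <= th by rewrite normrM; apply: le_trans hs'; rewrite ler_wpM2r.
  have t3 : `|E * sh x| * nm (tau z) <= th * nm z by rewrite ler_pM ?nm_ge0.
  have := ler_wpM2r (nm_ge0 ip z) t1; lra.
pose comb (c : 'cV[R]_m) := \sum_l c l 0 *: X l x.
have lin_comb : linear comb.
  move=> a c d; rewrite /comb scaler_sumr -big_split; apply: eq_bigr => l _ /=.
  by rewrite !mxE scalerDl scalerA.
have Acomb c : A (comb c) = M x (comb (K x *m c)).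
  rewrite /comb linear_sum; under eq_bigr do rewrite linearZ /= hA -linearZ scaler_sumr.
  rewrite -linear_sum; congr (M x _); rewrite exchange_big; apply: eq_bigr => i _.
  rewrite mxE scaler_suml; apply: eq_bigr => l _; by rewrite scalerA mulrC.
have comb_ip c i : ip (comb c) (V i) = c i 0.
  rewrite /comb (ip_suml hH); under eq_bigr do rewrite (ipZl hH) hb.
  by rewrite sum_mul_delta.
have combG c i : ip (X i x) (M x (comb c)) = (G x *m c) i 0.
  rewrite mxE /comb linear_sum (ip_sumr hH); apply: eq_bigr => l _.
  by rewrite linearZ /= (ipZr hH) mxE mulrC.
have combP u : pencil_ker x E u -> exists2 c, K x *m c = E *: c & u = comb c.
  (* This c makes z orthogonal to all X l x for the weight M. Then A z is orthogonal to them,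
     because A maps their span into its image under M; comparing the two facts gives K c = E c and A
     z = E M z. *)
  move=> hu; pose c := invmx (G x) *m \col_i ip (X i x) (M x u).
  pose z := u - comb c.
  have zM i : ip (X i x) (M x z) = 0.
    by rewrite /z linearB (ipBr hH) combG /c mulKVmx // mxE subrr.
  have zA i : ip (X i x) (A z) = 0.
    rewrite -sA hA pencil_op_sym (ip_suml hH) big1 // => l _.
    by rewrite (ipZl hH) zM mulr0.
  have ez : A z = E *: M x z - M x (comb (K x *m c - E *: c)).
    rewrite /z linearB Acomb hu [M x (u - _)]linearB scalerBr.
    have -> : comb (K x *m c - E *: c) = comb (K x *m c) - E *: comb c.
      by rewrite -[comb]/(mklinear lin_comb : _ -> _) linearB linearZ.
    by rewrite [M x (_ - _)]linearB [M x (E *: _)]linearZZ opprB addrA subrK.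
  have hKcc : K x *m c = E *: c.
    apply/eqP; rewrite -subr_eq0; apply/eqP.
    have : G x *m (K x *m c - E *: c) = G x *m 0.
      rewrite mulmx0; apply/matrixP => i j; rewrite ord1 [RHS]mxE -combG.
      have := zA i; rewrite ez (ipBr hH) (ipZr hH) zM mulr0 sub0r => /eqP.
      by rewrite oppr_eq0 => /eqP.
    move=> /(congr1 (mulmx (invmx (G x)))); by rewrite !mulKmx.
  exists c => //; apply/eqP; rewrite -subr_eq0 -/z; apply/eqP.
  have Az : A z = E *: M x z.
    rewrite ez hKcc subrr -[comb]/(mklinear lin_comb : _ -> _) linear0 linear0 subr0 //.
  (* The V-components of z are small since V is close to M X, and the part y orthogonal to V is
     controlled by the gap. Each of the two parts has norm at most |z|/4, so z = 0. *)
  pose y := z - \sum_i ip z (V i) *: V i.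
  have yV i : ip y (V i) = 0.
    rewrite (ipBl hH) (ip_suml hH); under eq_bigr do rewrite (ipZl hH) oV.
    by rewrite sum_mul_delta subrr.
  have Ay : A y - E0 *: y = E *: M x z - E0 *: z.
    rewrite /y; set W := \sum_i _.
    have AW : A W = E0 *: W.
      rewrite [A W]linear_sum scaler_sumr; apply: eq_bigr => i _.
      by rewrite linearZ /= AV !scalerA mulrC.
    by rewrite linearB AW Az scalerBr opprB addrA subrK.
  have ny : nm y <= 4^-1 * nm z.
    apply: le_trans (gap _ yV) _; rewrite Ay.
    apply: le_trans (ler_wpM2l C0 (smallM z)) _.
    by rewrite mulrA ler_wpM2r ?nm_ge0.
  have nV i : `|ip z (V i)| <= (4 * (m%:R + 1))^-1 * nm z.
    have -> : ip z (V i) = ip z (V i - M x (X i x)).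
      by rewrite (ipBr hH) (ipC hH z (M x _)) pencil_op_sym zM subr0.
    by apply: le_trans (cauchy_schwarz hH _ _) _; rewrite mulrC ler_wpM2r ?nm_ge0.
  have nV1 i : nm (V i) = 1 by rewrite /hnorm oV eqxx sqrtr1.
  have ns : nm (\sum_i ip z (V i) *: V i) <= 4^-1 * nm z.
    apply: le_trans (nm_sum hH _ _ _) _.
    apply: (@le_trans _ _ (\sum_(i < m) (4 * (m%:R + 1))^-1 * nm z)).
      by apply: ler_sum => i _; rewrite nmZ // nV1 mulr1.
    rewrite sumr_const card_ord -[X in X <= _]mulr_natl mulrA ler_wpM2r ?nm_ge0 //.
  have : nm z <= nm y + nm (\sum_i ip z (V i) *: V i).
    by rewrite -{1}(subrK (\sum_i ip z (V i) *: V i) z) nmD.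
  move=> h; apply: (nm_le0 hH); have := nm_ge0 ip z; lra.
have combK c : K x *m c = E *: c -> pencil_ker x E (comb c).
  by move=> hc1; rewrite /pencil_ker Acomb hc1 -[comb]/(mklinear lin_comb : _ -> _) linearZ linearZ.
split.
  rewrite -hr; apply: (rdim_map (phi := mklinear lin_comb)) (rdim_kernel (K x) E).
  - by move=> c; exact: combK.
  - move=> c hc1; apply/matrixP => i j; rewrite ord1 mxE -comb_ip.
    by rewrite [comb c]hc1 ip0l.
  - by move=> u /combP[c hc1 ->]; exists c.
move=> u /[dup] hu /combP[c _ uc] u0.
(* u1 is the projection of u on the E0-eigenspace. Pairing A u = E M u with it gives E0 |u1|^2 = E
   (ch |u1|^2 + sh <u1, tau u>), and |u| <= 2 |u1|; hence the rate involves only Kc and Ks. *)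
pose u1 := \sum_i c i 0 *: V i.
have uu : ip u1 u = nm u1 ^+ 2.
  rewrite (sqr_nm hH) {1 2}/u1 !(ip_suml hH); apply: eq_bigr => i _; rewrite !(ipZl hH); congr (_ * _).
  rewrite uc (ipC hH) comb_ip (ip_sumr hH); under eq_bigr do rewrite (ipZr hH) oV eq_sym.
  by rewrite sum_mul_delta.
have c_le i : `|c i 0| <= nm u1.
  have -> : c i 0 = ip u1 (V i).
    rewrite (ip_suml hH); under eq_bigr do rewrite (ipZl hH) oV.
    by rewrite sum_mul_delta.
  apply: le_trans (cauchy_schwarz hH _ _) _.
  by rewrite [nm (V i)]/hnorm oV eqxx sqrtr1 mulr1.
have nu : nm u <= 2 * nm u1.
  have -> : u = u1 + \sum_i c i 0 *: (X i x - V i).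
    rewrite uc -big_split; apply: eq_bigr => i _ /=; by rewrite scalerBr addrC subrK.
  apply: le_trans (nmD hH _ _) _; rewrite mulrDl mul1r lerD2l.
  apply: le_trans (nm_sum hH _ _ _) _.
  apply: (@le_trans _ _ (\sum_(i < m) (4 * (m%:R + 1))^-1 * nm u1)).
    by apply: ler_sum => i _; rewrite nmZ // mulrC ler_pM ?nm_ge0.
  rewrite sumr_const card_ord -[X in X <= _]mulr_natl mulrA ler_piMl ?nm_ge0 //.
  by apply: le_trans mq _; lra.
have u1p : 0 < nm u1.
  rewrite lt_neqAle nm_ge0 andbT eq_sym; apply: contra u0 => /eqP h.
  apply/eqP/(nm_le0 hH); by rewrite (le_trans nu) // h mulr0.
have e1 : E0 * nm u1 ^+ 2 = E * (ch x * nm u1 ^+ 2 + sh x * ip u1 (tau u)).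
  rewrite -uu -(ipZl hH).
  have -> : E0 *: u1 = A u1.
    rewrite [A u1]linear_sum scaler_sumr; apply: eq_bigr => i _.
    by rewrite [A (_ *: _)]linearZ /= AV !scalerA mulrC.
  by rewrite sA hu (ipZr hH) pencil_opE (ipDr hH) !(ipZr hH).
have e2 : (E0 - E * ch x) * nm u1 ^+ 2 = E * sh x * ip u1 (tau u).
  rewrite mulrBl e1; ring.
have e3 : `|E0 - E * ch x| <= `|E| * (2 * `|sh x|).
  have p2 : 0 < nm u1 ^+ 2 by rewrite exprn_gt0.
  rewrite -(ler_pM2r p2) -{1}(gtr0_norm p2) -normrM e2 !normrM -!mulrA ler_wpM2l //.
  rewrite mulrCA ler_wpM2l //; apply: le_trans (cauchy_schwarz hH _ _) _.
  rewrite expr2 mulrCA ler_wpM2l ?nm_ge0 //; exact: le_trans (ntau u) nu.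
have e4 : `|E - E0| <= `|E| * (2 * `|sh x| + `|ch x - 1|).
  rewrite distrC; have -> : E0 - E = (E0 - E * ch x) + E * (ch x - 1) by ring.
  apply: le_trans (ler_normD _ _) _; rewrite normrM mulrDr lerD2r; exact: e3.
have nE2 : `|E| <= 2 * `|E0|.
  have := ler_normD (E - E0) E0; rewrite subrK; lra.
apply: le_trans e4 _.
apply: (@le_trans _ _ (2 * `|E0| * ((Kc + 2 * Ks) * `|x|))).
  by apply: ler_pM => //; rewrite ?addr_ge0 ?mulr_ge0 //; lra.
by rewrite le_eqVlt; apply/orP; left; apply/eqP; ring.
Unshelve. all: by end_near. Qed.
End LocalTheorem.

(** * Continuation of eigenvalue branches *)

Section AnalyticAt.
Variable R : realType.
Implicit Types f g : R -> R.

Definition an_at f (x0 : R) := san (fun h => f (x0 + h)).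

Lemma near_translate (P : R -> Prop) (x : R) :
  (\forall y \near x, P y) <-> \forall h \near 0, P (x + h).
Proof. exact: nbhs0P. Qed.

Lemma near_opp (P : R -> Prop) (x : R) : (\forall y \near - x, P y) -> \forall y \near x, P (- y).
Proof.
move=> /nbhs_ballP[e /= e0 he]; apply/nbhs_ballP; exists e => // y xy; apply: he.
by move: xy; rewrite /ball /= -opprD normrN.
Qed.

Lemma an_at_near f x : an_at f x -> \forall y \near x, an_at f y.
Proof.
move=> /san_shift h; apply/near_translate; apply: filterS h => y; congr san.
by apply/funext => h; rewrite addrA.
Qed.

Lemma an_at_ext f g x : (\forall y \near x, f y = g y) -> an_at f x -> an_at g x.
Proof. by move=> /near_translate h; apply: san_ext. Qed.

Lemma an_at_continuous f x e : an_at f x -> 0 < e -> \forall y \near x, `|f y - f x| < e.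
Proof.
move=> /san_continuous h /h {}h; apply/near_translate; apply: filterS h => y.
by rewrite addr0.
Qed.

Lemma dnbhs_translate (P : R -> Prop) x : (\forall h \near 0^', P (x + h)) ->
  \forall y \near x^', P y.
Proof.
move=> h; have h' : \forall h \near 0, h != 0 -> P (x + h) := h.
apply: near_dnbhs; apply/near_translate; apply: filterS h' => y hy yx; apply: hy.
by apply: contra_neq yx => ->; rewrite addr0.
Qed.

Lemma an_at_cases f g x : an_at f x -> an_at g x ->
  (\forall y \near x, f y = g y) \/ (\forall y \near x^', f y != g y).
Proof.
move=> hf hg; have := san_zero_or_isolated (sanB hf hg) => -[h|h]; [left|right].
  by apply/near_translate; apply: filterS h => y /eqP; rewrite subr_eq0 => /eqP.
by apply: dnbhs_translate; apply: filterS h => y; rewrite subr_eq0.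
Qed.

Lemma san_opp f : san f -> san (fun x => f (- x)).
Proof.
move=> [a [C [r [C0 r0 h]]]]; exists (fun n => (-1) ^+ n * a n), C, r; split=> // x hx N.
have := h (- x); rewrite normrN => /(_ hx N); congr (`|_ - _| <= _).
apply: eq_bigr => i _; rewrite -[LHS]/((- x) ^+ i * (a i : R)) [(- x) ^+ i]exprNn.
exact: (esym (mulrCA (x ^+ i) ((-1) ^+ i) (a i : R))) || (rewrite -mulrA; exact: mulrCA).
Qed.

Lemma an_at_opp f x : an_at f (- x) -> an_at (fun y => f (- y)) x.
Proof. by move=> /san_opp; congr san; apply/funext => h; rewrite opprD. Qed.

Lemma an_at_translate f c x : an_at f (x + c) -> an_at (fun y => f (y + c)) x.
Proof. by congr san; apply/funext => h; rewrite addrAC. Qed.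

(** The derivative is the coefficient of order 1. Transferring to it a Lipschitz bound at x prepares
    the Gronwall estimate. *)
Lemma an_at_derivable f x : an_at f x ->
  exists2 d, is_derive x 1 f d & forall K, (\forall y \near x, `|f y - f x| <= K * `|y - x|) ->
    `|d| <= K.
Proof.
move=> [a [C [r [C0 r0 h]]]].
have e0 : f x = a 0%N.
  have ha : an_coef (U := R^o) (@Num.norm R R) (fun h => f (x + h)) a by exists C, r.
  by have := an_coef0 (real_norm R) ha; rewrite addr0.
have cv : (fun h => h^-1 *: (f (h *: 1 + x) - f x)) @ 0^' --> (a 1%N : R^o).
  apply/cvgrPdist_le => e e_gt0.
  have s0 : 0 < r + C * r ^+ 2 / e.
    by rewrite ltr_pwDl // divr_ge0 ?mulr_ge0 ?sqr_ge0 // ltW.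
  apply: near_dnbhs; apply: filterS (near0_small s0) => y hy y0.
  have ry : r * `|y| <= 2^-1.
    apply: le_trans hy; rewrite ler_wpM2r // lerDl divr_ge0 ?mulr_ge0 ?sqr_ge0 // ltW //.
  have Cy : C * r ^+ 2 / e * `|y| <= 1.
    apply: (@le_trans _ _ 2^-1); last by rewrite invf_le1 ?ler1n.
    by apply: le_trans hy; rewrite ler_wpM2r // lerDr ltW.
  have := h y ry 2%N; rewrite big_ord_recl big_ord1 expr0 scale1r /bump /= expr1.
  rewrite -e0 => h2.
  have -> : a 1%N - y^-1 *: (f (y *: (1 : R^o) + x) - f x) =
      - y^-1 * (f (x + y) - (f x + y * a 1%N)).
    rewrite -[y *: _]/(y * 1) mulr1 [y + x]addrC -[_ *: _]/(_ * _) opprD addrA.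
    by move: (f (x + y)) (f x) (a 1%N : R) => u v w; field.
  rewrite normrM normrN normfV ler_pdivrMl ?normr_gt0 //.
  apply: le_trans h2 _; rewrite exprMn mulrA.
  move: Cy; rewrite mulrAC ler_pdivrMr // mul1r => Cy.
  by rewrite expr2 mulrA mulrC ler_wpM2l.
exists (a 1%N).
  by apply: DeriveDef; [apply/cvg_ex; exists (a 1%N); exact: cv|exact: cvg_lim cv].
move=> K /near_translate hK.
have cvn : (fun h => `|h^-1 *: (f (h *: 1 + x) - f x)|) @ 0^' --> `|(a 1%N : R^o)|.
  exact: cvg_norm cv.
rewrite -(cvg_lim _ cvn) //; apply: limr_le; first by apply/cvg_ex; eexists; exact: cvn.
apply: near_dnbhs; apply: filterS hK => y; rewrite [x + y - x]addrAC subrr add0r => hy y0.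
rewrite -[_ *: _]/(_ * _) normrM normfV ler_pdivrMl ?normr_gt0 // mulrC.
by rewrite -[y *: _]/(y * 1) mulr1 [y + x]addrC.
Qed.
End AnalyticAt.

(** * Connectedness of intervals and the identity theorem *)

Section LocallyConstant.
Variable R : realType.

(** Connectedness by calculus: the indicator of Q, composed with the retraction [cl] of the line
    onto [a, b], is locally constant, so its derivative vanishes and it is constant. *)
Lemma locally_constant (Q : R -> Prop) (a b : R) : a <= b ->
  (forall x, a <= x <= b -> \forall y \near x, a <= y <= b -> (Q y <-> Q x)) ->
  Q a <-> Q b.
Proof.
move=> ab hQ; pose cl y := Num.min (Num.max y a) b.
have clb y : a <= cl y <= b.
  by rewrite /cl le_min ab le_max lexx orbT /= ge_min lexx orbT.
have cla : cl a = a by rewrite /cl maxxx min_l.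
have clbb : cl b = b by rewrite /cl max_l // minxx.
have cllip x y : `|cl y - cl x| <= `|y - x|.
  rewrite /cl /Num.min /Num.max.
  have [h1|h1] := ltP y a; have [h2|h2] := ltP x a.
  - by rewrite subrr normr0.
  - case: (ltP a b) => h3; case: (ltP x b) => h4; rewrite ler_norml;
      move: (ler_norm (y - x)) (ler_norm (x - y)); rewrite -(distrC x y); lra.
  - case: (ltP a b) => h3; case: (ltP y b) => h4; rewrite ler_norml;
      move: (ler_norm (y - x)) (ler_norm (x - y)); rewrite -(distrC x y); lra.
  - case: (ltP x b) => h3; case: (ltP y b) => h4; rewrite ler_norml;
      move: (ler_norm (y - x)) (ler_norm (x - y)); rewrite -(distrC x y); lra.
pose g y : R := `[< Q (cl y) >]%:R.
have gd (x : R) : is_derive x 1 g (0 : R).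
  have nb : \forall y \near x, g y = g x.
    have /nbhs_ballP[e /= e0 he] := hQ _ (clb x).
    apply/nbhs_ballP; exists e => // y; rewrite /ball /= => xy.
    rewrite /g; congr (nat_of_bool _)%:R; apply: asbool_equiv_eq.
    apply: he => //; rewrite /ball /= distrC; apply: le_lt_trans (cllip x y) _.
    by rewrite distrC.
  have cv : (fun h => h^-1 *: (g (h *: 1 + x) - g x)) @ 0^' --> (0 : R^o).
    have : (fun h : R => (0 : R^o)) @ 0^' --> (0 : R^o) by exact: cvg_cst.
    apply: cvg_trans; apply: near_eq_cvg; apply: near_dnbhs.
    move/near_translate: nb; apply: filterS => h gh _.
    by rewrite -[h *: _]/(h * 1) mulr1 [h + x]addrC gh subrr scaler0.
  by apply: DeriveDef; [apply/cvg_ex; exists 0; exact: cv|exact: cvg_lim cv].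
have := is_derive_0_is_cst a b gd; rewrite /g cla clbb.
have [qa|qa] := asboolP (Q a); have [qb|qb] := asboolP (Q b) => //.
- by move/eqP; rewrite oner_eq0.
- by move/eqP; rewrite eq_sym oner_eq0.
Qed.

(** Near a point the two functions either agree or differ off that point, so the set where their
    germs agree is open and closed. *)
Lemma an_at_identity (f g : R -> R) a b : a <= b ->
  (forall x, a <= x <= b -> an_at f x /\ an_at g x) ->
  (\forall x \near a, f x = g x) <-> (\forall x \near b, f x = g x).
Proof.
move=> ab h; apply: (locally_constant (Q := fun z => \forall x \near z, f x = g x) ab) => x xab.
have [af ag] := h x xab.
have [e|ne] := an_at_cases af ag.
  by have := near_join e; apply: filterS => y hy _; split.
have ne' : \forall y \near x, y != x -> f y != g y := ne.
apply: filterS (near_join ne') => y hy; split.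
  have [->//|yx] := eqVneq y x.
  by move=> /nbhs_singleton e; have := nbhs_singleton hy yx; rewrite e eqxx.
move=> e; have [z] := dnbhs_ex2 (near_dnbhsW e) ne.
by case=> -> /eqP.
Qed.
End LocallyConstant.

Section Continuation.
Variable R : realType.
Implicit Types (f g : R -> R) (D : R -> R -> nat -> Prop).

(* [D k E n] is to be read as: E has multiplicity n at the parameter k. The bound on [E - E0]
   makes branches Lipschitz on a logarithmic scale, so they neither vanish nor blow up. *)
Definition locally_analytic_spectrum (L : R) D := forall k0 E0, E0 != 0 ->
  exists (es : seq (R -> R)) (eps : R), [/\ 0 < eps,
    forall i, (i < size es)%N -> an_at (nth (fun=> 0) es i) k0 /\ nth (fun=> 0) es i k0 = E0 &
    \forall k \near k0, forall E, `|E - E0| < eps ->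
      D k E (count (fun f => f k == E) es) /\
      ((0 < count (fun f => f k == E) es)%N -> `|E - E0| <= L * `|E0| * `|k - k0|)].

Definition in_spectrum D k E := exists2 n, (0 < n)%N & D k E n.

Definition good_at D f x :=
  [/\ an_at f x, f x != 0 & \forall y \near x, in_spectrum D y (f y)].

Definition branch D f := forall x, good_at D f x.

Lemma good_at_near D f x : good_at D f x -> \forall y \near x, good_at D f y.
Proof.
move=> [h1 h2 h3].
have h4 : \forall y \near x, f y != 0.
  have := an_at_continuous h1 (e := `|f x|); rewrite normr_gt0 => /(_ h2).
  apply: filterS => y; apply: contraTneq => ->.
  by rewrite sub0r normrN ltxx.
by apply: filterS3 (an_at_near h1) h4 (near_join h3) => y; split.
Qed.

Lemma good_at_ext D f g x : (\forall y \near x, f y = g y) -> good_at D f x -> good_at D g x.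
Proof.
move=> e [h1 h2 h3]; split; first exact: an_at_ext h1.
  by rewrite -(nbhs_singleton e).
by apply: filterS2 e h3 => y ->.
Qed.

Section Fixed.
Variables (D : R -> R -> nat -> Prop) (L : R).
Hypothesis Dfun : forall k E n m, D k E n -> D k E m -> n = m.
Hypothesis Dloc : locally_analytic_spectrum L D.

(** If no germ in [es] were that of f, each would differ from f off x near x, and so would all of
    them together since they are finitely many; but f always takes one of their values. *)
Lemma pigeonhole_germ (es : seq (R -> R)) f x :
  (forall i, (i < size es)%N -> an_at (nth (fun=> 0) es i) x) -> an_at f x ->
  (\forall y \near x, (0 < count (fun g : R -> R => g y == f y) es)%N) ->
  exists2 i, (i < size es)%N & \forall y \near x, nth (fun=> 0) es i y = f y.
Proof.
move=> ha hf hc; apply: contrapT => hn.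
have hd (i : 'I_(size es)) : \forall y \near x^', nth (fun=> 0) es i y != f y.
  have [h|//] := an_at_cases (ha i (ltn_ord i)) hf.
  by case: hn; exists i.
have hd' := @near_forall R 'I_(size es) (fun i y => y != x -> nth (fun=> 0) es i y != f y) x hd.
have hd2 : \forall y \near x^', forall i : 'I_(size es), nth (fun=> 0) es i y != f y.
  by apply: near_dnbhs; apply: filterS hd' => y h yx i; exact: h.
have [y [h1 h2]] := dnbhs_ex2 hd2 (near_dnbhsW hc).
move: h2; rewrite -has_count => /(has_nthP (fun=> 0))[i hi] /eqP e.
by have := h1 (Ordinal hi); rewrite /= e eqxx.
Qed.

Lemma local_good k0 E0 : E0 != 0 -> exists (es : seq (R -> R)) (eps : R), [/\ 0 < eps,
    forall i, (i < size es)%N -> nth (fun=> 0) es i k0 = E0,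
    D k0 E0 (size es),
    \forall k \near k0, forall i, (i < size es)%N -> good_at D (nth (fun=> 0) es i) k &
    \forall k \near k0, forall E, `|E - E0| < eps ->
      D k E (count (fun f => f k == E) es) /\
      ((0 < count (fun f => f k == E) es)%N -> `|E - E0| <= L * `|E0| * `|k - k0|)].
Proof.
move=> E0n; have [es [eps [eps0 he hk]]] := Dloc k0 E0n.
exists es, eps; split => //.
- by move=> i hi; have [] := he i hi.
- have := nbhs_singleton hk E0; rewrite subrr normr0 => /(_ eps0)[].
  have -> // : count (fun f => f k0 == E0) es = size es.
  apply/eqP; rewrite -all_count; apply/(all_nthP (fun=> 0)) => i hi.
  by have [_ ->] := he i hi.
- have hg (i : 'I_(size es)) : \forall k \near k0, good_at D (nth (fun=> 0) es i) k.
    have [h1 h2] := he i (ltn_ord i); apply: good_at_near; split; rewrite ?h2 //.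
    have h3 := an_at_continuous h1 eps0; rewrite h2 in h3.
    apply: filterS2 h3 hk => y hy /(_ _ hy)[h _].
    exists (count (fun f => f y == nth (fun=> 0) es i y) es) => //.
    by rewrite -has_count; apply/(has_nthP (fun=> 0)); exists i.
  by apply: filterS (near_forall hg) => k h i hi; exact: (h (Ordinal hi)).
Qed.

(** Spectral values close to E0 are values of the finite list, so [pigeonhole_germ] upgrades
    agreement of values to agreement of germs. This is stated at all k near k0 because continuation
    only approaches k0. *)
Lemma near_branch k0 E0 : E0 != 0 -> exists (es : seq (R -> R)) (eps : R), [/\ 0 < eps,
    forall i, (i < size es)%N -> nth (fun=> 0) es i k0 = E0,
    D k0 E0 (size es),
    \forall k \near k0, forall i, (i < size es)%N -> good_at D (nth (fun=> 0) es i) k &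
    \forall k \near k0,
      (forall E, `|E - E0| < eps -> D k E (count (fun f => f k == E) es)) /\
      forall f, good_at D f k -> `|f k - E0| < eps ->
      exists2 i, (i < size es)%N & \forall y \near k, nth (fun=> 0) es i y = f y].
Proof.
move=> E0n; have [es [eps [eps0 he hD hg hk]]] := local_good k0 E0n.
exists es, eps; split=> //.
apply: filterS2 hg (near_join hk) => k hgk hkk.
split=> [E /(nbhs_singleton hkk)[]//|f [f1 f2 f3] fE].
apply: pigeonhole_germ => //; first by move=> i hi; have [] := hgk i hi.
have h1 : \forall y \near k, `|f y - E0| < eps.
  have := an_at_continuous f1 (e := eps - `|f k - E0|); rewrite subr_gt0 => /(_ fE).
  apply: filterS => y; rewrite ltrBrDl; apply: le_lt_trans.
  by rewrite (_ : f y - E0 = (f k - E0) + (f y - f k)) ?ler_normD // [RHS]addrC addrA subrK.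
apply: filterS3 h1 hkk f3 => y hy /(_ _ hy)[h _] [n n0 hn].
by rewrite (Dfun h hn).
Qed.

Lemma good_at_lipschitz f x : good_at D f x ->
  \forall y \near x, `|f y - f x| <= L * `|f x| * `|y - x|.
Proof.
move=> [f1 f2 f3]; have [es [eps [eps0 he hD hg hk]]] := local_good x f2.
apply: filterS3 (an_at_continuous f1 eps0) hk f3 => y hy /(_ _ hy)[h h'] [n n0 hn].
by apply: h'; rewrite (Dfun h hn).
Qed.

(** The local Lipschitz bound gives |f'| <= L |f|, so f^2 exp(2 L x) is nondecreasing and f^2 exp(-2
    L x) nonincreasing. *)
Lemma good_gronwall f a b : a <= b -> (forall x, a <= x <= b -> good_at D f x) ->
  (f a ^+ 2 * expR (- (2 * L) * (b - a)) <= f b ^+ 2) /\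
  (f b ^+ 2 <= f a ^+ 2 * expR ((2 * L) * (b - a))).
Proof.
move=> ab hf.
have der x : a <= x <= b -> exists2 d, is_derive x 1 f d & `|d| <= L * `|f x|.
  move=> hx; have hg := hf x hx; have [h1 _ _] := hg; have [d hd hb] := an_at_derivable h1.
  by exists d => //; apply: hb; exact: good_at_lipschitz.
have key (c : R) x : a <= x <= b -> exists2 d, is_derive x 1 (fun y => f y ^+ 2 * expR (c * y)) d &
    exists2 e, `|e| <= L * `|f x| & d = (2 * f x * e + c * f x ^+ 2) * expR (c * x).
  move=> hx; have [e h1 h2] := der x hx; eexists; last by exists e => //; reflexivity.
  have h3 : is_derive x 1 (fun y => expR (c * y)) (c * expR (c * x)).
    have hc : is_derive x 1 (c \*: (id : R -> R)) (c *: 1) by apply: is_deriveZ.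
    have := is_derive1_comp (is_derive_expR (c * x)) hc.
    by rewrite -[c *: 1]/(c * 1) mulr1 [_ * c]mulrC.
  have := is_deriveM (is_deriveM h1 h1) h3; rewrite -[_ * (fun y => _)]/(fun y => f y * f y * expR (c * y)).
  have -> : (fun y => f y * f y * expR (c * y)) = (fun y => f y ^+ 2 * expR (c * y)).
    by apply/funext => y; rewrite expr2.
  set d1 := (X in is_derive _ _ _ X).
  suff -> : (2 * f x * e + c * f x ^+ 2) * expR (c * x) = d1 by [].
  rewrite /d1 -[_ *: _]/(_ * _) -[expR _ *: _]/(_ * _) -![f x *: _]/(_ * _).
  rewrite -[(f * f) x]/(f x * f x); ring.
have cont c : {within `[a, b], continuous (fun y => f y ^+ 2 * expR (c * y))}.
  apply: derivable_within_continuous => x /itvP xab.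
  by have [|d [? _] _] := key c x; rewrite ?xab.
(* The sign s treats both monotonicity statements at once. *)
have mono c (s : R) : (s == 1) || (s == -1) -> 2 * L = s * c ->
    0 <= s * (f b ^+ 2 * expR (c * b) - f a ^+ 2 * expR (c * a)).
  move=> s1 cL; move: ab; rewrite le_eqVlt => /predU1P[->|lab]; first by rewrite subrr mulr0.
  pose df x := derive1 (fun y => f y ^+ 2 * expR (c * y)) x.
  have [|x /itvP xab ->] := MVT lab (df := df) _ (cont c).
    move=> x /itvP xab; have [|d hd _] := key c x; first by rewrite !ltW ?xab.
    by rewrite /df derive1E; case: (hd) => h _; exact/derivableP.
  have [|d hd [e he de]] := key c x; first by rewrite !ltW ?xab.
  have -> : df x = d by rewrite /df derive1E; case: hd.
  rewrite mulrA mulr_ge0 ?subr_ge0 ?(ltW lab) // de mulrA mulr_ge0 ?expR_ge0 //.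
  have -> : s * (2 * f x * e + c * f x ^+ 2) = 2 * (s * (f x * e) + L * f x ^+ 2).
    by rewrite [RHS]mulrDr [2 * (L * _)]mulrA cL; ring.
  rewrite mulr_ge0 // -lerBlDr sub0r.
  have h1 : `|f x * e| <= L * f x ^+ 2.
    by rewrite normrM mulrC -[f x ^+ 2]real_normK ?num_real // expr2 mulrA ler_wpM2r.
  have h2 : `|s * (f x * e)| = `|f x * e|.
    by case/orP: s1 => /eqP ->; rewrite normrM ?normrN normr1 mul1r.
  by rewrite lerNl; apply: le_trans h1; rewrite -h2 -normrN ler_norm.
have := mono (2 * L) 1; rewrite eqxx mul1r => /(_ isT erefl); rewrite mul1r subr_ge0 => h1.
have := mono (- (2 * L)) (-1); rewrite eqxx orbT mulN1r opprK => /(_ isT erefl).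
rewrite mulN1r oppr_ge0 subr_le0 => h2; split.
  have -> : - (2 * L) * (b - a) = 2 * L * a - 2 * L * b by ring.
  by rewrite expRD expRN mulrA ler_pdivrMr ?expR_gt0.
have -> : 2 * L * (b - a) = - (2 * L) * a - - (2 * L) * b by ring.
by rewrite expRD [expR (- (- _ * b))]expRN mulrA ler_pdivlMr ?expR_gt0.
Qed.

Lemma good_unique f g a b : a <= b -> (forall x, a <= x <= b -> good_at D f x) ->
  (forall x, a <= x <= b -> good_at D g x) -> (\forall x \near a, f x = g x) ->
  \forall x \near b, f x = g x.
Proof.
move=> ab hf hg; apply: (an_at_identity ab _).1 => x xab.
by have [? _ _] := hf x xab; have [? _ _] := hg x xab.
Qed.

(** Let s be the supremum of the points that can be reached. By Gronwall the squares of the end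
    values stay between positive bounds, so the end values cluster at some E != 0 as c tends to s.
    The local branches through (s, E) live on both sides of s, and by [near_branch] one of them
    carries an extension past s, a contradiction. *)
Lemma good_extend f0 a b : good_at D f0 a -> a <= b ->
  exists2 f, (forall x, a <= x <= b -> good_at D f x) & \forall x \near a, f x = f0 x.
Proof.
move=> g0 ab; pose P b := a <= b /\
  exists2 f, (forall x, a <= x <= b -> good_at D f x) & \forall x \near a, f x = f0 x.
suff: forall b, a <= b -> P b by move=> /(_ b ab)[].
have Pdown c d : a <= c -> c <= d -> P d -> P c.
  move=> ac cd [_ [f fg f0e]]; split=> //; exists f => // x /andP[ax xc].
  by apply: fg; rewrite ax (le_trans xc).
have Pa : P a.
  by split=> //; exists f0; [move=> x /andP[ax xa]; have -> : x = a by lra|exact: filterE].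
move=> {b ab} b ab; apply: contrapT => nPb.
have ubS c : P c -> c <= b.
  move=> Pc; rewrite leNgt; apply/negP => bc; apply: nPb; apply: Pdown Pc => //; exact: ltW.
pose S := [set c | P c].
have hS : has_sup S by split; [exists a|exists b => c /ubS].
pose s := sup S.
have as_ : a <= s by apply: ub_le_sup => //; case: hS.
have Slt c : a <= c -> c < s -> P c.
  move=> ac cs; have [|d Sd dlt] := @sup_adherent _ S (s - c) _ hS; first by rewrite subr_gt0.
  by apply: Pdown Sd => //; move: dlt; rewrite -/s; lra.
have sa : a < s.
  have /nbhs_ballP[e /= e0 he] := good_at_near g0.
  have Pe : P (a + e / 2).
    split; first by rewrite lerDl divr_ge0 // ltW.
    exists f0; last exact: filterE.
    move=> x /andP[ax xe]; apply: he; rewrite /ball /= distrC ger0_norm ?subr_ge0 //.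
    by rewrite ltrBlDl; apply: le_lt_trans xe _; rewrite ltrD2l ltr_pdivrMr // ltr_pMr ?ltr1n.
  have : a + e / 2 <= s by apply: ub_le_sup => //; case: hS.
  by apply: lt_le_trans; rewrite ltrDl divr_gt0.
have [F hF] : exists F : R -> R -> R, forall c, a <= c < s ->
    (forall x, a <= x <= c -> good_at D (F c) x) /\ \forall x \near a, F c x = f0 x.
  have hex c : exists f, a <= c < s -> (forall x, a <= x <= c -> good_at D f x) /\
      \forall x \near a, f x = f0 x.
    have [/andP[ac cs]|_] := boolP (a <= c < s); last by exists f0.
    by have [_ [f h1 h2]] := Slt c ac cs; exists f.
  by exists (fun c => projT1 (cid (hex c))) => c; exact: projT2 (cid (hex c)).
have Fa c : a <= c < s -> F c a = f0 a by move=> /hF[_ /nbhs_singleton].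
(* Each c < s has its own extension, of which only the end value is recorded. The bounds [m] and [M]
   are those of Gronwall over the full length s - a. *)
pose g c := F c c; pose K := 2 * `|L| * (s - a).
pose M := f0 a ^+ 2 * expR K; pose m := f0 a ^+ 2 * expR (- K).
have m0 : 0 < m by rewrite mulr_gt0 ?expR_gt0 // exprn_even_gt0 //=; case: g0.
have M0 : 0 < M by rewrite mulr_gt0 ?expR_gt0 // exprn_even_gt0 //=; case: g0.
have gb c : a <= c < s -> m <= g c ^+ 2 <= M.
  move=> acs; have /andP[ac cs] := acs; have [Fg _] := hF c acs.
  have [h1 h2] := good_gronwall ac Fg; rewrite (Fa c acs) in h1 h2.
  have Kle : `|2 * L * (c - a)| <= K.
    rewrite !normrM [`|2|]ger0_norm // (ger0_norm (x := c - a)) ?subr_ge0 //.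
    by rewrite ler_wpM2l ?mulr_ge0 // lerD2r ltW.
  move: Kle; rewrite ler_norml => /andP[K1 K2].
  apply/andP; split; [apply: le_trans h1|apply: (le_trans h2)]; rewrite ler_wpM2l ?sqr_ge0 // ler_expR //.
  by rewrite mulNr lerN2.
have nl : \forall c \near s^'-, a <= c < s.
  near=> c; apply/andP; split; [apply: ltW|]; near: c.
    exact: nbhs_left_gt.
  exact: nbhs_left_lt.
have gK : (g @ s^'-) [set` `[- (M + 1), M + 1]%R].
  apply: filterS nl => c /gb /andP[_ h]; rewrite /= in_itv /= -ler_norml.
  have M1 : 0 <= M + 1 by rewrite addr_ge0 // ltW.
  rewrite -ler_sqr ?nnegrE // real_normK ?num_real //; apply: (le_trans h).
  by clear -M0; move: M M0 => M M0; nra.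
have [E [_ clE]] := segment_compact (fmap_proper_filter g (at_left_proper_filter s)) gK.
have E0 : E != 0.
  apply/eqP => E0; have : nbhs E (fun y : R => y ^+ 2 < m).
    have nb : \forall y \near (0 : R), `|y| < Num.min m 1.
      apply/nbhs_ballP; exists (Num.min m 1) => [|y]; first by rewrite /= lt_min m0 ltr01.
      by rewrite /ball /= sub0r normrN lt_min.
    rewrite E0; apply: filterS nb => y; rewrite lt_min => /andP[ym y1].
    rewrite -real_normK ?num_real // expr2; apply: le_lt_trans ym.
    by rewrite ler_piMl // ltW.
  have : (g @ s^'-) (fun y : R => m <= y ^+ 2) by apply: filterS nl => c /gb /andP[].
  by move=> /clE h /h [y [/= h1 h2]]; have := le_lt_trans h1 h2; rewrite ltxx.
have [es [eps [eps0 he hD hg hk]]] := near_branch s E0.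
have hgk : \forall k \near s, (forall i, (i < size es)%N -> good_at D (nth (fun=> 0) es i) k) /\
    (forall f, good_at D f k -> `|f k - E| < eps ->
      exists2 i, (i < size es)%N & \forall y \near k, nth (fun=> 0) es i y = f y).
  by apply: filterS2 hg hk => k h1 [_ h2].
have /nbhs_ballP[e /= e0 hge] := hgk.
have [y [[c [acs cse ->]] /= cE]] : (fun y : R => exists c, [/\ a <= c < s, s - c < e & y = g c]) `&`
    (fun y : R => `|y - E| < eps) !=set0.
  apply: clE.
    have nl2 : \forall c \near s^'-, s - e < c by apply: nbhs_left_gt; rewrite ltrBlDr ltrDl.
    by apply: filterS2 nl nl2 => c h1 h2; exists c; split=> //; rewrite ltrBlDr addrC -ltrBlDr.
  by apply/nbhs_ballP; exists eps => // y; rewrite /ball /= distrC.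
have /andP[ac cs] := acs.
have [Fg Fe] := hF c acs.
have [|_ hkc] := hge c; first by rewrite /ball /= gtr0_norm ?subr_gt0.
have [|i hi ei] := hkc (F c) _ cE; first by apply: Fg; rewrite ac lexx.
(* The two pieces are glued at c, where their germs coincide. *)
pose G x := if x < c then F c x else nth (fun=> 0) es i x.
have GF x : x < c -> \forall y \near x, F c y = G y.
  by move=> xc; apply: filterS (lt_nbhsl xc) => z zc; rewrite /G zc.
have Ge x : c < x -> \forall y \near x, nth (fun=> 0) es i y = G y.
  by move=> xc; apply: filterS (lt_nbhsr xc) => z zc; rewrite /G ltNge (ltW zc).
have Gc : \forall y \near c, F c y = G y.
  by apply: filterS ei => z ez; rewrite /G; case: ifP.
have Gg x : a <= x <= s + e / 2 -> good_at D G x.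
  move=> /andP[ax xs]; have [xc|xc|->] := ltgtP x c.
  - by apply: good_at_ext (GF x xc) _; apply: Fg; rewrite ax ltW.
  - apply: good_at_ext (Ge x xc) _; have [|h _] := hge x; last exact: h.
    rewrite /ball /= ltr_norml; have : e / 2 < e by rewrite ltr_pdivrMr // ltr_pMr ?ltr1n.
    move: xs xc cs cse; lra.
  - by apply: good_at_ext Gc _; apply: Fg; rewrite ac lexx.
have : P (s + e / 2).
  split; first by rewrite (le_trans as_) // lerDl divr_ge0 // ltW.
  exists G => //; have : \forall x \near a, F c x = G x.
    by move: ac; rewrite le_eqVlt => /predU1P[->|/GF].
  by move=> h; apply: filterS2 h Fe => x <-.
move=> Ps; have : s + e / 2 <= s by apply: ub_le_sup => //; case: hS.
by rewrite gerDl pmulr_lle0 // leNgt e0.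
Unshelve. all: by end_near.
Qed.

(** Extensions to different end points agree by uniqueness, so the diagonal F x x is coherent; near
    x it is compared with the single extension up to x + 1. *)
Lemma good_extend_right f0 a : good_at D f0 a ->
  exists2 f, (forall x, a < x -> good_at D f x) & \forall x \near a, a <= x -> f x = f0 x.
Proof.
move=> g0.
have hex c : exists f, a <= c -> (forall x, a <= x <= c -> good_at D f x) /\
    \forall x \near a, f x = f0 x.
  have [ac|_] := boolP (a <= c); last by exists f0.
  by have [f h1 h2] := good_extend g0 ac; exists f.
pose F c := projT1 (cid (hex c)).
have hF c : a <= c -> (forall x, a <= x <= c -> good_at D (F c) x) /\
    \forall x \near a, F c x = f0 x := projT2 (cid (hex c)).
have Fe c d : a <= c -> c <= d -> F c c = F d c.
  move=> ac cd; have [F1 F2] := hF c ac; have [F3 F4] := hF d (le_trans ac cd).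
  apply: nbhs_singleton (good_unique ac F1 _ _).
    by move=> x /andP[ax xc]; apply: F3; rewrite ax (le_trans xc).
  by apply: filterS2 F2 F4 => x -> ->.
exists (fun x => F x x).
  move=> x ax; have ax1 : a <= x + 1 by rewrite (le_trans (ltW ax)) ?lerDl.
  apply: (@good_at_ext _ (F (x + 1))); last first.
    by apply: (hF _ ax1).1; rewrite (ltW ax) lerDl ler01.
  have h1 := lt_nbhsr ax; have h2 : \forall y \near x, y < x + 1 by apply: lt_nbhsl; rewrite ltrDl.
  by apply: filterS2 h1 h2 => y ay yx; rewrite (Fe y (x + 1)) // ltW.
have a1 : a <= a + 1 by rewrite lerDl.
have h2 : \forall y \near a, y < a + 1 by apply: lt_nbhsl; rewrite ltrDl.
by apply: filterS2 h2 (hF _ a1).2 => y ya e ay; rewrite (Fe y (a + 1)) // ltW.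
Qed.
End Fixed.

(** Reflection reduces continuation to the left to continuation to the right. *)
Lemma good_at_opp D f x : good_at D f (- x) ->
  good_at (fun k => D (- k)) (fun y => f (- y)) x.
Proof.
move=> [h1 h2 h3]; split=> //; first exact: an_at_opp.
exact: near_opp h3.
Qed.

Lemma locally_analytic_spectrum_opp L D : locally_analytic_spectrum L D ->
  locally_analytic_spectrum L (fun k => D (- k)).
Proof.
move=> h k0 E0 E0n; have [es [eps [eps0 he hk]]] := h (- k0) E0 E0n.
have nE i : (i < size es)%N -> nth (fun=> 0) [seq (fun k => f (- k)) | f : R -> R <- es] i =
    fun k => nth (fun=> 0) es i (- k) by move=> hi; rewrite (nth_map (fun=> 0)).
exists [seq (fun k => f (- k)) | f : R -> R <- es], eps; rewrite size_map; split=> //.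
  by move=> i hi; have [h1 h2] := he i hi; rewrite nE //; split=> //; exact: an_at_opp.
have := near_opp hk; apply: filterS => k hk' E hE.
rewrite count_map; have [h1 h2] := hk' E hE; split=> //.
by move=> /h2; rewrite -opprD normrN.
Qed.

Lemma branch_extend L D f0 a : (forall k E n m, D k E n -> D k E m -> n = m) ->
  locally_analytic_spectrum L D -> good_at D f0 a ->
  exists2 f, branch D f & \forall x \near a, f x = f0 x.
Proof.
move=> Dfun Dloc g0.
have [fr fr1 fr2] := good_extend_right Dfun Dloc g0.
have g0' : good_at (fun k => D (- k)) (fun y => f0 (- y)) (- a).
  by apply: good_at_opp; rewrite opprK.
have [fl fl1 fl2] := good_extend_right (fun k => @Dfun (- k)) (locally_analytic_spectrum_opp Dloc) g0'.
pose f x := if a <= x then fr x else fl (- x).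
have fa : \forall x \near a, f x = f0 x.
  have fl3 := near_opp fl2.
  apply: filterS2 fr2 fl3 => x h1 h2; rewrite /f.
  case: leP => [/h1//|xa]; rewrite h2 ?opprK // lerN2; exact: ltW.
exists f => // x.
have [xa|ax|->] := ltgtP x a.
- have nb : \forall y \near x, fl (- y) = f y.
    by apply: filterS (lt_nbhsl xa) => y ya; rewrite /f leNgt ya.
  apply: good_at_ext nb _; have := @good_at_opp (fun k => D (- k)) fl x.
  have -> : (fun k => D (- - k)) = D by apply/funext => k; rewrite opprK.
  by apply; apply: fl1; rewrite ltrN2.
- have nb : \forall y \near x, fr y = f y.
    by apply: filterS (lt_nbhsr ax) => y ya; rewrite /f ltW.
  by apply: good_at_ext nb _; exact: fr1.
- by apply: good_at_ext g0; apply: filterS fa => y ->.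
Qed.
End Continuation.

(** * Enumeration of the branches *)

Section BranchEnumeration.
Variables (R : realType) (D : R -> R -> nat -> Prop) (L : R).
Hypothesis Dfun : forall k E n m, D k E n -> D k E m -> n = m.
Hypothesis Dloc : locally_analytic_spectrum L D.
Implicit Types (f g : R -> R).

Lemma branch_unique f g a : branch D f -> branch D g -> (\forall x \near (a : R), f x = g x) -> f = g.
Proof.
move=> bf bg e; apply/funext => x; apply: (@nbhs_singleton _ x (fun x => f x = g x)).
have [ax|/ltW xa] := leP a x.
  by apply: (good_unique ax (fun y _ => bf y) (fun y _ => bg y)).
have h : (\forall y \near x, f y = g y) <-> (\forall y \near a, f y = g y).
  by apply: an_at_identity xa _ => y _; have [? _ _] := bf y; have [? _ _] := bg y.
exact/h.
Qed.

(** Analytic functions with different germs at x differ off x near x, so counting equal values there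
    is counting equal germs. *)
Lemma germ_count (es : seq (R -> R)) f x :
  (forall i, (i < size es)%N -> an_at (nth (fun=> 0) es i) x) -> an_at f x ->
  \forall y \near x^', count (fun e : R -> R => e y == f y) es =
    count (fun e : R -> R => `[< \forall z \near x, e z = f z >]) es.
Proof.
elim: es => [|e es IH] he hf; first by apply: near_dnbhsW; exact: filterE.
have h1 : \forall y \near x^', (e y == f y) = `[< \forall z \near x, e z = f z >].
  have [h|h] := an_at_cases (he 0%N isT) hf.
    by apply: near_dnbhsW; apply: filterS (h) => y ey; rewrite [e y]ey eqxx; apply/esym/asboolT.
  apply: filterS (h) => y hy; rewrite (negbTE hy); apply/esym/asboolF => h'.
  by have [z [/eqP]] := dnbhs_ex2 h (near_dnbhsW h').
have h2 := IH (fun i => he i.+1) hf.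
by apply: filterS2 h1 h2 => y /= -> ->.
Qed.

(** By [germ_count] the multiplicity of f y is constant off x near x. The punctured neighbourhoods
    of nearby points overlap, so the constant does not depend on x. *)
Lemma branch_multiplicity f : branch D f -> exists r, forall x, \forall y \near x^', D y (f y) r.
Proof.
move=> bf.
have loc x : exists r, \forall y \near x^', D y (f y) r.
  have [f1 f2 f3] := bf x.
  have [es [eps [eps0 he hD hg hk]]] := local_good Dloc x f2.
  have hc := @germ_count es f x _ f1.
  exists (count (fun e : R -> R => `[< \forall z \near x, e z = f z >]) es).
  have h1 : \forall y \near x^', D y (f y) (count (fun e : R -> R => e y == f y) es).
    apply: near_dnbhsW.
    by apply: filterS2 (an_at_continuous f1 eps0) hk => y hy /(_ _ hy)[].
  apply: filterS2 h1 (hc _) => [y hy <-//|i hi].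
  by have [] := nbhs_singleton hg i hi.
have [r hr] := loc 0; exists r.
suff iff a b : a <= b -> (\forall y \near a^', D y (f y) r) <-> (\forall y \near b^', D y (f y) r).
  move=> x; have [x0|/ltW x0] := leP 0 x; first exact: (iff _ _ x0).1.
  exact: (iff _ _ x0).2.
move=> ab; apply: (locally_constant (Q := fun x => \forall y \near x^', D y (f y) r) ab) => x _.
have [r0 hr0] := loc x.
have hr0' : \forall y \near x, y != x -> D y (f y) r0 := hr0.
apply: filterS (near_join hr0') => z hz _.
have [->//|zx] := eqVneq z x.
have hz0 : \forall y \near z^', D y (f y) r0.
  apply: near_dnbhsW; have nb : \forall y \near z, y != x.
    apply: (@open_nbhs_nbhs _ (z : R^o) [set y | y != x]); split=> //; exact: open_neq.
  by apply: filterS2 hz nb => y h yx; exact: h.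
by split=> h; [have [y [h1 h2]] := dnbhs_ex2 h hz0|have [y [h1 h2]] := dnbhs_ex2 h hr0];
  rewrite (Dfun h1 h2).
Qed.

(** [fs] consists of the global continuations of the local branches through (k, E), repeated as
    often as their germs occur. Off k, near k, the value of a branch f is shared exactly by the
    copies of its germ, so f is repeated according to its generic multiplicity. *)
Lemma branch_list k E n : E != 0 -> D k E n -> exists fs : seq (R -> R),
  [/\ size fs = n, forall f, f \in fs <-> branch D f /\ f k = E &
    forall f r, f \in fs -> (forall x, \forall y \near x^', D y (f y) r) -> count_mem f fs = r].
Proof.
move=> E0 hn; have [es [eps [eps0 he hD hg hk]]] := near_branch Dfun Dloc k E0.
rewrite (Dfun hn hD) {n hn}.
have hg1 := nbhs_singleton hg.
have hex i : exists f, (i < size es)%N -> branch D f /\ \forall x \near k, f x = nth (fun=> 0) es i x.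
  have [hi|_] := boolP (i < size es)%N; last by exists (fun=> 0).
  by have [f h1 h2] := branch_extend Dfun Dloc (hg1 i hi); exists f.
pose F i := projT1 (cid (hex i)).
have hF i : (i < size es)%N -> branch D (F i) /\ \forall x \near k, F i x = nth (fun=> 0) es i x
  := projT2 (cid (hex i)).
have Fk i : (i < size es)%N -> F i k = E.
  by move=> hi; rewrite (nbhs_singleton (hF i hi).2) he.
exists [seq F i | i <- iota 0 (size es)].
have mem f : f \in [seq F i | i <- iota 0 (size es)] <-> branch D f /\ f k = E.
  split=> [hf|[bf fk]].
    have [i hi ->] := elimT (@seq.mapP nat _ F (iota 0 (size es)) f) hf.
    by move: hi; rewrite mem_iota /= add0n => hi; split; [exact: (hF i hi).1|exact: Fk].
  have [|i hi e] := (nbhs_singleton hk).2 f (bf k); first by rewrite fk subrr normr0.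
  apply/seq.mapP; exists i; first by rewrite mem_iota.
  apply: (@branch_unique f (F i) k bf (hF i hi).1).
  by apply: filterS2 e (hF i hi).2 => x -> ->.
split=> // [|f r /mem[bf fk] hr]; first by rewrite size_map size_iota.
have [f1 f2 f3] := bf k.
have an_es i : (i < size es)%N -> an_at (nth (fun=> 0) es i) k by move=> /hg1[].
have h1 : \forall y \near k^', D y (f y) (count (fun e : R -> R => e y == f y) es).
  apply: near_dnbhsW; have := an_at_continuous f1 eps0; rewrite fk => h.
  by apply: filterS2 h hk => y hy [/(_ _ hy)].
have h2 : \forall y \near k^', count (fun e : R -> R => e y == f y) es = r.
  by apply: filterS2 h1 (hr k) => y; exact: Dfun.
have [y [hy ce]] := dnbhs_ex2 h2 (germ_count an_es f1).
rewrite -hy ce count_map -[in RHS](mkseq_nth (fun=> 0) es) count_map; apply: eq_in_count => i.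
rewrite mem_iota /= add0n => hi; apply/eqP/asboolP => [<-|e].
  by apply: filterS (hF i hi).2 => x ->.
apply: (@branch_unique _ _ k (hF i hi).1 bf).
by apply: filterS2 e (hF i hi).2 => x <- ->.
Qed.

(** At k = 0 a nonzero eigenvalue is isolated, so a rational slightly above f 0 determines f 0; the
    position of the germ of f in the local list then determines f. *)
Lemma branch_code : exists code : (R -> R) -> nat, forall f g, branch D f -> branch D g ->
  code f = code g -> f = g.
Proof.
have hex E : exists d : seq (R -> R) * R, E != 0 -> [/\ 0 < d.2,
    forall E', E' != E -> `|E' - E| < d.2 -> ~ in_spectrum D 0 E' &
    forall f, branch D f -> f 0 = E ->
      exists2 i, (i < size d.1)%N & \forall y \near (0 : R), nth (fun=> 0) d.1 i y = f y].
  have [->|E0] := eqVneq E 0; first by exists ([::], 0).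
  have [es [eps [eps0 he hD hg hk]]] := near_branch Dfun Dloc 0 E0.
  exists (es, eps) => _; have [h1 h2] := nbhs_singleton hk; split=> //= [E' E'E hE' [n n0 hn]|f bf f0].
    have := Dfun hn (h1 _ hE'); rewrite (_ : count _ _ = 0%N); first by move=> nn; rewrite nn in n0.
    apply/eqP; rewrite -leqn0 leqNgt -has_count; apply/negP => /(has_nthP (fun=> 0))[i hi].
    by rewrite he // eq_sym (negbTE E'E).
  by apply: h2; rewrite ?f0 ?subrr ?normr0.
pose d E := projT1 (cid (hex E)).
have hd E : E != 0 -> _ := projT2 (cid (hex E)).
have hcode f : exists c : rat * nat, branch D f ->
    f 0 < ratr c.1 < f 0 + (d (f 0)).2 /\
    \forall y \near (0 : R), nth (fun=> 0) (d (f 0)).1 c.2 y = f y.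
  have [bf|nbf] := pselect (branch D f); last by exists (0, 0%N).
  have f0 : f 0 != 0 by case: (bf 0).
  have [e0 _ /(_ f bf erefl)[i hi ei]] := hd _ f0.
  have [|q] := @rat_in_itvoo R (f 0) (f 0 + (d (f 0)).2); first by rewrite ltrDl.
  by rewrite in_itv /= => hq; exists (q, i).
exists (fun f => pickle (projT1 (cid (hcode f)))) => f g bf bg /(pcan_inj pickleK).
have [fq fi] := projT2 (cid (hcode f)) bf; have [gq gi] := projT2 (cid (hcode g)) bg.
move=> e; rewrite -{}e in gq gi; move: (projT1 _) fq fi gq gi => c fq fi gq gi.
have spec h : branch D h -> in_spectrum D 0 (h 0) by move=> /(_ 0)[_ _ /nbhs_singleton].
have sep h h' : branch D h -> branch D h' -> h 0 < h' 0 -> h' 0 < h 0 + (d (h 0)).2 -> False.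
  move=> bh bh' lt1 lt2; have h0 : h 0 != 0 by case: (bh 0).
  have [_ /(_ (h' 0)) sp _] := hd _ h0; apply: sp (spec _ bh'); first by rewrite gt_eqF.
  by rewrite gtr0_norm ?subr_gt0 // ltrBlDl.
have e : f 0 = g 0.
  move: fq gq => /andP[f1 f2] /andP[g1 g2].
  have [lt|lt|//] := ltgtP (f 0) (g 0); first by case: (sep f g) => //; exact: lt_trans f2.
  by case: (sep g f) => //; exact: lt_trans g2.
rewrite e in fi; apply: (@branch_unique _ _ 0 bf bg).
by apply: filterS2 fi gi => x <- <-.
Qed.

(** A branch f of generic multiplicity 2q is entered q times, under the indices (code f, a) with a <
    q. The entries through (k, E) are then half as many as the elements of [branch_list]. *)
Lemma branch_enumeration : (forall k E n, E != 0 -> D k E n -> ~~ odd n) ->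
  exists (J : set nat) (F : nat -> R -> R), [/\ forall j, J j -> branch D (F j),
    forall f, branch D f -> exists2 j, J j & F j = f &
    forall k E n, E != 0 -> D k E n.*2 -> exists s : seq nat,
      [/\ uniq s, size s = n & forall j, j \in s <-> J j /\ F j k = E]].
Proof.
move=> Deven.
have [code code_inj] := branch_code.
have hq f : exists q, branch D f -> (0 < q)%N /\ forall x, \forall y \near x^', D y (f y) q.*2.
  have [bf|nbf] := pselect (branch D f); last by exists 0%N.
  have [r hr] := branch_multiplicity bf; exists r./2 => _.
  have sp : \forall y \near (0 : R)^', in_spectrum D y (f y) /\ f y != 0.
    by apply: near_dnbhsW; apply: filterE => y; have [_ ? /nbhs_singleton] := bf y.
  have [y [[[n n0 h1] fy] h2]] := dnbhs_ex2 sp (hr 0).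
  have re := Deven _ _ _ fy h2; have e2 : r = r./2.*2 by rewrite -[LHS]odd_double_half (negbTE re).
  by split; [rewrite -double_gt0 -e2 -(Dfun h1 h2)|rewrite -e2].
pose q f := projT1 (cid (hq f)); have qP f : branch D f -> _ := projT2 (cid (hq f)).
pose entry f a j := [/\ branch D f, (a < q f)%N & j = pickle (code f, a)].
have entry_inj f a g b j : entry f a j -> entry g b j -> f = g.
  by case=> bf _ -> [bg _ /(pcan_inj pickleK)[/(code_inj _ _ bf bg)]].
have hF j : exists f, forall g a, entry g a j -> f = g.
  have [[f [a fa]]|n] := pselect (exists f a, entry f a j).
    by exists f => g b; apply: entry_inj fa.
  by exists (fun=> 0) => g a ga; case: n; exists g, a.
pose F j := projT1 (cid (hF j)); have FE j f a : entry f a j -> F j = f.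
  exact: (projT2 (cid (hF j)) f a).
exists [set j | exists f a, entry f a j], F; split.
- by move=> j [f [a fa]]; rewrite (FE _ _ _ fa); case: fa.
- move=> f bf; have fa : entry f 0%N (pickle (code f, 0%N)) by split=> //; case: (qP f bf).
  by exists (pickle (code f, 0%N)); [exists f, 0%N|exact: FE fa].
move=> k E n E0 hn; have [fs [szs mem cnt]] := branch_list E0 hn.
exists [seq pickle (code f, a) | f <- undup fs, a <- iota 0 (q f)]; split.
- apply: allpairs_uniq_dep; [exact: undup_uniq|by move=> f _; exact: iota_uniq|].
  move=> [f a] [g b] /= /allpairsPdep[f' [a' [f1 a1 [-> ->]]]] /allpairsPdep[g' [b' [g1 b1 [-> ->]]]].
  move: f1 g1; rewrite !mem_undup => /mem[bf _] /mem[bg _].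
  by move=> /(pcan_inj pickleK)[/(code_inj _ _ bf bg) -> ->].
(* Grouping [fs] by distinct branches expresses its length as the sum of their generic
   multiplicities. *)
- have : size (flatten [seq nseq (count_mem f fs) f | f <- undup fs]) = n.*2.
    by rewrite (perm_size (perm_count_undup fs)).
  rewrite size_flatten /shape -map_comp size_allpairs_dep => h; apply: double_inj; rewrite -h.
  have : {subset undup fs <= fs} by move=> f; rewrite mem_undup.
  elim: (undup fs) => //= f gs IH sub; rewrite doubleD IH; last first.
    by move=> g hg; apply: sub; rewrite inE hg orbT.
  congr (_ + _)%N; rewrite size_nseq size_iota.
  have ff : f \in fs by apply: sub; rewrite inE eqxx.
  by rewrite (cnt f (q f).*2) //; case: (qP f ((mem f).1 ff).1).
move=> j; split=> [/allpairsPdep[f [a [h1 h2 ->]]]|[[f [a fa]]]].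
  move: h1 h2; rewrite mem_undup mem_iota add0n /= => /mem[bf fk] aq.
  have fa : entry f a (pickle (code f, a)) by [].
  by split; [exists f, a|rewrite (FE _ _ _ fa)].
rewrite (FE _ _ _ fa) => fk; have [bf aq ->] := fa; apply/allpairsPdep; exists f, a.
by rewrite mem_undup mem_iota add0n; split=> //; exact/mem.
Qed.
End BranchEnumeration.

(** * The modulus of the Gamma function on vertical lines *)

Section ImproperIntegral.
Variable R : realType.
Implicit Types f F : R -> R.
Notation mu := (@lebesgue_measure R).
Notation D := (`]0%R, +oo[%classic : set (measurableTypeR R)).

(** Both ends are cut, since integrands may blow up at 0. The shift [n.+2] keeps the interval
    nondegenerate for n = 0. *)
Definition exhaust (n : nat) : set R := `[(n.+2%:R)^-1, n.+2%:R]%classic.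

Lemma exhaust_lt n : (n.+2%:R)^-1 < n.+2%:R :> R.
Proof. by apply: (@lt_trans _ _ 1); rewrite ?invf_lt1 ?ltr0n // ltr1n. Qed.

Lemma exhaust_gt0 n : 0 < (n.+2%:R)^-1 :> R. Proof. by rewrite invr_gt0 ltr0n. Qed.

Lemma exhaust_sub n : exhaust n `<=` D.
Proof.
move=> x; rewrite /exhaust /= !in_itv /= andbT => /andP[h _].
exact: lt_le_trans (exhaust_gt0 n) h.
Qed.

Lemma exhaust_near x : D x -> \forall n \near \oo, exhaust n x.
Proof.
rewrite /= in_itv /= andbT => x0.
exists (maxn (Num.truncn x) (Num.truncn x^-1)) => // n; rewrite /= geq_max => /andP[h1 h2].
rewrite /exhaust /= in_itv /=; apply/andP; split.
  rewrite -[x]invrK lef_pV2 ?posrE ?invr_gt0 ?ltr0n //; apply/ltW.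
  apply: (lt_le_trans (truncnS_gt _)); rewrite ler_nat; exact: leq_trans h2 _.
apply/ltW/(lt_le_trans (truncnS_gt _)); rewrite ler_nat; exact: leq_trans h1 _.
Qed.

Lemma exhaust_homo m n : (m <= n)%N -> exhaust m `<=` exhaust n.
Proof.
move=> mn x; rewrite /exhaust /= !in_itv /= => /andP[h1 h2]; apply/andP; split.
  by apply: le_trans h1; rewrite lef_pV2 ?posrE ?ltr0n // ler_nat !ltnS.
by apply: le_trans h2 _; rewrite ler_nat !ltnS.
Qed.

Section FTC.
Variables f F : R -> R.
Hypothesis fF : forall t : R, 0 < t -> is_derive t 1 F (f t).
Hypothesis cf : forall t : R, 0 < t -> {for t, continuous f}.

Let cut n : R -> R := f \_ (exhaust n).

Lemma measurable_improper : measurable_fun D f.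
Proof.
apply: open_continuous_measurable_fun => // x.
by rewrite inE /= in_itv /= andbT => /cf.
Qed.

Lemma exhaust_FTC n : (\int[mu]_(x in exhaust n) (f x)%:E = (F n.+2%:R - F (n.+2%:R)^-1)%:E)%E.
Proof.
have cF t : 0 < t -> {for t, continuous F}.
  by move=> t0; apply/differentiable_continuous/derivable1_diffP; case: (fF t0).
rewrite EFinB; apply: continuous_FTC2 (exhaust_lt n) _ _ _.
- apply/continuous_within_itvP; first exact: exhaust_lt.
  split=> [x||].
  + rewrite in_itv /= => /andP[h _]; apply: cf; exact: lt_trans (exhaust_gt0 n) h.
  + by apply: cvg_at_right_filter; exact: cf (exhaust_gt0 n).
  + by apply: cvg_at_left_filter; apply: cf; rewrite ltr0n.
- split=> [x||].
  + rewrite in_itv /= => /andP[h _].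
    by case: (fF (lt_trans (exhaust_gt0 n) h)).
  + by apply: cvg_at_right_filter; exact: cF (exhaust_gt0 n).
  + by apply: cvg_at_left_filter; apply: cF; rewrite ltr0n.
move=> x; rewrite in_itv /= => /andP[h _]; rewrite derive1E.
by case: (fF (lt_trans (exhaust_gt0 n) h)).
Qed.

Lemma integral_exhaust n :
  (\int[mu]_(x in D) (cut n x)%:E = (F n.+2%:R - F (n.+2%:R)^-1)%:E)%E.
Proof.
rewrite -exhaust_FTC.
rewrite -[in RHS](setIidr (@exhaust_sub n)) integral_mkcondr; apply: eq_integral => x _.
by rewrite /cut /patch; case: ifP.
Qed.

Lemma measurable_patch_exhaust n : measurable_fun D (fun x => (cut n x)%:E).
Proof.
apply/measurable_EFinP/measurable_restrict => //.
  exact: measurable_itv.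
by apply: measurable_funS measurable_improper => // x [].
Qed.

Lemma patch_exhaust_cvg x : D x -> (fun n => (cut n x)%:E) @ \oo --> (f x)%:E.
Proof.
move=> /exhaust_near Dx; apply: cvg_near_cst; apply: filterS Dx => n nx.
by rewrite /cut /patch mem_set.
Qed.

(** The fundamental theorem of calculus on [exhaust n], then dominated convergence. *)
Lemma improper_FTC l0 l1 : mu.-integrable D (EFin \o f) ->
  (fun n => F (n.+2%:R)^-1) @ \oo --> l0 -> (fun n => F n.+2%:R) @ \oo --> l1 ->
  Rintegral mu D f = l1 - l0.
Proof.
move=> fi c0 c1.
have mD : measurable D by exact: measurable_itv.
have fi' : mu.-integrable D (fun x => `|(f x)%:E|)%E by exact: integrable_abse.
have h := dominated_cvg mD measurable_patch_exhaust patch_exhaust_cvg _ fi'.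
have {}h : (fun n => \int[mu]_(x in D) (cut n x)%:E)%E @ \oo -->
    (\int[mu]_(x in D) (f x)%:E)%E.
  apply: h => // n x Dx; rewrite /cut /patch; case: ifP => // _.
  by rewrite (_ : point = 0 :> R) // abse0 abse_ge0.
have e : (fun n => \int[mu]_(x in D) (cut n x)%:E)%E =
    (fun n => (F n.+2%:R - F (n.+2%:R)^-1)%:E) by apply/funext => n; exact: integral_exhaust.
rewrite e in h.
have h2 : (fun n => (F n.+2%:R - F (n.+2%:R)^-1)%:E) @ \oo --> (l1 - l0)%:E.
  by apply: cvg_EFin; [exact: nearW|exact: cvgB].
by rewrite /Rintegral (cvg_unique _ h h2).
Qed.

(** Monotone convergence along [exhaust n], where the integrals are increments of the bounded
    primitive F. *)
Lemma improper_integrable C : (forall t, 0 < t -> 0 <= f t) -> (forall t, 0 < t -> `|F t| <= C) ->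
  mu.-integrable D (EFin \o f).
Proof.
move=> f0 FC; apply/integrableP; split.
  by apply/measurable_EFinP; exact: measurable_improper.
have D0 x : D x -> 0 < x by rewrite /= in_itv /= andbT.
have -> : (\int[mu]_(x in D) `|(EFin \o f) x| = \int[mu]_(x in D)
    limn (fun n => (cut n x)%:E))%E.
  apply: eq_integral => x; rewrite inE => Dx; rewrite (cvg_lim _ (patch_exhaust_cvg Dx)) //=.
  by rewrite ger0_norm // f0 // D0.
have mD : measurable D by exact: measurable_itv.
have ge0 n x : D x -> (0 <= (cut n x)%:E)%E.
  by move=> Dx; rewrite lee_fin /cut /patch; case: ifP => // _; apply/f0/D0.
have mono x : D x -> nondecreasing_seq (fun n => (cut n x)%:E).
  move=> Dx m n mn; rewrite lee_fin /cut /patch; case: ifPn => [|_].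
    by rewrite inE => /(exhaust_homo mn) h; rewrite mem_set.
  by case: ifP => // _; apply/f0/D0.
have h := @cvg_monotone_convergence _ _ R mu D mD (fun n x => (cut n x)%:E)
  measurable_patch_exhaust ge0 mono.
rewrite -(cvg_lim _ h) //.
apply: (@le_lt_trans _ _ (C + C)%:E); last exact: ltry.
apply: lime_le; first by apply/cvg_ex; eexists; exact: h.
apply: nearW => n; rewrite integral_exhaust lee_fin lerD //.
  by apply: le_trans (ler_norm _) (FC _ _); rewrite ltr0n.
by apply: le_trans (FC _ (exhaust_gt0 n)); rewrite -normrN ler_norm.
Qed.
End FTC.
End ImproperIntegral.

Lemma is_derive_continuous (R : realType) (f : R -> R) (t d : R) : is_derive t 1 f d ->
  {for t, continuous f}.
Proof. by case=> h _; apply/differentiable_continuous/derivable1_diffP. Qed.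

Lemma squeeze_norm0 (R : realType) (u v : nat -> R) : (forall n, `|u n| <= v n) ->
  v @ \oo --> 0 -> u @ \oo --> 0.
Proof.
move=> uv v0; apply: (@squeeze_cvgr _ _ _ _ (fun n => - v n) v) => //.
  by apply: nearW => n; rewrite -ler_norml.
by rewrite -oppr0; exact: cvgN.
Qed.

Lemma cvg_inv_natr2 (R : realType) : (fun n : nat => n.+2%:R^-1 : R) @ \oo --> 0.
Proof. by have := @cvg_harmonic R; rewrite -(cvg_shiftS (@harmonic R)). Qed.

Lemma mean_value (R : realType) (f f' : R -> R) a b : (forall x : R, is_derive x 1 f (f' x)) ->
  a < b -> exists2 c, a < c < b & f b - f a = f' c * (b - a).
Proof.
move=> df ab; have hc : {within `[a, b], continuous f}.
  by apply: derivable_within_continuous => x _; case: (df x).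
have [c] := MVT ab (fun x _ => df x) hc.
by rewrite in_itv; exists c.
Qed.

Lemma normr_sin_le (R : realType) (y : R) : `|sin y| <= `|y|.
Proof.
wlog y0 : y / 0 <= y => [wl|].
  have [/wl//|/ltW y0] := leP 0 y.
  by rewrite -normrN -sinN -[leRHS]normrN wl // oppr_ge0.
move: y0; rewrite le_eqVlt => /predU1P[<-|y0]; first by rewrite sin0.
have [c _] := mean_value (@is_derive_sin R) y0.
by rewrite sin0 !subr0 => ->; rewrite normrM ler_piMl // cos_max.
Qed.

Lemma cos_ge_quadratic (R : realType) (y : R) : 1 - y ^+ 2 / 2 <= cos y.
Proof.
have e : y = (y / 2) *+ 2 by rewrite -mulr_natr -mulrA mulVf ?mulr1.
rewrite {2}e cos_mulr2n cos2sin2; have h := normr_sin_le (y / 2).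
have : sin (y / 2) ^+ 2 <= (y / 2) ^+ 2.
  by rewrite -[leLHS]real_normK ?num_real // -[leRHS]real_normK ?num_real // lerXn2r ?nnegrE.
rewrite -mulr_natr; clear; lra.
Qed.

(** The right side is the square of exp(a/2) - exp(-a/2), and for a >= 0 this difference is at least
    a/2. *)
Lemma expR_symmetric_ge (R : realType) (a : R) : a ^+ 2 / 4 <= expR a + expR (- a) - 2.
Proof.
wlog a0 : a / 0 <= a => [wl|].
  have [/wl//|/ltW a0] := leP 0 a.
  by have := wl (- a); rewrite sqrrN opprK [expR (- a) + _]addrC; apply; rewrite oppr_ge0.
have h1 := expR_ge1Dx (a / 2).
have h2 : expR (- (a / 2)) <= 1 by rewrite -[leRHS]expR0 ler_expR oppr_le0 divr_ge0.
have e1 : expR a = expR (a / 2) ^+ 2 by rewrite -expRM_natl; congr expR; field.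
have e2 : expR (- a) = expR (- (a / 2)) ^+ 2 by rewrite -expRM_natl; congr expR; field.
have e3 : expR (a / 2) * expR (- (a / 2)) = 1 by rewrite -expRD subrr expR0.
rewrite e1 e2; move: h1 h2 e3; move: (expR (a / 2)) (expR (- (a / 2))) => u v h1 h2 e3.
have -> : u ^+ 2 + v ^+ 2 - 2 = (u - v) ^+ 2 + 2 * (u * v - 1) by ring.
rewrite e3 subrr mulr0 addr0.
have -> : a ^+ 2 / 4 = (a / 2) ^+ 2 by field.
by rewrite lerXn2r ?nnegrE ?divr_ge0 //; lra.
Qed.

(** * Gamma on vertical lines as a pair of real integrals *)

Section GammaIntegrals.
Variable R : realType.
Notation mu := (@lebesgue_measure R).
Notation D := (`]0%R, +oo[%classic : set (measurableTypeR R)).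
Implicit Types (s x t : R).

(** The density of the Gamma integral. [Gcos s x] and [Gsin s x] are the real and imaginary parts of
    Gamma(s + i x), and [Gnorm2 s x] is its squared modulus. *)
Definition gweight s t : R := t `^ (s - 1) * expR (- t).
Definition gcos s x t : R := gweight s t * cos (x * ln t).
Definition gsin s x t : R := gweight s t * sin (x * ln t).
Definition Gcos s x : R := Rintegral mu D (gcos s x).
Definition Gsin s x : R := Rintegral mu D (gsin s x).

Lemma gweight_ge0 s t : 0 <= gweight s t.
Proof. by rewrite mulr_ge0 ?powR_ge0 ?expR_ge0. Qed.

Lemma powR_subr1 s t : 0 < t -> t `^ (s - 1) = t `^ s / t.
Proof. move=> t0; have t1 : t != 0 by rewrite gt_eqF.
by rewrite powRB ?t1 ?implybT // powRr1 // ltW. Qed.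

Lemma gweightS s t : 0 < t -> gweight (s + 1) t = t * gweight s t.
Proof.
move=> t0; rewrite /gweight addrK mulrA powR_subr1 // mulrCA divff ?mulr1 //.
by rewrite gt_eqF.
Qed.

Lemma is_derive_cos_ln x t : 0 < t -> is_derive t 1 (fun t => cos (x * ln t)) (- sin (x * ln t) * (x / t)).
Proof.
move=> t0; have h : is_derive t 1 (fun t => x * ln t) (x / t) := is_deriveZ x (is_derive1_ln t0).
exact: (is_derive1_comp (g := fun t => x * ln t) (is_derive_cos (x * ln t)) h).
Qed.

Lemma is_derive_sin_ln x t : 0 < t -> is_derive t 1 (fun t => sin (x * ln t)) (cos (x * ln t) * (x / t)).
Proof.
move=> t0; have h : is_derive t 1 (fun t => x * ln t) (x / t) := is_deriveZ x (is_derive1_ln t0).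
exact: (is_derive1_comp (g := fun t => x * ln t) (is_derive_sin (x * ln t)) h).
Qed.

Lemma is_derive_expRN t : is_derive t 1 (fun t => expR (- t)) (- expR (- t)).
Proof.
have h := is_deriveN (is_derive_id t (1 : R)).
have := is_derive1_comp (is_derive_expR (- t)) h; by rewrite mulrN1.
Qed.

Lemma is_derive_gweight s t : 0 < t ->
  is_derive t 1 (fun t => t `^ s * expR (- t)) (s * gweight s t - gweight (s + 1) t).
Proof.
move=> t0; have := is_deriveM (is_derive1_powR s t0) (is_derive_expRN t).
set d := (X in is_derive _ _ _ X -> _).
suff -> : d = s * gweight s t - gweight (s + 1) t by [].
rewrite /d /gweight addrK -![_ *: _]/(_ * _); ring.
Qed.

Lemma continuous_gweight s t : 0 < t -> {for t, continuous (gweight s)}.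
Proof. by move=> t0; exact: is_derive_continuous (is_derive_gweight (s - 1) t0). Qed.

(** The Taylor term of order N + 2 of exp(t + 1), with N above s, dominates; this accounts for the
    factorial and the factor exp 1 in the constant. *)
Lemma gweight_decay s : 0 < s -> exists2 K, 0 <= K & forall t, 0 < t ->
  t `^ s * expR (- t) <= K / (t + 1) ^+ 2.
Proof.
move=> s0; pose N := (Num.truncn s).+1; exists ((N.+2)`!%:R * expR 1).
  by rewrite mulr_ge0 ?expR_ge0.
move=> t t0; have t1 : 0 < t + 1 by rewrite ltr_wpDl // ltW.
rewrite ler_pdivlMr ?exprn_gt0 // expRN mulrAC ler_pdivrMr ?expR_gt0 //.
rewrite -mulrA -expRD; have h1 : t `^ s <= (t + 1) ^+ N.
  apply: (@le_trans _ _ ((t + 1) `^ s)).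
    by apply: ge0_ler_powR; rewrite ?nnegrE ?ltW // ltrDl.
  have h2 : 1 <= t + 1 by rewrite lerDr ltW.
  rewrite -(powR_mulrn N (ltW t1)); apply: (ler_powR h2).
  exact/ltW/truncnS_gt.
apply: (@le_trans _ _ ((t + 1) ^+ N.+2)).
  by rewrite -[N.+2]addn2 exprD ler_wpM2r // exprn_ge0 // ltW.
have := expR_ge1Dxn N.+1 (ltW t1); rewrite [1 + t]addrC.
rewrite -[_ <= _ * _]ler_pdivrMl ?ltr0n ?fact_gt0 // mulrC; apply: le_trans.
by rewrite lerDr.
Qed.

(** In general the density has no elementary primitive. Adding the nonnegative correction supplied
    by [gweight_decay] gives a larger function [f] with the bounded explicit primitive [F]. *)
Lemma gweight_integrable s : 0 < s -> mu.-integrable D (EFin \o gweight s).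
Proof.
move=> s0; have [K K0 hK] := gweight_decay s0.
have s'0 : s != 0 by rewrite gt_eqF.
pose f t := gweight s t + s^-1 * (K / (t + 1) ^+ 2 - t `^ s * expR (- t)).
pose F t := s^-1 * (t `^ s * expR (- t) - K * (t + 1)^-1).
have dinv t : 0 < t -> is_derive t 1 (fun t => (t + 1)^-1) (- (t + 1) ^- 2).
  move=> t0; have t1 : t + 1 != 0 by rewrite gt_eqF // ltr_wpDl // ltW.
  have := is_deriveV (f := fun t => t + 1) t1 (is_derive_shift t 1 1).
  set d := (X in is_derive _ _ _ X -> _).
  suff -> : d = - (t + 1) ^- 2 by [].
  by rewrite /d -[_ *: _]/(_ * _) mulr1.
have dF t : 0 < t -> is_derive t 1 F (f t).
  move=> t0.
  have := is_deriveZ s^-1 (is_deriveB (is_derive_gweight s t0) (is_deriveZ K (dinv t t0))).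
  set d := (X in is_derive _ _ _ X -> _).
  suff -> : d = f t by [].
  rewrite /d /f /gweight addrK -![_ *: _]/(_ * _); field.
  by rewrite s'0 gt_eqF // ltr_wpDr // ltW.
have cf t : 0 < t -> {for t, continuous f}.
  move=> t0; have h1 := @continuous_gweight s t t0.
  have h2 := is_derive_continuous (is_derive_gweight s t0).
  have h3 := is_derive_continuous (dinv t t0).
  have h4 : {for t, continuous (fun t => (t + 1)^-1 * (t + 1)^-1)} by exact: cvgM.
  have h5 : {for t, continuous (fun t => gweight s t +
      s^-1 * (K * ((t + 1)^-1 * (t + 1)^-1) - t `^ s * expR (- t)))}.
    apply: cvgD h1 _; apply: cvgM; first exact: cvg_cst.
    by apply: cvgB h2; apply: cvgM; first exact: cvg_cst.
  have fe : f = fun t => gweight s t +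
      s^-1 * (K * ((t + 1)^-1 * (t + 1)^-1) - t `^ s * expR (- t)).
    by apply/funext => u; rewrite /f -exprVn expr2.
  by rewrite fe.
have fw t : 0 < t -> gweight s t <= f t.
  by move=> t0; rewrite lerDl mulr_ge0 ?invr_ge0 ?(ltW s0) // subr_ge0 hK.
have FC t : 0 < t -> `|F t| <= s^-1 * (K + K).
  move=> t0; rewrite normrM gtr0_norm ?invr_gt0 // ler_wpM2l ?invr_ge0 ?(ltW s0) //.
  have t1 : 1 <= t + 1 by rewrite lerDr ltW.
  have t1' : (t + 1)^-1 <= 1 by rewrite invf_le1 // (lt_le_trans ltr01).
  have t1n : 0 <= (t + 1)^-1 by rewrite invr_ge0 (le_trans ler01).
  apply: le_trans (ler_normB _ _) _; apply: lerD.
    rewrite ger0_norm ?mulr_ge0 ?powR_ge0 ?expR_ge0 //; apply: le_trans (hK t t0) _.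
    by rewrite -exprVn ler_piMr // exprn_ile1.
  by rewrite ger0_norm ?mulr_ge0 // ler_piMr.
have f0 t : 0 < t -> 0 <= f t by move=> /fw; apply: le_trans; exact: gweight_ge0.
have fi := improper_integrable dF cf f0 FC.
apply: le_integrable fi; first exact: measurable_itv.
  by apply/measurable_EFinP; apply: measurable_improper => t; exact: continuous_gweight.
move=> t; rewrite /= in_itv /= andbT => t0; rewrite lee_fin ger0_norm ?gweight_ge0 //.
exact: le_trans (fw t t0) (ler_norm _).
Qed.

Lemma gamma_integrable s (h : R -> R) : 0 < s -> (forall t, 0 < t -> {for t, continuous h}) ->
  (exists K, forall t, 0 < t -> `|h t| <= K) -> mu.-integrable D (EFin \o (fun t => gweight s t * h t)).
Proof.
move=> s0 ch [K hK].
have mD : measurable D by exact: measurable_itv.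
have wK := integrableZr mD K (gweight_integrable s0).
apply: le_integrable wK => //.
  apply/measurable_EFinP; apply: measurable_improper => t t0; apply: cvgM; last exact: ch.
  exact: continuous_gweight.
move=> t; rewrite /= in_itv /= andbT => t0; rewrite lee_fin !normrM ler_wpM2l //.
exact: le_trans (hK t t0) (ler_norm _).
Qed.

Lemma continuous_cos_ln x t : 0 < t -> {for t, continuous (fun t => cos (x * ln t))}.
Proof. by move=> t0; exact: is_derive_continuous (is_derive_cos_ln x t0). Qed.

Lemma continuous_sin_ln x t : 0 < t -> {for t, continuous (fun t => sin (x * ln t))}.
Proof. by move=> t0; exact: is_derive_continuous (is_derive_sin_ln x t0). Qed.

Lemma gcos_integrable s x : 0 < s -> mu.-integrable D (EFin \o gcos s x).
Proof.
move=> s0; apply: gamma_integrable => //; first exact: continuous_cos_ln.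
by exists 1 => t _; rewrite ler_norml cos_le1 cos_geN1.
Qed.

Lemma gsin_integrable s x : 0 < s -> mu.-integrable D (EFin \o gsin s x).
Proof.
move=> s0; apply: gamma_integrable => //; first exact: continuous_sin_ln.
by exists 1 => t _; rewrite ler_norml sin_le1 sin_geN1.
Qed.

Lemma gweight_boundary s (h : R -> R) : 0 < s -> (forall t, `|h t| <= 1) ->
  (fun n : nat => (n.+2%:R)^-1 `^ s * expR (- (n.+2%:R)^-1) * h (n.+2%:R)^-1) @ \oo --> (0 : R) /\
  (fun n : nat => n.+2%:R `^ s * expR (- n.+2%:R) * h n.+2%:R) @ \oo --> (0 : R).
Proof.
move=> s0 h1; have hle t : `|t `^ s * expR (- t) * h t| <= t `^ s * expR (- t).
  by rewrite normrM ger0_norm ?mulr_ge0 ?powR_ge0 ?expR_ge0 // ler_piMr // mulr_ge0 ?powR_ge0 ?expR_ge0.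
split.
  apply: (squeeze_norm0 (v := fun n : nat => (n.+2%:R)^-1 `^ s)).
    move=> n; apply: le_trans (hle _) _; by rewrite ler_piMr ?powR_ge0 //.
  have /cvg_at_rightP h0 := powR_cvg0 s0; apply: h0; split; last exact: cvg_inv_natr2.
  by move=> n; rewrite invr_gt0 ltr0n.
have [K K0 hK] := gweight_decay s0.
apply: (squeeze_norm0 (v := fun n : nat => K * (n.+2%:R)^-1)).
  move=> n; apply: le_trans (hle _) (le_trans (hK _ _) _); first by rewrite ltr0n.
  rewrite ler_wpM2l // lef_pV2 ?posrE ?exprn_gt0 ?addr_gt0 ?ltr0n //.
  by rewrite natr1 -natrX ler_nat; nia.
by rewrite -[X in _ --> X](mulr0 K); apply: cvgM; [exact: cvg_cst|exact: cvg_inv_natr2].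
Qed.

(** Real part of Gamma(z + 1) = z Gamma(z) for z = s + i x, obtained by integrating the derivative
    of t^s exp(-t) cos(x ln t). *)
Lemma GcosS s x : 0 < s -> Gcos (s + 1) x = s * Gcos s x - x * Gsin s x.
Proof.
move=> s0; have s1 : 0 < s + 1 by rewrite addr_gt0.
have mD : measurable D by exact: measurable_itv.
pose f t := (s * gcos s x t - x * gsin s x t) - gcos (s + 1) x t.
pose F t := t `^ s * expR (- t) * cos (x * ln t).
have dF t : 0 < t -> is_derive t 1 F (f t).
  move=> t0; have := is_deriveM (is_derive_gweight s t0) (is_derive_cos_ln x t0).
  set d := (X in is_derive _ _ _ X -> _).
  suff -> : d = f t by [].
  rewrite /d /f /gcos /gsin gweightS // /gweight powR_subr1 // -![_ *: _]/(_ * _); field.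
  by rewrite gt_eqF.
have ic := integrableZl mD s (gcos_integrable x s0).
have is_ := integrableZl mD x (gsin_integrable x s0).
have ics := gcos_integrable x s1.
have ib := integrableB mD ic is_.
have if_ : mu.-integrable D (EFin \o f) by have := integrableB mD ib ics.
have cf t : 0 < t -> {for t, continuous f}.
  move=> t0; have c1 := @continuous_gweight s t t0; have c2 := @continuous_gweight (s + 1) t t0.
  have c3 := @continuous_cos_ln x t t0; have c4 := @continuous_sin_ln x t t0.
  by apply: cvgB; [apply: cvgB; apply: cvgM; [exact: cvg_cst|exact: cvgM|exact: cvg_cst|exact: cvgM]|exact: cvgM].
have [b0 b1] := gweight_boundary s0 (h := fun t => cos (x * ln t))
   (fun t => ltac:(by rewrite ler_norml cos_le1 cos_geN1)).
have := improper_FTC dF cf if_ b0 b1; rewrite subrr RintegralB // RintegralB //.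
rewrite !RintegralZl //; [|exact: gsin_integrable|exact: gcos_integrable].
by move=> /subr0_eq h; exact: esym h.
Qed.

Lemma GsinS s x : 0 < s -> Gsin (s + 1) x = s * Gsin s x + x * Gcos s x.
Proof.
move=> s0; have s1 : 0 < s + 1 by rewrite addr_gt0.
have mD : measurable D by exact: measurable_itv.
pose f t := (s * gsin s x t + x * gcos s x t) - gsin (s + 1) x t.
pose F t := t `^ s * expR (- t) * sin (x * ln t).
have dF t : 0 < t -> is_derive t 1 F (f t).
  move=> t0; have := is_deriveM (is_derive_gweight s t0) (is_derive_sin_ln x t0).
  set d := (X in is_derive _ _ _ X -> _).
  suff -> : d = f t by [].
  rewrite /d /f /gcos /gsin gweightS // /gweight powR_subr1 // -![_ *: _]/(_ * _); field.
  by rewrite gt_eqF.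
have ic := integrableZl mD s (gsin_integrable x s0).
have is_ := integrableZl mD x (gcos_integrable x s0).
have ics := gsin_integrable x s1.
have ib := integrableD mD ic is_.
have if_ : mu.-integrable D (EFin \o f) by have := integrableB mD ib ics.
have cf t : 0 < t -> {for t, continuous f}.
  move=> t0; have c1 := @continuous_gweight s t t0; have c2 := @continuous_gweight (s + 1) t t0.
  have c3 := @continuous_cos_ln x t t0; have c4 := @continuous_sin_ln x t t0.
  by apply: cvgB; [apply: cvgD; apply: cvgM; [exact: cvg_cst|exact: cvgM|exact: cvg_cst|exact: cvgM]|exact: cvgM].
have [b0 b1] := gweight_boundary s0 (h := fun t => sin (x * ln t))
   (fun t => ltac:(by rewrite ler_norml sin_le1 sin_geN1)).
have := improper_FTC dF cf if_ b0 b1; rewrite subrr RintegralB // RintegralD //.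
rewrite !RintegralZl //; [|exact: gcos_integrable|exact: gsin_integrable].
by move=> /subr0_eq h; exact: esym h.
Qed.

Definition Gnorm2 s x := Gcos s x ^+ 2 + Gsin s x ^+ 2.

Lemma Gnorm2S s x : 0 < s -> Gnorm2 (s + 1) x = (s ^+ 2 + x ^+ 2) * Gnorm2 s x.
Proof. by move=> s0; rewrite /Gnorm2 GcosS // GsinS //; ring. Qed.

Lemma Gsin0 s : Gsin s 0 = 0.
Proof.
rewrite /Gsin; under eq_Rintegral do rewrite /gsin mul0r sin0 mulr0.
by rewrite /Rintegral integral0.
Qed.

Lemma Gcos0S s : 0 < s -> Gcos (s + 1) 0 = s * Gcos s 0.
Proof. by move=> s0; rewrite GcosS // mul0r subr0. Qed.

Lemma Gcos0_ge0 s : 0 <= Gcos s 0.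
Proof. by apply: Rintegral_ge0 => t _; rewrite /gcos mul0r cos0 mulr1 gweight_ge0. Qed.

Lemma Gcomb_integrable s x a b : 0 < s -> [/\ mu.-integrable D (EFin \o (fun t => a * gcos s x t)),
  mu.-integrable D (EFin \o (fun t => b * gsin s x t)) &
  mu.-integrable D (EFin \o (fun t => a * gcos s x t + b * gsin s x t))].
Proof.
move=> s0; have mD : measurable D by exact: measurable_itv.
have h1 := integrableZl mD a (gcos_integrable x s0).
have h2 := integrableZl mD b (gsin_integrable x s0).
by split=> //; have := integrableD mD h1 h2.
Qed.

Lemma Gcomb s x a b : 0 < s ->
  Rintegral mu D (fun t => a * gcos s x t + b * gsin s x t) = a * Gcos s x + b * Gsin s x.
Proof.
move=> s0; have mD : measurable D by exact: measurable_itv.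
have [h1 h2 _] := @Gcomb_integrable s x a b s0.
rewrite (RintegralD mD h1 h2) (RintegralZl _ mD (gcos_integrable x s0)).
by rewrite (RintegralZl _ mD (gsin_integrable x s0)).
Qed.

Lemma cauchy2 (a b c d : R) : (a * c + b * d) ^+ 2 <= (a ^+ 2 + b ^+ 2) * (c ^+ 2 + d ^+ 2).
Proof. by have := sqr_ge0 (a * d - b * c); nra. Qed.

(** With Gamma(s + i x) = a + i b of modulus r, its squared modulus is the integral of the density
    against a cos + b sin, a function bounded by r; divide by r. *)
Lemma Gnorm2_le s x : 0 < s -> Gnorm2 s x <= Gcos s 0 ^+ 2.
Proof.
move=> s0; have mD : measurable D by exact: measurable_itv.
set r := Num.sqrt (Gnorm2 s x).
have N0 : 0 <= Gnorm2 s x by rewrite addr_ge0 ?sqr_ge0.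
have r2 : r ^+ 2 = Gnorm2 s x by rewrite sqr_sqrtr.
have le1 : Gnorm2 s x <= r * Gcos s 0.
  have -> : r * Gcos s 0 = Rintegral mu D (fun t => r * gcos s 0 t + 0 * gsin s 0 t).
    by rewrite Gcomb // mul0r addr0.
  rewrite {1}/Gnorm2 !expr2 -Gcomb //.
  have [_ _ i1] := @Gcomb_integrable s x (Gcos s x) (Gsin s x) s0.
  have [_ _ i2] := @Gcomb_integrable s 0 r 0 s0.
  apply: (le_Rintegral mD i1 i2).
  move=> t _; rewrite mul0r addr0 /gcos /gsin [0 * ln t]mul0r cos0 mulr1.
  rewrite ![_ * (gweight s t * _)]mulrCA -mulrDr [r * _]mulrC ler_wpM2l ?gweight_ge0 //.
  apply: le_trans (ler_norm _) _; rewrite -ler_sqr ?nnegrE ?sqrtr_ge0 // real_normK ?num_real // r2.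
  by apply: le_trans (cauchy2 _ _ _ _) _; rewrite cos2Dsin2 mulr1.
have [r0|r0] := eqVneq r 0; first by rewrite -r2 r0 expr0n /= sqr_ge0.
have rp : 0 < r by rewrite lt_neqAle eq_sym r0 sqrtr_ge0.
move: le1; rewrite -r2 expr2 ler_pM2l // => le1.
by rewrite expr2 -expr2 lerXn2r ?nnegrE ?sqrtr_ge0 ?Gcos0_ge0.
Qed.

(** Project Gamma(s + i x) on the phase at the maximum c = s - 1 of the density. The projection
    integrates cos(x ln(t/c)) >= 1 - 2 x^2 (t/c + c/t - 2), and the functional equation evaluates
    the lower bound exactly: t/c + c/t - 2 has mean 1/c under the density. *)
Lemma Gnorm2_ge s x : 1 < s ->
  Gcos s 0 * (1 - 2 * x ^+ 2 / (s - 1)) <= Num.sqrt (Gnorm2 s x).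
Proof.
move=> s1; have s0 : 0 < s by exact: lt_trans s1.
have c0 : 0 < s - 1 by rewrite subr_gt0.
have mD : measurable D by exact: measurable_itv.
set c := s - 1 in c0 *.
pose a := cos (x * ln c); pose b := sin (x * ln c).
have h1 : a * Gcos s x + b * Gsin s x <= Num.sqrt (Gnorm2 s x).
  apply: le_trans (ler_norm _) _; rewrite -ler_sqr ?nnegrE ?sqrtr_ge0 // real_normK ?num_real //.
  rewrite sqr_sqrtr ?addr_ge0 ?sqr_ge0 //; apply: le_trans (cauchy2 _ _ _ _) _.
  by rewrite cos2Dsin2 mul1r.
apply: le_trans h1; rewrite -Gcomb //.
pose k := 2 * x ^+ 2.
pose f1 t := (1 + 2 * k) * gcos s 0 t + 0 * gsin s 0 t.
pose f2 t := k / c * gcos (s + 1) 0 t + 0 * gsin (s + 1) 0 t.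
pose f3 t := k * c * gcos c 0 t + 0 * gsin c 0 t.
have [_ _ i1] := @Gcomb_integrable s 0 (1 + 2 * k) 0 s0.
have [_ _ i2] := @Gcomb_integrable (s + 1) 0 (k / c) 0 (addr_gt0 s0 ltr01).
have [_ _ i3] := @Gcomb_integrable c 0 (k * c) 0 c0.
have i12 : mu.-integrable D (EFin \o (fun t => f1 t - f2 t)) by have := integrableB mD i1 i2.
have i123 : mu.-integrable D (EFin \o (fun t => f1 t - f2 t - f3 t)) by have := integrableB mD i12 i3.
have -> : Gcos s 0 * (1 - k / c) = Rintegral mu D (fun t => f1 t - f2 t - f3 t).
  have z p q : p + 0 * q = p :> R by rewrite mul0r addr0.
  have e1' : Rintegral mu D f1 = (1 + 2 * k) * Gcos s 0 := etrans (Gcomb _ _ _ s0) (z _ _).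
  have e2' : Rintegral mu D f2 = k / c * Gcos (s + 1) 0 :=
    etrans (Gcomb _ _ _ (addr_gt0 s0 ltr01)) (z _ _).
  have e3' : Rintegral mu D f3 = k * c * Gcos c 0 := etrans (Gcomb _ _ _ c0) (z _ _).
  have eB := RintegralB mD i12 i3; have eB' := RintegralB mD i1 i2.
  rewrite e1' e2' in eB'; rewrite eB' e3' in eB; apply: etrans (esym eB).
  have e1 := Gcos0S c0; rewrite /c subrK -/c in e1; rewrite (Gcos0S s0) e1.
  have -> : s = c + 1 by rewrite /c subrK.
  by field; rewrite gt_eqF.
have [_ _ i4] := @Gcomb_integrable s x a b s0.
apply: (le_Rintegral mD i123 i4).
move=> t; rewrite /= in_itv /= andbT => t0.
rewrite /f1 /f2 /f3 /gcos /gsin !mul0r !addr0 cos0 !mulr1 gweightS //.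
have -> : gweight c t = gweight s t / t.
  have := gweightS c t0; rewrite /c subrK => ->; rewrite mulrC mulrA mulVf ?mul1r // gt_eqF //.
rewrite ![_ * (gweight s t * _)]mulrCA -mulrDr -cosB -mulrBr.
have -> : (1 + 2 * k) * gweight s t - k / c * (t * gweight s t) - gweight s t * (k * c / t) =
  gweight s t * (1 - k * (t / c + c / t - 2)) by field; rewrite !gt_eqF.
rewrite ler_wpM2l ?gweight_ge0 //; apply: le_trans (cos_ge_quadratic _).
have := expR_symmetric_ge (ln c - ln t).
rewrite opprB !expRD !expRN !lnK ?posrE // exprMn /k [t / c + _]addrC => h.
have := ler_wpM2l (sqr_ge0 x) h; clear; lra.
Qed.

Lemma Gcos1 : Gcos 1 0 = 1.
Proof.
have w1 t : gcos 1 0 t = expR (- t).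
  by rewrite /gcos mul0r cos0 mulr1 /gweight subrr powRr0 mul1r.
pose F (t : R) := - expR (- t).
have dF (t : R) : 0 < t -> is_derive t 1 F (gcos 1 0 t).
  by move=> _; have := is_deriveN (is_derive_expRN t); rewrite opprK w1.
have cf (t : R) : 0 < t -> {for t, continuous (gcos 1 0)}.
  move=> t0; have -> : gcos 1 0 = fun t => expR (- t) by apply/funext.
  exact: is_derive_continuous (is_derive_expRN t).
have h0 : (fun n : nat => F (n.+2%:R)^-1) @ \oo --> (-1 : R).
  have c0 := is_derive_continuous (is_deriveN (is_derive_expRN (0 : R))).
  have e0 : F 0 = -1 by rewrite /F oppr0 expR0.
  by rewrite -e0; exact: cvg_comp _ _ (@cvg_inv_natr2 R) c0.
have h1 : (fun n : nat => F n.+2%:R) @ \oo --> (0 : R).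
  apply: (squeeze_norm0 (v := fun n : nat => (n.+2%:R)^-1)); last exact: cvg_inv_natr2.
  move=> n; rewrite normrN ger0_norm ?expR_ge0 // expRN lef_pV2 ?posrE ?expR_gt0 ?ltr0n //.
  by apply: le_trans (expR_ge1Dx _); rewrite lerDr.
have := improper_FTC dF cf (gcos_integrable 0 ltr01) h0 h1.
by rewrite sub0r opprK.
Qed.

(** From t^(-1/2) + t^(1/2) >= 2 one gets Gamma(1/2) + Gamma(3/2) >= 2 Gamma(1) = 2, and Gamma(3/2)
    is half of Gamma(1/2). *)
Lemma Gcos32_gt0 : 0 < Gcos (2^-1 + 1) 0.
Proof.
have mD : measurable D by exact: measurable_itv.
have h0 : 0 < 2^-1 :> R by rewrite invr_gt0.
have i1 := gcos_integrable 0 h0.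
have i2 := gcos_integrable 0 (addr_gt0 h0 ltr01).
have i3 := gcos_integrable 0 (@ltr01 R).
have i12 : mu.-integrable D (EFin \o (fun t => gcos 2^-1 0 t + gcos (2^-1 + 1) 0 t)).
  by have := integrableD mD i1 i2.
have i33 : mu.-integrable D (EFin \o (fun t => gcos 1 0 t + gcos 1 0 t)).
  by have := integrableD mD i3 i3.
have h : Gcos 1 0 + Gcos 1 0 <= Gcos 2^-1 0 + Gcos (2^-1 + 1) 0.
  have := le_Rintegral mD i33 i12; rewrite (RintegralD mD i1 i2) (RintegralD mD i3 i3); apply.
  move=> t; rewrite /= in_itv /= andbT => t0.
  rewrite /gcos mul0r cos0 !mulr1 gweightS // /gweight subrr powRr0 mul1r.
  rewrite powR_subr1 // powR12_sqrt ?(ltW t0) //.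
  have s0 : 0 < Num.sqrt t by rewrite sqrtr_gt0.
  have e : t = Num.sqrt t ^+ 2 by rewrite sqr_sqrtr ?(ltW t0).
  set r := Num.sqrt t in s0 e *; rewrite e.
  rewrite mulrA -mulrDl -[expR _ + _]mulr2n -mulr_natl ler_wpM2r ?expR_ge0 //.
  have -> : r / r ^+ 2 + r ^+ 2 * (r / r ^+ 2) = r^-1 + r by field; rewrite gt_eqF.
  rewrite -subr_ge0; have -> : r^-1 + r - 2 = (r - 1) ^+ 2 / r by field; rewrite gt_eqF.
  by rewrite divr_ge0 ?sqr_ge0 ?(ltW s0).
rewrite Gcos1 in h; rewrite (Gcos0S h0) in h *; rewrite mulr_gt0 //.
by move: h; clear; lra.
Qed.
End GammaIntegrals.

(** * The integrals of cosh(2 x th) cos^n th *)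

Section CosineIntegrals.
Variable R : realType.
Notation mu := (@lebesgue_measure R).
Implicit Types (a th : R).

Definition Rcosh a := (expR a + expR (- a)) / 2 : R.
Definition Rsinh a := (expR a - expR (- a)) / 2 : R.

Lemma is_derive_expRZ a th : is_derive th 1 (fun t => expR (a * t)) (a * expR (a * th)).
Proof.
have h : is_derive th 1 (fun t => a * t) (a * 1) := is_deriveZ a (is_derive_id th (1 : R)).
have := is_derive1_comp (g := fun t => a * t) (is_derive_expR (a * th)) h.
by rewrite mulr1 mulrC.
Qed.

Lemma is_derive_coshZ a th : is_derive th 1 (fun t => Rcosh (a * t)) (a * Rsinh (a * th)).
Proof.
have h := is_deriveD (is_derive_expRZ a th) (is_derive_expRZ (- a) th).
have := is_deriveZ 2^-1 h; set d := (X in is_derive _ _ _ X -> _).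
have -> : a * Rsinh (a * th) = d.
  by rewrite /d /Rsinh -[_ *: _]/(_ * _) !mulNr; field.
set f := (X in is_derive _ _ X _ -> _).
suff -> : (fun t => Rcosh (a * t)) = f by [].
by apply/funext => t; rewrite /f /Rcosh mulrC -mulNr.
Qed.

Lemma is_derive_sinhZ a th : is_derive th 1 (fun t => Rsinh (a * t)) (a * Rcosh (a * th)).
Proof.
have h := is_deriveB (is_derive_expRZ a th) (is_derive_expRZ (- a) th).
have := is_deriveZ 2^-1 h; set d := (X in is_derive _ _ _ X -> _).
have -> : a * Rcosh (a * th) = d.
  by rewrite /d /Rcosh -[_ *: _]/(_ * _) !mulNr; field.
set f := (X in is_derive _ _ X _ -> _).
suff -> : (fun t => Rsinh (a * t)) = f by [].
by apply/funext => t; rewrite /f /Rsinh mulrC -mulNr.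
Qed.

Lemma Rsinh0 : Rsinh 0 = 0 :> R. Proof. by rewrite /Rsinh oppr0 subrr mul0r. Qed.

Lemma Rcosh_ge1 a : 1 <= Rcosh a.
Proof. by have := expR_symmetric_ge a; have := sqr_ge0 a; rewrite /Rcosh; clear; lra. Qed.

(** Classically equal to pi n! / 2^(n+1) divided by |Gamma(n/2 + 1 + i x)|^2; the proof shows that
    the product of the two does not depend on x. *)
Definition ccint n x : R := Rintegral mu `[0, pi / 2] (fun th => Rcosh (2 * x * th) * cos th ^+ n).

Lemma is_derive_cosX n th : is_derive th 1 (fun t => cos t ^+ n.+1) (- n.+1%:R * cos th ^+ n * sin th).
Proof.
have := is_deriveX n.+1 (is_derive_cos th); set d := (X in is_derive _ _ _ X -> _).
have -> : (fun t : R => cos t ^+ n.+1) = cos ^+ n.+1 by apply/funext => t; rewrite exprfctE.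
suff -> : - n.+1%:R * cos th ^+ n * sin th = d by [].
by rewrite /d -[_ *: _]/(_ * _) /=; ring.
Qed.

Lemma continuous_cc n x : continuous (fun th : R => Rcosh (2 * x * th) * cos th ^+ n).
Proof.
move=> th; have h1 := is_derive_continuous (is_derive_coshZ (2 * x) th).
have h2 : {for th, continuous (fun th : R => cos th ^+ n)}.
  by case: n => [|n]; [exact: cvg_cst|exact: is_derive_continuous (is_derive_cosX n th)].
exact: cvgM h1 h2.
Qed.

Lemma segment_FTC (f F : R -> R) a b : a < b -> continuous f -> (forall x : R, is_derive x 1 F (f x)) ->
  Rintegral mu `[a, b] f = F b - F a.
Proof.
move=> ab cf dF; rewrite /Rintegral (@continuous_FTC2 _ f F) //.
- exact: continuous_subspaceT.
- have cF x : {for x, continuous F} := is_derive_continuous (dF x).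
  split=> [x _||]; first by case: (dF x).
    by apply: cvg_at_right_filter; exact: cF.
  by apply: cvg_at_left_filter; exact: cF.
by move=> x _; rewrite derive1E; case: (dF x).
Qed.

Lemma cc_integrable n x : mu.-integrable `[0, pi / 2] (EFin \o (fun th => Rcosh (2 * x * th) * cos th ^+ n)).
Proof.
apply: continuous_compact_integrable; first exact: segment_compact.
apply: continuous_subspaceT; exact: continuous_cc.
Qed.

(** Two integrations by parts, condensed into a primitive [F] that vanishes at both ends: at 0
    through sinh and sin, at pi/2 through cos. *)
Lemma ccint_rec n x : (n.+2%:R ^+ 2 + 4 * x ^+ 2) * ccint n.+2 x = n.+2%:R * n.+1%:R * ccint n x.
Proof.
set a := 2 * x.
pose F th := a * (Rsinh (a * th) * cos th ^+ n.+2) + n.+2%:R * (Rcosh (a * th) * (cos th ^+ n.+1 * sin th)).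
pose g m th := Rcosh (a * th) * cos th ^+ m.
pose f th := (n.+2%:R ^+ 2 + a ^+ 2) * g n.+2 th - n.+2%:R * n.+1%:R * g n th.
have dF (th : R) : is_derive th 1 F (f th).
  have h1 := is_deriveZ a (is_deriveM (is_derive_sinhZ a th) (is_derive_cosX n.+1 th)).
  have h2 := is_deriveM (is_derive_cosX n th) (is_derive_sin th).
  have := is_deriveD h1 (is_deriveZ n.+2%:R (is_deriveM (is_derive_coshZ a th) h2)).
  set d := (X in is_derive _ _ _ X -> _).
  suff -> : f th = d by [].
  rewrite /d /f /g -![_ *: _]/(_ * _) -[((fun t => cos t ^+ n.+1) * sin) th]/(cos th ^+ n.+1 * sin th).
  have e2 : n.+2%:R = n.+1%:R + 1 :> R by rewrite natr1.
  have e1 : cos th ^+ n.+1 = cos th * cos th ^+ n by rewrite exprS.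
  have e0 : cos th ^+ n.+2 = cos th * (cos th * cos th ^+ n) by rewrite !exprS.
  have := sin2cos2 th; rewrite e2 e0 e1.
  move: (cos th) (cos th ^+ n) (sin th) (Rcosh _) (Rsinh _) (n.+1%:R : R) => c cn s C S m e.
  transitivity (a ^+ 2 * C * (c * (c * cn)) + (m + 1) * C * (c * (c * cn)) -
    (m + 1) * m * C * cn * s ^+ 2); last by ring.
  by rewrite e; ring.
have cg m : continuous (g m) by exact: continuous_cc.
have cf : continuous f.
  move=> th; have h1 := cg n.+2 th; have h2 := cg n th.
  by apply: cvgB; [apply: cvgM h1; exact: cvg_cst|apply: cvgM h2; exact: cvg_cst].
have mD : measurable (`[0, pi / 2]%classic : set (measurableTypeR R)) by exact: measurable_itv.
have pi0 : 0 < pi / 2 :> R by rewrite divr_gt0 ?pi_gt0.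
have := segment_FTC pi0 cf dF.
have i1 := cc_integrable n.+2 x; have i2 := cc_integrable n x.
have i3 : mu.-integrable `[0, pi / 2] (EFin \o (fun th => (n.+2%:R ^+ 2 + a ^+ 2) * g n.+2 th)).
  by have := integrableZl mD (n.+2%:R ^+ 2 + a ^+ 2) i1.
have i4 : mu.-integrable `[0, pi / 2] (EFin \o (fun th => n.+2%:R * n.+1%:R * g n th)).
  by have := integrableZl mD (n.+2%:R * n.+1%:R) i2.
rewrite (RintegralB mD i3 i4) (RintegralZl _ mD i1) (RintegralZl _ mD i2).
have F0 : F 0 = 0 by rewrite /F sin0 mulr0 Rsinh0 mul0r !mulr0 addr0.
have F1 : F (pi / 2) = 0 by rewrite /F cos_pihalf !exprS !mul0r !mulr0 addr0.
rewrite F0 F1 subrr => /subr0_eq; rewrite -/(ccint n x) -/(ccint n.+2 x) => <-.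
by congr (_ * _); rewrite /a exprMn; congr (_ + _ * _); ring.
Qed.

Let pih0 : 0 < pi / 2 :> R.
Proof. by rewrite divr_gt0 ?pi_gt0. Qed.

Lemma ccint0 x : 2 * x * ccint 0 x = Rsinh (pi * x).
Proof.
have mD : measurable (`[0, pi / 2]%classic : set (measurableTypeR R)) by exact: measurable_itv.
have i1 := cc_integrable 0 x; rewrite /ccint -(RintegralZl _ mD i1).
have -> : (fun th : R => 2 * x * (Rcosh (2 * x * th) * cos th ^+ 0)) =
    (fun th => 2 * x * Rcosh (2 * x * th)) by apply/funext => th; rewrite expr0 mulr1.
rewrite (segment_FTC pih0 _ (is_derive_sinhZ (2 * x))).
  by rewrite mulr0 Rsinh0 subr0; congr Rsinh; field.
move=> th; apply: cvgM; first exact: cvg_cst.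
exact: is_derive_continuous (is_derive_coshZ (2 * x) th).
Qed.

Lemma ccint1 x : (1 + 4 * x ^+ 2) * ccint 1 x = Rcosh (pi * x).
Proof.
have mD : measurable (`[0, pi / 2]%classic : set (measurableTypeR R)) by exact: measurable_itv.
have i1 := cc_integrable 1 x; rewrite /ccint -(RintegralZl _ mD i1).
set a := 2 * x; set f := (X in Rintegral _ _ X).
pose F th := a * (Rsinh (a * th) * cos th) + Rcosh (a * th) * sin th.
have dF (th : R) : is_derive th 1 F (f th).
  have h1 := is_deriveZ a (is_deriveM (is_derive_sinhZ a th) (is_derive_cos th)).
  have := is_deriveD h1 (is_deriveM (is_derive_coshZ a th) (is_derive_sin th)).
  set d := (X in is_derive _ _ _ X -> _).
  suff -> : f th = d by [].
  by rewrite /d /f -![_ *: _]/(_ * _) expr1 /a; ring.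
have cf : continuous f by move=> th; apply: cvgM; [exact: cvg_cst|exact: continuous_cc].
rewrite (segment_FTC pih0 cf dF) /F cos_pihalf sin_pihalf sin0 [a * 0]mulr0 Rsinh0 mul0r !mulr0.
rewrite add0r addr0 subr0 mulr1.
by rewrite /a; congr Rcosh; field.
Qed.

Lemma le_ccint n x (f : R -> R) : mu.-integrable `[0, pi / 2] (EFin \o f) ->
  (forall th, 0 <= th <= pi / 2 -> Rcosh (2 * x * th) * cos th ^+ n <= f th) ->
  ccint n x <= Rintegral mu `[0, pi / 2] f.
Proof.
move=> fi h; have mD : measurable (`[0, pi / 2]%classic : set (measurableTypeR R)) by exact: measurable_itv.
apply: (le_Rintegral mD (cc_integrable n x) fi) => th; rewrite /= in_itv /=; exact: h.
Qed.

Lemma cosX_ge0 n th : 0 <= th <= pi / 2 -> 0 <= cos th ^+ n.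
Proof.
move=> /andP[t0 t1]; rewrite exprn_ge0 // cos_ge0_pihalf // t1 andbT.
by apply: le_trans t0; rewrite oppr_le0 ltW.
Qed.

Lemma Rcosh0 : Rcosh 0 = 1 :> R. Proof. by rewrite /Rcosh oppr0 expR0; field. Qed.

Lemma ccint_ge n x : ccint n 0 <= ccint n x.
Proof.
apply: le_ccint; first exact: cc_integrable.
by move=> th tth; rewrite mulr0 mul0r Rcosh0 ler_wpM2r ?Rcosh_ge1 // cosX_ge0.
Qed.

Lemma ccint_gt0 n : 0 < ccint n 0.
Proof.
suff : 0 < ccint n 0 /\ 0 < ccint n.+1 0 by case.
elim: n => [|n [IH1 IH2]].
  split; last by have := ccint1 0; rewrite expr0n mulr0 addr0 mul1r mulr0 Rcosh0 => ->.
  rewrite /ccint; have -> : (fun th => Rcosh (2 * 0 * th) * cos th ^+ 0) = cst (1 : R).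
    by apply/funext => th; rewrite mulr0 mul0r Rcosh0 expr0 mulr1.
  rewrite (segment_FTC pih0 _ (fun th => is_derive_id th 1)) ?subr0 //.
  by move=> th; exact: cvg_cst.
split=> //; have := ccint_rec n 0; rewrite expr0n mulr0 addr0 => h.
have n0 : 0 < n.+2%:R ^+ 2 :> R by rewrite exprn_gt0.
by rewrite -(pmulr_rgt0 _ n0) h mulr_gt0 // mulr_gt0.
Qed.

Lemma Rcosh_le y : Rcosh y <= 1 + y ^+ 2 / 2 * expR `|y|.
Proof.
wlog y0 : y / 0 <= y => [wl|].
  have [/wl//|/ltW y0] := leP 0 y.
  have := wl (- y); rewrite oppr_ge0 sqrrN normrN => /(_ y0).
  by rewrite /Rcosh opprK addrC.
rewrite ger0_norm //.
have h1 := expR_ge1Dx (- y).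
have e1 : expR y = expR (y / 2) ^+ 2 by rewrite -expRM_natl; congr expR; field.
have e3 : expR y * expR (- y) = 1 by rewrite -expRD subrr expR0.
have h2 : expR (- y) <= 1 by rewrite -[leRHS]expR0 ler_expR oppr_le0.
have u0 := expR_gt0 y.
rewrite /Rcosh; move: (expR y) (expR (- y)) h1 e3 h2 u0 => u v h1 e3 h2 u0.
have : u * (1 - v) ^+ 2 <= u * y ^+ 2.
  by rewrite ler_pM2l // lerXn2r ?nnegrE ?subr_ge0 //; lra.
have -> : u * (1 - v) ^+ 2 = u - 2 * (u * v) + v * (u * v) by ring.
rewrite e3 => h; lra.
Qed.

(** The mean value theorem gives th cos th <= sin th. Squaring yields th^2 <= (1 + th^2) sin^2 th,
    and th <= 2. *)
Lemma sqr_le_sin th : 0 <= th <= pi / 2 -> th ^+ 2 <= 5 * sin th ^+ 2.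
Proof.
move=> /andP[]; rewrite le_eqVlt => /predU1P[<- _|t0 t1].
  by rewrite sin0 expr0n mulr0.
have [c /andP[c0 ct]] := mean_value (@is_derive_sin R) t0; rewrite sin0 !subr0 => e.
have cos0' : 0 <= cos th by have := @cosX_ge0 1 th; rewrite expr1; apply; rewrite ltW.
have cosle : cos th <= cos c.
  have tpi : th <= pi by apply: le_trans t1 _; have := pi_gt0 R; clear; lra.
  by apply: ltW; rewrite ltr_cos // in_itv /= ?(ltW c0) ?(ltW t0) //= (le_trans (ltW ct)).
have tle : th <= 2 by apply: le_trans t1 _; exact/ltW/pihalf_lt2.
have h1 : (th * cos th) ^+ 2 <= sin th ^+ 2.
  rewrite lerXn2r ?nnegrE ?mulr_ge0 ?(ltW t0) // ?e; last by rewrite mulrC ler_wpM2r // ltW.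
  by rewrite mulr_ge0 ?(ltW t0) // (le_trans cos0').
move: h1; rewrite exprMn cos2sin2 => h1.
have h2 : th ^+ 2 <= 4 by have := ltW t0; nra.
have := sqr_ge0 (sin th); nra.
Qed.

(** cosh(2 x th) - 1 is at most C sin^2 th, and by the recursion at x = 0 the integral of cos^n
    sin^2 is that of cos^n divided by n + 2. In C, the factor 10 is twice the 5 of [sqr_le_sin], and
    4|x| bounds |2 x th| because th <= 2. *)
Lemma ccint_le x : exists2 C, 0 <= C & forall n, ccint n x <= ccint n 0 * (1 + C / n.+2%:R).
Proof.
have mD : measurable (`[0, pi / 2]%classic : set (measurableTypeR R)) by exact: measurable_itv.
pose C := 10 * x ^+ 2 * expR (4 * `|x|).
have C0 : 0 <= C by rewrite mulr_ge0 ?expR_ge0 // mulr_ge0 ?sqr_ge0.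
exists C => // n.
pose g m th : R := Rcosh (2 * 0 * th) * cos th ^+ m.
have i1 := cc_integrable n 0; have i2 := cc_integrable n.+2 0.
have i3 : mu.-integrable `[0, pi / 2] (EFin \o (fun th => (1 + C) * g n th)).
  by have := integrableZl mD (1 + C) i1.
have i4 : mu.-integrable `[0, pi / 2] (EFin \o (fun th => C * g n.+2 th)).
  by have := integrableZl mD C i2.
have i5 : mu.-integrable `[0, pi / 2] (EFin \o (fun th => (1 + C) * g n th - C * g n.+2 th)).
  by have := integrableB mD i3 i4.
apply: le_trans (le_ccint (n := n) (x := x) i5 _) _.
  move=> th tth; rewrite /g mulr0 mul0r Rcosh0 !mul1r -[n.+2]addn2 exprD.
  have -> : (1 + C) * cos th ^+ n - C * (cos th ^+ n * cos th ^+ 2) = cos th ^+ n * (1 + C - C * cos th ^+ 2) by ring.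
  rewrite mulrC.
  rewrite ler_wpM2l ?cosX_ge0 // cos2sin2.
  apply: le_trans (Rcosh_le _) _.
  have -> : 1 + C - C * (1 - sin th ^+ 2) = 1 + C * sin th ^+ 2 by ring.
  rewrite lerD2l /C; have [t0 t1] := andP tth.
  have h1 : expR `|2 * x * th| <= expR (4 * `|x|).
    rewrite ler_expR !normrM (ger0_norm t0) ger0_norm // mulrAC.
    rewrite ler_wpM2r // [4](_ : _ = 2 * 2) ?ler_wpM2l //; last by ring.
    by apply: le_trans t1 _; exact/ltW/pihalf_lt2.
  have h2 := sqr_le_sin tth.
  have -> : 10 * x ^+ 2 * expR (4 * `|x|) * sin th ^+ 2 = (2 * x ^+ 2 * (5 * sin th ^+ 2)) * expR (4 * `|x|) by ring.
  apply: ler_pM => //; rewrite ?expR_ge0 ?divr_ge0 ?sqr_ge0 //.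
  have -> : (2 * x * th) ^+ 2 / 2 = 2 * x ^+ 2 * th ^+ 2 by field.
  by rewrite ler_wpM2l // mulr_ge0 ?sqr_ge0.
rewrite (RintegralB mD i3 i4) (RintegralZl _ mD i1) (RintegralZl _ mD i2).
rewrite -/(ccint n 0) -/(ccint n.+2 0).
have := ccint_rec n 0; rewrite expr0n mulr0 addr0 => h.
have e2 : n.+2%:R = n.+1%:R + 1 :> R by rewrite natr1.
have n1 : 0 < n.+1%:R :> R by rewrite ltr0n.
have -> : ccint n.+2 0 = n.+1%:R / n.+2%:R * ccint n 0.
  apply: (@mulfI _ (n.+2%:R ^+ 2)); first by rewrite expf_neq0 // pnatr_eq0.
  rewrite h; have n2 : n.+2%:R != 0 :> R by rewrite pnatr_eq0.
  by move: n2; move: (n.+2%:R : R) => N n2; field.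
rewrite e2 le_eqVlt; apply/orP; left; apply/eqP; field.
by rewrite gt_eqF // addr_gt0.
Qed.
End CosineIntegrals.

(** * Closed forms for the modulus of Gamma at 1 + i x and 1/2 + i x *)

Section GammaModulus.
Variable R : realType.
Implicit Types x : R.

Lemma le_of_harmonic (a b C : R) : 0 <= C -> (forall j : nat, a <= b + C / j.+1%:R) -> a <= b.
Proof.
move=> C0 h; apply/ler_addgt0Pr => e e0; apply: le_trans (h (Num.truncn (C / e))) _.
rewrite lerD2l ler_pdivrMr ?ltr0n // mulrC -ler_pdivrMr //.
exact/ltW/truncnS_gt.
Qed.

Definition gamma_ccint n x := ccint n x * Gnorm2 (n%:R / 2 + 1) x.

Let half_gt0 n : 0 < n%:R / 2 + 1 :> R.
Proof. by rewrite ltr_wpDl. Qed.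

(** The factor (n/2 + 1)^2 + x^2 gained by the Gamma term is, up to 4, the one lost by the cosine
    integral, so the multiplier is free of x. *)
Lemma gamma_ccintSS n x : gamma_ccint n.+2 x = n.+2%:R * n.+1%:R / 4 * gamma_ccint n x.
Proof.
rewrite /gamma_ccint; have -> : n.+2%:R / 2 + 1 = n%:R / 2 + 1 + 1 :> R.
  by rewrite -addn2 natrD; field.
rewrite Gnorm2S // mulrACA -[in RHS]mulrA; have := ccint_rec n x.
have e : n.+2%:R = 2 * (n%:R / 2 + 1) :> R by rewrite -addn2 natrD; field.
rewrite {1}e => h.
have -> : ccint n.+2 x * (((n%:R / 2 + 1) ^+ 2 + x ^+ 2) * Gnorm2 (n%:R / 2 + 1) x) =
  ((2 * (n%:R / 2 + 1)) ^+ 2 + 4 * x ^+ 2) * ccint n.+2 x / 4 * Gnorm2 (n%:R / 2 + 1) x by field.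
by rewrite h; field.
Qed.

Lemma Gcos0_gt0 n : 0 < Gcos (n%:R / 2 + 1) 0 :> R.
Proof.
suff : 0 < Gcos (n%:R / 2 + 1) 0 :> R /\ 0 < Gcos (n.+1%:R / 2 + 1) 0 :> R by case.
elim: n => [|n [IH1 IH2]].
  by rewrite mul0r add0r Gcos1 ltr01 mul1r; split=> //; exact: Gcos32_gt0.
split; first exact: IH2.
have -> : n.+2%:R / 2 + 1 = n%:R / 2 + 1 + 1 :> R.
  by rewrite -addn2 natrD; field.
rewrite (Gcos0S (half_gt0 n)); exact: mulr_gt0 (half_gt0 n) IH1.
Qed.

Lemma Gnorm20 s : Gnorm2 s 0 = Gcos s 0 ^+ 2 :> R.
Proof. by rewrite /Gnorm2 Gsin0 expr0n addr0. Qed.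

Lemma gamma_ccint0_gt0 n : 0 < gamma_ccint n 0.
Proof. by rewrite mulr_gt0 ?ccint_gt0 // Gnorm20 exprn_gt0 // Gcos0_gt0. Qed.

(* The quotient [gamma_ccint n x / gamma_ccint n 0] is 2-periodic in n and tends to 1 as n grows. *)
Lemma gamma_ccint_const n x : gamma_ccint n x = gamma_ccint n 0.
Proof.
have W0 := gamma_ccint0_gt0.
pose w m := gamma_ccint m x / gamma_ccint m 0.
have wS m : w m.+2 = w m.
  by rewrite /w !gamma_ccintSS -mulf_div divff ?mul1r // mulf_neq0 // mulf_neq0.
have wj j : w n = w (n + j.*2)%N.
  elim: j => [|j IH]; first by rewrite double0 addn0.
  rewrite doubleS !addnS wS; exact: IH.
suff w1 : w n = 1 by rewrite -[LHS](divfK (lt0r_neq0 (W0 n))) -/(w n) w1 mul1r.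
have [C C0 hC] := ccint_le x.
apply/eqP; rewrite eq_le; apply/andP; split.
- apply: (le_of_harmonic C0) => j; rewrite (wj j) ler_pdivrMr //.
  have N0 m : 0 <= Gnorm2 m x by rewrite addr_ge0 ?sqr_ge0.
  apply: (@le_trans _ _ (ccint (n + j.*2) 0 * (1 + C / (n + j.*2).+2%:R) * Gnorm2 ((n + j.*2)%:R / 2 + 1) x)).
    by rewrite ler_wpM2r.
  rewrite mulrAC mulrC; apply: ler_pM.
  + by rewrite addr_ge0 // divr_ge0.
  + by rewrite mulr_ge0 // ltW // ccint_gt0.
  + rewrite lerD2l ler_wpM2l // lef_pV2 ?posrE ?ltr0n // ler_nat; lia.
  + by rewrite ler_wpM2l ?(ltW (ccint_gt0 _ _)) // Gnorm20 Gnorm2_le.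
- apply: (@le_of_harmonic _ _ (8 * x ^+ 2)) => [|j]; first by rewrite mulr_ge0 ?sqr_ge0.
  rewrite (wj j.+1); set m := (n + j.+1.*2)%N.
  have m0 : 0 < m%:R / 2 :> R by rewrite divr_gt0 // ltr0n; lia.
  have h := @Gnorm2_ge R (m%:R / 2 + 1) x; rewrite ltrDr addrK in h; have {}h := h m0.
  (* With d = 2 x^2/(m/2), [Gnorm2_ge] bounds the quotient below by (1 - d)^2 >= 1 - 2 d when d <=
     1; for d > 1 the bound 1 - 2 d is negative. *)
  have h2 : 1 - 2 * (2 * x ^+ 2 / (m%:R / 2)) <= w m.
    rewrite ler_pdivlMr //; set d := 2 * x ^+ 2 / (m%:R / 2) in h *.
    have G0 := Gcos0_gt0 m.
    apply: (@le_trans _ _ (ccint m 0 * Gnorm2 (m%:R / 2 + 1) x)); last first.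
      by rewrite ler_wpM2r ?ccint_ge // addr_ge0 ?sqr_ge0.
    rewrite /gamma_ccint mulrCA ler_wpM2l ?(ltW (ccint_gt0 _ _)) // Gnorm20.
    have S2 : Num.sqrt (Gnorm2 (m%:R / 2 + 1) x) ^+ 2 = Gnorm2 (m%:R / 2 + 1) x.
      by rewrite sqr_sqrtr // addr_ge0 ?sqr_ge0.
    have S0 := sqrtr_ge0 (Gnorm2 (m%:R / 2 + 1) x).
    rewrite -S2; move: (Num.sqrt _) (Gcos _ _) S0 h G0 => r G r0 h G0.
    have [d1|d1] := leP d 1.
      apply: (@le_trans _ _ ((G * (1 - d)) ^+ 2)).
        by rewrite exprMn mulrC ler_wpM2l ?sqr_ge0 //; have := sqr_ge0 d; lra.
      by rewrite lerXn2r ?nnegrE // mulr_ge0 ?(ltW G0) // subr_ge0.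
    apply: (@le_trans _ _ 0); last exact: sqr_ge0.
    by rewrite nmulr_rle0 ?sqr_ge0 //; lra.
  apply: (@le_trans _ _ (w m + 2 * (2 * x ^+ 2 / (m%:R / 2)))); first by rewrite -lerBlDr.
  rewrite lerD2l.
  have -> : 2 * (2 * x ^+ 2 / (m%:R / 2)) = 8 * x ^+ 2 / m%:R by field; rewrite pnatr_eq0; lia.
  apply: ler_wpM2l; first by rewrite mulr_ge0 ?sqr_ge0.
  rewrite lef_pV2 ?posrE ?ltr0n ?ler_nat //; lia.
Qed.

(** The constancy for n = 0, where 2 x times the cosine integral is sinh(pi x). The product form
    includes x = 0. *)
Lemma Gnorm2_one x : Gnorm2 1 x * Rsinh (pi * x) = pi * x.
Proof.
have h := gamma_ccint_const 0 x; rewrite /gamma_ccint mul0r add0r Gnorm20 Gcos1 in h.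
have e : ccint 0 0 = pi / 2 :> R.
  rewrite /ccint; have -> : (fun th => Rcosh (2 * 0 * th) * cos th ^+ 0) = cst (1 : R).
    by apply/funext => th; rewrite mulr0 mul0r Rcosh0 expr0 mulr1.
  rewrite (segment_FTC _ _ (fun th => is_derive_id th 1)) ?subr0 ?divr_gt0 ?pi_gt0 //.
  by move=> th; exact: cvg_cst.
rewrite e expr1n mulr1 in h.
rewrite -ccint0 mulrCA [Gnorm2 1 x * _]mulrC h.
by move: (pi : R) => q; field.
Qed.

(** The constancy for n = 1, brought from 3/2 to 1/2 by the functional equation. *)
Lemma Gnorm2_half x : Gnorm2 2^-1 x * Rcosh (pi * x) = Gnorm2 2^-1 0.
Proof.
have h0 : 0 < 2^-1 :> R by rewrite invr_gt0.
have := gamma_ccint_const 1 x; rewrite /gamma_ccint mul1r !Gnorm2S // expr0n addr0.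
have c1 := ccint1 (0 : R); rewrite expr0n !mulr0 addr0 mul1r Rcosh0 in c1; rewrite c1 => h.
rewrite -ccint1.
have -> : Gnorm2 2^-1 x * ((1 + 4 * x ^+ 2) * ccint 1 x) =
  4 * (ccint 1 x * ((2^-1 ^+ 2 + x ^+ 2) * Gnorm2 2^-1 x)) by field.
by rewrite h; field.
Qed.

Lemma Gnorm2_half_gt0 x : 0 < Gnorm2 2^-1 x.
Proof.
have h0 : 0 < 2^-1 :> R by rewrite invr_gt0.
have c0 : 0 < Rcosh (pi * x) by exact: lt_le_trans ltr01 (Rcosh_ge1 _).
rewrite -(pmulr_lgt0 _ c0) Gnorm2_half Gnorm20 exprn_gt0 //.
by have := Gcos32_gt0 R; rewrite Gcos0S // pmulr_rgt0.
Qed.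

Lemma Gnorm2_one_gt0 x : 0 < Gnorm2 1 x.
Proof.
have := gamma_ccint0_gt0 0; rewrite -(gamma_ccint_const 0 x) /gamma_ccint mul0r add0r => h.
have c0 : 0 < ccint 0 x := lt_le_trans (ccint_gt0 R 0) (ccint_ge 0 x).
by rewrite -(pmulr_rgt0 _ c0).
Qed.
End GammaModulus.

(** * The Hilbert space of square-summable sequences *)

Section IntegerSums.
Variable R : realType.
Implicit Types (f g : int -> R).

Definition zrange (N : nat) : seq int := [seq i%:Z - N%:Z | i <- iota 0 (N + N).+1].

Lemma zpsumE f N : zpsum f N = \sum_(x <- zrange N) f x.
Proof. have e : iota 0 (N + N).+1 = index_iota 0 (N + N).+1 by rewrite /index_iota subn0.
by rewrite /zpsum big_map e big_mkord. Qed.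

Lemma mem_zrange x N : (x \in zrange N) = (`|x| <= N)%N.
Proof.
apply/seq.mapP/idP => [[i iN ->]|xN]; first by move: iN; rewrite mem_iota; lia.
by exists (absz (x + N%:Z)%R); [rewrite mem_iota|]; lia.
Qed.

Lemma zrange_uniq N : uniq (zrange N).
Proof. by rewrite map_inj_uniq ?iota_uniq // => i j; lia. Qed.

Lemma sum_le_zpsum f s N : (forall x, 0 <= f x) -> uniq s -> (forall x, x \in s -> (`|x| <= N)%N) ->
  \sum_(x <- s) f x <= zpsum f N.
Proof.
move=> f0 us sN; rewrite zpsumE [leRHS](bigID (mem s)) /=.
have -> : \sum_(x <- zrange N | x \in s) f x = \sum_(x <- s) f x.
  rewrite -big_filter; apply: perm_big; apply: uniq_perm => //.
    by rewrite filter_uniq // zrange_uniq.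
  move=> x; rewrite mem_filter mem_zrange andbC.
  by have [/sN ->|] := boolP (x \in s); rewrite ?andbF.
by rewrite lerDl sumr_ge0.
Qed.

Lemma zpsum_le f g N : (forall x, f x <= g x) -> zpsum f N <= zpsum g N.
Proof. by move=> fg; apply: ler_sum => i _. Qed.

Lemma zpsumD f g N : zpsum (fun x => f x + g x) N = zpsum f N + zpsum g N.
Proof. by rewrite /zpsum big_split. Qed.

Lemma zpsumZ c f N : zpsum (fun x => c * f x) N = c * zpsum f N.
Proof. by rewrite /zpsum mulr_sumr. Qed.

Lemma zpsum_mono f m n : (forall x, 0 <= f x) -> (m <= n)%N -> zpsum f m <= zpsum f n.
Proof.
move=> f0 mn; rewrite [leLHS]zpsumE; apply: sum_le_zpsum => // [|x]; first exact: zrange_uniq.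
by rewrite mem_zrange => h; exact: leq_trans mn.
Qed.

Definition zsum f : R := lim (zpsum f @ \oo).

Lemma zabs_dominated f g : (forall x, `|f x| <= g x) -> zabs_summable g -> zabs_summable f.
Proof.
move=> fg [M hM]; exists M => N; apply: le_trans (hM N); apply: zpsum_le => x.
exact: le_trans (fg x) (ler_norm _).
Qed.

Lemma zabs_norm f : zabs_summable f -> zabs_summable (fun x => `|f x|).
Proof. by case=> M hM; exists M => N; apply: le_trans (hM N); apply: zpsum_le => x; rewrite normr_id. Qed.

Lemma zabsD f g : zabs_summable f -> zabs_summable g -> zabs_summable (fun x => f x + g x).
Proof.
move=> [M hM] [M' hM']; exists (M + M') => N.
apply: le_trans (zpsum_le N (fun x => ler_normD (f x) (g x))) _; rewrite zpsumD; exact: lerD.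
Qed.

Lemma zabsZ c f : zabs_summable f -> zabs_summable (fun x => c * f x).
Proof.
move=> [M hM]; exists (`|c| * M) => N.
have -> : (fun x => `|c * f x|) = fun x => `|c| * `|f x| by apply/funext => x; rewrite normrM.
by rewrite zpsumZ ler_wpM2l.
Qed.

Lemma zabs_ge0P f : (forall x, 0 <= f x) -> zabs_summable f <-> exists M, forall N, zpsum f N <= M.
Proof.
move=> f0; have e : (fun x => `|f x|) = f by apply/funext => x; rewrite ger0_norm.
by rewrite /zabs_summable e.
Qed.

Lemma zsum_ge0_cvg f : (forall x, 0 <= f x) -> zabs_summable f -> zpsum f @ \oo --> zsum f.
Proof.
move=> f0 /(zabs_ge0P f0)[M hM]; apply: nondecreasing_is_cvgn.
  by move=> m n; exact: zpsum_mono.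
by exists M => _ [n _ <-].
Qed.

(** f is the difference of the nonnegative summable functions f + |f| and |f|, whose partial sums
    are monotone. *)
Lemma zsum_cvg f : zabs_summable f -> zpsum f @ \oo --> zsum f.
Proof.
move=> sf; have sn := zabs_norm sf.
have h1 := zsum_ge0_cvg (fun x => normr_ge0 (f x)) sn.
have pos x : 0 <= f x + `|f x| by rewrite -lerBlDr sub0r lerNl -normrN ler_norm.
have h2 := zsum_ge0_cvg pos (zabsD sf sn).
have -> : zpsum f = fun N => zpsum (fun x => f x + `|f x|) N - zpsum (fun x => `|f x|) N.
  by apply/funext => N; rewrite zpsumD addrK.
have h3 := cvgB h2 h1; rewrite /zsum.
suff -> : lim (zpsum f @ \oo) = zsum (fun x => f x + `|f x|) - zsum (fun x => `|f x|) by exact: h3.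
apply: cvg_lim => //.
have -> : zpsum f = fun N => zpsum (fun x => f x + `|f x|) N - zpsum (fun x => `|f x|) N.
  by apply/funext => N; rewrite zpsumD addrK.
exact: h3.
Qed.

Lemma zsum_toP f s : zsum_to f s <-> zabs_summable f /\ zsum f = s.
Proof.
split=> [[sf cf]|[sf <-]]; split=> //; last exact: zsum_cvg.
exact: cvg_lim cf.
Qed.

Lemma zsum_unique f s : zpsum f @ \oo --> s -> zsum f = s.
Proof. by move=> h; exact: cvg_lim h. Qed.

Lemma zsumD f g : zabs_summable f -> zabs_summable g -> zsum (fun x => f x + g x) = zsum f + zsum g.
Proof.
move=> sf sg; apply: zsum_unique.
have -> : zpsum (fun x => f x + g x) = fun N => zpsum f N + zpsum g N by apply/funext => N; rewrite zpsumD.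
by apply: cvgD; exact: zsum_cvg.
Qed.

Lemma zsumZ c f : zabs_summable f -> zsum (fun x => c * f x) = c * zsum f.
Proof.
move=> sf; apply: zsum_unique.
have -> : zpsum (fun x => c * f x) = fun N => c * zpsum f N by apply/funext => N; rewrite zpsumZ.
by apply: cvgM; [exact: cvg_cst|exact: zsum_cvg].
Qed.

Lemma zsum_le M f : zabs_summable f -> (forall N, zpsum f N <= M) -> zsum f <= M.
Proof.
move=> /zsum_cvg cf h; rewrite -(cvg_lim _ cf) //; apply: limr_le; first by apply/cvg_ex; eexists; exact: cf.
exact: nearW.
Qed.

Lemma zpsum_le_zsum f N : (forall x, 0 <= f x) -> zabs_summable f -> zpsum f N <= zsum f.
Proof.
move=> f0 /(zsum_ge0_cvg f0) cf; rewrite -(cvg_lim _ cf) //.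
apply: nondecreasing_cvgn_le; last by apply/cvg_ex; eexists; exact: cf.
by move=> m n; exact: zpsum_mono.
Qed.

Lemma sum_le_zsum f s : (forall x, 0 <= f x) -> zabs_summable f -> uniq s ->
  \sum_(x <- s) f x <= zsum f.
Proof.
move=> f0 sf us; apply: le_trans (zpsum_le_zsum (\max_(x <- s) `|x|%N) f0 sf).
by apply: sum_le_zpsum => // x xs; exact: (@leq_bigmax_seq _ s predT (fun x : int => `|x|%N) x xs isT).
Qed.

Lemma zsum_tail f e : (forall x, 0 <= f x) -> zabs_summable f -> 0 < e ->
  exists N, forall M, zpsum (fun n => if n \in zrange N then 0 else f n) M <= e.
Proof.
move=> f0 sf e0; have /cvgrPdist_le/(_ _ e0)[N _ hN] := zsum_ge0_cvg f0 sf.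
exists N => M; have := hN N (leqnn N); rewrite ger0_norm ?subr_ge0 ?zpsum_le_zsum //.
apply: le_trans; rewrite lerBrDr; apply: le_trans (zpsum_le_zsum (maxn M N) f0 sf).
apply: (@le_trans _ _ (zpsum (fun n => if n \in zrange N then 0 else f n) (maxn M N) + zpsum f N)).
  by rewrite lerD2r; apply: zpsum_mono; [move=> x; case: ifP|exact: leq_maxl].
rewrite !zpsumE [leRHS](bigID (mem (zrange N))) /= [leRHS]addrC; apply: lerD.
  by rewrite [leRHS]big_mkcond /=; apply: ler_sum => i _; rewrite if_neg.
rewrite -[leRHS]big_filter le_eqVlt; apply/orP; left; apply/eqP; apply: perm_big; apply: uniq_perm.
- exact: zrange_uniq.
- by rewrite filter_uniq // zrange_uniq.
- move=> x; rewrite mem_filter !mem_zrange; have := leq_maxr M N; lia.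
Qed.

Lemma le_zsum_term f n : (forall x, 0 <= f x) -> zabs_summable f -> f n <= zsum f.
Proof. by move=> f0 sf; have := sum_le_zsum f0 sf (isT : uniq [:: n]); rewrite big_seq1. Qed.

Lemma zabs_inj f phi : injective phi -> zabs_summable f -> zabs_summable (fun x => f (phi x)).
Proof.
move=> phi_inj /zabs_norm sf; exists (zsum (fun x => `|f x|)) => N.
rewrite zpsumE -(big_map phi predT (fun x => `|f x|)); apply: sum_le_zsum => //.
by rewrite map_inj_uniq // zrange_uniq.
Qed.

(** A bijection does not preserve symmetric windows. For nonnegative terms each sum bounds the
    other, by comparing finite sums along phi and along psi; the general case is a difference of two
    such sums. *)
Lemma zsum_bij f phi psi : cancel phi psi -> cancel psi phi -> zabs_summable f ->
  zsum (fun x => f (phi x)) = zsum f.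
Proof.
move=> phiK psiK.
have le g u v : cancel u v -> (forall x, 0 <= g x) -> zabs_summable g -> zsum (fun x => g (u x)) <= zsum g.
  move=> uK g0 sg; have ui := can_inj uK.
  apply: zsum_le => [|N]; first exact: zabs_inj ui sg.
  by rewrite zpsumE -(big_map u predT g); apply: sum_le_zsum => //; rewrite map_inj_uniq // zrange_uniq.
have pos g : (forall x, 0 <= g x) -> zabs_summable g -> zsum (fun x => g (phi x)) = zsum g.
  move=> g0 sg; apply/eqP; rewrite eq_le (le _ _ _ phiK) //=.
  have := le (fun x => g (phi x)) psi phi psiK (fun x => g0 _) (zabs_inj (can_inj phiK) sg).
  by rewrite (_ : (fun x => g (phi (psi x))) = g) //; apply/funext => x; rewrite psiK.
move=> sf; have sn := zabs_norm sf.
have posf x : 0 <= f x + `|f x| by rewrite -lerBlDr sub0r lerNl -normrN ler_norm.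
have sf' := zabs_inj (can_inj phiK) sf; have sn' := zabs_inj (can_inj phiK) sn.
have := pos _ posf (zabsD sf sn); rewrite (zsumD sf' sn') (zsumD sf sn).
by rewrite (pos (fun x => `|f x|)) // => /addIr.
Qed.
End IntegerSums.

Lemma cvg_sqr_dist (R : realType) (x y : nat -> R) (a b c d : R) : x @ \oo --> a -> y @ \oo --> b ->
  (fun M => (x M - c) * (x M - c) + (y M - d) * (y M - d)) @ \oo -->
  (a - c) * (a - c) + (b - d) * (b - d).
Proof.
move=> hx hy; have h1 : (fun M => x M - c) @ \oo --> a - c by apply: cvgB => //; exact: cvg_cst.
have h2 : (fun M => y M - d) @ \oo --> b - d by apply: cvgB => //; exact: cvg_cst.
by apply: cvgD; apply: cvgM.
Qed.

Lemma zpsum_cvg (R : realType) (f : nat -> int -> R) (g : int -> R) M :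
  (forall n, (fun L => f L n) @ \oo --> g n) -> (fun L => zpsum (f L) M) @ \oo --> zpsum g M.
Proof.
move=> h; have -> : (fun L => zpsum (f L) M) = (fun L => \sum_(x <- zrange M) f L x).
  by apply/funext => L; rewrite zpsumE.
rewrite zpsumE; elim: (zrange M) => [|x s IH].
  rewrite big_nil (_ : (fun L => _) = cst 0); first exact: cvg_cst.
  by apply/funext => L; rewrite big_nil.
rewrite big_cons (_ : (fun L => _) = (fun L => f L x + \sum_(y <- s) f L y)).
  by apply: cvgD; [exact: h|exact: IH].
by apply/funext => L; rewrite big_cons.
Qed.

(** * Square-summable sequences as a real Hilbert space *)

Section SquareSummable.
Variable R : realType.
Local Open Scope complex_scope.

Definition csq (z : R[i]) : R := complex.Re z ^+ 2 + complex.Im z ^+ 2.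

Lemma csq_ge0 z : 0 <= csq z. Proof. by rewrite addr_ge0 ?sqr_ge0. Qed.

(** [Rcomplex R] is R[i] seen as a real vector space, so that l2 becomes a module over R, as the
    Hilbert space theory above requires. *)
Definition l2pred : {pred (int -> Rcomplex R)} := fun v => `[< l2Z (v : int -> R[i]) >].

Lemma csq_lin (a : R) (u v : Rcomplex R) : csq (a *: u + v) <= 2 * a ^+ 2 * csq u + 2 * csq v.
Proof.
case: u v => u1 u2 [v1 v2]; rewrite /csq /=.
by have := sqr_ge0 (a * u1 - v1); have := sqr_ge0 (a * u2 - v2); nra.
Qed.

Lemma l2_submod : submod_closed l2pred.
Proof.
split=> [|a u v /asboolP su /asboolP sv]; apply/asboolP.
  exists 0 => N; rewrite /zpsum big1 // => i _ /=.
  by rewrite expr0n addr0 normr0.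
apply: (zabs_dominated (g := fun x => 2 * a ^+ 2 * csq (u x) + 2 * csq (v x))).
  by move=> x; rewrite ger0_norm ?csq_ge0 //; exact: csq_lin.
by apply: zabsD; exact: zabsZ.
Qed.
HB.instance Definition _ := GRing.isSubmodClosed.Build R (int -> Rcomplex R) l2pred
  l2_submod.

Definition l2 := {v : int -> Rcomplex R | v \in l2pred}.
HB.instance Definition _ := SubChoice.copy l2 {v : int -> Rcomplex R | v \in l2pred}.
HB.instance Definition _ := [SubChoice_isSubLmodule of l2 by <:].

Definition l2fun (v : l2) : int -> R[i] := val v.
Definition l2re (n : int) (v : l2) : R := complex.Re (l2fun v n).
Definition l2im (n : int) (v : l2) : R := complex.Im (l2fun v n).

Lemma l2funP v : l2Z (l2fun v). Proof. by have /asboolP := valP v. Qed.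

Definition mkl2 (v : int -> R[i]) (h : l2Z v) : l2 :=
  exist _ (v : int -> Rcomplex R) (asboolT h).

Lemma l2fun_mk v h : l2fun (@mkl2 v h) = v. Proof. by []. Qed.

Lemma l2_eq u v : (forall n, l2re n u = l2re n v) -> (forall n, l2im n u = l2im n v) -> u = v.
Proof.
move=> h1 h2; apply: val_inj; apply/funext => n; apply/eqP; rewrite eq_complex.
by apply/andP; split; apply/eqP; [exact: h1|exact: h2].
Qed.

Lemma l2fun_lin n (a : R) (u v : l2) :
  l2fun (a *: u + v) n = (a *: (l2fun u n : Rcomplex R) + (l2fun v n : Rcomplex R)).
Proof. by rewrite /l2fun linearP. Qed.

Lemma l2re_lin n a u v : l2re n (a *: u + v) = a * l2re n u + l2re n v.
Proof. by rewrite /l2re l2fun_lin; case: (l2fun u n) (l2fun v n) => u1 u2 [v1 v2]. Qed.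
Lemma l2im_lin n a u v : l2im n (a *: u + v) = a * l2im n u + l2im n v.
Proof. by rewrite /l2im l2fun_lin; case: (l2fun u n) (l2fun v n) => u1 u2 [v1 v2]. Qed.
HB.instance Definition _ n := GRing.isLinear.Build R l2 R^o *:%R (l2re n) (l2re_lin n).
HB.instance Definition _ n := GRing.isLinear.Build R l2 R^o *:%R (l2im n) (l2im_lin n).

(** The real part of u_n times the conjugate of v_n; summed over n, it is the real inner product
    underlying the hermitian one. *)
Definition ip_term (u v : l2) (n : int) : R := l2re n u * l2re n v + l2im n u * l2im n v.
Definition l2ip (u v : l2) : R := zsum (ip_term u v).
Notation nm := (hnorm l2ip).

Lemma ip_term_self u n : ip_term u u n = csq (l2fun u n).
Proof. by rewrite /ip_term -!expr2. Qed.

Lemma ip_term_ge0 u n : 0 <= ip_term u u n. Proof. by rewrite ip_term_self csq_ge0. Qed.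

Lemma ip_term_summable u v : zabs_summable (ip_term u v).
Proof.
apply: (zabs_dominated (g := fun n => csq (l2fun u n) + csq (l2fun v n))).
  move=> n; rewrite /ip_term /csq -/(l2re n u) -/(l2im n u) -/(l2re n v) -/(l2im n v).
  move: (l2re n u) (l2im n u) (l2re n v) (l2im n v) => a b c d.
  rewrite ler_norml; have := sqr_ge0 (a - c); have := sqr_ge0 (a + c).
  have := sqr_ge0 (b - d); have := sqr_ge0 (b + d); move=> h1 h2 h3 h4.
  by apply/andP; split; nra.
by apply: zabsD; exact: l2funP.
Qed.

Lemma l2ipDl u v w : l2ip (u + v) w = l2ip u w + l2ip v w.
Proof.
rewrite /l2ip -zsumD; try exact: ip_term_summable.
by congr zsum; apply/funext => n; rewrite /ip_term !linearD /=; ring.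
Qed.

Lemma l2ipZl a u v : l2ip (a *: u) v = a * l2ip u v.
Proof.
rewrite /l2ip -zsumZ; last exact: ip_term_summable.
congr zsum; apply/funext => n.
by rewrite /ip_term !linearZ /= -![_ *: _]/(_ * _); ring.
Qed.

Lemma l2ipC u v : l2ip u v = l2ip v u.
Proof. by rewrite /l2ip; congr zsum; apply/funext => n; rewrite /ip_term mulrC [l2im _ _ * _]mulrC. Qed.

Lemma csq_le_ip u n : csq (l2fun u n) <= l2ip u u.
Proof.
rewrite -ip_term_self; apply: le_zsum_term; first exact: ip_term_ge0.
exact: ip_term_summable.
Qed.

Lemma zpsum_le_ip u N : zpsum (fun n => csq (l2fun u n)) N <= l2ip u u.
Proof.
have -> : (fun n => csq (l2fun u n)) = ip_term u u by apply/funext => n; rewrite ip_term_self.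
apply: zpsum_le_zsum; [exact: ip_term_ge0|exact: ip_term_summable].
Qed.

Lemma l2ip_le u M : (forall N, zpsum (fun n => csq (l2fun u n)) N <= M) -> l2ip u u <= M.
Proof.
move=> h; apply: zsum_le => [|N]; first exact: ip_term_summable.
by apply: le_trans (h N); apply: zpsum_le => n; rewrite ip_term_self.
Qed.

Lemma l2ip_gt0 u : u != 0 -> 0 < l2ip u u.
Proof.
move=> u0; rewrite lt_neqAle eq_sym; apply/andP; split; last first.
  exact: le_trans (csq_ge0 _) (csq_le_ip u 0).
apply: contraNneq u0 => e; apply/eqP; apply: l2_eq => n; have := csq_le_ip u n;
  rewrite e /csq -/(l2re n u) -/(l2im n u) linear0;
  have := sqr_ge0 (l2re n u); have := sqr_ge0 (l2im n u) => h1 h2 h3; apply/eqP;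
  by rewrite -sqrf_eq0 eq_le; apply/andP; split; lra.
Qed.

Lemma l2re_le n u : `|l2re n u| <= nm u.
Proof.
rewrite -ler_sqr ?nnegrE ?sqrtr_ge0 // real_normK ?num_real // sqr_sqrtr; last first.
  exact: le_trans (csq_ge0 _) (csq_le_ip u 0).
by apply: le_trans (csq_le_ip u n); rewrite lerDl sqr_ge0.
Qed.

Lemma l2im_le n u : `|l2im n u| <= nm u.
Proof.
rewrite -ler_sqr ?nnegrE ?sqrtr_ge0 // real_normK ?num_real // sqr_sqrtr; last first.
  exact: le_trans (csq_ge0 _) (csq_le_ip u 0).
by apply: le_trans (csq_le_ip u n); rewrite lerDr sqr_ge0.
Qed.

Lemma l2ip_ge0 u : 0 <= l2ip u u.
Proof. exact: le_trans (csq_ge0 _) (csq_le_ip u 0). Qed.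

Lemma sqr_l2nm u : nm u ^+ 2 = l2ip u u.
Proof. by rewrite sqr_sqrtr // l2ip_ge0. Qed.

(** Obtained by hand from the nonnegative square of |v| u - |u| v: the general [cauchy_schwarz]
    presupposes the completeness that [l2_hilbert] derives from this inequality. *)
Lemma l2ip_le_nm u v : l2ip u v <= nm u * nm v.
Proof.
have [->|u0] := eqVneq u 0.
  have := l2ipZl 0 0 v; rewrite scaler0 mul0r => ->.
  by rewrite mulr_ge0 ?sqrtr_ge0.
have [->|v0] := eqVneq v 0.
  have := l2ipZl 0 0 u; rewrite scaler0 mul0r l2ipC => ->.
  by rewrite mulr_ge0 ?sqrtr_ge0.
have a0 : 0 < nm u by rewrite sqrtr_gt0 l2ip_gt0.
have b0 : 0 < nm v by rewrite sqrtr_gt0 l2ip_gt0.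
have := l2ip_ge0 (nm v *: u + - nm u *: v).
rewrite !(l2ipDl, l2ipZl) ![l2ip _ (_ + _)]l2ipC !(l2ipDl, l2ipZl) -!sqr_l2nm [l2ip v u]l2ipC.
move: (nm u) (nm v) (l2ip u v) a0 b0 => a b p a0 b0 h.
have : 0 <= 2 * (a * b) * (a * b - p) by apply: le_trans h _; rewrite le_eqVlt; apply/orP; left; apply/eqP; ring.
by rewrite pmulr_rge0 ?subr_ge0 // !mulr_gt0.
Qed.

Lemma l2nmD u v : nm (u + v) <= nm u + nm v.
Proof.
rewrite -ler_sqr ?nnegrE ?addr_ge0 ?sqrtr_ge0 // sqr_l2nm l2ipDl ![l2ip _ (_ + _)]l2ipC !l2ipDl.
rewrite -!sqr_l2nm [l2ip v u]l2ipC sqrrD; have := l2ip_le_nm u v.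
by rewrite mulr2n => h; lra.
Qed.

Lemma l2nm_sum (I : Type) (s : seq I) (F : I -> l2) : nm (\sum_(i <- s) F i) <= \sum_(i <- s) nm (F i).
Proof.
elim/big_rec2: _ => [|i x y _ h]; first by rewrite /hnorm /= -[0 : l2](scale0r 0) l2ipZl mul0r sqrtr0.
by apply: le_trans (l2nmD _ _) _; rewrite lerD2l.
Qed.

Lemma l2_hilbert : hilbert l2ip.
Proof.
split; [exact: l2ipDl|exact: l2ipZl|exact: l2ipC|exact: l2ip_gt0|].
have ip0 := l2ip_ge0.
move=> a C q q01 C0 ha.
have hre n : exists s : R, forall N, `|s - \sum_(j < N) l2re n (a j)| <= C * q ^+ N / (1 - q).
  apply: (@geo_complete_real R (fun j => l2re n (a j)) C q q01 C0) => j.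
  exact: le_trans (l2re_le n (a j)) (ha j).
have him n : exists s : R, forall N, `|s - \sum_(j < N) l2im n (a j)| <= C * q ^+ N / (1 - q).
  apply: (@geo_complete_real R (fun j => l2im n (a j)) C q q01 C0) => j.
  exact: le_trans (l2im_le n (a j)) (ha j).
pose s n := Complex (projT1 (cid (hre n))) (projT1 (cid (him n))).
have q1 : 0 < 1 - q by case/andP: q01 => _; rewrite subr_gt0.
pose K := C / (1 - q); pose S N := \sum_(j < N) a j.
have K0 : 0 <= K by rewrite divr_ge0 // ltW.
have geo0 : (fun N => C * q ^+ N / (1 - q)) @ \oo --> (0 : R).
  have -> : (fun N => C * q ^+ N / (1 - q)) = (fun N => K * q ^+ N).
    by apply/funext => N; rewrite /K mulrAC.
  by apply: cvg_geometric; case/andP: q01 => ? ?; rewrite ger0_norm.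
have sre n : (fun N => l2re n (S N)) @ \oo --> complex.Re (s n).
  have : (fun N => l2re n (S N) - complex.Re (s n)) @ \oo --> (0 : R).
    apply: squeeze_norm0 geo0 => N; rewrite distrC linear_sum.
    exact: (projT2 (cid (hre n)) N).
  by move/subr_cvg0.
have sim n : (fun N => l2im n (S N)) @ \oo --> complex.Im (s n).
  have : (fun N => l2im n (S N) - complex.Im (s n)) @ \oo --> (0 : R).
    apply: squeeze_norm0 geo0 => N; rewrite distrC linear_sum.
    exact: (projT2 (cid (him n)) N).
  by move/subr_cvg0.
have Sdist N M : (N <= M)%N -> nm (S M - S N) <= K * q ^+ N.
  move=> NM; rewrite /S -(subnKC NM) big_split_ord /= addrAC subrr add0r.
  rewrite /K mulrAC; apply: le_trans (l2nm_sum _ _) _.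
  by apply: le_trans (sum_geometric_le N (M - N) C0 q01); apply: ler_sum => i _; exact: ha.
have cS n N : (fun M => csq (l2fun (S M - S N) n)) @ \oo --> csq (s n - l2fun (S N) n).
  have -> : (fun M => csq (l2fun (S M - S N) n)) = (fun M => (l2re n (S M) - l2re n (S N)) *
     (l2re n (S M) - l2re n (S N)) + (l2im n (S M) - l2im n (S N)) * (l2im n (S M) - l2im n (S N))).
    apply/funext => M; rewrite /csq -/(l2re n (S M - S N)) -/(l2im n (S M - S N)) !linearB /=.
    by rewrite !expr2.
  have -> : csq (s n - l2fun (S N) n) = (complex.Re (s n) - l2re n (S N)) *
     (complex.Re (s n) - l2re n (S N)) + (complex.Im (s n) - l2im n (S N)) * (complex.Im (s n) - l2im n (S N)).
    by rewrite /csq raddfB /= raddfB /= !expr2.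
  exact: cvg_sqr_dist (sre n) (sim n).
(* The estimate passes to the limit on a finite window, where coordinatewise convergence suffices;
   its uniformity in M then covers all coordinates. *)
have bound N M : zpsum (fun n => csq (s n - l2fun (S N) n)) M <= (K * q ^+ N) ^+ 2.
  have cv : (fun L => zpsum (fun n => csq (l2fun (S L - S N) n)) M) @ \oo -->
      zpsum (fun n => csq (s n - l2fun (S N) n)) M.
    by apply: zpsum_cvg => n; exact: cS.
  rewrite -(cvg_lim _ cv) //; apply: limr_le; first by apply/cvg_ex; eexists; exact: cv.
  exists N => // L /= NL; apply: le_trans (zpsum_le_ip _ _) _.
  have := Sdist N L NL; rewrite -[l2ip _ _]sqr_sqrtr // -/(nm _) => h.
  by rewrite lerXn2r ?nnegrE ?sqrtr_ge0 // mulr_ge0 // exprn_ge0 //; case/andP: q01.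
have ls : l2Z s.
  apply/zabs_ge0P; first by move=> x; exact: csq_ge0.
  exists ((K * q ^+ 0) ^+ 2) => N; apply: le_trans (bound 0%N N).
  apply: zpsum_le => n; have e0 : l2fun 0 n = 0 by rewrite /l2fun linear0.
  by rewrite /S big_ord0 e0 subr0.
have sN N n : csq (l2fun (mkl2 ls - S N) n) = csq (s n - l2fun (S N) n).
  by rewrite /csq -/(l2re n (mkl2 ls - S N)) -/(l2im n (mkl2 ls - S N)) !linearB /=.
exists (mkl2 ls), K => N.
have KN : 0 <= K * q ^+ N by rewrite mulr_ge0 // exprn_ge0 //; case/andP: q01.
rewrite -ler_sqr ?nnegrE ?sqrtr_ge0 // sqr_sqrtr //; apply: l2ip_le => M.
apply: le_trans (bound N M); apply: zpsum_le => n; by rewrite sN.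
Qed.

Definition unit_fun (c : R[i]) (k : int) (n : int) : R[i] := if n == k then c else 0.

Lemma unit_fun_l2 c k : l2Z (unit_fun c k).
Proof.
apply/zabs_ge0P; first by move=> x; exact: csq_ge0.
exists (csq c) => N; rewrite zpsumE.
have h n : complex.Re (unit_fun c k n) ^+ 2 + complex.Im (unit_fun c k n) ^+ 2 =
    (if n == k then csq c else 0).
  by rewrite /unit_fun; case: eqP => //= _; rewrite expr0n addr0.
under eq_bigr do rewrite h.
case: (boolP (k \in zrange N)) => kN.
  by rewrite (bigD1_seq k) ?zrange_uniq //= eqxx big1 ?addr0 // => i /negbTE ->.
rewrite big_seq_cond big1 ?csq_ge0 // => i /andP[iN _]; case: eqP => // e.
by rewrite -e iN in kN.
Qed.

Definition unit_l2 c k : l2 := mkl2 (unit_fun_l2 c k).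

Lemma l2ip_unit u c k : l2ip u (unit_l2 c k) = l2re k u * complex.Re c + l2im k u * complex.Im c.
Proof.
apply: zsum_unique; apply: cvg_near_cst; exists (absz k) => // N /= kN.
rewrite zpsumE (bigD1_seq k) ?zrange_uniq ?mem_zrange //= big1 ?addr0.
  by rewrite /ip_term /l2re /l2im !l2fun_mk /unit_fun eqxx.
move=> i ik; rewrite /ip_term [l2re i (unit_l2 _ _)]/l2re [l2im i (unit_l2 _ _)]/l2im !l2fun_mk.
by rewrite /unit_fun (negbTE ik) /= !mulr0 addr0.
Qed.

Definition truncation N (v : l2) : l2 := \sum_(k <- zrange N) unit_l2 (l2fun v k) k.

Lemma truncation_csq N v n :
  csq (l2fun (v - truncation N v) n) = if n \in zrange N then 0 else csq (l2fun v n).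
Proof.
have wre : l2re n (truncation N v) = if n \in zrange N then l2re n v else 0.
  rewrite /truncation linear_sum /=; case: ifP => nN.
    rewrite (bigD1_seq n) ?zrange_uniq //= big1 ?addr0.
      by rewrite /l2re l2fun_mk /unit_fun eqxx.
    by move=> i ni; rewrite /l2re l2fun_mk /unit_fun eq_sym (negbTE ni).
  rewrite big_seq_cond big1 // => i /andP[iN _]; rewrite /l2re l2fun_mk /unit_fun.
  by case: eqP => // e1; rewrite e1 iN in nN.
have wim : l2im n (truncation N v) = if n \in zrange N then l2im n v else 0.
  rewrite /truncation linear_sum /=; case: ifP => nN.
    rewrite (bigD1_seq n) ?zrange_uniq //= big1 ?addr0.
      by rewrite /l2im l2fun_mk /unit_fun eqxx.
    by move=> i ni; rewrite /l2im l2fun_mk /unit_fun eq_sym (negbTE ni).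
  rewrite big_seq_cond big1 // => i /andP[iN _]; rewrite /l2im l2fun_mk /unit_fun.
  by case: eqP => // e1; rewrite e1 iN in nN.
rewrite /csq -/(l2re n (v - _)) -/(l2im n (v - _)) !linearB /= wre wim.
by case: ifP => _; rewrite ?subrr ?subr0 ?expr0n ?addr0.
Qed.

Lemma l2_truncation v e : 0 < e -> exists N, nm (v - truncation N v) <= e.
Proof.
move=> e0; have [N hN] := zsum_tail (fun n => csq_ge0 (l2fun v n)) (l2funP v) (exprn_gt0 2 e0).
exists N; rewrite -ler_sqr ?nnegrE ?sqrtr_ge0 ?(ltW e0) // sqr_l2nm.
apply: l2ip_le => M; apply: le_trans (hN M); apply: zpsum_le => n.
by rewrite truncation_csq.
Qed.

Lemma unit_l2E c k : unit_l2 c k = complex.Re c *: unit_l2 1 k + complex.Im c *: unit_l2 'i k.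
Proof.
apply: l2_eq => n; rewrite !linearD !linearZ /= -![_ *: _]/(_ * _) /l2re /l2im !l2fun_mk /unit_fun;
  by case: eqP => _ /=; rewrite ?mulr0 ?mulr1 ?addr0 ?add0r.
Qed.

Lemma compact_op_seq (A : l2 -> l2) : (forall e : R, 0 < e -> exists s : seq (l2 * l2), forall x,
    nm (A x - \sum_(p <- s) l2ip x p.1 *: p.2) <= e * nm x) -> compact_op l2ip A.
Proof.
move=> h e /h[s hs]; exists (size s), (fun i => (tnth (in_tuple s) i).1), (fun i => (tnth (in_tuple s) i).2) => x.
by have := hs x; rewrite big_tnth.
Qed.

(** * Hermitian Hilbert-Schmidt matrices *)

Section HilbertSchmidt.
Variables (K : int -> int -> R[i]) (rho : int -> R).
Hypotheses (Kr : forall n, zabs_summable (fun m => csq (K n m)))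
  (Krho : forall n, zsum (fun m => csq (K n m)) <= rho n) (srho : zabs_summable rho)
  (Kherm : forall n m, K m n = (K n m)^*).

Lemma csqM z w : csq (z * w) = csq z * csq w.
Proof. by case: z w => a b [c d]; rewrite /csq /=; ring. Qed.

Lemma row_l2 n (c : R[i]) : l2Z (fun m => c * (K n m)^*).
Proof.
rewrite /l2Z; have -> : (fun m => complex.Re (c * (K n m)^*) ^+ 2 + complex.Im (c * (K n m)^*) ^+ 2) =
    fun m => csq c * csq (K n m).
  by apply/funext => m; rewrite -/(csq (c * (K n m)^*)) csqM; case: (K n m) => a b; rewrite /csq /= sqrrN.
exact: zabsZ.
Qed.

(** The vector whose real inner product with u is the real part of conj(c) times the n-th coordinate
    of K u: c = 1 yields the real part of that coordinate, and c = 'i its imaginary part. *)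
Definition row n c : l2 := mkl2 (row_l2 n c).

Lemma row_ip n c u : l2ip u (row n c) =
  zsum (fun m => complex.Re (c^* * (K n m * l2fun u m))).
Proof.
rewrite /l2ip; congr zsum; apply/funext => m; rewrite /ip_term /l2re /l2im !l2fun_mk.
by case: c (K n m) (l2fun u m) => a b [a' b'] [a2 b2] /=; ring.
Qed.

Lemma matrix_summable n u : zabs_summable (fun m => complex.Re (K n m * l2fun u m)) /\
  zabs_summable (fun m => complex.Im (K n m * l2fun u m)).
Proof.
split.
  have := ip_term_summable u (row n 1); congr zabs_summable; apply/funext => m.
  rewrite /ip_term /l2re /l2im !l2fun_mk.
  by case: (K n m) (l2fun u m) => a b [a' b'] /=; ring.
have := ip_term_summable u (row n 'i); congr zabs_summable; apply/funext => m.
rewrite /ip_term /l2re /l2im !l2fun_mk.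
by case: (K n m) (l2fun u m) => a b [a' b'] /=; ring.
Qed.

Definition matrix_fun (u : l2) (n : int) : R[i] :=
  Complex (l2ip u (row n 1)) (l2ip u (row n 'i)).

Lemma matrix_funE u n : zsumC_to (fun m => K n m * l2fun u m) (matrix_fun u n).
Proof.
have [h1 h2] := matrix_summable n u.
split; apply/zsum_toP; split=> //=; rewrite row_ip; congr zsum; apply/funext => m.
  by case: (K n m * l2fun u m) => a b /=; ring.
by case: (K n m * l2fun u m) => a b /=; ring.
Qed.

Lemma row_norm n c : l2ip (row n c) (row n c) = csq c * zsum (fun m => csq (K n m)).
Proof.
rewrite /l2ip -zsumZ //; congr zsum; apply/funext => m; rewrite ip_term_self l2fun_mk csqM.
by case: (K n m) => a b; rewrite /csq /= sqrrN.
Qed.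

Lemma matrix_fun_le u n : csq (matrix_fun u n) <= 2 * rho n * l2ip u u.
Proof.
have h c : csq c = 1 -> l2ip u (row n c) ^+ 2 <= rho n * l2ip u u.
  move=> c1; have := cauchy_schwarz l2_hilbert u (row n c) => cs.
  rewrite -[leLHS]real_normK ?num_real //.
  apply: (@le_trans _ _ ((nm u * nm (row n c)) ^+ 2)).
    by rewrite lerXn2r ?nnegrE ?mulr_ge0 ?sqrtr_ge0.
  by rewrite exprMn !sqr_l2nm row_norm c1 mul1r mulrC ler_wpM2r ?l2ip_ge0.
have h1 := h 1 _; have h2 := h 'i _.
rewrite /csq /= -mulrA mulr2n mulrDl !mul1r; apply: lerD.
  by apply: h1; rewrite /csq /= expr0n addr0 expr1n.
by apply: h2; rewrite /csq /= expr0n add0r expr1n.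
Qed.

Lemma rho_ge0 n : 0 <= rho n.
Proof.
apply: le_trans (Krho n); apply: le_trans (csq_ge0 (K n 0)) _.
by apply: le_zsum_term => // m; exact: csq_ge0.
Qed.

Lemma matrix_fun_l2 u : l2Z (matrix_fun u).
Proof.
apply: (zabs_dominated (g := fun n => 2 * l2ip u u * rho n)); last exact: zabsZ.
by move=> n; rewrite ger0_norm ?csq_ge0 // mulrAC; exact: matrix_fun_le.
Qed.

Definition matrix_op (u : l2) : l2 := mkl2 (matrix_fun_l2 u).

Lemma matrix_op_linear : linear matrix_op.
Proof.
by move=> a u v; apply: l2_eq => n; rewrite !linearP /= /l2re /l2im !l2fun_mk /= l2ipDl l2ipZl.
Qed.

Lemma matrix_op_bounded : exists2 B, 0 <= B & forall u, nm (matrix_op u) <= B * nm u.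
Proof.
have [M hM] := srho.
have M0 : 0 <= M by apply: le_trans (hM 0%N); rewrite sumr_ge0 // => i _; exact: normr_ge0.
exists (Num.sqrt (2 * M)); first exact: sqrtr_ge0.
move=> u; rewrite -ler_sqr ?nnegrE ?mulr_ge0 ?sqrtr_ge0 // exprMn !sqr_l2nm sqr_sqrtr ?mulr_ge0 //.
apply: l2ip_le => N; apply: (@le_trans _ _ (zpsum (fun n => 2 * l2ip u u * rho n) N)).
  by apply: zpsum_le => n; rewrite l2fun_mk mulrAC; exact: matrix_fun_le.
rewrite zpsumZ [leRHS]mulrAC ler_wpM2l ?mulr_ge0 ?l2ip_ge0 //.
by apply: le_trans (hM N); apply: zpsum_le => n; exact: ler_norm.
Qed.

(** Keeping the output coordinates in a window gives an operator of finite rank, and the discarded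
    ones are bounded through the tail of the summable [rho]. *)
Lemma matrix_op_compact : compact_op l2ip matrix_op.
Proof.
apply: compact_op_seq => e e0.
have e2 : 0 < e ^+ 2 / 2 by rewrite divr_gt0 ?exprn_gt0.
have [N hN] := zsum_tail rho_ge0 srho e2.
exists ([seq (row n 1, unit_l2 1 n) | n <- zrange N] ++ [seq (row n 'i, unit_l2 'i n) | n <- zrange N]) => u.
have tr : truncation N (matrix_op u) = \sum_(n <- zrange N) l2ip u (row n 1) *: unit_l2 1 n +
    \sum_(n <- zrange N) l2ip u (row n 'i) *: unit_l2 'i n.
  by rewrite -big_split; apply: eq_bigr => n _; rewrite [LHS]unit_l2E.
have -> : \sum_(p <- [seq (row n 1, unit_l2 1 n) | n <- zrange N] ++
    [seq (row n 'i, unit_l2 'i n) | n <- zrange N]) l2ip u p.1 *: p.2 = truncation N (matrix_op u).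
  by rewrite tr big_cat; congr (_ + _); rewrite big_map.
rewrite -ler_sqr ?nnegrE ?mulr_ge0 ?sqrtr_ge0 ?(ltW e0) // exprMn !sqr_l2nm.
apply: l2ip_le => M.
apply: (@le_trans _ _ (zpsum (fun n => 2 * l2ip u u * (if n \in zrange N then 0 else rho n)) M)).
  apply: zpsum_le => n; rewrite truncation_csq; case: ifP => _; first by rewrite mulr0.
  by rewrite l2fun_mk mulrAC; exact: matrix_fun_le.
rewrite zpsumZ; apply: le_trans (ler_wpM2l _ (hN M)) _; first by rewrite mulr_ge0 ?l2ip_ge0.
by rewrite le_eqVlt; apply/orP; left; apply/eqP; field.
Qed.

Lemma rowE k c : row k c = complex.Re c *: row k 1 + complex.Im c *: row k 'i.
Proof.
apply: l2_eq => n; rewrite !linearD !linearZ /= -![_ *: _]/(_ * _) /l2re /l2im !l2fun_mk;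
  by case: c (K k n) => a b [a' b'] /=; ring.
Qed.

Lemma matrix_op_unit c k : matrix_op (unit_l2 c k) = row k c.
Proof.
apply: l2_eq => n; rewrite /l2re /l2im !l2fun_mk /= l2ipC l2ip_unit /l2re /l2im !l2fun_mk (Kherm k n);
  by case: c (K k n) => a b [a' b'] /=; ring.
Qed.

(** For a second argument supported on one coordinate, symmetry is the relation [Kherm]. Truncations
    approximate a general one, and the operator is bounded. *)
Lemma matrix_op_symmetric : symmetric_op l2ip matrix_op.
Proof.
have hH := l2_hilbert; have [B B0 hB] := matrix_op_bounded.
pose A := mklinear matrix_op_linear.
have unit u c k : l2ip (A u) (unit_l2 c k) = l2ip u (A (unit_l2 c k)).
  rewrite /A /= matrix_op_unit l2ip_unit rowE (ipDr hH) !(ipZr hH) /l2re /l2im !l2fun_mk /=.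
  by rewrite mulrC; congr (_ + _); rewrite mulrC.
have trunc u N v : l2ip (A u) (truncation N v) = l2ip u (A (truncation N v)).
  rewrite /truncation linear_sum !(ip_sumr hH); apply: eq_bigr => k _; exact: unit.
move=> u v; apply/eqP; rewrite -subr_eq0 -normr_le0; apply/ler_addgt0Pr => d d0; rewrite add0r.
pose c := 2 * B * nm u.
have c0 : 0 <= c by rewrite !mulr_ge0 ?sqrtr_ge0.
have [N hN] := l2_truncation v (divr_gt0 d0 (ltr_wpDl c0 ltr01)).
set w := truncation N v in hN.
have -> : l2ip (matrix_op u) v - l2ip u (matrix_op v) = l2ip (A u) (v - w) - l2ip u (A (v - w)).
  by rewrite linearB !(ipBr hH) trunc /=; ring.
apply: le_trans (ler_normB _ _) _.
have h1 := cauchy_schwarz hH (A u) (v - w); have h2 := cauchy_schwarz hH u (A (v - w)).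
apply: le_trans (lerD h1 h2) _.
apply: (@le_trans _ _ (c * nm (v - w))).
  rewrite /c -mulrA mulr2n !mulrDl !mul1r; apply: lerD.
    by rewrite mulrA ler_wpM2r ?sqrtr_ge0 // hB.
  by rewrite mulrCA ler_wpM2l ?sqrtr_ge0 // hB.
apply: le_trans (ler_wpM2l c0 hN) _; rewrite mulrA ler_pdivrMr ?ltr_wpDl //.
by rewrite mulrC ler_wpM2l ?(ltW d0) // lerDl.
Qed.
End HilbertSchmidt.
End SquareSummable.

(** * The fiber operators *)

Section Exponential.
Variable R : realType.

Lemma san_expRZ (c : R) : san (fun x => expR (c * x)).
Proof.
pose a (j : nat) : R^o := c ^+ j / j`!%:R.
have ha j : `|a j| <= 1 * (`|c| + 1) ^+ j.
  rewrite /a normrM normrX normfV [`|_%:R|]ger0_norm // mul1r.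
  apply: (@le_trans _ _ (`|c| ^+ j)).
    by rewrite ler_piMr ?exprn_ge0 // invf_le1 ?ltr0n ?fact_gt0 // ler1n fact_gt0.
  by rewrite lerXn2r ?nnegrE ?addr_ge0 // lerDl.
have c1 : 0 < `|c| + 1 by rewrite ltr_wpDl.
have [f hf] := an_of_coef (real_norm R) (@geo_complete_real R) ler01 c1 ha.
exists a, (2 * 1), (`|c| + 1); split=> // x hx N.
suff <- : f x = expR (c * x) by exact: hf.
have cf : (fun N => \sum_(j < N) x ^+ j *: a j) @ \oo --> f x.
  have : (fun N => (\sum_(j < N) x ^+ j *: a j : R) - f x) @ \oo --> (0 : R).
    apply: (squeeze_norm0 (v := fun N => (2 * 1) * ((`|c| + 1) * `|x|) ^+ N)).
      by move=> M; rewrite distrC; exact: hf.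
    apply: cvg_geometric; rewrite ger0_norm ?mulr_ge0 ?(ltW c1) //.
    by apply: le_lt_trans hx _; rewrite invf_lt1 ?ltr1n.
  by move/subr_cvg0.
have ce : (fun N => \sum_(j < N) x ^+ j *: a j) @ \oo --> expR (c * x).
  have := @is_cvg_series_exp_coeff R (c * x); rewrite -/(expR (c * x)).
  rewrite (_ : series (exp_coeff (c * x)) = fun N => \sum_(j < N) x ^+ j *: a j) //.
  apply/funext => M; rewrite /series /= big_mkord; apply: eq_bigr => j _.
  by rewrite exp_coeffE exprMn /a -[RHS]/(x ^+ j * (c ^+ j / j`!%:R)); ring.
exact: (cvg_unique _ cf ce).
Qed.

Lemma san_coshZ (c : R) : san (fun x => Rcosh (c * x)).
Proof.
have h := sanM (sanD (san_expRZ c) (san_expRZ (- c))) (san_cst 2^-1).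
by apply: san_ext h; apply: filterE => x; rewrite mulNr.
Qed.

Lemma san_sinhZ (c : R) : san (fun x => Rsinh (c * x)).
Proof.
have h := sanM (sanB (san_expRZ c) (san_expRZ (- c))) (san_cst 2^-1).
by apply: san_ext h; apply: filterE => x; rewrite mulNr.
Qed.

Lemma san_lipschitz (f : R -> R) : san f ->
  exists2 K, 0 <= K & \forall x \near 0, `|f x - f 0| <= K * `|x|.
Proof.
move=> [a /(an_lipschitz (real_norm R))[K [r [K0 r0 h]]]]; exists K => //.
by apply: filterS (near0_small r0) => x; exact: h.
Qed.

Lemma RcoshD (x y : R) : Rcosh (x + y) = Rcosh x * Rcosh y + Rsinh x * Rsinh y.
Proof. by rewrite /Rcosh /Rsinh opprD !expRD; field. Qed.

Lemma RsinhB (x y : R) : Rsinh (x - y) = Rsinh x * Rcosh y - Rcosh x * Rsinh y.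
Proof. by rewrite /Rcosh /Rsinh opprB !expRD; field. Qed.

Definition Rtanh (x : R) := Rsinh x / Rcosh x.

Lemma Rcosh_gt0 (x : R) : 0 < Rcosh x.
Proof. exact: lt_le_trans ltr01 (Rcosh_ge1 x). Qed.

Lemma Rtanh_le1 (x : R) : `|Rtanh x| <= 1.
Proof.
rewrite /Rtanh normrM normfV (gtr0_norm (Rcosh_gt0 x)) ler_pdivrMr ?Rcosh_gt0 // mul1r.
rewrite ler_norml /Rsinh /Rcosh; have := expR_ge0 x; have := expR_ge0 (- x) => h1 h2.
by apply/andP; split; lra.
Qed.

(** The reason why sums along diagonals telescope: 1/(cosh x cosh y) is an increment of tanh divided
    by sinh(x - y), and x - y is constant along a diagonal. *)
Lemma RtanhB (x y : R) : Rtanh x - Rtanh y = Rsinh (x - y) / (Rcosh x * Rcosh y).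
Proof.
have hx := lt0r_neq0 (Rcosh_gt0 x); have hy := lt0r_neq0 (Rcosh_gt0 y).
by rewrite RsinhB /Rtanh; field; rewrite hx hy.
Qed.

Lemma Rcosh_shift_le (x y : R) : Rcosh (x + y) <= expR `|y| * Rcosh x.
Proof.
rewrite /Rcosh mulrA ler_pM2r // opprD !expRD mulrDr.
have h1 : expR y <= expR `|y| by rewrite ler_expR ler_norm.
have h2 : expR (- y) <= expR `|y| by rewrite ler_expR -normrN ler_norm.
by apply: lerD; rewrite mulrC ler_wpM2r ?expR_ge0.
Qed.

Lemma Rsinh_gt0 (x : R) : 0 < x -> 0 < Rsinh x.
Proof.
move=> x0; rewrite /Rsinh divr_gt0 // subr_gt0 ltr_expR.
by apply: (@lt_trans _ _ 0) => //; rewrite oppr_lt0.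
Qed.
End Exponential.

(** * Double sums along diagonals *)

Section DoubleSums.
Variable R : realType.

Lemma zpsum_exchange (a : int -> int -> R) N M :
  zpsum (fun n => zpsum (a n) M) N = zpsum (fun m => zpsum (fun n => a n m) N) M.
Proof.
rewrite !zpsumE; under eq_bigr do rewrite zpsumE.
by rewrite exchange_big /=; apply: eq_bigr => i _; rewrite zpsumE.
Qed.

(* Tonelli along the diagonals. *)
Lemma diagonal_sums_le (a : int -> int -> R) (b : int -> R) N M :
  (forall n m, 0 <= a n m) -> (forall l L, zpsum (fun n => a n (n - l)) L <= b l) ->
  zpsum (fun n => zpsum (a n) M) N <= zpsum b (N + M).
Proof.
move=> a0 hb; apply: (@le_trans _ _ (zpsum (fun n => zpsum (fun l => a n (n - l)) (N + M)) N)).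
  rewrite !zpsumE big_seq [leRHS]big_seq; apply: ler_sum => n; rewrite mem_zrange => nN.
  rewrite [leLHS]zpsumE.
  have -> : \sum_(m <- zrange M) a n m = \sum_(l <- [seq n - m | m <- zrange M]) a n (n - l).
    by rewrite [RHS]big_map; apply: eq_bigr => m _; congr (a n _); lia.
  apply: sum_le_zpsum => //; first by rewrite map_inj_uniq ?zrange_uniq // => i j; lia.
  by move=> x /seq.mapP[m mM ->]; move: mM; rewrite mem_zrange; lia.
rewrite zpsum_exchange; exact: zpsum_le.
Qed.

Lemma zpsum_succ (t : int -> R) N : zpsum (fun n => t (n + 1) - t n) N = t (N%:Z + 1) - t (- N%:Z).
Proof.
rewrite /zpsum; pose u (i : nat) := t (i%:Z - N%:Z).
have -> : \sum_(i < (N + N).+1) (t (i%:Z - N%:Z + 1) - t (i%:Z - N%:Z)) =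
    \sum_(0 <= i < (N + N).+1) (u i.+1 - u i).
  by rewrite big_mkord; apply: eq_bigr => i _; rewrite /u; congr (t _ - _); lia.
rewrite telescope_sumr // /u; congr (t _ - t _); lia.
Qed.

(** A shift by d consists of d unit shifts, each of which telescopes to a difference of two values
    of t. *)
Lemma zpsum_shift_le (t : int -> R) (d : nat) N : (forall n, `|t n| <= 1) ->
  zpsum (fun n => t (n + d%:Z) - t n) N <= 2 * d%:R.
Proof.
move=> t1; elim: d => [|d IH].
  rewrite mulr0 /zpsum big1 // => i _; by rewrite addr0 subrr.
have -> : (fun n : int => t (n + d.+1%:Z) - t n) =
    fun n => (t (n + d%:Z + 1) - t (n + d%:Z)) + (t (n + d%:Z) - t n).
  by apply/funext => n; rewrite -addn1 PoszD addrA addrA subrK.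
rewrite zpsumD -[d.+1%:R]natr1 mulrDr mulr1 addrC; apply: lerD => //.
have -> : (fun x : int => t (x + d%:Z + 1) - t (x + d%:Z)) =
    fun x => (fun y => t (y + d%:Z)) (x + 1) - (fun y => t (y + d%:Z)) x.
  by apply/funext => x; congr (t _ - _); lia.
rewrite zpsum_succ; apply: le_trans (ler_norm _) _; apply: le_trans (ler_normB _ _) _.
by rewrite mulr2n -[leRHS]/(1 + 1) lerD.
Qed.
End DoubleSums.

Section RealDimension.
Variable R : realType.

(** The matrix of J in a basis squares to -1, so the square of its determinant is (-1)^n, which
    excludes odd n over the reals. *)
Lemma rdim_even (V : lmodType R) (P : V -> Prop) (J : {linear V -> V}) n :
  (forall v, P v -> P (J v)) -> (forall v, J (J v) = - v) -> rdim P n -> ~~ odd n.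
Proof.
move=> PJ JJ [b [Pb fb sb]].
have hex i : exists c : 'I_n -> R, J (b i) = \sum_(j < n) c j *: b j by exact: sb (PJ _ (Pb i)).
pose M : 'M[R]_n := \matrix_(i, j) projT1 (cid (hex i)) j.
have hM i : J (b i) = \sum_j M i j *: b j.
  by rewrite (projT2 (cid (hex i))); apply: eq_bigr => j _; rewrite mxE.
have MM : M *m M = - 1%:M.
  apply/matrixP => i k; apply/eqP; rewrite -subr_eq0; apply/eqP; move: k.
  apply: (fb (fun k => (M *m M) i k - (- 1%:M : 'M[R]_n) i k)).
  under eq_bigr do rewrite scalerBl.
  rewrite sumrB; have -> : \sum_k (M *m M) i k *: b k = J (J (b i)).
    rewrite hM linear_sum /=; under [RHS]eq_bigr do rewrite linearZ /= hM scaler_sumr.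
    rewrite exchange_big /=; apply: eq_bigr => k _; rewrite mxE scaler_suml.
    by apply: eq_bigr => j _; rewrite scalerA.
  rewrite JJ (bigD1 i) //= big1 ?addr0 => [|k ki].
    by rewrite !mxE eqxx scaleN1r opprK addNr.
  by rewrite !mxE eq_sym (negbTE ki) oppr0 scale0r.
apply/negP => n1; have := congr1 determinant MM.
rewrite det_mulmx -scaleN1r detZ det1 mulr1 -signr_odd n1 expr1 => h.
by have := sqr_ge0 (\det M); rewrite expr2 h oppr_ge0 ler10.
Qed.

Lemma rdim_gt0 (V : lmodType R) (P : V -> Prop) n : rdim P n -> (0 < n)%N ->
  exists2 v, P v & v != 0.
Proof.
move=> [b [Pb fb _]] n0; exists (b (Ordinal n0)); first exact: Pb.
apply/eqP => b0; have := fb (fun i => (i == Ordinal n0)%:R).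
rewrite (bigD1 (Ordinal n0)) //= b0 scaler0 add0r big1 => [/(_ erefl)/(_ (Ordinal n0))|i /negbTE ->].
  by rewrite eqxx => /eqP; rewrite oner_eq0.
by rewrite scale0r.
Qed.
End RealDimension.

Section GammaComplex.
Variable R : realType.
Local Open Scope complex_scope.
Notation mu := (@lebesgue_measure R).

Lemma RintegralN_integrable (D : set (measurableTypeR R)) (f : R -> R) : measurable D ->
  mu.-integrable D (EFin \o f) -> Rintegral mu D (fun x => - f x) = - Rintegral mu D f.
Proof.
move=> mD fi; rewrite -[RHS]mulN1r -(RintegralZl _ mD fi).
by apply: eq_Rintegral => x _; rewrite mulN1r.
Qed.

Lemma Gamma_conj (s x : R) : 0 < s -> Gamma (Complex s (- x)) = conjc (Gamma (Complex s x)).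
Proof.
move=> s0; congr (_ +i* _) => /=.
  by apply: eq_Rintegral => t _; rewrite mulNr cosN.
have mD : measurable (`]0%R, +oo[%classic : set (measurableTypeR R)) by exact: measurable_itv.
have := RintegralN_integrable mD (gsin_integrable x s0); apply: etrans.
by apply: eq_Rintegral => t _; rewrite mulNr sinN mulrN.
Qed.

Lemma csq_Gamma (s x : R) : csq (Gamma (Complex s x)) = Gnorm2 s x. Proof. by []. Qed.

Lemma csq_eq0 (z : R[i]) : csq z = 0 -> z = 0.
Proof.
case: z => a b; rewrite /csq /= => h; have a0 := sqr_ge0 a; have b0 := sqr_ge0 b.
have : a ^+ 2 = 0 /\ b ^+ 2 = 0 by split; lra.
by case=> /eqP; rewrite sqrf_eq0 => /eqP -> /eqP; rewrite sqrf_eq0 => /eqP ->.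
Qed.

Lemma csq_conj (z : R[i]) : csq (conjc z) = csq z.
Proof. by case: z => a b; rewrite /csq /= sqrrN. Qed.

Lemma csqV (z : R[i]) : csq z^-1 = (csq z)^-1.
Proof.
have [->|z0] := eqVneq z 0; first by rewrite invr0 /csq /= expr0n addr0 invr0.
have c0 : csq z != 0 by apply: contraNneq z0 => /csq_eq0 ->.
apply: (mulfI c0); rewrite divff // -csqM divff //.
by rewrite /csq /= expr1n expr0n addr0.
Qed.

Lemma csq_conjM (z : R[i]) : conjc z * z = (csq z)%:C.
Proof. by case: z => a b; congr (_ +i* _) => /=; rewrite /csq /=; ring. Qed.
End GammaComplex.

Section Multiplication.
Variable R : realType.
Local Open Scope complex_scope.
Notation nm := (hnorm (@l2ip R)).

Lemma l2_eqfun (u v : l2 R) : (forall n, l2fun u n = l2fun v n) -> u = v.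
Proof. by move=> h; apply: l2_eq => n; rewrite /l2re /l2im h. Qed.

Lemma l2fun0 n : l2fun (0 : l2 R) n = 0.
Proof. by rewrite /l2fun linear0. Qed.

Lemma l2funN (v : l2 R) n : l2fun (- v) n = - l2fun v n.
Proof. by rewrite /l2fun linearN. Qed.

Lemma l2funD (u v : l2 R) n : l2fun (u + v) n = l2fun u n + l2fun v n.
Proof. by rewrite /l2fun linearD. Qed.

Lemma l2funZ (a : R) (v : l2 R) n : l2fun (a *: v) n = a%:C * l2fun v n.
Proof.
have -> : l2fun (a *: v) n = a *: (l2fun v n : Rcomplex R) by rewrite /l2fun linearZ.
by case: (l2fun v n) => b d; congr (_ +i* _) => /=; ring.
Qed.

Lemma l2fun_sum (I : Type) (s : seq I) (P : pred I) (F : I -> l2 R) n :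
  l2fun (\sum_(i <- s | P i) F i) n = \sum_(i <- s | P i) l2fun (F i) n.
Proof. by elim/big_rec2: _ => [|i x y _ <-]; rewrite ?l2fun0 ?l2funD. Qed.

Lemma mul_l2 (b : int -> R[i]) (B : R) (v : l2 R) : (forall n, csq (b n) <= B) ->
  l2Z (fun n => b n * l2fun v n).
Proof.
move=> hb; apply: (zabs_dominated (g := fun n => B * csq (l2fun v n))); last first.
  by apply: zabsZ; exact: l2funP.
move=> n; rewrite ger0_norm ?csq_ge0 // -/(csq (b n * l2fun v n)) csqM.
by rewrite ler_wpM2r ?csq_ge0.
Qed.

Definition mulop (b : int -> R[i]) (B : R) (hb : forall n, csq (b n) <= B) (v : l2 R) : l2 R :=
  mkl2 (mul_l2 v hb).

Lemma mulop_linear b B (hb : forall n, csq (b n) <= B) : linear (mulop hb).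
Proof.
move=> a u v; apply: l2_eqfun => n; rewrite l2fun_lin !l2fun_mk l2fun_lin.
by case: (b n) (l2fun u n) (l2fun v n) => b1 b2 [u1 u2] [v1 v2]; congr (_ +i* _) => /=; ring.
Qed.

Definition mulop_lin b B (hb : forall n, csq (b n) <= B) := mklinear (mulop_linear hb).

Lemma mulop_linE b B (hb : forall n, csq (b n) <= B) v n :
  l2fun (mulop_lin hb v) n = b n * l2fun v n.
Proof. by []. Qed.

Lemma mulop_real_symmetric (t : int -> R) B (hb : forall n, csq (t n)%:C <= B) :
  symmetric_op (@l2ip R) (mulop_lin hb).
Proof.
move=> u v; rewrite /l2ip; congr zsum; apply/funext => n; rewrite /ip_term /l2re /l2im !mulop_linE.
by case: (l2fun u n) (l2fun v n) => a b [c d] /=; ring.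
Qed.

Lemma mulop_contraction b (hb : forall n, csq (b n) <= 1) (v : l2 R) : nm (mulop_lin hb v) <= nm v.
Proof.
rewrite -ler_sqr ?nnegrE ?sqrtr_ge0 // !sqr_l2nm; apply: l2ip_le => N.
apply: le_trans (zpsum_le_ip v N); apply: zpsum_le => n.
by rewrite mulop_linE csqM ler_piMl ?csq_ge0.
Qed.

Lemma zsumC_unique (f : int -> R[i]) s s' : zsumC_to f s -> zsumC_to f s' -> s = s'.
Proof.
move=> [/zsum_toP[_ h1] /zsum_toP[_ h2]] [/zsum_toP[_ h3] /zsum_toP[_ h4]].
by apply/eqP; rewrite eq_complex -h1 -h2 -h3 -h4 !eqxx.
Qed.

Lemma zsumC_scale (c : R[i]) (f : int -> R[i]) s : zsumC_to f s -> zsumC_to (fun m => c * f m) (c * s).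
Proof.
move=> [/zsum_toP[s1 h1] /zsum_toP[s2 h2]]; case: c => a b.
have e1 : (fun m => complex.Re ((a +i* b) * f m)) = fun m => a * complex.Re (f m) + (- b) * complex.Im (f m).
  by apply/funext => m; case: (f m) => x y /=; rewrite mulNr.
have e2 : (fun m => complex.Im ((a +i* b) * f m)) = fun m => a * complex.Im (f m) + b * complex.Re (f m).
  by apply/funext => m; case: (f m) => x y /=.
split; apply/zsum_toP.
  rewrite e1; split; first by apply: zabsD; exact: zabsZ.
  rewrite zsumD ?zsumZ ?h1 ?h2 //; try exact: zabsZ.
  by case: (s) => x y /=; rewrite mulNr.
rewrite e2; split; first by apply: zabsD; exact: zabsZ.
rewrite zsumD ?zsumZ ?h1 ?h2 //; try exact: zabsZ.
by case: (s) => x y.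
Qed.
End Multiplication.

(** * The fiber operators, their eigenspaces and their symmetries *)

Section HankelFiber.
Variables (R : realType) (T : R) (p : R -> R).
Local Open Scope complex_scope.
Hypotheses (T0 : 0 < T) (mp : measurable_fun `[0, T] p)
  (ip : lebesgue_measure.-integrable `[0, T] (EFin \o p))
  (sp : zabs_summable (fun l => cabs (fourier_coef T p l) * powR (1 + l%:~R ^+ 2) (4^-1))).
Local Notation w := (omega T).
Local Notation pf := (fourier_coef T p).

Definition freq (k : R) (n : int) : R := w * n%:~R + k.
Definition gam (k : R) (n : int) : R[i] := Gamma (Complex 2^-1 (freq k n)).
Definition sym (l : int) : R[i] := pf l / Gamma (Complex 1 (- (w * l%:~R))).

Lemma omega_gt0 : 0 < w.
Proof. by rewrite /omega divr_gt0 // mulr_gt0 ?pi_gt0. Qed.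

Let half0 : 0 < 2^-1 :> R. Proof. by rewrite invr_gt0. Qed.

Lemma Hmat_factor k n m : Hmat T p k n m = conjc (gam k n) * gam k m * sym (n - m).
Proof.
rewrite /Hmat /Beta /sym /gam -Gamma_conj //.
have -> : (2^-1)%:C - 'i * (w * n%:~R)%:C - 'i * k%:C = Complex 2^-1 (- freq k n).
  by congr (_ +i* _) => /=; rewrite /freq; ring.
have -> : (2^-1)%:C + 'i * (w * m%:~R)%:C + 'i * k%:C = Complex 2^-1 (freq k m).
  by congr (_ +i* _) => /=; rewrite /freq; ring.
have -> : Complex 2^-1 (- freq k n) + Complex 2^-1 (freq k m) = Complex 1 (- (w * (n - m)%:~R)).
  by congr (_ +i* _) => /=; rewrite /freq ?intrB; [field|ring].
by rewrite [_ / _ * _]mulrAC mulrA.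
Qed.

Lemma csq_gam k n : csq (gam k n) = Gnorm2 2^-1 0 / Rcosh (pi * freq k n).
Proof.
by rewrite csq_Gamma -(Gnorm2_half (freq k n)) mulfK // lt0r_neq0 // Rcosh_gt0.
Qed.

Lemma gam_neq0 k n : gam k n != 0.
Proof.
apply/eqP => e; have := Gnorm2_half_gt0 (freq k n); rewrite -csq_Gamma -/(gam k n) e.
by rewrite /csq /= expr0n addr0 ltxx.
Qed.

Lemma trig_integrable (f : R -> R) : continuous f -> (forall x, `|f x| <= 1) ->
  lebesgue_measure.-integrable `[0, T] (EFin \o (fun x => f x * p x)).
Proof.
move=> cf f1; apply: le_integrable ip; first exact: measurable_itv.
  apply/measurable_EFinP; apply: measurable_funM => //.
  by apply: measurable_funTS; exact: continuous_measurable_fun.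
by move=> x _; rewrite lee_fin normrM ler_piMl.
Qed.

Lemma fourier_conj l : pf (- l) = conjc (pf l).
Proof.
rewrite /fourier_coef; congr (_ +i* _) => /=.
  congr (_ * _); apply: eq_Rintegral => x _.
  by rewrite intrN mulNr mulNr cosN.
have mD : measurable (`[0, T]%classic : set (measurableTypeR R)) by exact: measurable_itv.
have si : lebesgue_measure.-integrable `[0, T] (EFin \o (fun x => sin (l%:~R * w * x) * p x)).
  apply: (@trig_integrable (fun x => sin (l%:~R * w * x))) => x; last exact: sin_max.
  apply: (@continuous_comp _ _ _ (fun x => l%:~R * w * x) sin); last exact: continuous_sin.
  by apply: cvgM; [exact: cvg_cst|exact: cvg_id].
have -> : Rintegral lebesgue_measure `[0, T] (fun x => sin ((- l)%:~R * w * x) * p x) =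
    Rintegral lebesgue_measure `[0, T] (fun x => - (sin (l%:~R * w * x) * p x)).
  by apply: eq_Rintegral => x _; rewrite intrN !mulNr sinN mulNr.
by rewrite (RintegralN_integrable mD si) mulrN.
Qed.

Lemma sym_conj l : conjc (sym l) = sym (- l).
Proof.
have cM (a b : R[i]) : conjc (a / b) = conjc a / conjc b by rewrite rmorphM fmorphV.
by rewrite /sym cM -fourier_conj -Gamma_conj ?ltr01 // intrN mulrN opprK.
Qed.

Lemma Hmat_hermitian k n m : Hmat T p k m n = conjc (Hmat T p k n m).
Proof.
rewrite !Hmat_factor -[m - n]opprB -sym_conj.
by case: (gam k n) (gam k m) (sym (n - m)) => a b [c d] [e f]; congr (_ +i* _) => /=; ring.
Qed.

(** The weight is at least 1, so |p_l| is at most its weighted value f l, which is at most the sum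
    of f; hence |p_l|^2 is at most a multiple of f l. *)
Lemma csq_fourier_summable : zabs_summable (fun l => csq (pf l)).
Proof.
have [M hM] := sp; pose f l := cabs (pf l) * (1 + l%:~R ^+ 2) `^ 4^-1.
have c0 l : 0 <= cabs (pf l) by exact: sqrtr_ge0.
have f0 l : 0 <= f l by rewrite mulr_ge0 ?powR_ge0.
have le1 l : cabs (pf l) <= f l.
  rewrite ler_peMr // -[leLHS](powRr0 (1 + l%:~R ^+ 2)).
  by apply: ler_powR; rewrite ?lerDl ?sqr_ge0 // invr_ge0.
have leM l : f l <= zsum f by apply: le_zsum_term.
apply: (zabs_dominated (g := fun l => zsum f * f l)); last exact: zabsZ.
move=> l; rewrite ger0_norm ?csq_ge0 //.
have -> : csq (pf l) = cabs (pf l) * cabs (pf l) by rewrite -expr2 sqr_sqrtr // addr_ge0 ?sqr_ge0.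
by apply: ler_pM => //; apply: le_trans (le1 l) (leM l).
Qed.

Let c := Gnorm2 2^-1 0 : R.

Let c_gt0 : 0 < c. Proof. exact: Gnorm2_half_gt0. Qed.

Let t k (n : int) := Rtanh (pi * freq k n).

Lemma freq_succ k n : freq k (n + 1) = freq k n + w.
Proof. by rewrite /freq intrD; ring. Qed.

Lemma csq_Hmat k n l : csq (Hmat T p k n (n - l)) =
  c ^+ 2 / (Rcosh (pi * freq k n) * Rcosh (pi * freq k (n - l))) * (csq (pf l) / Gnorm2 1 (w * l%:~R)).
Proof.
rewrite Hmat_factor !csqM csq_conj !csq_gam subKr.
rewrite -/c mulf_div -expr2; congr (_ * _).
by rewrite csqV Gamma_conj ?ltr01 // csq_conj csq_Gamma.
Qed.

(* On the l-th diagonal the squared entries are, up to a factor [csq (pf l)], the increments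
   [t k n - t k (n - l)], which telescope. *)
Lemma Hmat_diagonal_bound k : exists2 C, 0 <= C & forall l N,
  zpsum (fun n => csq (Hmat T p k n (n - l))) N <= C * csq (pf l).
Proof.
have w0 := omega_gt0; have pi0 := pi_gt0 R.
have t1 n : `|t k n| <= 1 by exact: Rtanh_le1.
have pw : 0 < pi * w by rewrite mulr_gt0.
pose e := expR (pi * w) / Rsinh (pi * w).
have e0 : 0 < e by rewrite divr_gt0 ?expR_gt0 ?Rsinh_gt0.
have [g gE g0] : exists2 g, g = Gnorm2 1 (0 : R) & 0 < g by eexists; [reflexivity|exact: Gnorm2_one_gt0].
pose C := c ^+ 2 * (2 * e / g + 2 / (pi * w)).
have A0 : 0 <= 2 * e / g by apply: divr_ge0 (ltW g0); exact: mulr_ge0 (ler0n _ 2) (ltW e0).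
have B0 : 0 <= 2 / (pi * w) by rewrite divr_ge0 // ltW.
have C0 : 0 <= C by rewrite mulr_ge0 ?sqr_ge0 // addr_ge0.
exists C => // l N; have q0 := csq_ge0 (pf l).
(* On the main diagonal the increment of tanh degenerates. The entry is compared instead with the
   increment from n to n + 1, at the cost of the factor [e], since cosh grows by at most exp(pi w)
   over that step. *)
have [l0|l0] := eqVneq l 0.
  apply: (@le_trans _ _ (zpsum (fun n => (c ^+ 2 * e / g * csq (pf l)) * (t k (n + 1) - t k n)) N)).
    apply: zpsum_le => n; rewrite csq_Hmat l0 subr0 mulr0 -gE -l0.
    have -> : t k (n + 1) - t k n =
        Rsinh (pi * w) / (Rcosh (pi * freq k n + pi * w) * Rcosh (pi * freq k n)).
      by rewrite /t RtanhB freq_succ [pi * (_ + w)]mulrDr addrAC subrr add0r.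
    have h := Rcosh_shift_le (pi * freq k n) (pi * w); rewrite (gtr0_norm pw) in h.
    have x0 := Rcosh_gt0 (pi * freq k n); have y0 := Rcosh_gt0 (pi * freq k n + pi * w).
    have s0 := Rsinh_gt0 pw.
    rewrite /e; move: (Rcosh (pi * freq k n)) (Rcosh _) (Rsinh _) (expR _) (csq _) h x0 y0 s0 q0
      => x y s u q h x0 y0 s0 q0.
    have -> : c ^+ 2 / (x * x) * (q / g) = c ^+ 2 * q / g * (x * x)^-1.
      by field; rewrite !gt_eqF.
    have -> : c ^+ 2 * (u / s) / g * q * (s / (y * x)) = c ^+ 2 * q / g * (u / (y * x)).
      by field; rewrite !gt_eqF.
    rewrite ler_wpM2l //; first by rewrite divr_ge0 ?(ltW g0) // mulr_ge0 ?sqr_ge0.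
    rewrite ler_pdivlMr ?mulr_gt0 // [_ * (y * x)](_ : _ = y / x); last by field; rewrite gt_eqF.
    by rewrite ler_pdivrMr.
  rewrite zpsumZ; have h := zpsum_shift_le 1 N t1; rewrite mulr1 in h.
  apply: le_trans (ler_wpM2l _ h) _.
    by rewrite mulr_ge0 // divr_ge0 ?(ltW g0) // mulr_ge0 ?sqr_ge0 ?(ltW e0).
  have -> : c ^+ 2 * e / g * csq (pf l) * 2 = c ^+ 2 * (2 * e / g) * csq (pf l) by ring.
  by rewrite ler_wpM2r // ler_wpM2l ?sqr_ge0 // lerDl.
have lR : (l%:~R : R) != 0 by rewrite intr_eq0.
(* By [Gnorm2_one], 1/|Gamma(1 + i w l)|^2 is sinh(pi w l)/(pi w l), and this sinh is the one that
   turns 1/(cosh cosh) into an increment of tanh. Increments over l steps sum to at most 2|l| in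
   modulus, and the division by l makes the bound uniform in l. *)
have E n : csq (Hmat T p k n (n - l)) = c ^+ 2 * csq (pf l) / (pi * w) * ((t k n - t k (n - l)) / l%:~R).
  rewrite csq_Hmat RtanhB -mulrBr.
  have -> : freq k n - freq k (n - l) = w * l%:~R by rewrite /freq intrB; ring.
  have h := Gnorm2_one (w * l%:~R); have G0 := Gnorm2_one_gt0 (w * l%:~R).
  have x0 := Rcosh_gt0 (pi * freq k n); have y0 := Rcosh_gt0 (pi * freq k (n - l)).
  have -> : Rsinh (pi * (w * l%:~R)) = pi * (w * l%:~R) / Gnorm2 1 (w * l%:~R).
    by apply: (mulfI (lt0r_neq0 G0)); rewrite h [RHS]mulrC divfK // gt_eqF.
  clear h; move: G0 x0 y0 lR.
  move: (Gnorm2 1 (w * l%:~R)) (Rcosh (pi * freq k n)) (Rcosh (pi * freq k (n - l))) (csq (pf l)).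
  move: (l%:~R : R) => L G x y q G0 x0 y0 L0.
  have [piN wN] : (pi : R) != 0 /\ w != 0 by rewrite !gt_eqF.
  clear -G0 x0 y0 L0 piN wN; move: piN wN; move: (pi : R) w => P W PN WN.
  by field; rewrite PN WN L0 !gt_eqF.
have -> : (fun n => csq (Hmat T p k n (n - l))) =
    fun n => c ^+ 2 * csq (pf l) / (pi * w) * ((t k n - t k (n - l)) / l%:~R) by apply/funext.
rewrite zpsumZ; have h : zpsum (fun n => (t k n - t k (n - l)) / l%:~R) N <= 2.
  have -> : (fun n => (t k n - t k (n - l)) / l%:~R) = fun n => (l%:~R)^-1 * (t k n - t k (n - l)).
    by apply/funext => n; rewrite mulrC.
  rewrite zpsumZ; clear E; case: l l0 lR q0 => d l0 lR _.
    have d0 : 0 < d%:R :> R by move: l0; rewrite eqz_nat -lt0n ltr0n.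
    rewrite ler_pdivrMl //; have := zpsum_shift_le d N (t := fun n => t k (n - d%:Z)) (fun n => t1 _).
    rewrite mulrC; apply: le_trans; rewrite le_eqVlt; apply/orP; left; apply/eqP.
    by congr zpsum; apply/funext => n; rewrite addrK.
  have d0 : 0 < d.+1%:R :> R by rewrite ltr0n.
  rewrite NegzE intrN invrN mulNr -mulrN ler_pdivrMl //.
  have := zpsum_shift_le d.+1 N t1; rewrite mulrC; apply: le_trans.
  rewrite -mulN1r -zpsumZ le_eqVlt; apply/orP; left; apply/eqP.
  by congr zpsum; apply/funext => n; rewrite mulN1r opprB opprK.
apply: le_trans (ler_wpM2l _ h) _.
  by rewrite divr_ge0 ?(ltW pw) // mulr_ge0 ?sqr_ge0.
have -> : c ^+ 2 * csq (pf l) / (pi * w) * 2 = c ^+ 2 * (2 / (pi * w)) * csq (pf l) by ring.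
by rewrite ler_wpM2r // ler_wpM2l ?sqr_ge0 // lerDr.
Qed.

Definition rowsum k (n : int) : R := zsum (fun m => csq (Hmat T p k n m)).

Lemma Hmat_double_sum k : exists M, forall N L, zpsum (fun n => zpsum (fun m => csq (Hmat T p k n m)) L) N <= M.
Proof.
have [C C0 hC] := Hmat_diagonal_bound k.
exists (C * zsum (fun l => csq (pf l))) => N L.
apply: le_trans (@diagonal_sums_le R _ (fun l => C * csq (pf l)) N L _ _) _.
- by move=> n m; exact: csq_ge0.
- by move=> l M; exact: hC.
rewrite zpsumZ ler_wpM2l //; apply: zpsum_le_zsum; last exact: csq_fourier_summable.
by move=> l; exact: csq_ge0.
Qed.

Lemma Hmat_row_summable k n : zabs_summable (fun m => csq (Hmat T p k n m)).
Proof.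
have [M hM] := Hmat_double_sum k.
apply/zabs_ge0P; first by move=> m; exact: csq_ge0.
exists M => L; apply: le_trans (hM (absz n) L).
have := @sum_le_zpsum R (fun n => zpsum (fun m => csq (Hmat T p k n m)) L) [:: n] (absz n).
rewrite big_seq1; apply=> //.
  by move=> x; rewrite /zpsum sumr_ge0 // => i _; exact: csq_ge0.
by move=> x; rewrite inE => /eqP ->.
Qed.

Lemma rowsum_summable k : zabs_summable (rowsum k).
Proof.
have [M hM] := Hmat_double_sum k.
have r0 n : 0 <= rowsum k n.
  apply: le_trans (csq_ge0 (Hmat T p k n 0)) (le_zsum_term _ _ (Hmat_row_summable k n)) => m.
  exact: csq_ge0.
apply/zabs_ge0P => //; exists M => N.
have cv : (fun L => zpsum (fun n => zpsum (fun m => csq (Hmat T p k n m)) L) N) @ \oo --> zpsum (rowsum k) N.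
  by apply: zpsum_cvg => n; exact: zsum_cvg (Hmat_row_summable k n).
rewrite -(cvg_lim _ cv) //; apply: limr_le; first by apply/cvg_ex; eexists; exact: cv.
by apply: nearW => L; exact: hM.
Qed.

Definition fiber k : {linear l2 R -> l2 R} := mklinear
  (matrix_op_linear (Hmat_row_summable k) (fun n => lexx (rowsum k n)) (rowsum_summable k)).

Lemma fiber_symmetric k : symmetric_op (@l2ip R) (fiber k).
Proof. exact: matrix_op_symmetric (Hmat_hermitian k). Qed.

Lemma fiber_compact k : compact_op (@l2ip R) (fiber k).
Proof. exact: matrix_op_compact. Qed.

Lemma fiberE k u n : zsumC_to (fun m => Hmat T p k n m * l2fun u m) (l2fun (fiber k u) n).
Proof. exact: matrix_funE (Hmat_row_summable k) u n. Qed.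

Definition eigsp k (E : R) (v : l2 R) :=
  forall n, zsumC_to (fun m => Hmat T p k n m * l2fun v m) (E%:C * l2fun v n).

Lemma csq_tanh_le k n : csq (Rtanh (pi * freq k n))%:C <= 1.
Proof.
rewrite /csq /= expr0n addr0 -real_normK ?num_real //.
by rewrite exprn_ile1 // Rtanh_le1.
Qed.

Definition tanh_op k := mulop_lin (csq_tanh_le k).

(* [H(k0 + x)] is [H(k0)] conjugated by the diagonal matrix with entries [gratio k0 x]. *)
Definition gratio k0 x n : R[i] := gam (k0 + x) n / gam k0 n.

Lemma freqD k x n : freq (k + x) n = freq k n + x.
Proof. by rewrite /freq addrA. Qed.

Lemma ratio_neq0 k0 x n : gratio k0 x n != 0.
Proof. by rewrite mulf_neq0 ?invr_eq0 ?gam_neq0. Qed.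

(** The squared modulus of g_n is c/cosh, and the quotient of cosh(y + pi x) by cosh y is cosh(pi x)
    + sinh(pi x) tanh y. This is the origin of the pencil. *)
Lemma csq_ratio k0 x n : csq (gratio k0 x n) =
  (Rcosh (pi * x) + Rsinh (pi * x) * Rtanh (pi * freq k0 n))^-1.
Proof.
rewrite csqM csqV !csq_gam freqD mulrDr RcoshD -/c /Rtanh.
have h := Rcosh_gt0 (pi * (freq k0 n + x)); rewrite mulrDr RcoshD in h.
have h0 := Rcosh_gt0 (pi * freq k0 n); have cn := lt0r_neq0 c_gt0.
move: h h0; move: (Rcosh _) (Rsinh _) (Rcosh _) (Rsinh _) => a b a' b' h h0.
have e : a + b * (b' / a') = (a' * a + b' * b) / a' by field; rewrite gt_eqF.
by rewrite e; field; rewrite cn !gt_eqF.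
Qed.

(** A bound uniform in n, for the ratio and then for its inverse, is what lets the rescaling of
    coordinates map l2 onto itself. *)
Lemma csq_ratio_le k0 x n : csq (gratio k0 x n) <= expR `|pi * x|.
Proof.
rewrite csqM csqV !csq_gam freqD mulrDr -/c.
have h := Rcosh_shift_le (pi * freq k0 n + pi * x) (- (pi * x)); rewrite addrK normrN in h.
have h1 := Rcosh_gt0 (pi * freq k0 n + pi * x); have h0 := Rcosh_gt0 (pi * freq k0 n).
have cn := lt0r_neq0 c_gt0.
have -> : c / Rcosh (pi * freq k0 n + pi * x) / (c / Rcosh (pi * freq k0 n)) =
   Rcosh (pi * freq k0 n) / Rcosh (pi * freq k0 n + pi * x) by field; rewrite cn !gt_eqF.
by rewrite ler_pdivrMr.
Qed.

Lemma csq_ratioV_le k0 x n : csq (gratio k0 x n)^-1 <= expR `|pi * x|.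
Proof.
have -> : (gratio k0 x n)^-1 = gratio (k0 + x) (- x) n by rewrite /gratio addrK invf_div.
by apply: le_trans (csq_ratio_le _ _ _) _; rewrite mulrN normrN.
Qed.

Lemma Hmat_ratio k0 x n m : Hmat T p (k0 + x) n m = conjc (gratio k0 x n) * (Hmat T p k0 n m * gratio k0 x m).
Proof.
rewrite !Hmat_factor /gratio; have g1 := gam_neq0 k0 n; have g2 := gam_neq0 k0 m.
have cM (a b : R[i]) : conjc (a / b) = conjc a / conjc b by rewrite rmorphM fmorphV.
have g1' : conjc (gam k0 n) != 0 by rewrite conjc_eq0.
rewrite cM; move: (conjc (gam (k0 + x) n)) (conjc (gam k0 n)) g1' (gam (k0 + x) m) (gam k0 m) g2 (sym _).
by move=> a b b0 d e e0 s; field; rewrite b0 e0.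
Qed.

Lemma pencil_fun k0 x (E : R) u n :
  l2fun (E *: pencil_op (fun x => Rcosh (pi * x)) (fun x => Rsinh (pi * x)) (tanh_op k0) x u) n =
  (E / csq (gratio k0 x n))%:C * l2fun u n.
Proof.
rewrite l2funZ pencil_opE l2funD !l2funZ mulop_linE csq_ratio invrK.
by case: (l2fun u n) => b d; congr (_ +i* _) => /=; ring.
Qed.

(** Put u_n = r_n v_n with r the ratio. Then H(k0 + x) v = E v reads conj(r_n) (H(k0) u)_n = E u_n /
    r_n, and dividing by conj(r_n) leaves the weight 1/|r_n|^2 of the pencil. *)
Lemma eigsp_rdim k0 x (E : R) n :
  rdim (pencil_ker (fun x => Rcosh (pi * x)) (fun x => Rsinh (pi * x)) (fiber k0) (tanh_op k0) x E) n ->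
  rdim (eigsp (k0 + x) E) n.
Proof.
pose r := gratio k0 x; have r0 n : r n != 0 := ratio_neq0 k0 x n.
have rc m : conjc (r m) != 0 by rewrite conjc_eq0.
have rr (m : int) : ((csq (r m))^-1)%:C = (conjc (r m))^-1 * (r m)^-1.
  by rewrite -invfM csq_conjM -fmorphV.
have Ecs (m : int) : (E / csq (r m))%:C = E%:C * ((conjc (r m))^-1 * (r m)^-1).
  by rewrite -rr; congr (_ +i* _) => /=; ring.
apply: (rdim_map (phi := mulop_lin (csq_ratioV_le k0 x))).
- move=> u hu m; rewrite mulop_linE -/(r m).
  have := zsumC_scale (conjc (r m)) (fiberE k0 u m); rewrite hu pencil_fun -/(r m) Ecs.
  have -> : conjc (r m) * (E%:C * ((conjc (r m))^-1 * (r m)^-1) * l2fun u m) = E%:C * ((r m)^-1 * l2fun u m).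
    by move: (rc m) (r0 m) => h1 h2; field; rewrite h1 h2.
  congr zsumC_to; apply/funext => j; rewrite Hmat_ratio mulop_linE -/(r m) -/(r j).
  by move: (r0 j) => h; field.
- move=> u hu; apply: l2_eqfun => m; have := congr1 (fun v => l2fun v m) hu; rewrite mulop_linE.
  rewrite l2fun0 => /eqP; rewrite mulf_eq0 invr_eq0 (negbTE (r0 m)) /= => /eqP -> //.
move=> y hy; exists (mulop_lin (csq_ratio_le k0 x) y); last first.
  by apply: l2_eqfun => m; rewrite !mulop_linE mulrA mulVf ?mul1r // r0.
apply: l2_eqfun => m; rewrite pencil_fun mulop_linE -/(r m) Ecs.
apply: zsumC_unique (fiberE k0 _ m) _.
have := zsumC_scale (conjc (r m))^-1 (hy m).
have -> : (conjc (r m))^-1 * (E%:C * l2fun y m) = E%:C * ((conjc (r m))^-1 * (r m)^-1) * (r m * l2fun y m).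
  by move: (rc m) (r0 m) => h1 h2; field; rewrite h1 h2.
congr zsumC_to; apply/funext => j; rewrite Hmat_ratio mulop_linE -/(r m) -/(r j).
by move: (rc m) => h; field.
Qed.

(* Twice the complex dimension of the eigenspace. *)
Definition fiber_dim k E n := rdim (eigsp k E) n.

(** L comes from the Lipschitz constants of cosh(pi x) and sinh(pi x) at x = 0; as k = k0 + x, the
    same constants serve for every k0. *)
Lemma fiber_locally_analytic : exists L, locally_analytic_spectrum L fiber_dim.
Proof.
pose ch (x : R) := Rcosh (pi * x); pose sh (x : R) := Rsinh (pi * x).
have ach : san ch by exact: san_coshZ.
have ash : san sh by exact: san_sinhZ.
have ch0 : ch 0 = 1 by rewrite /ch mulr0 Rcosh0.
have sh0 : sh 0 = 0 by rewrite /sh mulr0 Rsinh0.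
have [Kc Kc0 hKc] := san_lipschitz ach; have [Ks Ks0 hKs] := san_lipschitz ash.
rewrite ch0 in hKc.
have hKs' : \forall x \near 0, `|sh x| <= Ks * `|x|.
  by apply: filterS hKs => x; rewrite sh0 subr0.
exists (2 * (Kc + 2 * Ks)) => k0 E0 E0n.
have [es [eps [eps0 he hE]]] := local_branches (l2_hilbert R) ach ash ch0 sh0 hKc hKs'
  (fiber_symmetric k0) (fiber_compact k0) E0n
  (mulop_real_symmetric (csq_tanh_le k0)) (mulop_contraction (csq_tanh_le k0)).
exists [seq (fun k => f (k - k0)) | f : R -> R <- es], eps; rewrite size_map; split=> //.
  move=> i hi; have [h1 h2] := he i hi; rewrite (nth_map (fun=> 0)) // subrr; split=> //.
  by move: h1; rewrite /an_at; congr san; apply/funext => h; rewrite addrC addKr.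
apply/near_translate; apply: filterS hE => h hE E /hE[h1 h2].
rewrite count_map; have e : (fun f : R -> R => f h == E) =1
    preim (fun f : R -> R => fun k => f (k - k0)) (fun f : R -> R => f (k0 + h) == E).
  by move=> f /=; rewrite addrC addKr.
rewrite -(eq_count e); split; first exact: eigsp_rdim h1.
move=> n0; have [v hv v0] := rdim_gt0 h1 n0.
by rewrite [k0 + h - k0]addrAC subrr add0r; exact: h2 hv v0.
Qed.

Lemma i_bounded (n : int) : csq ('i : R[i]) <= 1.
Proof. by rewrite /csq /= expr0n add0r expr1n. Qed.

Definition imul := mulop_lin i_bounded.

Lemma fiber_even k E n : E != 0 -> fiber_dim k E n -> ~~ odd n.
Proof.
move=> _; apply: (rdim_even (J := imul)).
  move=> v hv m; have := zsumC_scale 'i (hv m); rewrite mulop_linE mulrCA.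
  congr zsumC_to; apply/funext => j; by rewrite mulop_linE mulrCA.
move=> v; apply: l2_eqfun => m; rewrite !mulop_linE mulrA l2funN.
by case: (l2fun v m) => a b; congr (_ +i* _) => /=; ring.
Qed.

Lemma in_eigenspace_l2 k (z : R[i]) v : in_eigenspace (Hmat T p k) z v <->
  exists2 u : l2 R, v = l2fun u & forall n, zsumC_to (fun m => Hmat T p k n m * l2fun u m) (z * l2fun u n).
Proof.
split=> [[vl h]|[u -> h]]; first by exists (mkl2 vl).
by split=> //; exact: l2funP.
Qed.

(** With z = a + i b, pair H u = a u + b i u with i u. The left side vanishes because H is symmetric
    and commutes with i, while multiplication by i is antisymmetric; as u is orthogonal to i u, this
    leaves b |u|^2 = 0. *)
Lemma eigenvalue_real k z : is_eigenvalue (Hmat T p k) z -> z = (complex.Re z)%:C.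
Proof.
move=> [v [/in_eigenspace_l2[u -> h] [n0 un0]]].
have hH := l2_hilbert R.
have Au : fiber k u = complex.Re z *: u + complex.Im z *: imul u.
  apply: l2_eqfun => n; rewrite (zsumC_unique (fiberE k u n) (h n)).
  rewrite l2funD !l2funZ.
  by rewrite mulop_linE; case: z (l2fun u n) {h} => a b [c' d]; congr (_ +i* _) => /=; ring.
have anti x y : l2ip (imul x) y = - l2ip x (imul y).
  rewrite -mulN1r -zsumZ; last exact: ip_term_summable.
  congr zsum; apply/funext => n; rewrite /ip_term /l2re /l2im !mulop_linE.
  by case: (l2fun x n) (l2fun y n) => a b [c' d] /=; ring.
have AJ : fiber k (imul u) = imul (fiber k u).
  apply: l2_eqfun => n; rewrite mulop_linE; apply: zsumC_unique (fiberE k (imul u) n) _.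
  have := zsumC_scale 'i (fiberE k u n); congr zsumC_to; apply/funext => m.
  by rewrite mulop_linE mulrCA.
have e1 : l2ip (fiber k u) (imul u) = 0.
  have := fiber_symmetric k u (imul u); rewrite AJ => e.
  have := anti u (fiber k u); rewrite (ipC hH) e => e2; lra.
have anti0 : l2ip u (imul u) = 0.
  by have := anti u u; rewrite (ipC hH) => e2; lra.
move: e1; rewrite Au (ipDl hH) !(ipZl hH) anti0 mulr0 add0r => /eqP.
rewrite mulf_eq0 => /orP[/eqP im0|]; first by case: z im0 {h Au} => a b /= ->.
rewrite anti; have JJ : imul (imul u) = - u.
  apply: l2_eqfun => m; rewrite !mulop_linE mulrA l2funN.
  by case: (l2fun u m) => a b; congr (_ +i* _) => /=; ring.
rewrite JJ (ipNr hH) opprK => /eqP uu.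
have u0 : u != 0 by apply/eqP => e; apply: un0; rewrite e l2fun0.
by have := ip_gt0 hH u0; rewrite uu ltxx.
Qed.

(** A complex basis u_i of the eigenspace gives the real basis formed by the u_i and the i u_i. *)
Lemma eig_multiplicity_dim k E m : eig_multiplicity (Hmat T p k) E%:C m -> fiber_dim k E m.*2.
Proof.
move=> [W [hW [fW sW]]].
have hu i : exists u : l2 R, (i < m)%N -> W i = l2fun u /\ eigsp k E u.
  have [im|_] := boolP (i < m)%N; last by exists 0.
  by have /in_eigenspace_l2[u e h] := hW i im; exists u.
pose u i := projT1 (cid (hu i)); have uP i : (i < m)%N -> _ := projT2 (cid (hu i)).
rewrite -addnn; pose b (i : 'I_(m + m)) := match fintype.split i with inl j => u j | inr j => imul (u j) end.
have bl (i : 'I_m) : b (lshift m i) = u i by rewrite /b (unsplitK (inl i)).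
have br (i : 'I_m) : b (rshift m i) = imul (u i) by rewrite /b (unsplitK (inr i)).
have comb (d : 'I_(m + m) -> R) n : l2fun (\sum_i d i *: b i) n =
    \sum_(i < m) (d (lshift m i) +i* d (rshift m i)) * W i n.
  rewrite big_split_ord /= -big_split /= l2fun_sum; apply: eq_bigr => i _.
  rewrite bl br l2funD !l2funZ mulop_linE (uP i (ltn_ord i)).1 -/(u i).
  by case: (l2fun (u i) n) => x y; congr (_ +i* _) => /=; ring.
exists b; split.
- move=> i; rewrite /b; case: (fintype.split i) => j; first exact: (uP j (ltn_ord j)).2.
  move=> l; have := zsumC_scale 'i ((uP j (ltn_ord j)).2 l); rewrite mulop_linE mulrCA.
  by congr zsumC_to; apply/funext => q; rewrite mulop_linE mulrCA.
- move=> d d0; pose z (i : nat) : R[i] := if insub i is Some j then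
    d (lshift m j) +i* d (rshift m j) else 0.
  have zE (i : 'I_m) : z i = d (lshift m i) +i* d (rshift m i) by rewrite /z valK.
  have z0 : forall i, (i < m)%N -> z i = 0.
    apply: fW => n; have := comb d n; rewrite d0 l2fun0 => /esym; apply: etrans.
    by apply: eq_bigr => i _; rewrite zE.
  have z0' (i : 'I_m) : d (lshift m i) = 0 /\ d (rshift m i) = 0.
    by have := z0 i (ltn_ord i); rewrite zE => -[-> ->].
  by move=> i; case: (split_ordP i) => j ->; [exact: (z0' j).1|exact: (z0' j).2].
- move=> v hv; have [d hd] := sW (l2fun v) (conj (l2funP v) hv).
  exists (fun i => match fintype.split i with inl j => complex.Re (d j) | inr j => complex.Im (d j) end).
  apply: l2_eqfun => n; rewrite comb hd; apply: eq_bigr => i _.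
  by rewrite (unsplitK (inl i)) (unsplitK (inr i)); case: (d i).
Qed.

(** * Symmetries of the spectrum in k *)

Section Reindexing.
Variables (b : bool) (phi psi : int -> int).
Hypotheses (phiK : cancel phi psi) (psiK : cancel psi phi).
Definition conjc_if (z : R[i]) := if b then conjc z else z.

Lemma conjc_ifK : involutive conjc_if.
Proof. by rewrite /conjc_if => -[x y]; case: b => //=; rewrite opprK. Qed.

Lemma conjc_ifM x y : conjc_if (x * y) = conjc_if x * conjc_if y.
Proof. by rewrite /conjc_if; case: b => //; rewrite rmorphM. Qed.

Lemma conjc_if_real x : conjc_if x%:C = x%:C.
Proof. by rewrite /conjc_if; case: b => //=; rewrite oppr0. Qed.

Lemma zsumC_reindex (f : int -> R[i]) s : zsumC_to f s ->
  zsumC_to (fun m => conjc_if (f (phi m))) (conjc_if s).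
Proof.
have phi_inj := can_inj phiK.
have N (g : int -> R) x : zsum_to g x -> zsum_to (fun m => - g (phi m)) (- x).
  move=> /zsum_toP[sg gx]; apply/zsum_toP; have s1 := zabs_inj phi_inj sg.
  have -> : (fun m => - g (phi m)) = fun m => -1 * g (phi m) by apply/funext => m; rewrite mulN1r.
  by split; [exact: zabsZ|rewrite zsumZ // (zsum_bij phiK psiK) // gx mulN1r].
have P (g : int -> R) x : zsum_to g x -> zsum_to (fun m => g (phi m)) x.
  move=> /zsum_toP[sg gx]; apply/zsum_toP; split; first exact: (zabs_inj phi_inj sg).
  by rewrite (zsum_bij phiK psiK).
case=> hr hi; rewrite /conjc_if; split; case: b.
- have := P _ _ hr; have -> : complex.Re (conjc s) = complex.Re s by case: (s).
  by congr zsum_to; apply/funext => m; case: (f (phi m)).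
- exact: P hr.
- have := N _ _ hi; have -> : complex.Im (conjc s) = - complex.Im s by case: (s).
  by congr zsum_to; apply/funext => m; case: (f (phi m)).
exact: P hi.
Qed.

Lemma l2Z_reindex (v : l2 R) : l2Z (fun n => conjc_if (l2fun v (phi n))).
Proof.
have := zabs_inj (can_inj phiK) (l2funP v); rewrite /l2Z; congr zabs_summable.
apply/funext => m; rewrite /conjc_if; case: b => //.
by case: (l2fun v (phi m)) => x y /=; rewrite sqrrN.
Qed.

Lemma reindex_linear : linear (fun v => mkl2 (l2Z_reindex v)).
Proof.
move=> a u v; apply: l2_eqfun => n; rewrite l2fun_lin !l2fun_mk l2fun_lin /conjc_if.
case: b => //; case: (l2fun u _) (l2fun v _) => x y [x' y'].
by congr (_ +i* _) => /=; ring.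
Qed.
End Reindexing.

(** One statement for two symmetries: k to -k reverses the indices and conjugates (b = true), k to k
    + w j only shifts the indices. Conjugation is harmless because E is real and dimensions are
    real. *)
Lemma fiber_dim_reindex b phi psi k k' E n : cancel phi psi -> cancel psi phi ->
  (forall n m, Hmat T p k' n m = conjc_if b (Hmat T p k (phi n) (phi m))) ->
  fiber_dim k E n -> fiber_dim k' E n.
Proof.
move=> phiK psiK hH.
have hH' i j : Hmat T p k i j = conjc_if b (Hmat T p k' (psi i) (psi j)) by rewrite hH !psiK conjc_ifK.
apply: (rdim_map (phi := mklinear (reindex_linear b phiK))).
- move=> v hv m; rewrite l2fun_mk -(conjc_if_real b) -conjc_ifM.
  have := zsumC_reindex b phiK psiK (hv (phi m)); congr zsumC_to.
  by apply/funext => j; rewrite conjc_ifM hH.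
- move=> v hv; apply: l2_eqfun => m; have := congr1 (fun u => l2fun u (psi m)) hv.
  rewrite l2fun_mk psiK => /(congr1 (conjc_if b)); rewrite conjc_ifK !l2fun0 => ->.
  by rewrite -[0]/(0%:C) conjc_if_real.
move=> y hy; exists (mklinear (reindex_linear b psiK) y).
  move=> m; rewrite l2fun_mk -(conjc_if_real b) -conjc_ifM.
  have := zsumC_reindex b psiK phiK (hy (psi m)); congr zsumC_to.
  by apply/funext => j; rewrite conjc_ifM hH'.
by apply: l2_eqfun => m; rewrite !l2fun_mk phiK conjc_ifK.
Qed.

(** H(-k) is the conjugate of H(k) with reversed indices, because p is real, which enters through
    [sym_conj]. *)
Lemma fiber_dim_opp k E n : fiber_dim k E n -> fiber_dim (- k) E n.
Proof.
apply: (fiber_dim_reindex (b := true) (phi := -%R) (psi := -%R)); try exact: opprK.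
move=> i j; rewrite -[RHS]/(conjc (Hmat T p k (- i) (- j))) !Hmat_factor.
have cM (x y : R[i]) : conjc (x * y) = conjc x * conjc y by rewrite rmorphM.
rewrite 2!cM sym_conj.
have hg l : gam (- k) l = conjc (gam k (- l)).
  by rewrite /gam -Gamma_conj //; congr (Gamma (Complex _ _)); rewrite /freq intrN; ring.
by rewrite !hg; congr (_ * sym _); rewrite opprB opprK addrC.
Qed.

Lemma fiber_dim_shift j k E n : fiber_dim k E n -> fiber_dim (k + w * j%:~R) E n.
Proof.
apply: (fiber_dim_reindex (b := false) (phi := +%R^~ j) (psi := +%R^~ (- j))).
- by move=> x; rewrite addrK.
- by move=> x; rewrite subrK.
move=> i l; rewrite !Hmat_factor /conjc_if.
have hg q : gam (k + w * j%:~R) q = gam k (q + j).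
  by rewrite /gam; congr (Gamma (Complex _ _)); rewrite /freq intrD; ring.
by rewrite !hg; congr (_ * sym _); lia.
Qed.

Lemma branch_opp f : branch fiber_dim f -> branch fiber_dim (fun k => f (- k)).
Proof.
move=> bf x; have [h1 h2 h3] := good_at_opp (bf (- x)); split; [exact: h1|exact: h2|].
apply: filterS h3 => y [n n0 hn]; exists n => //.
by have := fiber_dim_opp hn; rewrite opprK.
Qed.

Lemma branch_shift j f : branch fiber_dim f -> branch fiber_dim (fun k => f (k + w * j%:~R)).
Proof.
move=> bf x; have [h1 h2 h3] := bf (x + w * j%:~R); split=> //; first exact: an_at_translate.
apply/near_translate; apply: filterS ((near_translate _ _).1 h3) => h [n n0 hn].
exists n => //; have := fiber_dim_shift (- j) hn; congr fiber_dim.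
  by rewrite intrN; ring.
by congr f; rewrite addrAC.
Qed.

Lemma in_spectrum_eigenvalue k E : in_spectrum fiber_dim k E -> is_eigenvalue (Hmat T p k) E%:C.
Proof.
move=> [n n0 hn]; have [v hv v0] := rdim_gt0 hn n0; exists (l2fun v); split.
  by apply/in_eigenspace_l2; exists v.
apply: contrapT => h; move/eqP: v0; apply; apply: l2_eqfun => m; rewrite l2fun0.
by apply: contrapT => e; apply: h; exists m.
Qed.
End HankelFiber.

Lemma an_at_real_analytic (R : realType) (f : R -> R) : (forall x, an_at f x) -> real_analytic f.
Proof.
move=> af x0; have [a [C [r [C0 r0 h]]]] := af x0.
exists (2 * r)^-1; first by rewrite invr_gt0 mulr_gt0.
exists a => x hx; apply/subr_cvg0.
have hx' : r * `|x - x0| <= 2^-1.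
  by rewrite -ler_pdivlMl // -invfM mulrC ltW.
apply: (squeeze_norm0 (v := fun N => C * (r * `|x - x0|) ^+ N)).
  move=> N; rewrite distrC; have := h _ hx' N; rewrite /= [x0 + _]addrC subrK.
  apply: le_trans; rewrite le_eqVlt; apply/orP; left; apply/eqP; congr `|_ - _|.
  by apply: eq_bigr => j _; rewrite mulrC.
apply: cvg_geometric; rewrite ger0_norm ?mulr_ge0 ?(ltW r0) //.
by apply: le_lt_trans hx' _; rewrite invf_lt1 ?ltr1n.
Qed.

Local Open Scope complex_scope.

Theorem theorem1p4 (R : realType) (T : R) (p : R -> R) :
  0 < T ->
  (forall x, p (x + T) = p x) ->
  measurable_fun `[0, T] p ->
  lebesgue_measure.-integrable `[0, T] (EFin \o p) ->
  zabs_summable (fun l => cabs (fourier_coef T p l) * powR (1 + l%:~R ^+ 2) (4^-1)) ->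
  exists (J : set nat) (F : nat -> R -> R),
    (forall j, J j -> real_analytic (F j) /\ forall k, F j k != 0) /\
    (forall (k : R) (Es : R[i]) (m : nat), Es != 0 -> (1 <= m)%N ->
       is_eigenvalue (Hmat T p k) Es -> eig_multiplicity (Hmat T p k) Es m ->
       exists s : seq nat, [/\ uniq s, size s = m &
         forall j, j \in s <-> (J j /\ (F j k)%:C = Es)]) /\
    (forall k j, J j -> is_eigenvalue (Hmat T p k) (F j k)%:C) /\
    (forall j, J j ->
       (exists2 j', J j' & F j' = (fun k => F j (- k))) /\
       (forall n : int, exists2 j', J j' & F j' = (fun k => F j (k + omega T * n%:~R)))).
Proof.
move=> T0 _ mp ip sp.
have [L loc] := fiber_locally_analytic T0 mp ip sp.
have [J [F [bF surj hF]]] := branch_enumeration (fun k E n m => @rdim_unique _ _ _ n m) loc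
  (fun k E n => @fiber_even R T p k E n).
exists J, F; split; [|split; [|split]].
- move=> j /bF bj; split=> [|k]; last by have [_ h _] := bj k.
  by apply: an_at_real_analytic => x; have [h _ _] := bj x.
(* The given complex eigenvalue is real, so the real enumeration applies, with real multiplicity
   2m. *)
- move=> k Es m Es0 _ /(eigenvalue_real T0 mp ip sp) eEs; rewrite eEs => hm.
  have E0 : complex.Re Es != 0 by apply: contraNneq Es0 => e; rewrite eEs e.
  have [s [us ss hs]] := hF k _ m E0 (eig_multiplicity_dim hm).
  exists s; split=> // j; rewrite hs; split=> [[Jj <-]|[Jj [e]]] //.
- move=> k j /bF bj; apply: in_spectrum_eigenvalue; have [_ _ h] := bj k.
  exact: nbhs_singleton h.
move=> j /bF bj; split=> [|n]; apply: surj; first exact: branch_opp bj.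
exact: branch_shift bj.
Qed.
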